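(* Let $\varphi:\mathbb{R}^d\to\mathbb{R}\cup\{+\infty\}$ be an essentially continuous convex function with $\int_{\mathbb{R}^d}e^{-\varphi}\,dx<+\infty$, and let $\varrho_\varphi=e^{-\varphi}/\int_{\mathbb{R}^d}e^{-\varphi}$ be its Gibbs probability measure. Then there exists a constant $C_d>0$ depending only on the dimension $d$ such that for every locally Lipschitz function $f\in L^2(\varrho_\varphi)$, $$\operatorname{dist}_{L^1(\varrho_\varphi)}(f,\mathcal{O}_{BL})\le C_d\,\delta_{BL}(f)^{1/2}.$$
   Context: A convex function $\psi:\mathbb{R}^d\to\mathbb{R}\cup\{+\infty\}$ is called essentially continuous if it is lower semi-continuous and the set of points where it is discontinuous has zero $\mathcal{H}^{d-1}$ (Hausdorff) measure. Gradients $\nabla\varphi$ and Hessians $D^2\varphi$ of the convex function $\varphi$ are understood in the Alexandrov sense (defined $\varrho_\varphi$-a.e.). The Brascamp–Lieb deficit is $$\delta_{BL}(f)=\int_{\mathbb{R}^d}\langle (D^2\varphi)^{-1}\nabla f,\nabla f\rangle\,d\varrho_\varphi-\operatorname{Var}_{\varrho_\varphi}(f)\ (\ge 0).$$ The manifold of optimizers is $\mathcal{O}_{BL}=\{f:\ f(x)=a\cdot\nabla\varphi(x)+b \text{ for some } a\in\mathbb{R}^d,\ b\in\mathbb{R}\}$, and $\operatorname{dist}_{L^1(\varrho_\varphi)}(f,\mathcal{O}_{BL})=\inf_{g\in\mathcal{O}_{BL}}\|f-g\|_{L^1(\varrho_\varphi)}$. *)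

(* Defs.v *)
From HB Require Import structures.
From mathcomp Require Import all_boot all_order all_algebra.
From mathcomp Require Import all_classical all_reals all_analysis.
Import Order.TTheory GRing.Theory Num.Theory.
Import numFieldNormedType.Exports.
Local Open Scope classical_set_scope.
Local Open Scope ring_scope.

Set Implicit Arguments.
Unset Strict Implicit.
Unset Printing Implicit Defensive.

Definition dotv {R : realType} {d : nat} (u v : 'rV[R]_d) : R :=
  \sum_(i < d) u 0 i * v 0 i.

Definition enorm {R : realType} {d : nat} (u : 'rV[R]_d) : R :=
  Num.sqrt (dotv u u).

Definition box {R : realType} {d : nat} (ab : 'rV[R]_d * 'rV[R]_d) : set 'rV[R]_d :=
  [set x | forall i, ab.1 0 i <= x 0 i <= ab.2 0 i].

Definition box_vol {R : realType} {d : nat} (ab : 'rV[R]_d * 'rV[R]_d) : R :=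
  \prod_(i < d) Num.max 0 (ab.2 0 i - ab.1 0 i).

Definition leb_outer {R : realType} {d : nat} (A : set 'rV[R]_d) : \bar R :=
  ereal_inf [set (\sum_(0 <= k <oo) (box_vol (B k))%:E)%E
            | B in [set B : nat -> 'rV[R]_d * 'rV[R]_d |
                     A `<=` \bigcup_k box (B k)]].

(* Lebesgue integral over R^d of a nonnegative extended-real function,
   via the layer-cake formula  int g dx = int_0^oo |{g > t}| dt          *)
Definition leb_int {R : realType} {d : nat} (g : 'rV[R]_d -> \bar R) : \bar R :=
  (\int[lebesgue_measure]_(t in [set t : R | (0 <= t)%R])
      leb_outer [set x | (t%:E < g x)%E])%E.

Definition ediam {R : realType} {d : nat} (C : set 'rV[R]_d) : \bar R :=
  ereal_sup [set (enorm (x - y))%:E | x in C & y in C].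

Definition hterm {R : realType} {d : nat} (s : nat) (C : set 'rV[R]_d) : \bar R :=
  if pselect (C = set0) then 0%E else ((fine (ediam C)) ^+ s)%:E.

Definition hausdorff_pre {R : realType} {d : nat} (s : nat) (delta : R)
    (A : set 'rV[R]_d) : \bar R :=
  ereal_inf [set (\sum_(0 <= k <oo) hterm s (C k))%E
            | C in [set C : nat -> set 'rV[R]_d |
                     A `<=` \bigcup_k C k /\ forall k, (ediam (C k) <= delta%:E)%E]].

(* s-dimensional Hausdorff (outer) measure, without the normalising
   constant omega_s / 2^s (irrelevant for null sets) *)
Definition hausdorff {R : realType} {d : nat} (s : nat) (A : set 'rV[R]_d) : \bar R :=
  ereal_sup [set hausdorff_pre s delta A | delta in [set delta : R | 0 < delta]].

Definition ext_convex {R : realType} {d : nat} (phi : 'rV[R]_d -> \bar R) : Prop :=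
  forall (x y : 'rV[R]_d) (t : R), 0 < t < 1 ->
    (phi (t *: x + (1 - t) *: y)%R <= t%:E * phi x + (1 - t)%:E * phi y)%E.

Definition essentially_continuous {R : realType} {d : nat}
    (phi : 'rV[R]_d -> \bar R) : Prop :=
  lower_semicontinuous phi /\
  hausdorff (d - 1) [set x | ~ {for x, continuous phi}] = 0%E.

Definition Zphi {R : realType} {d : nat} (phi : 'rV[R]_d -> \bar R) : \bar R :=
  leb_int (fun x => expeR (- phi x)%E).

Definition rho_int {R : realType} {d : nat} (phi : 'rV[R]_d -> \bar R)
    (g : 'rV[R]_d -> \bar R) : \bar R :=
  ((fine (Zphi phi))^-1)%:E * leb_int (fun x => g x * expeR (- phi x))%E.

Definition in_L2 {R : realType} {d : nat} (phi : 'rV[R]_d -> \bar R)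
    (f : 'rV[R]_d -> R) : Prop :=
  (rho_int phi (fun x => ((f x) ^+ 2)%:E) < +oo)%E.

Definition rho_mean {R : realType} {d : nat} (phi : 'rV[R]_d -> \bar R)
    (f : 'rV[R]_d -> R) : R :=
  fine (rho_int phi (fun x => (Num.max (f x) 0)%:E))
  - fine (rho_int phi (fun x => (Num.max (- f x) 0)%:E)).

Definition rho_var {R : realType} {d : nat} (phi : 'rV[R]_d -> \bar R)
    (f : 'rV[R]_d -> R) : \bar R :=
  rho_int phi (fun x => ((f x - rho_mean phi f) ^+ 2)%:E).

Definition has_grad {R : realType} {d : nat} (f : 'rV[R]_d -> R) (x g : 'rV[R]_d)
    : Prop :=
  forall e : R, 0 < e -> exists2 delta : R, 0 < delta &
    forall h : 'rV[R]_d, `|h| < delta ->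
      `|f (x + h) - f x - dotv g h| <= e * `|h|.

Definition in_int_dom {R : realType} {d : nat} (phi : 'rV[R]_d -> \bar R)
    (x : 'rV[R]_d) : Prop :=
  exists2 r : R, 0 < r & forall y, `|y - x| < r -> (phi y < +oo)%E.

Definition ext_has_grad {R : realType} {d : nat} (phi : 'rV[R]_d -> \bar R)
    (x g : 'rV[R]_d) : Prop :=
  in_int_dom phi x /\ has_grad (fun y => fine (phi y)) x g.

Definition alexandrov_hess {R : realType} {d : nat} (phi : 'rV[R]_d -> \bar R)
    (x : 'rV[R]_d) (A : 'M[R]_d) : Prop :=
  in_int_dom phi x /\ A^T = A /\
  exists p : 'rV[R]_d, has_grad (fun y => fine (phi y)) x p /\
    forall e : R, 0 < e -> exists2 delta : R, 0 < delta &
      forall h : 'rV[R]_d, `|h| < delta ->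
        `|fine (phi (x + h)) - fine (phi x) - dotv p h - 2^-1 * dotv (h *m A) h|
          <= e * `|h| ^+ 2.

(* a.e.-defined objects, chosen (arbitrarily 0 where undefined) *)
Definition grad {R : realType} {d : nat} (f : 'rV[R]_d -> R) (x : 'rV[R]_d)
    : 'rV[R]_d := xget 0 [set g | has_grad f x g].

Definition ext_grad {R : realType} {d : nat} (phi : 'rV[R]_d -> \bar R)
    (x : 'rV[R]_d) : 'rV[R]_d := xget 0 [set g | ext_has_grad phi x g].

Definition hess {R : realType} {d : nat} (phi : 'rV[R]_d -> \bar R)
    (x : 'rV[R]_d) : 'M[R]_d := xget 0 [set A | alexandrov_hess phi x A].

(* <A^{-1} v, v> for a symmetric positive semidefinite A, defined as the
   Legendre-type supremum  sup_w (2<v,w> - <Aw,w>)  (= +oo if v is not in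
   the range of A, = <A^{-1}v,v> if A is invertible) *)
Definition qinv {R : realType} {d : nat} (A : 'M[R]_d) (v : 'rV[R]_d) : \bar R :=
  ereal_sup (range (fun w : 'rV[R]_d => (2 * dotv v w - dotv (w *m A) w)%:E)).

Definition deltaBL {R : realType} {d : nat} (phi : 'rV[R]_d -> \bar R)
    (f : 'rV[R]_d -> R) : \bar R :=
  (rho_int phi (fun x => qinv (hess phi x) (grad f x)) - rho_var phi f)%E.

Definition distL1_OBL {R : realType} {d : nat} (phi : 'rV[R]_d -> \bar R)
    (f : 'rV[R]_d -> R) : \bar R :=
  ereal_inf (range (fun ab : 'rV[R]_d * R =>
    rho_int phi (fun x => (`|f x - (dotv ab.1 (ext_grad phi x) + ab.2)|)%:E))).

Definition locally_lipschitz {R : realType} {d : nat} (f : 'rV[R]_d -> R) : Prop :=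
  forall x : 'rV[R]_d, exists2 r : R, 0 < r & exists L : R,
    forall y z, `|y - x| < r -> `|z - x| < r -> `|f y - f z| <= L * `|y - z|.

Definition mul_sqrte {R : realType} (C : R) (x : \bar R) : \bar R :=
  match x with
  | r%:E => (C * Num.sqrt r)%:E
  | +oo%E => +oo%E
  | -oo%E => 0%E
  end.

(* Main.v *)
(** Let L u = sum_i (d_ii u - d_i phi d_i u), so that int (L u) v rho = - int (grad u . grad v) rho
    for rho = e^{-phi}.  For smooth phi, Bochner's formula and the Legendre form of <(D^2 phi)^{-1} w, w>
    bound int |D^2 u|^2 rho by the deficit of f as soon as L u is close to f - mean f, and such u
    exist by minimising int (f - L u)^2 rho.  Writing V = grad u - mean(grad u), the function
    f - mean f - a . grad phi, with a = mean(- grad u) = Cov(f, x), equals div V - V . grad phi up to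
    a small error.  In an affine position adapted to phi, both terms are controlled in L^1 by the
    weighted L^2 norm of D^2 u, through an L^1 Poincare inequality with constants depending on
    the dimension only, obtained by transporting rho along segments (log-concavity).

    A Lipschitz phi is mollified.  A general phi is replaced by its infimal convolutions with
    m |x|, which are Lipschitz and coincide with phi near each interior point of the domain for m
    large; the topological boundary of the domain is a null set since phi is discontinuous there, and
    a small Huber function restores uniform convexity where the two functions differ.  No second
    order differentiability of phi is needed: the deficit is bounded below using second difference
    quotients of phi in countably many directions. *)
Require Import Defs.
From HB Require Import structures.
From mathcomp Require Import all_boot all_order all_algebra perm.
From mathcomp Require Import all_classical all_reals all_analysis.
From mathcomp Require Import measurable_realfun.
From mathcomp Require Import ring lra.
Set Implicit Arguments.
Unset Strict Implicit.
Unset Printing Implicit Defensive.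
Import Order.TTheory GRing.Theory Num.Theory.
Import numFieldNormedType.Exports.
Local Open Scope classical_set_scope.
Local Open Scope ring_scope.

(** * Lebesgue measure on R^d *)

(** The deficit is carried through the approximations by a majorant G with $2\partial_h
    f-\partial^2_{hh}\phi\le G$ for all directions h. Unlike $\langle(D^2\phi)^{-1}\nabla f,\nabla
    f\rangle$, this family of inequalities is affine in (f, phi): it survives averaging, the
    addition of a convex function to phi and the replacement of derivatives by difference quotients,
    and G enters the final estimate monotonically. The slope Cov(f, x) is determined by f and the
    weight alone, not by u or by the affine position, so it converges at every stage, while the
    $L^1$ error passes to the limit by Fatou's lemma. The equation for u is never solved by elliptic
    theory. A near minimiser satisfies its Euler equation only against smooth test functions, so the
    residual is tested with a mollification of itself, adjoint for the weight; its Dirichlet energy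
    tends to 0, and the Poincare inequality turns this into smallness of the residual. Constants in
    d alone arise because the volume l of the unit parallelepiped and the minimum m of phi occur
    only through $l e^{-m}$, which is at most a dimensional multiple of the total mass. *)

Section leb_outer_measure.
Context {R : realType} {d' : nat}.
Local Notation d := d'.+1.
Local Notation V := 'rV[R]_d.
Implicit Types (A : set V) (ab : V * V).
Local Open Scope ereal_scope.

Lemma box_vol_ge0 ab : (0 <= box_vol ab)%R.
Proof. by apply: prodr_ge0 => i _; rewrite le_max lexx. Qed.

Lemma leb_outer_ge0 A : 0 <= leb_outer A.
Proof.
apply: le_ereal_inf_tmp => x [B _ <-]; apply: nneseries_ge0 => n _ _.
by rewrite lee_fin box_vol_ge0.
Qed.

Lemma leb_outer_le A (B : nat -> V * V) : A `<=` \bigcup_k box (B k) ->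
  leb_outer A <= \sum_(0 <= k <oo) (box_vol (B k))%:E.
Proof. by move=> AB; apply: ereal_inf_lbound; exists B. Qed.

Lemma le_leb_outer : {homo (@leb_outer R d) : A B / A `<=` B >-> A <= B}.
Proof.
move=> A B AB; apply/ereal_inf_le_tmp => x [B' BB'] <-{x}.
by exists B' => //; exact: subset_trans BB'.
Qed.

(** Positive dimension enters here: in dimension 0 the empty product would be 1. The dimension is
    therefore written [d'.+1] throughout. *)
Lemma box_vol00 : box_vol ((0%R, 0%R) : V * V) = 0%R.
Proof.
by rewrite /box_vol (bigD1 ord0)//= mxE subrr maxxx mul0r.
Qed.

Lemma leb_outer0 : leb_outer (set0 : set V) = 0.
Proof.
apply/eqP; rewrite eq_le leb_outer_ge0 andbT.
apply: (le_trans (@leb_outer_le _ (fun=> (0%R : V, 0%R : V)) _)) => //.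
by rewrite eseries0// => i _ _; rewrite box_vol00.
Qed.

(** Each set is covered by boxes up to an excess $e/2^{n+1}$, and a bijection of nat with pairs
    enumerates the resulting double sequence of boxes. *)
Lemma leb_outer_sigma_subadditive : sigma_subadditive (@leb_outer R d).
Proof.
move=> A; have [[i ioo]|] := pselect (exists i, leb_outer (A i) = +oo).
  rewrite (eseries_pinfty _ _ ioo) ?leey// => n _.
  by rewrite -ltNye (lt_le_trans _ (leb_outer_ge0 _)).
rewrite -forallNE => Aoo.
suff add2e (e : {posnum R}) :
    leb_outer (\bigcup_n A n) <= \sum_(i <oo) leb_outer (A i) + e%:num%:E.
  by apply/lee_addgt0Pr => _/posnumP[].
rewrite (le_trans _ (epsilon_trick _ _ _))//; last first.
  by move=> n; exact: leb_outer_ge0.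
pose P n (B : nat -> V * V) := A n `<=` \bigcup_k box (B k) /\
  \sum_(0 <= k <oo) (box_vol (B k))%:E <=
    leb_outer (A n) + (e%:num / (2 ^ n.+1)%:R)%:E.
have [G PG] : {G : nat -> (nat -> V * V) & forall n, P n (G n)}.
  apply: (@choice _ _ P) => n; rewrite /P /leb_outer.
  set S := (X in ereal_inf X); move infS : (ereal_inf S) => iS.
  case: iS infS => [r Sr|Soo|Soo].
  - have en1 : (0 < e%:num / (2 ^ n.+1)%:R)%R by [].
    have /(lb_ereal_inf_adherent en1) : ereal_inf S \is a fin_num by rewrite Sr.
    move=> [x [B AnB muBx] xS].
    by exists B; split => //; rewrite muBx -Sr; exact/ltW.
  - by have := Aoo n; rewrite /leb_outer Soo.
  - suff : lbound S 0 by move/le_ereal_inf_tmp; rewrite Soo.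
    move=> /= _ [B AnB <-]; apply: nneseries_ge0 => k _ _.
    by rewrite lee_fin box_vol_ge0.
pose g (p : nat * nat) : \bar R := (box_vol (G p.1 p.2))%:E.
have g_ge0 x : 0 <= g x by rewrite lee_fin box_vol_ge0.
apply: (@le_trans _ _ (\esum_(i in setT) g i)).
  have /card_esym/ppcard_eqP[f] := card_nat2.
  have := @leb_outer_le (\bigcup_n A n) (fun n => G (f n).1 (f n).2).
  move=> /(_ _)/le_trans; apply.
    move=> t [i _ /(proj1 (PG i))[j _ Bijt]].
    by exists (f^-1%FUN (i, j)) => //=; rewrite invK ?inE.
  rewrite -(esum_pred_image g _ xpredT) ?[fun=> _]set_true//.
  by rewrite image_eq.
rewrite (_ : esum _ _ = \sum_(i <oo) \sum_(j <oo ) g (i, j)); last first.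
  pose J : nat -> set (nat * nat) := fun i => [set (i, j) | j in setT].
  rewrite (_ : setT = \bigcup_k J k); last first.
    by rewrite predeqE => -[a b]; split => // _; exists a => //; exists b.
  rewrite esum_bigcupT //=; last first.
    apply/trivIsetP => i j _ _ ij.
    rewrite predeqE => -[n m] /=; split => //= -[] [_] _ [<-{n} _].
    by move=> [m' _] [] /esym/eqP; rewrite (negbTE ij).
  rewrite -(image_id [set: nat]) -fun_true esum_pred_image//; last first.
    by move=> n _; exact: esum_ge0.
  apply: eq_eseriesr => /= j _.
  rewrite -(esum_pred_image g (pair j) predT)//=; last first.
    by move=> ? ? _ _; exact: (@can_inj _ _ _ snd).
  by congr esum; rewrite predeqE => -[a b]; split; move=> [i _ <-]; exists i.
apply: lee_lim.
- apply: is_cvg_nneseries => n *.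
  by apply: nneseries_ge0 => m *; exact: (g_ge0 (n, m)).
- by apply: is_cvg_nneseries => n *; apply: adde_ge0 => //; exact: leb_outer_ge0.
- by near=> n; apply: lee_sum => i _; exact: (PG i).2.
Unshelve. all: by end_near. Qed.

End leb_outer_measure.

Section leb_outer_prop.
Context {R : realType} {d' : nat}.
Local Notation d := d'.+1.
Local Notation V := 'rV[R]_d.
Implicit Types (A : set V) (ab : V * V).
Local Open Scope ereal_scope.

HB.instance Definition _ := isOuterMeasure.Build R V (@leb_outer R d)
  leb_outer0 leb_outer_ge0 le_leb_outer leb_outer_sigma_subadditive.

Definition halfspace (i : 'I_d) (c : R) : set V := [set x | (x 0%R i < c)%R].

(** A hyperplane $x_i=c$ cuts a box into two boxes that differ from it only in the i-th side, and
    the two side lengths add up, also when one piece is empty. *)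
Lemma halfspace_caratheodory i c : (@leb_outer R d).-caratheodory (halfspace i c).
Proof.
apply: le_caratheodory_measurable => X; apply: le_ereal_inf_tmp => _ [B XB <-].
pose B1 k : V * V :=
  ((B k).1, \row_j (if j == i then Num.min ((B k).2 0%R j) c else (B k).2 0%R j)).
pose B2 k : V * V :=
  (\row_j (if j == i then Num.max ((B k).1 0%R j) c else (B k).1 0%R j), (B k).2).
have -> : \sum_(0 <= k <oo) (box_vol (B k))%:E =
    \sum_(0 <= k <oo) (box_vol (B1 k))%:E + \sum_(0 <= k <oo) (box_vol (B2 k))%:E.
  rewrite -nneseriesD//; last 2 first.
    by move=> k _ _; rewrite lee_fin box_vol_ge0.
    by move=> k _ _; rewrite lee_fin box_vol_ge0.
  apply: eq_eseriesr => k _; rewrite -EFinD; congr EFin.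
  rewrite /box_vol (bigD1 i)//= [in X in (_ = X + _)%R](bigD1 i)//=.
  rewrite [in X in (_ = _ + X)%R](bigD1 i)//= !mxE eqxx.
  rewrite [in X in (_ = X + _)%R](eq_bigr
    (fun j => Num.max 0%R ((B k).2 0%R j - (B k).1 0%R j)%R)); last first.
    by move=> j /negbTE ji; rewrite mxE ji.
  rewrite [in X in (_ = _ + X)%R](eq_bigr
    (fun j => Num.max 0%R ((B k).2 0%R j - (B k).1 0%R j)%R)); last first.
    by move=> j /negbTE ji; rewrite mxE ji.
  rewrite -mulrDl; congr (_ * _)%R.
  set a := (B k).1 0%R i; set b := (B k).2 0%R i.
  rewrite /Num.max /Num.min.
  by do ![case: ifPn => //=; rewrite -?leNgt] => *; lra.
apply: leeD; apply: leb_outer_le.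
  move=> x [/XB[k _ Bx] xc]; exists k => // j; rewrite /B1/= mxE.
  case: eqP => [ji|_]; last exact: Bx.
  have /andP[-> bx] := Bx j; rewrite /= le_min bx/= ji; exact: ltW.
move=> x [/XB[k _ Bx] /negP]; rewrite -leNgt => xc; exists k => // j.
rewrite /B2/= mxE.
case: eqP => [ji|_]; last exact: Bx.
by have /andP[ax ->] := Bx j; rewrite andbT ge_max ax/= ji.
Qed.

Lemma leb_outer_shift_le (v : V) A :
  leb_outer [set x | A (x + v)%R] <= leb_outer A.
Proof.
apply: le_ereal_inf_tmp => _ [B AB <-].
have := @leb_outer_le R d' [set x | A (x + v)%R]
  (fun k => ((B k).1 - v, (B k).2 - v)%R).
move=> /(_ _)/le_trans; apply.
  move=> x /AB[k _ Bx]; exists k => // j; have := Bx j.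
  by rewrite /= !mxE lerBlDr lerBrDr.
rewrite le_eqVlt; apply/orP; left; apply/eqP.
apply: eq_eseriesr => k _; congr EFin; apply: eq_bigr => i _.
by rewrite !mxE; congr Num.max; lra.
Qed.

Lemma leb_outer_shift (v : V) A : leb_outer [set x | A (x + v)%R] = leb_outer A.
Proof.
apply/eqP; rewrite eq_le leb_outer_shift_le/=.
rewrite -[in leLHS](_ : [set x | [set x | A (x + v)%R] (x - v)%R] = A).
  exact: leb_outer_shift_le.
by apply/seteqP; split => x /=; rewrite subrK.
Qed.

Lemma leb_outer_scale_le (s : R) A : (0 < s)%R ->
  (s ^+ d)%:E * leb_outer [set x | A (s *: x)%R] <= leb_outer A.
Proof.
move=> s0; apply: le_ereal_inf_tmp => _ [B AB <-].
have := @leb_outer_le R d' [set x | A (s *: x)%R]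
  (fun k => (s^-1 *: (B k).1, s^-1 *: (B k).2)%R).
have sd0 : 0 <= (s ^+ d)%:E by rewrite lee_fin exprn_ge0// ltW.
move=> /(_ _)/(lee_wpmul2l sd0)/le_trans; apply.
  move=> x /AB[k _ Bx]; exists k => // j; have := Bx j.
  by rewrite /= !mxE ler_pdivrMl// ler_pdivlMl.
rewrite -nneseriesZl; last by move=> k _; rewrite lee_fin box_vol_ge0.
rewrite le_eqVlt; apply/orP; left; apply/eqP.
apply: eq_eseriesr => k _; rewrite -EFinM; congr EFin.
have -> : (s ^+ d = \prod_(i < d) s)%R by rewrite prodr_const card_ord.
rewrite /box_vol -big_split/=.
apply: eq_bigr => i _.
rewrite !mxE maxr_pMr ?(ltW s0)// mulr0 -mulrBr mulrA divff ?gt_eqF//.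
by rewrite mul1r.
Qed.

Lemma leb_outer_scale (s : R) A : (0 < s)%R ->
  (s ^+ d)%:E * leb_outer [set x | A (s *: x)%R] = leb_outer A.
Proof.
move=> s0; apply/eqP; rewrite eq_le leb_outer_scale_le//=.
have si : (0 < s^-1)%R by rewrite invr_gt0.
have := leb_outer_scale_le [set x | A (s *: x)%R] si.
rewrite (_ : [set x | [set y | A (s *: y)%R] (s^-1 *: x)%R] = A); last first.
  by apply/seteqP; split => x /=; rewrite scalerA divff ?gt_eqF// scale1r.
have sd0 : 0 <= (s ^+ d)%:E by rewrite lee_fin exprn_ge0// ltW.
move=> /(lee_wpmul2l sd0); rewrite muleA -EFinM -exprMn divff ?gt_eqF//.
by rewrite expr1n mul1e.
Qed.

Lemma leb_outer_box_le ab : leb_outer (box ab) <= (box_vol ab)%:E.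
Proof.
have := @leb_outer_le R d' (box ab) (fun k => if k == 0%N then ab else (0,0)%R).
move=> /(_ _)/le_trans; apply; first by move=> x abx; exists 0%N.
rewrite (nneseriesD1 (n:=0%N))//; last first.
  by move=> k _; rewrite lee_fin box_vol_ge0.
rewrite /= eseries0 ?adde0//= => k _ /=; case: k => //= k _.
by rewrite box_vol00.
Qed.

End leb_outer_prop.

(** Opaque, so that this display is not convertible to another one. *)
Definition rv_display : measure_display.
Proof. exact: default_measure_display. Qed.

Section rv_measurable.
Context {R : realType} {d' : nat}.
Local Notation d := d'.+1.
Local Notation V := 'rV[R]_d.

Definition rv_gen : set (set V) :=
  [set A | exists i c, A = halfspace i c].

HB.instance Definition _ := @isMeasurable.Build rv_display 'rV[R]_d <<s rv_gen >>
  (@sigma_algebra0 _ _ rv_gen) (@sigma_algebraC _ rv_gen)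
  (@sigma_algebra_bigcup _ _ rv_gen).

Lemma measurable_halfspace i c : measurable (halfspace i c : set V).
Proof. by apply: sub_sigma_algebra; exists i, c. Qed.

Lemma measurable_coord i : measurable_fun setT (fun x : V => x 0 i).
Proof.
apply: (@measurability _ _ V R setT _ _ (RGenInftyO.measurableE R)).
move=> _ [_ [c ->] <-]; rewrite setTI.
rewrite (_ : _ @^-1` _ = halfspace i c); first exact: measurable_halfspace.
by apply/seteqP; split => x; rewrite /= in_itv.
Qed.

Lemma measurable_fun_rv d0 (T : measurableType d0) (f : T -> V) :
  (forall i, measurable_fun setT (fun x => f x 0 i)) -> measurable_fun setT f.
Proof.
move=> mf; apply: (@measurability _ _ T V setT f rv_gen) => //.
move=> _ [_ [i [c ->]] <-]; rewrite setTI.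
rewrite (_ : _ @^-1` _ = (fun x => f x 0 i) @^-1` `]-oo, c[%classic); last first.
  by apply/seteqP; split => x; rewrite /= in_itv.
by rewrite -[X in measurable X]setTI; apply: mf => //; exact: measurable_itv.
Qed.

Lemma coord_le_norm (x : V) i : `|x 0 i| <= `|x|.
Proof.
by rewrite [leRHS]/Num.norm /= mx_normrE; exact: (le_bigmax _ (fun ij => `|x ij.1 ij.2|) (0, i)).
Qed.

Lemma norm_rv_le (x : V) c : 0 <= c -> (forall i, `|x 0 i| <= c) -> `|x| <= c.
Proof.
move=> c0 xc; rewrite [leLHS]/Num.norm /= mx_normrE; apply/bigmax_leP; split => // -[i j] _/=.
by rewrite ord1.
Qed.

Lemma norm_rv_lt (x : V) c : 0 < c -> (forall i, `|x 0 i| < c) -> `|x| < c.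
Proof.
move=> c0 xc; rewrite [ltLHS]/Num.norm /= mx_normrE; apply/bigmax_ltP; split => // -[i j] _/=.
by rewrite ord1.
Qed.

Lemma measurable_forall_ord (P : 'I_d -> set V) :
  (forall i, measurable (P i)) -> measurable [set x | forall i, P i x].
Proof.
move=> mP; rewrite (_ : [set x | _] = \bigcap_(i in setT) P i).
  exact: fin_bigcap_measurable.
by apply/seteqP; split => x h i //; exact: h.
Qed.

Definition rat_box (ab : 'rV[rat]_d * 'rV[rat]_d) : set V :=
  [set x | forall i, ratr (ab.1 0 i) < x 0 i < ratr (ab.2 0 i)].

Lemma measurable_rat_box ab : measurable (rat_box ab).
Proof.
apply: (@measurable_forall_ord (fun i => [set x | ratr (ab.1 0 i) < x 0 i < ratr (ab.2 0 i)])) => i; cbv beta.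
rewrite [X in measurable X](_ : _ = setT `&`
   ((fun x : V => x 0 i) @^-1` `]ratr (ab.1 0 i), ratr (ab.2 0 i)[%classic)).
  by apply: measurable_coord => //; exact: measurable_itv.
by rewrite setTI; apply/seteqP; split => x; rewrite /= in_itv.
Qed.

(** An open set is the union of the countably many rational open boxes that it contains; the norm on
    row vectors is the sup norm, so such boxes form a base. *)
Lemma open_measurable_rv (U : set V) : open U -> measurable U.
Proof.
move=> oU; pose F ab := if `[< rat_box ab `<=` U >] then rat_box ab else set0.
rewrite (_ : U = \bigcup_ab F ab).
  apply: countable_bigcupT_measurable; first exact: countableP.
  by move=> ab; rewrite /F; case: ifP => // _; exact: measurable_rat_box.
apply/seteqP; split => x; last first.
  by move=> [ab _]; rewrite /F; case: ifPn => // /asboolP + h; apply.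
move=> Ux; have /nbhs_ballP[e /= e0 xeU] : nbhs x U by exact: open_nbhs_nbhs.
have ha i : exists q : rat, x 0 i - e < ratr q < x 0 i.
  have [q] := @rat_in_itvoo R (x 0 i - e) (x 0 i) ltac:(lra).
  by rewrite in_itv/=; exists q.
have hb i : exists q : rat, x 0 i < ratr q < x 0 i + e.
  have [q] := @rat_in_itvoo R (x 0 i) (x 0 i + e) ltac:(lra).
  by rewrite in_itv/=; exists q.
have [a ax] := choice ha; have [b bx] := choice hb.
exists (\row_i a i, \row_i b i) => //; rewrite /F ifT; last first.
  apply/asboolP => y yab; apply: xeU; rewrite -ball_normE/=.
  apply: norm_rv_lt => // i; have := yab i; have := ax i; have := bx i.
  by rewrite !mxE /= ltr_norml => *; lra.
move=> i; rewrite !mxE/=.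
by have /andP[_ ->] := ax i; have /andP[-> _] := bx i.
Qed.

Lemma continuous_measurable_rv (f : V -> R) : continuous f -> measurable_fun setT f.
Proof.
move=> /continuousP cf; apply: (@measurability _ _ V R setT _ _ (RGenOpens.measurableE R)).
move=> _ [_ [a [b ->]] <-]; rewrite setTI; apply: open_measurable_rv.
by apply: cf; exact: interval_open.
Qed.

End rv_measurable.

Section lam_measure.
Context {R : realType} {d' : nat}.
Local Notation d := d'.+1.
Local Notation V := 'rV[R]_d.
Local Open Scope ereal_scope.

Lemma measurable_caratheodory (A : set V) : measurable A ->
  (@leb_outer R d).-caratheodory A.
Proof.
move: A; apply: smallest_sub; last by move=> _ [i [c ->]]; exact: halfspace_caratheodory.
split; first exact: caratheodory_measurable_set0.
  by move=> A mA; rewrite setTD; exact: caratheodory_measurable_setC.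
by move=> F mF; exact: caratheodory_measurable_bigcup.
Qed.

(** The same function as [leb_outer], under a name that carries the measure structure. Being an
    outer measure, it can still be evaluated on sets not known to be measurable. *)
Definition lam : set V -> \bar R := @leb_outer R d.

Lemma lam0 : lam set0 = 0. Proof. exact: leb_outer0. Qed.

Lemma lam_ge0 A : 0 <= lam A. Proof. exact: leb_outer_ge0. Qed.

Lemma lam_semi_sigma_additive : semi_sigma_additive lam.
Proof.
move=> F mF tF mUF.
apply: (@caratheodory_measure_sigma_additive R V (@leb_outer R d)) => //.
  by move=> i; apply: measurable_caratheodory; exact: mF.
exact: measurable_caratheodory.
Qed.

HB.instance Definition _ := isMeasure.Build _ V R lam
  lam0 lam_ge0 lam_semi_sigma_additive.

Lemma measurable_norm_le (r : R) : measurable [set x : V | (`|x| <= r)%R].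
Proof.
have mn := continuous_measurable_rv (@norm_continuous R V).
rewrite (_ : [set x | _] = setT `&` (fun x : V => `|x|%R) @^-1` `]-oo, r]%classic).
  by apply: mn => //; exact: measurable_itv.
by rewrite setTI; apply/seteqP; split => x; rewrite /= in_itv.
Qed.

Lemma lam_ball_lty (r : R) : lam [set x : V | (`|x| <= r)%R] < +oo.
Proof.
have := @leb_outer_box_le R d' ((const_mx (- r))%R, (const_mx r)%R).
move=> /(le_trans _)h; apply: le_lt_trans (h (lam [set x : V | (`|x| <= r)%R]) _) _; last exact: ltry.
apply: le_leb_outer => x /= xr i; rewrite !mxE -ler_norml.
exact: le_trans (coord_le_norm _ _) xr.
Qed.

Lemma lam_sigma_finite : sigma_finite setT lam.
Proof.
exists (fun n => [set x : V | (`|x| <= n%:R)%R]).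
  apply/seteqP; split => // x _; exists (Num.trunc `|x|).+1 => //=.
  by rewrite ltW// truncnS_gt.
by move=> n; split; [exact: measurable_norm_le|exact: lam_ball_lty].
Qed.

HB.instance Definition _ := Measure_isSigmaFinite.Build _ V R lam lam_sigma_finite.

(** The integral of a nonnegative function is a supremum over the simple functions below it, which
    gives monotonicity also for integrands not known to be measurable. *)
Lemma nn_le_integral dd (T : measurableType dd) (mu : {measure set T -> \bar R})
    (D : set T) (f g : T -> \bar R) :
  (forall x, D x -> 0 <= f x) -> (forall x, D x -> f x <= g x) ->
  \int[mu]_(x in D) f x <= \int[mu]_(x in D) g x.
Proof.
move=> f0 fg; rewrite !ge0_integralE//; last first.
  by move=> x Dx; exact: le_trans (f0 _ Dx) (fg _ Dx).
apply: ereal_sup_le => _ [h hf <-]; exists h => // x.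
apply: le_trans (hf x) _; rewrite !patchE; case: ifPn => // /set_mem; exact: fg.
Qed.

End lam_measure.

Section lam_integral.
Context {R : realType} {d' : nat}.
Local Notation d := d'.+1.
Local Notation V := 'rV[R]_d.
Local Notation mu := (@lam R d').
Local Open Scope ereal_scope.

Lemma measurable_fun_addv d0 (T : measurableType d0) (f g : T -> V) :
  measurable_fun setT f -> measurable_fun setT g ->
  measurable_fun setT (fun x => (f x + g x)%R).
Proof.
move=> mf mg; apply: measurable_fun_rv => i.
under eq_fun do rewrite mxE.
by apply: measurable_funD; apply: (measurableT_comp (measurable_coord i)).
Qed.

Lemma measurable_fun_scalev d0 (T : measurableType d0) (k : T -> R) (f : T -> V) :
  measurable_fun setT k -> measurable_fun setT f ->
  measurable_fun setT (fun x => (k x *: f x)%R).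
Proof.
move=> mk mf; apply: measurable_fun_rv => i.
under eq_fun do rewrite mxE.
by apply: measurable_funM => //; apply: (measurableT_comp (measurable_coord i)).
Qed.

Lemma measurable_fun_oppv d0 (T : measurableType d0) (f : T -> V) :
  measurable_fun setT f -> measurable_fun setT (fun x => (- f x)%R).
Proof.
move=> mf; under eq_fun do rewrite -scaleN1r.
exact: measurable_fun_scalev.
Qed.

Lemma measurable_fun_subv d0 (T : measurableType d0) (f g : T -> V) :
  measurable_fun setT f -> measurable_fun setT g ->
  measurable_fun setT (fun x => (f x - g x)%R).
Proof. by move=> mf mg; apply: measurable_fun_addv => //; exact: measurable_fun_oppv. Qed.

Lemma ge0_integral_shift (v : V) (f : V -> \bar R) :
  measurable_fun setT f -> (forall x, 0 <= f x) ->
  \int[mu]_x f (x + v)%R = \int[mu]_x f x.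
Proof.
move=> mf f0.
have mv : measurable_fun setT (fun x : V => (x + v)%R).
  by apply: measurable_fun_addv.
have := ge0_integral_pushforward mv mu measurableT mf (fun y _ => f0 y).
rewrite preimage_setT => <-; apply: eq_measure_integral => A mA _.
exact: leb_outer_shift.
Qed.

Lemma ge0_integral_scale (s : R) (f : V -> \bar R) : (0 < s)%R ->
  measurable_fun setT f -> (forall x, 0 <= f x) ->
  (s ^+ d)%:E * \int[mu]_x f (s *: x)%R = \int[mu]_x f x.
Proof.
move=> s0 mf f0.
have mv : measurable_fun setT (fun x : V => (s *: x)%R).
  by apply: measurable_fun_scalev.
have sd0 : (0 <= s ^+ d)%R by rewrite exprn_ge0// ltW.
have := ge0_integral_pushforward mv mu measurableT mf (fun y _ => f0 y).
rewrite preimage_setT => <-.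
rewrite -(ge0_integral_mscale _ measurableT (NngNum sd0))//.
apply: eq_measure_integral => A mA _.
by rewrite /= /mscale/=; exact: leb_outer_scale.
Qed.

Lemma leb_outer_opp (A : set V) : leb_outer [set x | A (- x)%R] = leb_outer A.
Proof.
have le B : leb_outer [set x : V | B (- x)%R] <= leb_outer B.
  apply: le_ereal_inf_tmp => _ [C AC <-].
  have := @leb_outer_le R d' [set x | B (- x)%R] (fun k => (- (C k).2, - (C k).1)%R).
  move=> /(_ _)/le_trans; apply.
    move=> x /AC[k _ Bx]; exists k => // j; have := Bx j.
    by rewrite /= !mxE => /andP[? ?]; apply/andP; split; lra.
  rewrite le_eqVlt; apply/orP; left; apply/eqP.
  apply: eq_eseriesr => k _; congr EFin; apply: eq_bigr => i _.
  by rewrite !mxE; congr Num.max; lra.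
apply/eqP; rewrite eq_le le/=.
rewrite -[in leLHS](_ : [set x | [set x | A (- x)%R] (- x)%R] = A); first exact: le.
by apply/seteqP; split => x /=; rewrite opprK.
Qed.

Lemma integral_lt_height (r : \bar R) : 0 <= r ->
  \int[lebesgue_measure]_(t in [set t : R | (0 <= t)%R])
    (\1_[set s : R | (s%:E < r)%E] t)%:E = r.
Proof.
move=> r0.
have mD : measurable [set t : R | (0 <= t)%R].
  rewrite (_ : [set t | _] = `[0%R, +oo[%classic); first exact: measurable_itv.
  by apply/seteqP; split => t; rewrite /= in_itv/= andbT.
have mr : measurable [set s : R | s%:E < r].
  case: r r0 => [r _|_|//].
    rewrite (_ : [set s : R | _] = `]-oo, r[%classic); first exact: measurable_itv.
    by apply/seteqP; split => t; rewrite /= in_itv/= lte_fin.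
  by rewrite (_ : [set s : R | _] = setT)//; apply/seteqP; split => // t _; exact: ltry.
rewrite integral_indic//.
case: r r0 mr => [r r0 _|_ _|//]; last first.
  rewrite (_ : _ `&` _ = `[0%R, +oo[%classic); last first.
    apply/seteqP; split => t /=; rewrite in_itv/= andbT; first by case.
    by move=> t0; split => //; exact: ltry.
  by have := @lebesgue_measure_itv R `[0%R, +oo[; rewrite /= ltry oppr0 adde0; exact.
rewrite (_ : _ `&` _ = `[0%R, r[%classic); last first.
  apply/seteqP; split => t /=; rewrite in_itv/= lte_fin; first by move=> [-> ->].
  by move=> /andP[].
have := @lebesgue_measure_itv R `[0%R, r[; rewrite /= lte_fin => h; rewrite [LHS]h.
case: ifPn => [_|]; first by rewrite oppr0 adde0.
by rewrite -leNgt => rle; congr EFin; apply/eqP; rewrite eq_le rle -lee_fin r0.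
Qed.

(** Tonelli for the indicator of the region under the graph of g: integrating first in x gives the
    layer-cake formula, integrating first in t gives the height [g x]. *)
Lemma leb_intE (g : V -> \bar R) : measurable_fun setT g ->
  (forall x, 0 <= g x) -> leb_int g = \int[mu]_x g x.
Proof.
move=> mg g0; rewrite /leb_int.
pose D := [set t : R | (0 <= t)%R].
have mD : measurable D.
  rewrite (_ : D = `[0%R, +oo[%classic); first exact: measurable_itv.
  by apply/seteqP; split => t; rewrite /D/= in_itv/= andbT.
pose h (p : V * R) : \bar R := (\1_[set q : V * R | (q.2%:E < g q.1)%E /\ (0 <= q.2)%R] p)%:E.
have mh : measurable_fun setT h.
  apply/measurable_EFinP/measurable_indic.
  rewrite (_ : [set q : V * R | _] =
    [set q : V * R | q.2%:E < g q.1] `&` [set q : V * R | (0 <= q.2)%R])//.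
  apply: measurableI.
    rewrite -[X in measurable X]setTI.
    apply: emeasurable_fun_lt => //.
      by apply: measurableT_comp => //.
    by apply: measurableT_comp => //.
  rewrite (_ : [set q : V * R | _] = setT `&` snd @^-1` D); last by rewrite setTI.
  exact: measurable_snd.
have h0 p : 0 <= h p by rewrite lee_fin.
transitivity (\int[lebesgue_measure]_t \int[mu]_x h (x, t)).
  rewrite [LHS]integral_mkcond; apply: eq_integral => t _; rewrite patchE.
  case: ifPn => [/set_mem/= t0|tD]; last first.
    rewrite integral0_eq// => x _; rewrite /h indicE memNset//= => -[_ t0].
    by move: tD; rewrite notin_setE.
  rewrite (_ : (fun x => h (x, t)) = (fun x => (\1_[set x | (t%:E < g x)%E] x)%:E)); last first.
    apply/funext => x; rewrite /h !indicE; congr ((nat_of_bool _)%:R%:E).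
    by apply/idP/idP => /set_mem/=[]; rewrite ?in_setE//= => h1 h2; exact/mem_set.
  rewrite integral_indic ?setIT//.
  by rewrite -[X in measurable X]setTI; apply: emeasurable_fun_lt.
rewrite -(@fubini_tonelli _ _ _ _ _ mu lebesgue_measure h)//.
apply: eq_integral => x _; rewrite -[RHS](integral_lt_height (g0 x)).
rewrite [RHS]integral_mkcond; apply: eq_integral => t _; rewrite patchE /h.
case: ifPn => [/set_mem/= t0|].
  rewrite !indicE; congr ((nat_of_bool _)%:R%:E).
  by apply/idP/idP => /set_mem/=; [case=> t1 _|move=> t1]; exact/mem_set.
rewrite notin_setE => /= t0; rewrite indicE memNset//=.
by case.
Qed.

(** The superlevel sets of g lie in those of h up to N, and outer measure is monotone and
    subadditive. This handles integrands such as the one built from [qinv], of which no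
    measurability is known. *)
Lemma leb_int_le_ae (N : set V) (g h : V -> \bar R) : leb_outer N = 0 ->
  (forall x, ~ N x -> g x <= h x) -> leb_int g <= leb_int h.
Proof.
move=> N0 gh; apply: nn_le_integral => t _; first exact: leb_outer_ge0.
apply: le_trans (_ : leb_outer ([set x | t%:E < h x] `|` N) <= _).
  apply: le_leb_outer => x /= tg; have [Nx|Nx] := pselect (N x); first by right.
  by left; exact: lt_le_trans (gh _ Nx).
by rewrite (le_trans (outer_measureU2 _ _ _))//= N0 adde0.
Qed.

Lemma leb_int_le (g h : V -> \bar R) : (forall x, g x <= h x) -> leb_int g <= leb_int h.
Proof. by move=> gh; apply: (@leb_int_le_ae set0) => //; exact: leb_outer0. Qed.

End lam_integral.

(** * Rademacher's theorem *)

Section lipschitz_derivable.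
Context {R : realType}.
Local Notation leb := (@lebesgue_measure R).

Section clamped.
Variables (k : R -> R) (C N : R).
Hypotheses (C0 : 0 <= C) (N0 : 0 < N).
Hypothesis kl : forall x y, x <= y -> y - x <= k y - k x <= C * (y - x).

Let clamp (x : R) := Num.max (- N) (Num.min N x).

Let clampE x : - N <= x <= N -> clamp x = x.
Proof. by move=> /andP[a b]; rewrite /clamp min_r// max_r. Qed.

Let clamp_homo x y : x <= y -> clamp x <= clamp y.
Proof.
move=> xy; rewrite /clamp ge_max le_max lexx/= le_max.
by apply/orP; right; rewrite le_min ge_min lexx/= ge_min xy orbT.
Qed.

Let clamp_lip x y : x <= y -> clamp y - clamp x <= y - x.
Proof.
move=> xy; rewrite /clamp /Num.max /Num.min.
by do ![case: ifPn => //=; rewrite -?leNgt] => *; lra.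
Qed.

Let M := k N - k (- N).

Let M_gt0 : 0 < M.
Proof.
have NN : - N <= N by move: N0 => /ltW N1; rewrite -subr_ge0 opprK addr_ge0.
rewrite /M; have /andP[h _] := kl NN.
by apply: lt_le_trans h; move: (N0) => N1; lra.
Qed.

Let G (x : R) : R := (k (clamp x) - k (- N)) / M.

Let Gle x y : x <= y -> 0 <= G y - G x <= C / M * (y - x).
Proof.
move=> xy; rewrite /G -mulrBl opprB addrA subrK.
have /andP[h1 h2] := kl (clamp_homo xy).
have cxy := clamp_homo xy; have cl := clamp_lip xy.
apply/andP; split.
  apply: divr_ge0; last exact: ltW.
  by apply: le_trans h1; rewrite subr_ge0.
rewrite mulrAC ler_pM2r ?invr_gt0//; apply: le_trans h2 _.
exact: ler_wpM2l.
Qed.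

Let G_nd : {homo G : x y / x <= y}.
Proof. by move=> x y xy; rewrite -subr_ge0; have /andP[] := Gle xy. Qed.

Let G_cont : continuous G.
Proof.
have GL x y : `|G x - G y| <= C / M * `|x - y|.
  have [xy|/ltW xy] := leP x y.
    rewrite distrC (distrC x) !ger0_norm ?subr_ge0 ?G_nd//.
    by have /andP[] := Gle xy.
  rewrite !ger0_norm ?subr_ge0 ?G_nd//.
  by have /andP[] := Gle xy.
have CM : 0 < C / M + 1 by rewrite ltr_wpDl// divr_ge0// ltW.
move=> x; apply/cvgrPdist_lt => e e0; near=> y.
apply: le_lt_trans (GL _ _) _.
apply: (@le_lt_trans _ _ ((C / M + 1) * `|x - y|)).
  by rewrite ler_wpM2r//; lra.
rewrite mulrC -ltr_pdivlMr//.
near: y; apply/nbhs_normP; exists (e / (C / M + 1)); last by [].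
by rewrite /= divr_gt0.
Unshelve. all: by end_near. Qed.

Let G_left x : x <= - N -> G x = 0.
Proof.
move: (N0) => N1 xN; rewrite /G /clamp min_r; last by lra.
by rewrite max_l// subrr mul0r.
Qed.

Let G_right x : N <= x -> G x = 1.
Proof.
move: (N0) => N1 xN; rewrite /G /clamp min_l// max_r; last by lra.
by rewrite divff// gt_eqF.
Qed.

Let G_rc : right_continuous G. Proof. exact: right_continuousW. Qed.

HB.instance Definition _ := isCumulative.Build R _ R G G_nd G_rc.

Let G_ny : G @ -oo --> (0 : R).
Proof.
apply: cvg_near_cst; near=> x; apply: G_left.
by near: x; apply: nbhs_ninfty_le; exact: num_real.
Unshelve. all: by end_near. Qed.

Let G_y : G @ +oo --> (1 : R).
Proof.
apply: cvg_near_cst; near=> x; apply: G_right.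
by near: x; apply: nbhs_pinfty_ge; exact: num_real.
Unshelve. all: by end_near. Qed.

HB.instance Definition _ := isCumulativeBounded.Build R 0 1 G G_ny G_y.

Let nu := lebesgue_stieltjes_measure G.

Let nu_itv a b : a <= b -> nu `]a, b]%classic = (G b - G a)%:E.
Proof.
move=> ab; rewrite /nu /lebesgue_stieltjes_measure /measure_extension.
rewrite measurable_mu_extE/=; last exact: is_ocitv.
by rewrite wlength_itv_bnd.
Qed.

(** On half-open intervals the G-length is at most K times the length; the covers that define the
    two outer measures transfer the comparison to every measurable set. *)
Let nu_dom : nu `<< leb.
Proof.
apply/null_content_dominatesP => A mA A0.
pose K := C / M + 1.
have K0 : 0 < K by rewrite /K ltr_wpDl// divr_ge0// ltW.
have wle X : ocitv X -> (wlength G X <= K%:E * wlength idfun X)%E.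
  move=> [[a b] _ <-]/=; have [ab|ba] := leP a b; last first.
    rewrite set_itv_ge ?wlength0 ?mule0//.
    by rewrite bnd_simp -leNgt ltW.
  rewrite !wlength_itv_bnd//= -EFinM lee_fin /K mulrDl mul1r.
  by have /andP[_ h] := Gle ab; lra.
suff : (K^-1%:E * nu A <= leb A)%E.
  rewrite [X in (_ <= X)%E]A0 => h; apply/eqP; rewrite eq_le measure_ge0 andbT.
  by rewrite -(@lee_pmul2l _ K^-1%:E)// ?mule0// lte_fin invr_gt0.
apply: le_ereal_inf_tmp => _ [F [mF AF] <-].
have Ki0 : (0 <= K^-1%:E)%E by rewrite lee_fin invr_ge0 ltW.
apply: (@le_trans _ _ (K^-1%:E * \sum_(0 <= k <oo) wlength G (F k))%E).
  by apply: lee_wpmul2l => //; apply: ereal_inf_lbound; exists F.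
rewrite -nneseriesZl; last by move=> j _; exact: wlength_ge0.
apply: lee_nneseries => [j _ _|j _].
  by apply: mule_ge0 => //; exact: wlength_ge0.
apply: (@le_trans _ _ (K^-1%:E * (K%:E * wlength idfun (F j)))%E).
  by apply: lee_wpmul2l => //; apply: wle; exact: mF.
by rewrite muleA -EFinM mulVf ?gt_eqF// mul1e.
Qed.

(** Clamped to [-N, N] and normalised, the increasing function k becomes the distribution function G
    of a probability measure. Since G is Lipschitz, this measure is absolutely continuous; its
    Radon-Nikodym density and the fundamental theorem of calculus differentiate G, hence k, almost
    everywhere. *)
Lemma clamped_ae_derivable :
  {ae leb, forall x, x \in `]- N, N[ -> derivable k x 1}.
Proof.
move: (N0) => N1.
have [h [h0 hfin hint hE]] := radon_nikodym_sigma_finite nu_dom.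
pose f x := fine (h x).
have fh : EFin \o f = h by apply/funext => x /=; rewrite fineK.
(* The base point lies where G vanishes, so that the integral of the density from there on is G
   itself. *)
pose a : itv_bound R := BRight (- N - 1).
have fint D : measurable D -> leb.-integrable D (EFin \o f).
  by move=> mD; rewrite fh; apply: integrableS hint.
have locf : locally_integrable [set: R] f.
  by apply: open_integrable_locally => //; [exact: openT|exact: fint].
have := @FTC1 R f a (fun y => fint _ (measurable_itv _)) locf.
apply: filterS; first exact: (ae_filter_ringOfSetsType leb).
move=> x + /itvP xN => /(_ _)[|dF _].
  have Nx : - N < x by rewrite xN.
  by rewrite /a (@lte_fin R); lra.
pose F y : R := (\int[leb]_(t in [set` Interval a (BRight y)]) f t)%R.
have FG y : - N - 1 <= y -> F y = G y.
  move=> Ny; rewrite /F /Rintegral.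
  rewrite [X in fine X](_ : _ = \int[leb]_(t in `](- N - 1)%R, y]) h t)%E; last first.
    by apply: eq_integral => t _; rewrite -fh.
  rewrite -hE; last exact: measurable_itv.
  have G0 : G (- N - 1) = 0 by apply: G_left; lra.
  by rewrite [X in fine X](nu_itv Ny)/= G0 subr0.
have : derivable G x 1.
  apply: near_eq_derivable dF; near=> y; apply: FG.
  have : - N <= y.
    near: y; apply: lt_le_nbhsr; by rewrite xN.
  lra.
move=> dG.
have : derivable (fun y => M * G y + k (- N)) x 1.
  apply: derivableD; last exact: derivable_cst.
  by apply: derivableM; [exact: derivable_cst|exact: dG].
apply: near_eq_derivable; near=> y.
rewrite /G mulrCA divff ?gt_eqF// mulr1 subrK clampE//.
apply/andP; split; near: y; [apply: lt_le_nbhsr|apply: lt_le_nbhsl]; by rewrite xN.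
Unshelve. all: by end_near. Qed.

End clamped.

Lemma lipschitz_ae_derivable (f : R -> R) (L : R) :
  (forall x y, `|f x - f y| <= L * `|x - y|) ->
  {ae leb, forall x, derivable f x 1}.
Proof.
move=> fL; have L0 : 0 <= L.
  by have := fL 1 0; rewrite subr0 normr1 mulr1; apply: le_trans.
(* Adding (L + 1) x to f gives slopes between 1 and 2 L + 1, as the monotone case wants. *)
pose k (x : R) := f x + (L + 1) * x.
have kl x y : x <= y -> y - x <= k y - k x <= (2 * L + 1) * (y - x).
  move=> xy; have := fL y x; rewrite (ger0_norm (_ : 0 <= y - x)) ?subr_ge0//.
  by rewrite ler_norml => /andP[h1 h2]; rewrite /k; apply/andP; split; lra.
have h n : {ae leb, forall x, x \in `]- (n.+1%:R), n.+1%:R[ -> derivable k x 1}.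
  by apply: (@clamped_ae_derivable k (2 * L + 1)) => //; lra.
apply: filterS (ae_foralln h) => x hx.
have dk : derivable k x 1.
  apply: (hx (Num.trunc `|x|)); rewrite in_itv/= -ltr_norml.
  exact: truncnS_gt.
have : derivable (fun y => k y - (L + 1) * y) x 1.
  by apply: (derivableB dk); apply: derivableM; [exact: derivable_cst|exact: derivable_id].
by rewrite (_ : (fun y => _) = f)//; apply/funext => y; rewrite /k addrK.
Qed.

End lipschitz_derivable.

Lemma pos_neg_partE {R : realDomainType} (x : R) : x = Num.max x 0 - Num.max (- x) 0.
Proof.
have [x0|/ltW x0] := leP 0 x; first by rewrite max_r ?subr0// oppr_le0.
by rewrite max_l ?oppr_ge0// sub0r opprK.
Qed.

Lemma ae_imp {dd} {T : measurableType dd} {R : realType} (mu : {measure set T -> \bar R})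
    (P Q : T -> Prop) :
  {ae mu, forall x, P x} -> (forall x, P x -> Q x) -> {ae mu, forall x, Q x}.
Proof.
move=> [A [mA A0 PA]] PQ; exists A; split => // x /= nQ; apply: PA => Px.
by apply: nQ; exact: PQ.
Qed.

Lemma ae_and {dd} {T : measurableType dd} {R : realType} (mu : {measure set T -> \bar R})
    (P Q : T -> Prop) :
  {ae mu, forall x, P x} -> {ae mu, forall x, Q x} -> {ae mu, forall x, P x /\ Q x}.
Proof.
move=> hP hQ; have [A [mA A0 PA]] := hP; have [B [mB B0 QB]] := hQ.
exists (A `|` B); split; first exact: measurableU.
  by rewrite null_set_setU.
move=> x /= /not_andP[nP|nQ]; [left; exact: PA|right; exact: QB].
Qed.

(** * Real-valued integrable functions and their integrals *)

Section real_integral.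
Context {R : realType} {dd : measure_display} {T : measurableType dd}.
Variable mu : {measure set T -> \bar R}.
Implicit Types f g : T -> R.

Definition intg f := mu.-integrable setT (EFin \o f).
Definition rint f : R := \int[mu]_x f x.

Lemma intg_meas f : intg f -> measurable_fun setT f.
Proof. by move=> /integrableP[/measurable_EFinP]. Qed.

Lemma rintE f : intg f -> (rint f)%:E = (\int[mu]_x (f x)%:E)%E.
Proof. by move=> fi; rewrite fineK//; exact: integrable_fin_num. Qed.

Lemma intg_le f g : measurable_fun setT f -> (forall x, `|f x| <= g x) ->
  intg g -> intg f.
Proof.
move=> mf fg; apply: le_integrable => //; first exact/measurable_EFinP.
by move=> x _ /=; rewrite lee_fin (le_trans (fg x))// ler_norm.
Qed.

Lemma intgD f g : intg f -> intg g -> intg (fun x => f x + g x).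
Proof. by move=> fi gi; exact: (integrableD measurableT fi gi). Qed.

Lemma intgB f g : intg f -> intg g -> intg (fun x => f x - g x).
Proof. by move=> fi gi; exact: (integrableB measurableT fi gi). Qed.

Lemma intgZ k f : intg f -> intg (fun x => k * f x).
Proof. by move=> fi; exact: (integrableZl measurableT k fi). Qed.

Lemma intg0 : intg (fun=> 0). Proof. exact: integrable0. Qed.

Lemma intg_sum (J : Type) (s : seq J) (F : J -> T -> R) :
  (forall j, intg (F j)) -> intg (fun x => \sum_(j <- s) F j x).
Proof.
move=> Fi; elim: s => [|j s ih].
  by under eq_fun do rewrite big_nil; exact: intg0.
by under eq_fun do rewrite big_cons; exact: intgD.
Qed.

Lemma intg_norm f : intg f -> intg (fun x => `|f x|).
Proof.
move=> fi; apply: (@intg_le _ (fun x => `|f x|)).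
- exact/measurableT_comp/intg_meas.
- by move=> x; rewrite normr_id.
- exact: integrable_norm.
Qed.

Lemma rintD f g : intg f -> intg g -> rint (fun x => f x + g x) = rint f + rint g.
Proof. by move=> fi gi; exact: RintegralD. Qed.

Lemma rintB f g : intg f -> intg g -> rint (fun x => f x - g x) = rint f - rint g.
Proof. by move=> fi gi; exact: RintegralB. Qed.

Lemma rintZ k f : intg f -> rint (fun x => k * f x) = k * rint f.
Proof. by move=> fi; exact: RintegralZl. Qed.

Lemma rintN f : intg f -> rint (fun x => - f x) = - rint f.
Proof.
move=> fi; rewrite -mulN1r -rintZ//; congr rint; apply/funext => x.
by rewrite mulN1r.
Qed.

Lemma rint0 : rint (fun=> 0) = 0.
Proof. by rewrite /rint /Rintegral integral0. Qed.

Lemma rint_sum (J : Type) (s : seq J) (F : J -> T -> R) :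
  (forall j, intg (F j)) -> rint (fun x => \sum_(j <- s) F j x) = \sum_(j <- s) rint (F j).
Proof.
move=> Fi; elim: s => [|j s ih].
  rewrite big_nil -[RHS]rint0; congr rint; apply/funext => x; exact: big_nil.
rewrite big_cons -ih -rintD//; last exact: intg_sum.
by congr rint; apply/funext => x; exact: big_cons.
Qed.

Lemma rint_le f g : intg f -> intg g -> (forall x, f x <= g x) -> rint f <= rint g.
Proof. by move=> fi gi fg; apply: le_Rintegral. Qed.

Lemma rint_ge0 f : (forall x, 0 <= f x) -> 0 <= rint f.
Proof. by move=> f0; apply: Rintegral_ge0. Qed.

Lemma rint_norm_le f : intg f -> `|rint f| <= rint (fun x => `|f x|).
Proof. by move=> fi; exact: le_normr_Rintegral. Qed.

Lemma rint_le_norm f g : intg f -> intg g -> (forall x, `|f x| <= g x) -> `|rint f| <= rint g.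
Proof.
move=> fi gi fg; apply: le_trans (rint_norm_le fi) _.
by apply: rint_le => //; exact: intg_norm.
Qed.

Lemma eq_rint f g : f =1 g -> rint f = rint g.
Proof. by move=> /funext ->. Qed.

Lemma ae_eq_rint f g : measurable_fun setT f -> measurable_fun setT g ->
  {ae mu, forall x, f x = g x} -> rint f = rint g.
Proof.
move=> mf mg fg; rewrite /rint /Rintegral; congr fine.
apply: ae_eq_integral => //; [exact/measurable_EFinP|exact/measurable_EFinP|].
by apply: filterS fg => x -> _.
Qed.

Lemma ae_intg f g : measurable_fun setT f -> measurable_fun setT g ->
  {ae mu, forall x, f x = g x} -> intg f -> intg g.
Proof.
move=> mf mg fg /integrableP[_ fi]; apply/integrableP; split; first exact/measurable_EFinP.
rewrite -(@ae_eq_integral _ _ _ mu setT _ (fun x => `|(f x)%:E|)%E)//.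
- by apply: measurableT_comp => //; exact/measurable_EFinP.
- by apply: measurableT_comp => //; exact/measurable_EFinP.
- by apply: filterS fg => x /= -> _.
Qed.

Lemma rint_le_ae f g : intg f -> intg g -> {ae mu, forall x, f x <= g x} -> rint f <= rint g.
Proof.
move=> fi gi fg.
have mm : measurable_fun setT (fun x => Num.max (f x) (g x)).
  by apply: measurable_maxr; exact: intg_meas.
have e : {ae mu, forall x, g x = Num.max (f x) (g x)}.
  by apply: filterS fg => x fgx; rewrite max_r.
rewrite (ae_eq_rint (intg_meas gi) mm e); apply: rint_le => //.
  exact: (ae_intg (intg_meas gi) mm e).
by move=> x; rewrite le_max lexx.
Qed.

Lemma rint_eq0_ae f : intg f -> (forall x, 0 <= f x) -> rint f = 0 ->
  {ae mu, forall x, f x = 0}.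
Proof.
move=> fi f0 h.
have : (\int[mu]_x `|(f x)%:E| = 0)%E.
  under eq_integral do rewrite gee0_abs ?lee_fin//.
  by rewrite -rintE// h.
move=> /(ae_eq_integral_abs mu measurableT).
move=> /(_ (measurable_int _ fi)); apply: filterS => x /(_ I)/= [].
by [].
Qed.

Lemma rint_dct (f_ : nat -> T -> R) f g :
  (forall n, measurable_fun setT (f_ n)) -> measurable_fun setT f ->
  {ae mu, forall x, f_ ^~ x @ \oo --> f x} -> intg g ->
  (forall n x, `|f_ n x| <= g x) ->
  intg f /\ (rint (f_ n) @[n --> \oo] --> rint f).
Proof.
move=> mf_ mf ff gi fg.
have [] := @dominated_convergence _ T R mu setT measurableT (fun n => EFin \o f_ n)
  (EFin \o f) (EFin \o g).
- by move=> n; exact/measurable_EFinP.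
- exact/measurable_EFinP.
- by apply: filterS ff => x fx _; apply: cvg_EFin => //; exact: nearW.
- exact: gi.
- by apply: aeW => x n _ /=; rewrite lee_fin.
move=> fi _ h; split; first exact: fi.
have fin n : intg (f_ n) by exact: intg_le (fg n) gi.
have := h; rewrite -(rintE fi) => /fine_cvg; exact.
Qed.

End real_integral.

Section rint_lam.
Context {R : realType} {d' : nat}.
Local Notation V := 'rV[R]_d'.+1.
Local Notation mu := (@lam R d').
Implicit Types f : V -> R.

Lemma intg_shift (v : V) f : intg mu f -> intg mu (fun x => f (x + v)).
Proof.
move=> fi; have mf := intg_meas fi.
have msh : measurable_fun setT (fun x : V => x + v) by exact: measurable_fun_addv.
apply/integrableP; split; first by apply/measurable_EFinP; apply: measurableT_comp mf msh.
have := ge0_integral_shift v (f := fun x => `|(f x)%:E|%E).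
move=> -> //; first by have /integrableP[] := fi.
apply: measurableT_comp => //; exact/measurable_EFinP.
Qed.

Lemma rint_shift (v : V) f : intg mu f -> rint mu (fun x => f (x + v)) = rint mu f.
Proof.
move=> fi; have mf := intg_meas fi.
have msh : measurable_fun setT (fun x : V => x + v) by exact: measurable_fun_addv.
rewrite /rint /Rintegral; congr fine.
have mE : measurable_fun setT (EFin \o f) by exact/measurable_EFinP.
have := @integral_pushforward _ _ _ _ R _ msh mu setT (EFin \o f) mE.
rewrite preimage_setT => /(_ (intg_shift v fi) measurableT)/= <-.
by apply: eq_measure_integral => A mA _; exact: leb_outer_shift.
Qed.

Lemma intg_scale (s : R) f : 0 < s -> intg mu f -> intg mu (fun x => f (s *: x)).
Proof.
move=> s0 fi; have mf := intg_meas fi.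
have msh : measurable_fun setT (fun x : V => s *: x) by exact: measurable_fun_scalev.
apply/integrableP; split; first by apply/measurable_EFinP; apply: measurableT_comp mf msh.
have sd : 0 < s ^+ d'.+1 by rewrite exprn_gt0.
have mE : measurable_fun setT (fun x => `|(f x)%:E|%E).
  by apply: measurableT_comp => //; exact/measurable_EFinP.
have h := ge0_integral_scale s0 mE (fun x => abse_ge0 _).
have /integrableP[_] := fi; rewrite /= -h ltey => ioo.
rewrite ltey; apply: contra_neq ioo => ->.
by rewrite mulry gtr0_sg// mul1e.
Qed.

Lemma rint_scale (s : R) f : 0 < s -> intg mu f ->
  s ^+ d'.+1 * rint mu (fun x => f (s *: x)) = rint mu f.
Proof.
move=> s0 fi; have mf := intg_meas fi.
have msh : measurable_fun setT (fun x : V => s *: x) by exact: measurable_fun_scalev.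
have sd : 0 <= s ^+ d'.+1 by rewrite exprn_ge0// ltW.
have h (g : V -> R) : intg mu g -> (forall x, 0 <= g x) ->
    s ^+ d'.+1 * rint mu (fun x => g (s *: x)) = rint mu g.
  move=> gi g0; apply/EFin_inj; rewrite EFinM !rintE//; last exact: intg_scale.
  have mE : measurable_fun setT (EFin \o g) by apply/measurable_EFinP; exact: (intg_meas gi).
  have gE x : (0 <= (EFin \o g) x)%E by rewrite /= lee_fin; exact: g0.
  exact: (ge0_integral_scale s0 mE gE).
have fp : intg mu (fun x => Num.max (f x) 0).
  apply: (@intg_le _ _ _ _ _ (fun x => `|f x|)); last exact: intg_norm.
    exact: measurable_maxr.
  by move=> x; rewrite ger0_norm ?le_max ?lexx ?orbT// ge_max ler_norm/=.
have fn : intg mu (fun x => Num.max (- f x) 0).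
  apply: (@intg_le _ _ _ _ _ (fun x => `|f x|)); last exact: intg_norm.
    by apply: measurable_maxr => //; exact: measurableT_comp.
  by move=> x; rewrite ger0_norm ?le_max ?lexx ?orbT// ge_max -normrN ler_norm/=.
have fE x : f x = Num.max (f x) 0 - Num.max (- f x) 0 by exact: pos_neg_partE.
have p0 (g : V -> R) x : 0 <= Num.max (g x) 0 by rewrite le_max lexx orbT.
rewrite [in RHS](eq_rint _ fE) rintB// -(h _ fp (p0 f)) -(h _ fn (p0 (fun x => - f x))).
rewrite -mulrBr -rintB//; [|exact: (intg_scale s0 fp)|exact: (intg_scale s0 fn)].
by congr (_ * _); apply: eq_rint => x; rewrite -fE.
Qed.

Lemma ae_shift (v : V) (P : V -> Prop) : {ae mu, forall x, P x} -> {ae mu, forall x, P (x + v)}.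
Proof.
move=> [A [mA A0 PA]]; exists [set x | A (x + v)]; split.
- rewrite -[X in measurable X]setTI.
  by apply: (measurable_fun_addv (f := id) (g := cst v)).
- by rewrite -[RHS]A0; exact: leb_outer_shift.
- by move=> x /= h; apply: PA.
Qed.

(** The bound A on the inner integrals of |F| makes F integrable on the product, and Fubini is then
    restated for real-valued integrals. *)
Lemma rint_fubini (F : V * V -> R) (A : V -> R) :
  measurable_fun setT F -> intg mu A ->
  (forall x, intg mu (fun y => F (x, y))) ->
  (forall y, intg mu (fun x => F (x, y))) ->
  (forall x, rint mu (fun y => `|F (x, y)|) <= A x) ->
  [/\ intg mu (fun x => rint mu (fun y => F (x, y))),
      intg mu (fun y => rint mu (fun x => F (x, y))) &
      rint mu (fun x => rint mu (fun y => F (x, y))) =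
      rint mu (fun y => rint mu (fun x => F (x, y)))].
Proof.
move=> mF Ai Fx Fy FA.
have mE : measurable_fun setT (EFin \o F) by exact/measurable_EFinP.
have iF : (mu \x mu)%E.-integrable setT (EFin \o F).
  apply/integrable12ltyP => //.
  apply: (@le_lt_trans _ _ (\int[mu]_x `|(A x)%:E|)%E); last by have /integrableP[] := Ai.
  apply: nn_le_integral => x _; first exact: integral_ge0.
  rewrite -[leLHS](_ : (rint mu (fun y => `|F (x, y)|))%:E = _); last first.
    by rewrite rintE//; exact: intg_norm.
  by rewrite /= lee_fin; apply: le_trans (FA x) _; exact: ler_norm.
have e1 : (fun x => \int[mu]_y (F (x, y))%:E)%E = EFin \o (fun x => rint mu (fun y => F (x, y))).
  by apply/funext => x /=; rewrite rintE.
have e2 : (fun y => \int[mu]_x (F (x, y))%:E)%E = EFin \o (fun y => rint mu (fun x => F (x, y))).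
  by apply/funext => y /=; rewrite rintE.
split.
- by rewrite /intg -e1; exact: (integrable_fubini_F iF).
- rewrite /intg -e2; apply/integrableP; split; first exact: measurable_fubini_G iF.
  have := (integrable21ltyP mu mu mE).1 iF; apply: le_lt_trans.
  apply: nn_le_integral => y _; first exact: abse_ge0.
  apply: le_abse_integral => //; exact/measurable_EFinP/intg_meas/Fy.
- rewrite /rint /Rintegral; congr fine.
  have := Fubini iF.
  by rewrite /= [X in integral _ _ X]e1 [X in _ = integral _ _ X]e2.
Qed.

End rint_lam.

Section cauchy_schwarz.
Context {R : realType} {dd : measure_display} {T : measurableType dd}.
Variable mu : {measure set T -> \bar R}.
Implicit Types f g : T -> R.

Lemma rint_cauchy_schwarz f g : intg mu (fun x => f x ^+ 2) -> intg mu (fun x => g x ^+ 2) ->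
  measurable_fun setT f -> measurable_fun setT g ->
  intg mu (fun x => f x * g x) /\
  (rint mu (fun x => f x * g x)) ^+ 2 <= rint mu (fun x => f x ^+ 2) * rint mu (fun x => g x ^+ 2).
Proof.
move=> f2 g2 mf mg.
have fg : intg mu (fun x => f x * g x).
  apply: (intg_le _ _ (intgD f2 g2)); first exact: measurable_funM.
  by move=> x; rewrite ler_norml; apply/andP; split; nra.
split => //.
set a := rint mu (fun x => f x ^+ 2); set b := rint mu (fun x => f x * g x).
set c := rint mu (fun x => g x ^+ 2).
have q t : 0 <= a - 2 * t * b + t ^+ 2 * c.
  rewrite /a /b /c -rintZ// -rintZ// -rintB//; last exact: intgZ.
  rewrite -rintD//; [|by apply: intgB => //; exact: intgZ|exact: intgZ].
  apply: rint_ge0 => x.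
  by rewrite (_ : _ + _ = (f x - t * g x) ^+ 2) ?sqr_ge0//; ring.
have a0 : 0 <= a by apply: rint_ge0 => x; exact: sqr_ge0.
have c0 : 0 <= c by apply: rint_ge0 => x; exact: sqr_ge0.
have [c1|c1] := eqVneq c 0.
  rewrite c1 mulr0; have [->|b1] := eqVneq b 0; first by rewrite expr0n.
  (* With vanishing leading coefficient the quadratic is affine in t, and at this t it equals -1. *)
  have := q ((a + 1) / (2 * b)); rewrite c1 mulr0 addr0.
  by rewrite (_ : 2 * _ * b = a + 1) ?subr_ge0; [lra|field].
have := q (b / c).
rewrite (_ : _ + _ = (a * c - b ^+ 2) / c); last by field.
by rewrite pmulr_lge0 ?invr_gt0 ?lt0r ?c1// subr_ge0.
Qed.

End cauchy_schwarz.

(** * Difference quotients in a fixed direction *)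

Section directional.
Context {R : realType} {d' : nat}.
Local Notation d := d'.+1.
Local Notation V := 'rV[R]_d.
Local Notation mu := (@lam R d').
Implicit Types (f : V -> R) (v w x : V).

Definition lip f := exists L : R, forall x y, `|f x - f y| <= L * `|x - y|.

Definition dq f v (n : nat) x : R := n.+1%:R * (f (x + n.+1%:R^-1 *: v) - f x).

(* Sealed, so that comparing two derivatives never unfolds the limit. *)
Fact pd_seal : {D : (V -> R) -> V -> V -> R |
  forall f v x, D f v x = fine (limn_esup (fun n => (dq f v n x)%:E))}.
Proof. by exists (fun f v x => fine (limn_esup (fun n => (dq f v n x)%:E))). Qed.

(** An upper limit of forward quotients along the steps 1/(n+1): it is defined at every point and
    measurable for measurable f, and it is the directional derivative wherever the quotients
    converge. *)
Definition pd := sval pd_seal.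

Lemma pdE f v x : pd f v x = fine (limn_esup (fun n => (dq f v n x)%:E)).
Proof. exact: svalP pd_seal _ _ _. Qed.

Lemma lip_continuous f : lip f -> continuous f.
Proof.
move=> [L fL] x; apply/(@cvgrPdist_lt R R^o V (nbhs x)) => e e0.
have L1 : 0 < `|L| + 1 by rewrite ltr_wpDl.
apply/nbhs_ballP; exists (e / (`|L| + 1)); first by rewrite /= divr_gt0.
move=> y; rewrite -ball_normE/= => xy.
apply: le_lt_trans (fL _ _) _.
apply: (@le_lt_trans _ _ ((`|L| + 1) * `|x - y|)).
  by rewrite ler_wpM2r// (le_trans (ler_norm L))// lerDl.
by rewrite mulrC -ltr_pdivlMr.
Qed.

Lemma lip_measurable f : lip f -> measurable_fun setT f.
Proof. by move=> /lip_continuous; exact: continuous_measurable_rv. Qed.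

Lemma lip_ge0 f : lip f -> exists2 L : R, 0 <= L & forall x y, `|f x - f y| <= L * `|x - y|.
Proof.
move=> [L fL]; exists `|L| => // x y; apply: le_trans (fL x y) _.
by rewrite ler_wpM2r// ler_norm.
Qed.

Lemma dq_measurable f v n : measurable_fun setT f -> measurable_fun setT (dq f v n).
Proof.
move=> mf; apply: measurable_funM => //; apply: measurable_funB => //.
by apply: (measurableT_comp mf); exact: measurable_fun_addv.
Qed.

Lemma dq_bound f v L n x : (forall x y, `|f x - f y| <= L * `|x - y|) ->
  `|dq f v n x| <= L * `|v|.
Proof.
move=> fL; rewrite /dq normrM ger0_norm//.
have := fL (x + n.+1%:R^-1 *: v) x; rewrite addrAC subrr add0r normrZ ger0_norm//.
by move=> h; rewrite mulrC -ler_pdivlMr// -mulrA [`|v| / _]mulrC.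
Qed.

Lemma pd_measurable f v : measurable_fun setT f -> measurable_fun setT (pd f v).
Proof.
move=> mf; rewrite (funext (pdE f v)); apply: measurableT_comp => //.
apply: measurable_fun_limn_esup => n; apply/measurable_EFinP; exact: dq_measurable.
Qed.

Lemma limn_esup_bound (u : nat -> R) (M : R) : (forall n, `|u n| <= M) ->
  ((- M)%:E <= limn_esup (fun n => (u n)%:E))%E /\
  (limn_esup (fun n => (u n)%:E) <= M%:E)%E.
Proof.
move=> uM; rewrite limn_esup_lim; split.
  apply: lime_ge; first exact: is_cvg_esups.
  apply: nearW => n; apply: (@le_trans _ _ (u n)%:E).
    by rewrite lee_fin; have := uM n; rewrite ler_norml => /andP[].
  by apply: ereal_sup_ubound; exists n => /=.
apply: lime_le; first exact: is_cvg_esups.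
apply: nearW => n; apply: ge_ereal_sup => _ [k _ <-].
by rewrite lee_fin; have := uM k; rewrite ler_norml => /andP[].
Qed.

Lemma pd_bound f v L x : (forall x y, `|f x - f y| <= L * `|x - y|) ->
  `|pd f v x| <= L * `|v|.
Proof.
move=> fL; have [] := @limn_esup_bound (fun n => dq f v n x) (L * `|v|) (fun n => dq_bound v n x fL).
rewrite pdE; case: limn_esup => //= r; rewrite !lee_fin ler_norml => -> //.
Qed.

Lemma pd_cvg f v x (l : R) : dq f v n x @[n --> \oo] --> l -> pd f v x = l.
Proof.
move=> h; rewrite pdE.
have : (dq f v n x)%:E @[n --> \oo] --> l%:E by apply: cvg_EFin => //; exact: nearW.
by move=> /cvg_limn_einf_sup[_ ->].
Qed.


Lemma einf_esup_cvg (u : nat -> \bar R) : limn_einf u = limn_esup u ->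
  u n @[n --> \oo] --> limn_esup u.
Proof.
move=> h; apply: (@squeeze_cvge _ _ _ _ (einfs u) u (esups u)).
- apply: nearW => n; apply/andP; split.
    by apply: ereal_inf_lbound; exists n => /=.
  by apply: ereal_sup_ubound; exists n => /=.
- by rewrite -h limn_einf_lim; exact: is_cvg_einfs.
- by rewrite limn_esup_lim; exact: is_cvg_esups.
Qed.

Lemma dq_cvg_line f v x (t : R) : derivable (fun s : R => f (x + s *: v)) t 1 ->
  exists l : R, dq f v n (x + t *: v) @[n --> \oo] --> l.
Proof.
rewrite /derivable => /cvg_ex[l hl]; exists l.
have h0 : (forall n, n.+1%:R^-1 != 0 :> R) /\ (n.+1%:R^-1 : R) @[n --> \oo] --> (0 : R).
  by split; [move=> n; rewrite invr_eq0 pnatr_eq0|exact: cvg_harmonic].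
have h2 := (cvgr_dnbhsP _ 0 l).1 hl _ h0.
rewrite (_ : (fun n => dq f v n (x + t *: v)) = (fun n => (n.+1%:R^-1)^-1 *:
  (f (x + ((n.+1%:R^-1 : R) *: (1 : R) + t) *: v) - f (x + t *: v)))); first exact: h2.
apply/funext => n.
by rewrite /dq invrK [(n.+1%:R^-1 : R) *: (1 : R)]mulr1 scalerDl
  [_ *: v + t *: v]addrC addrA.
Qed.

(** On each line of direction v the function is Lipschitz in one variable, so the set [bad] of
    divergence has a null trace on it. Tonelli in x and in t over [0, 1], together with translation
    invariance, turns this into a null measure for [bad]. *)
Lemma dq_cvg_ae f v : lip f ->
  {ae mu, forall x, dq f v n x @[n --> \oo] --> pd f v x}.
Proof.
move=> lf; have mf := lip_measurable lf.
have [L L0 fL] := lip_ge0 lf.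
pose S x := limn_esup (fun n => (dq f v n x)%:E).
pose J x := limn_einf (fun n => (dq f v n x)%:E).
have mS : measurable_fun setT S.
  by apply: measurable_fun_limn_esup => n; apply/measurable_EFinP; exact: dq_measurable.
have mJ : measurable_fun setT J.
  rewrite (_ : J = fun x => - limn_esup (fun n => (- dq f v n x)%:E))%E; last first.
    apply/funext => x; rewrite /J -[LHS]oppeK -limn_esupN; congr (- limn_esup _)%E.
  apply: measurableT_comp => //.
  apply: measurable_fun_limn_esup => n; apply/measurable_EFinP.
  by apply: measurableT_comp => //; exact: dq_measurable.
pose bad := [set x | J x != S x].
have mbad : measurable bad.
  by rewrite -[X in measurable X]setTI; exact: measurable_neqe.
have line x : {ae (@lebesgue_measure R), forall t, ~ bad (x + t *: v)}.
  have gL : forall s t, `|f (x + s *: v) - f (x + t *: v)| <= L * `|v| * `|s - t|.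
    move=> s t; apply: le_trans (fL _ _) _.
    by rewrite opprD addrACA subrr add0r -scalerBl normrZ -mulrA [`|v| * _]mulrC.
  apply: ae_imp (lipschitz_ae_derivable gL) _ => t /dq_cvg_line[l hl].
  apply/negP; rewrite negbK; apply/eqP; rewrite /J /S.
  have : (dq f v n (x + t *: v))%:E @[n --> \oo] --> l%:E by apply: cvg_EFin => //; exact: nearW.
  by move=> /cvg_limn_einf_sup[-> ->].
pose F (p : V * R) : \bar R := (\1_bad (p.1 + p.2 *: v) * \1_`[0%R, 1%R]%classic p.2)%:E.
have mF : measurable_fun setT F.
  apply/measurable_EFinP; apply: measurable_funM.
    apply: (measurableT_comp (measurable_indic mbad)).
    by apply: measurable_fun_addv => //; apply: measurable_fun_scalev.
  by apply: (measurableT_comp (measurable_indic _)) => //; exact: measurable_itv.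
have F0 p : (0 <= F p)%E by rewrite lee_fin mulr_ge0.
have := @fubini_tonelli _ _ _ _ _ mu (@lebesgue_measure R) F mF F0.
rewrite [X in X = _]integral0_eq; last first.
  move=> x _; rewrite -[RHS](@integral0 _ _ _ (@lebesgue_measure R) setT).
  apply: ae_eq_integral => //.
    by apply: (measurableT_comp mF); exact: measurable_pair1.
  apply: ae_imp (line x) _ => t nb _; rewrite /F/= indicE memNset ?mul0r//.
rewrite [X in _ = X](_ : _ = mu bad); last first.
  transitivity (\int[@lebesgue_measure R]_t (\1_`[0%R, 1%R]%classic t)%:E * mu bad)%E; last first.
    have h01 := @lebesgue_measure_itv R `[0%R, 1%R].
    rewrite /= lte_fin ltr01 oppr0 adde0 in h01.
    by rewrite integral_indic// setIT [X in (X * _)%E]h01 mul1e.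
  rewrite -ge0_integralZr//; last by apply/measurable_EFinP; apply: measurable_indic; exact: measurable_itv.
  apply: eq_integral => t _; rewrite /F/=.
  under eq_integral do rewrite mulrC EFinM.
  rewrite ge0_integralZl//; first congr (_ * _)%E.
    have mi : measurable_fun setT (fun x => (\1_bad x)%:E : \bar R).
      exact/measurable_EFinP/measurable_indic.
    rewrite (ge0_integral_shift (t *: v) mi); last by move=> x; rewrite lee_fin.
    by rewrite integral_indic// setIT.
  apply/measurable_EFinP; apply: (measurableT_comp (measurable_indic mbad)).
  exact: measurable_fun_addv.
move=> bad0; exists bad; split => //.
move=> x /= ncv; apply/negP => /eqP JS; apply: ncv.
have := einf_esup_cvg JS; rewrite -/(S x) => h.
have [M1 M2] := @limn_esup_bound (fun n => dq f v n x) (L * `|v|) (fun n => dq_bound v n x fL).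
have Sf : S x \is a fin_num.
  by rewrite fin_numElt (lt_le_trans _ M1) ?ltNyr//= (le_lt_trans M2) ?ltry.
by move: h; rewrite pdE -(fineK Sf) => /fine_cvg.
Qed.

End directional.

Section fundamental_lemma.
Context {R : realType} {d' : nat}.
Local Notation d := d'.+1.
Local Notation V := 'rV[R]_d.
Local Notation mu := (@lam R d').

Lemma ae_forall_count (I : countType) (P : I -> V -> Prop) :
  (forall i, {ae mu, forall x, P i x}) -> {ae mu, forall x, forall i, P i x}.
Proof.
move=> h; pose Q n x := if unpickle n is Some i then P i x else True.
have hQ n : {ae mu, forall x, Q n x}.
  by rewrite /Q; case: unpickle => [i|]; [exact: h|exact: aeW].
apply: ae_imp (ae_foralln hQ) _ => x hx i.
by have := hx (pickle i); rewrite /Q pickleK.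
Qed.

Lemma bounded_support_intg (f : V -> R) (r M : R) : measurable_fun setT f ->
  (forall x, `|f x| <= M) -> (forall x, r < `|x| -> f x = 0) -> intg mu f.
Proof.
move=> mf fM fr.
pose B := [set x : V | (`|x| <= r)%R].
apply: (@intg_le _ _ _ _ _ (fun x => M * \1_B x)) => //.
  move=> x; rewrite indicE; case: (leP `|x| r) => [xr|/fr ->].
    by rewrite mem_set// mulr1.
  by rewrite normr0 mulr_ge0// (le_trans _ (fM x)).
apply: intgZ; apply/integrableP; split.
  by apply/measurable_EFinP/measurable_indic; exact: measurable_norm_le.
under eq_integral do rewrite gee0_abs ?lee_fin//.
rewrite integral_indic//; last exact: measurable_norm_le.
by rewrite setIT; exact: lam_ball_lty.
Qed.

(** For a nonempty box this is the distance to the box in the sup norm; for an empty one it is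
    positive everywhere, so [boxdist_eq0] needs no case distinction. *)
Definition boxdist (ab : V * V) (x : V) : R :=
  `|\row_i (Num.max 0 (ab.1 0 i - x 0 i) + Num.max 0 (x 0 i - ab.2 0 i))|.

Let max0_lip (s t : R) : `|Num.max 0 s - Num.max 0 t| <= `|s - t|.
Proof.
rewrite /Num.max; do 2 case: ifPn; rewrite -?leNgt => s0 t0; rewrite ?subrr ?normr0//.
- rewrite ler_norml; have := ler_norm (s - t); have := ler_norm (t - s); rewrite distrC; lra.
- rewrite ler_norml; have := ler_norm (s - t); have := ler_norm (t - s); rewrite distrC; lra.
Qed.

Lemma boxdist_lip ab x y : `|boxdist ab x - boxdist ab y| <= 2 * `|x - y|.
Proof.
apply: le_trans (ler_dist_dist _ _) _; apply: norm_rv_le => [|i]; first exact: mulr_ge0.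
rewrite !mxE opprD addrACA; apply: le_trans (ler_normD _ _) _.
have := coord_le_norm (x - y) i; rewrite !mxE => xy.
rewrite mulrDl !mul1r; apply: lerD.
  apply: le_trans (max0_lip _ _) _.
  by rewrite (_ : _ - _ - _ = - (x 0 i - y 0 i)) ?normrN//; ring.
apply: le_trans (max0_lip _ _) _.
by rewrite (_ : _ - _ - _ = x 0 i - y 0 i)//; ring.
Qed.

Lemma boxdist_eq0 ab x : (boxdist ab x == 0) = `[< box ab x >].
Proof.
rewrite /boxdist normr_eq0; apply/eqP/asboolP => [/rowP h i|h].
  have := h i; rewrite !mxE /Num.max; do 2 case: ifPn; rewrite -?leNgt; lra.
apply/rowP => i; have /andP[h1 h2] := h i; rewrite !mxE.
by rewrite !max_l ?addr0// subr_le0.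
Qed.

Lemma boxdist_far ab x : `|x| <= boxdist ab x + `|ab.1| + `|ab.2|.
Proof.
apply: norm_rv_le => [|i]; first by rewrite !addr_ge0 ?normr_ge0.
rewrite /boxdist; set w := \row_i _.
have := coord_le_norm w i; rewrite !mxE.
have := coord_le_norm ab.1 i; have := coord_le_norm ab.2 i.
rewrite !ler_norml => /andP[b1 b2] /andP[a1 a2] /andP[_].
have m1 (t : R) : t <= Num.max 0 t by rewrite le_max lexx orbT.
have m2 (t : R) : 0 <= Num.max 0 t by rewrite le_max lexx.
have := m1 (ab.1 0 i - x 0 i); have := m2 (ab.1 0 i - x 0 i).
have := m1 (x 0 i - ab.2 0 i); have := m2 (x 0 i - ab.2 0 i).
move: (Num.max _ _) (Num.max _ _) => p q *; have := normr_ge0 ab.1; have := normr_ge0 ab.2.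
by move=> *; apply/andP; split; lra.
Qed.

Lemma measurable_box ab : measurable (box ab : set V).
Proof.
rewrite (_ : box ab = setT `&` (boxdist ab) @^-1` [set 0]).
  apply: lip_measurable => //; exists 2; exact: boxdist_lip.
by rewrite setTI; apply/seteqP; split => x /=; [move/asboolP|move=> h; apply/asboolP];
  rewrite -boxdist_eq0; [move/eqP|apply/eqP].
Qed.

Lemma rv_measurable_box : @measurable _ V = <<s range (@box R d) >>.
Proof.
apply/seteqP; split; last first.
  apply: smallest_sub; first exact: sigma_algebra_measurable.
  by move=> _ [ab _ <-]; exact: measurable_box.
apply: smallest_sub; first exact: smallest_sigma_algebra.
move=> _ [i [c ->]].
pose B n : V * V := (const_mx (- n%:R),
  \row_j (if j == i then c - n.+1%:R^-1 else n%:R)).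
rewrite (_ : halfspace i c = \bigcup_n box (B n)).
  by apply: sigma_algebra_bigcup => n; apply: sub_sigma_algebra; exists (B n).
apply/seteqP; split => x.
  rewrite /halfspace/= => xc.
  pose n := maxn (Num.trunc `|x|).+1 (Num.trunc (c - x 0 i)^-1).+1.
  have xn j : `|x 0 j| <= n%:R.
    apply: le_trans (coord_le_norm _ _) _; apply: le_trans (ltW (truncnS_gt _)) _.
    by rewrite ler_nat leq_maxl.
  exists n => // j; rewrite !mxE; have := xn j; rewrite ler_norml => /andP[-> xj2] /=.
  case: eqP => [->|//].
  rewrite lerBrDr -lerBrDl invf_ple ?posrE ?subr_gt0//.
  apply: le_trans (ltW (truncnS_gt _)) _.
  by rewrite ler_nat leqW// leq_maxr.
move=> [n _ /(_ i)]; rewrite !mxE eqxx => /andP[_ h].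
by rewrite /halfspace/= (le_lt_trans h)// ltrBlDr ltrDl invr_gt0.
Qed.

(** Lipschitz tents built from [boxdist] converge to the indicator of a box, so h integrates to 0
    over boxes. Boxes are stable under intersection and generate the measurable sets, so a pi-lambda
    argument inside each cube [K n] gives integral 0 over all measurable subsets of the cube. *)
Lemma fundamental_lemma (h : V -> R) (M : R) : measurable_fun setT h ->
  (forall x, `|h x| <= M) ->
  (forall z : V -> R, lip z -> (forall x, 0 <= z x <= 1) ->
     (exists r : R, forall x, r < `|x| -> z x = 0) -> rint mu (fun x => z x * h x) = 0) ->
  {ae mu, forall x, h x = 0}.
Proof.
move=> mh hM hz.
have M0 : 0 <= M by apply: le_trans (hM 0); exact: normr_ge0.
have hbox ab : rint mu (fun x => \1_(box ab) x * h x) = 0.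
  pose z k x : R := Num.max 0 (1 - k.+1%:R * boxdist ab x).
  pose r := 1 + `|ab.1| + `|ab.2|.
  have zl k : lip (z k).
    exists (k.+1%:R * 2) => x y; apply: le_trans (max0_lip _ _) _.
    rewrite (_ : 1 - _ - _ = k.+1%:R * (boxdist ab y - boxdist ab x)); last by ring.
    rewrite normrM ger0_norm// -mulrA ler_wpM2l// distrC; exact: boxdist_lip.
  have z01 k x : 0 <= z k x <= 1.
    rewrite /z le_max lexx/= ge_max ler01/= gerBl mulr_ge0//; exact: normr_ge0.
  have zr k x : r < `|x| -> z k x = 0.
    move=> rx; rewrite /z max_l// subr_le0.
    have := boxdist_far ab x; have k1 : 1 <= k.+1%:R :> R by rewrite ler1n.
    move=> far; have b1 : 1 < boxdist ab x by move: rx far; rewrite /r; lra.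
    by apply: (le_trans (ltW b1)); rewrite ler_peMl// ltW// (lt_trans ltr01).
  have bi : intg mu (fun x => M * \1_[set x : V | (`|x| <= r)%R] x).
    apply: (@bounded_support_intg _ r M).
    - by apply: measurable_funM => //; apply: measurable_indic; exact: measurable_norm_le.
    - by move=> x; rewrite normrM ger0_norm// ler_piMr// indicE; case: (_ \in _); rewrite ?normr1 ?normr0.
    - by move=> x rx; rewrite indicE memNset ?mulr0//= => /(lt_le_trans rx); rewrite ltxx.
  have [||||_ +] := @rint_dct _ _ _ mu (fun k x => z k x * h x) (fun x => \1_(box ab) x * h x) _
     _ _ _ bi _.
  - by move=> n; apply: measurable_funM => //; exact: lip_measurable.
  - by apply: measurable_funM => //; apply: measurable_indic; exact: measurable_box.
  - apply: aeW => x; apply: cvgMl; rewrite indicE.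
    have [xab|xab] := eqVneq (boxdist ab x) 0.
      rewrite mem_set; last by apply/asboolP; rewrite -boxdist_eq0 xab.
      by rewrite /z xab; under eq_fun do rewrite mulr0 subr0 max_r//; exact: cvg_cst.
    rewrite memNset; last by move/asboolP; rewrite -boxdist_eq0 (negbTE xab).
    have b0 : 0 < boxdist ab x by rewrite lt0r xab /= /boxdist normr_ge0.
    apply: cvg_near_cst; near=> n; rewrite /z max_l// subr_le0 -ler_pdivrMr// mul1r.
    have : (boxdist ab x)^-1 <= n%:R by near: n; exact: nbhs_infty_ger.
    by move/le_trans; apply; rewrite ler_nat.
  - move=> n x; rewrite indicE; have /andP[z0 z1] := z01 n x.
    case: (leP `|x| r) => [xr|/(zr n) ->]; last first.
      by rewrite mul0r normr0 mulr_ge0.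
    by rewrite mem_set// mulr1 normrM ger0_norm// (le_trans _ (hM x))// ler_piMl.
  move=> hl; have : rint mu (fun x => z n x * h x) @[n --> \oo] --> (0 : R).
    under eq_fun do rewrite (hz _ (zl _) (z01 _) (ex_intro _ r (zr _))).
    exact: cvg_cst.
  by move=> h0; exact: (cvg_unique _ hl h0).
pose K n : set V := box (const_mx (- n%:R), const_mx n%:R).
have mK n : measurable (K n) by exact: measurable_box.
have Kn n x : n%:R < `|x| -> ~ K n x.
  move=> nx Kx; have : `|x| <= n%:R.
    by apply: norm_rv_le => // i; have := Kx i; rewrite !mxE ler_norml.
  by move=> /(lt_le_trans nx); rewrite ltxx.
have Ki n (E : set V) : measurable E -> intg mu (fun x => \1_E x * (\1_(K n) x * h x)).
  move=> mE; apply: (@bounded_support_intg _ n%:R M).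
  - apply: measurable_funM; first exact: measurable_indic.
    by apply: measurable_funM => //; exact: measurable_indic.
  - move=> x; rewrite !indicE; case: (_ \in _); case: (_ \in _);
      by rewrite ?mul0r ?mul1r ?mulr0 ?normr0.
  - by move=> x /Kn nK; rewrite [X in _ * (X * _)]indicE memNset// mul0r mulr0.
have hE n (E : set V) : measurable E -> rint mu (fun x => \1_E x * (\1_(K n) x * h x)) = 0.
  move=> mE; have := mE; rewrite {1}rv_measurable_box.
  move: E {mE}; apply: (@dynkin_induction _ _ (range (@box R d))) => //.
  - exact: rv_measurable_box.
  - move=> _ _ [[a b] _ <-] [[a' b'] _ <-].
    exists (\row_i Num.max (a 0 i) (a' 0 i), \row_i Num.min (b 0 i) (b' 0 i)) => //.
    apply/seteqP; split => x.
      by move=> hx; split => i; have := hx i; rewrite !mxE/= ge_max le_min => /andP[/andP[h1 h2] /andP[h3 h4]]; apply/andP.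
    move=> [h1 h2] i; rewrite !mxE/= ge_max le_min.
    by have /andP[-> ->] := h1 i; have /andP[-> ->] := h2 i.
  - rewrite -[RHS](hbox (const_mx (- n%:R), const_mx n%:R)); apply: eq_rint => x.
    by rewrite indicT/= mul1r.
  - move=> _ [[a b] _ <-].
    rewrite -[RHS](hbox (\row_i Num.max (a 0 i) (- n%:R), \row_i Num.min (b 0 i) n%:R)).
    apply: eq_rint => x; rewrite mulrA !indicE -natrM mulnb; congr ((nat_of_bool _)%:R * _).
    apply/andP/idP => [[/set_mem h1 /set_mem h2]|/set_mem hx].
      apply/mem_set => i; rewrite !mxE/= ge_max le_min.
      by have /andP[-> ->] := h1 i; have := h2 i; rewrite !mxE/= => /andP[-> ->].
    split; apply/mem_set => i; have := hx i; rewrite !mxE/= ge_max le_min => /andP[/andP[h1 h2] /andP[h3 h4]];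
      by apply/andP.
  - move=> S mS hS.
    have := rintB (Ki n _ measurableT) (Ki n S mS); rewrite hS subr0.
    rewrite [RHS](_ : _ = 0).
      move=> <-; apply: eq_rint => x; rewrite -mulrBl; congr (_ * _).
      by rewrite !indicE in_setC in_setT; case: (x \in S); rewrite ?subrr ?subr0.
    rewrite -[RHS](hbox (const_mx (- n%:R), const_mx n%:R)); apply: eq_rint => x.
    by rewrite indicT/= mul1r.
  - move=> F mF tF hF.
    pose fs m x : R := \sum_(k < m) \1_(F k) x * (\1_(K n) x * h x).
    have fs0 m : rint mu (fs m) = 0.
      rewrite /fs rint_sum; last by move=> k; exact: Ki.
      by rewrite big1// => k _; exact: hF.
    have gi := intg_norm (Ki n _ measurableT).
    have [||||_ +] := @rint_dct _ _ _ mu fs (fun x => \1_(\bigcup_k F k) x * (\1_(K n) x * h x)) _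
      _ _ _ gi _.
    + by move=> m; apply: intg_meas; apply: intg_sum => k; exact: Ki.
    + by apply: intg_meas; apply: Ki; exact: bigcup_measurable.
    + apply: aeW => x; rewrite /fs; under eq_fun do rewrite -big_distrl/=.
      apply: cvgMl; rewrite indicE.
      case: (pselect ((\bigcup_k F k) x)) => [[j _ Fjx]|nF]; last first.
        rewrite memNset//; apply: cvg_near_cst; apply: nearW => m.
        by rewrite big1// => k _; rewrite indicE memNset// => Fk; apply: nF; exists k.
      rewrite mem_set; last by exists j.
      apply: cvg_near_cst; near=> m.
      have jm : (j < m)%N by near: m; exact: nbhs_infty_gt.
      rewrite (bigD1 (Ordinal jm))//= indicE mem_set// big1 ?addr0// => k kj.
      rewrite indicE memNset// => Fk; move/eqP: kj; apply.
      apply/val_inj => /=; apply: contrapT => kj.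
      have /trivIsetP/(_ k j I I (introN eqP kj))/seteqP[h0 _] := tF; exact: (h0 x (conj Fk Fjx)).
    + move=> m x; rewrite indicT/= mul1r /fs -big_distrl/= normrM ler_piMl//.
      rewrite ger0_norm; last by apply: sumr_ge0.
      case: (pselect (exists2 j, (j < m)%N & F j x)) => [[j jm Fjx]|nF]; last first.
        by rewrite big1// => k _; rewrite indicE memNset// => Fk; apply: nF; exists k.
      rewrite (bigD1 (Ordinal jm))//= indicE mem_set// big1 ?addr0// => k kj.
      rewrite indicE memNset// => Fk; move/eqP: kj; apply.
      apply/val_inj => /=; apply: contrapT => kj.
      have /trivIsetP/(_ k j I I (introN eqP kj))/seteqP[h0 _] := tF; exact: (h0 x (conj Fk Fjx)).
    move=> hl; have h0 : rint mu (fs m) @[m --> \oo] --> (0 : R).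
      by under eq_fun do rewrite fs0; exact: cvg_cst.
    exact: (cvg_unique _ hl h0).
have hn n : {ae mu, forall x, \1_(K n) x * h x = 0}.
  have Kin : intg mu (fun x => \1_(K n) x * h x).
    have := Ki n _ measurableT.
    by rewrite (_ : (fun x => \1_setT x * _) = (fun x => \1_(K n) x * h x))//; apply/funext => x; rewrite indicT mul1r.
  have := @integral_ae_eq _ _ R mu setT measurableT (cst 0%E) (EFin \o (fun x => \1_(K n) x * h x)) Kin _.
  move=> /(_ (measurable_cst _)) H.
  apply: ae_imp (H _) _ => [E _ mE|x /(_ I)/= []//].
  rewrite [RHS]integral0; transitivity ((rint mu (fun x => \1_E x * (\1_(K n) x * h x)))%:E); last by rewrite hE.
  rewrite rintE; last exact: Ki.
  rewrite integral_mkcond; apply: eq_integral => x _; rewrite patchE indicE.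
  by case: (x \in E); rewrite ?mul1r ?mul0r.
apply: ae_imp (ae_foralln hn) _ => x /(_ (Num.trunc `|x|).+1).
rewrite indicE mem_set ?mul1r// => i; rewrite !mxE -ler_norml.
by apply: le_trans (coord_le_norm _ _) _; rewrite ltW// truncnS_gt.
Unshelve. all: by end_near. Qed.

End fundamental_lemma.

(** * Total differentiability of Lipschitz functions *)

Section rademacher.
Context {R : realType} {d' : nat}.
Local Notation d := d'.+1.
Local Notation V := 'rV[R]_d.
Local Notation mu := (@lam R d').
Implicit Types (f : V -> R) (v w x : V).

Definition rd f v x (l : R) := forall e : R, 0 < e -> exists2 D : R, 0 < D &
  forall t, 0 < t < D -> `|f (x + t *: v) - f x - t * l| <= e * t.

Lemma rd_dq f v x l : rd f v x l -> dq f v n x @[n --> \oo] --> l.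
Proof.
move=> h; apply/cvgrPdist_le => e e0; have [D D0 hD] := h e e0.
near=> n.
have nD : n.+1%:R^-1 < D.
  rewrite invf_plt ?posrE//; apply: (@lt_le_trans _ _ n.+1%:R) => //.
  apply: (@le_lt_trans _ _ n%:R); last by rewrite ltr_nat.
  by near: n; exact: nbhs_infty_ger.
have n0 : 0 < n.+1%:R^-1 :> R by rewrite invr_gt0.
have := hD n.+1%:R^-1; rewrite n0 nD => /(_ isT); rewrite -ler_pdivrMr//.
rewrite -[X in _ / X](@ger0_norm _ n.+1%:R^-1)// -normf_div distrC.
by rewrite mulrBl invrK mulrAC mulVf ?gt_eqF// mul1r mulrC.
Unshelve. all: by end_near. Qed.

(** For small t let s = 1/(n+1) be the first step below t. Then t - s <= t s, so the Lipschitz bound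
    makes the passage from s to t a second-order error. *)
Lemma dq_rd f v x l : lip f -> dq f v n x @[n --> \oo] --> l -> rd f v x l.
Proof.
move=> /lip_ge0[L L0 fL] /cvgrPdist_le h e e0.
have e2 : 0 < e / 2 by rewrite divr_gt0.
have [N _ hN] := h (e / 2) e2.
pose K := L * `|v| + `|l|.
have K0 : 0 <= K by rewrite addr_ge0// mulr_ge0.
pose D := Num.min (N.+1%:R^-1) (e / 2 / (K + 1)).
have K1 : 0 < K + 1 by rewrite ltr_wpDl.
exists D; first by rewrite lt_min invr_gt0 ltr0n/= divr_gt0.
move=> t /andP[t0]; rewrite lt_min => /andP[tN tK].
pose n := Num.trunc t^-1.
have /andP[n1 n2] : n%:R <= t^-1 < n.+1%:R by apply: truncn_itv; rewrite invr_ge0 ltW.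
have Nn : (N <= n)%N.
  have : N.+1%:R < t^-1 by rewrite -[N.+1%:R]invrK ltf_pV2 ?posrE ?invr_gt0.
  by move=> /lt_trans/(_ n2); rewrite ltr_nat ltnS => /ltnW.
pose s := n.+1%:R^-1 : R.
have s0 : 0 < s by rewrite invr_gt0.
have st : s < t by rewrite /s -[t]invrK ltf_pV2 ?posrE ?invr_gt0.
have ts : t - s <= t * s.
  have : t^-1 >= s^-1 - 1 by rewrite /s invrK -natr1; lra.
  move=> h1; have := ler_wpM2l (ltW (mulr_gt0 t0 s0)) h1.
  have -> : t * s * t^-1 = s by rewrite mulrAC divff ?mul1r// gt_eqF.
  have -> : t * s * (s^-1 - 1) = t - t * s.
    by rewrite mulrBr mulr1 -mulrA divff ?mulr1// gt_eqF.
  lra.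
have := hN n Nn; rewrite /= distrC /dq -/s -[n.+1%:R]invrK -/s => hq.
have hs : `|f (x + s *: v) - f x - s * l| <= e / 2 * s.
  rewrite -ler_pdivrMr// -[X in _ / X](ger0_norm (ltW s0)) -normf_div.
  rewrite mulrBl [s * l / s]mulrAC divff ?gt_eqF// mul1r [_ / s]mulrC.
  exact: hq.
have hf : `|f (x + t *: v) - f (x + s *: v)| <= L * `|v| * (t - s).
  apply: le_trans (fL _ _) _.
  rewrite opprD addrACA subrr add0r -scalerBl normrZ ger0_norm ?subr_ge0 ?(ltW st)//.
  by rewrite [_ * `|v|]mulrC mulrA.
have -> : f (x + t *: v) - f x - t * l = (f (x + t *: v) - f (x + s *: v)) +
   (f (x + s *: v) - f x - s * l) - (t - s) * l by ring.
apply: le_trans (ler_normB _ _) _; rewrite normrM (ger0_norm (_ : 0 <= t - s)); last by rewrite subr_ge0 ltW.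
have h1 : K * (t - s) <= e / 2 * s.
  apply: (@le_trans _ _ (K * (t * s))); first by rewrite ler_wpM2l.
  rewrite mulrA ler_pM2r//; apply: (@le_trans _ _ ((K + 1) * t)).
    by rewrite ler_pM2r// lerDl.
  by rewrite mulrC ltW// -ltr_pdivlMr.
have := ler_normD (f (x + t *: v) - f (x + s *: v)) (f (x + s *: v) - f x - s * l).
have : e / 2 * s <= e / 2 * t by rewrite ler_pM2l// ltW.
move: h1; rewrite /K mulrDl; move: hs hf.
rewrite [in e * t](splitr e) mulrDl [`|l| * _]mulrC.
move: (`|_ + _|) (`|f (x + s *: v) - f x - s * l|) => A B.
move: (`|f _ - f _|) => C; lra.
Qed.

Lemma rd_scale f v x l (c : R) : 0 < c -> rd f v x l -> rd f (c *: v) x (c * l).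
Proof.
move=> c0 h e e0; have ec : 0 < e / c by rewrite divr_gt0.
have [D D0 hD] := h _ ec; exists (D / c); first by rewrite divr_gt0.
move=> t /andP[t0 tD].
have ct : 0 < c * t < D by rewrite mulr_gt0//= mulrC -ltr_pdivlMr.
have -> : t * (c * l) = c * t * l by ring.
have -> : e * t = e / c * (c * t) by rewrite mulrA divfK ?gt_eqF.
by rewrite scalerA [t * c]mulrC; exact: hD.
Qed.

Lemma rd_pd f v x l : rd f v x l -> pd f v x = l.
Proof. by move=> /rd_dq /pd_cvg. Qed.

Lemma rd0 f x : rd f 0 x 0.
Proof.
move=> e e0; exists 1 => // t /andP[t0 _].
by rewrite scaler0 addr0 subrr mulr0 subr0 normr0 mulr_ge0// ltW.
Qed.

Lemma rd_ae f v : lip f -> {ae mu, forall x, rd f v x (pd f v x)}.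
Proof. by move=> lf; apply: ae_imp (dq_cvg_ae v lf) _ => x; exact: dq_rd. Qed.

Lemma dqD f v w n x :
  dq f (v + w) n x = dq f v n (x + n.+1%:R^-1 *: w) + dq f w n x.
Proof. by rewrite /dq -mulrDr scalerDr addrA [x + _ + _]addrAC; congr (_ * _); ring. Qed.

(** By [dqD] the quotients fail to be additive only through a translation of [dq f v] by w/(n+1).
    Against a Lipschitz test function z the translation moves to z and costs a multiple of 1/(n+1).
    The limit is thus orthogonal to all test functions, and [fundamental_lemma] applies. *)
Lemma pdD_ae f v w : lip f -> {ae mu, forall x, pd f (v + w) x = pd f v x + pd f w x}.
Proof.
move=> lf; have mf := lip_measurable lf; have [L L0 fL] := lip_ge0 lf.
suff : {ae mu, forall x, pd f (v + w) x - pd f v x - pd f w x = 0}.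
  by move=> h; apply: ae_imp h _ => x; lra.
pose h_ n x := dq f (v + w) n x - dq f v n x - dq f w n x.
pose M := L * `|v + w| + L * `|v| + L * `|w|.
have h_M n x : `|h_ n x| <= M.
  apply: le_trans (ler_normB _ _) _; apply: lerD; last exact: dq_bound.
  by apply: le_trans (ler_normB _ _) _; apply: lerD; exact: dq_bound.
have mh_ n : measurable_fun setT (h_ n).
  by do 2 ?[apply: measurable_funB]; exact: dq_measurable.
apply: (@fundamental_lemma _ _ _ M).
- by do 2 ?[apply: measurable_funB]; exact: pd_measurable.
- move=> x; apply: le_trans (ler_normB _ _) _; apply: lerD; last exact: pd_bound.
  by apply: le_trans (ler_normB _ _) _; apply: lerD; exact: pd_bound.
move=> z lz z01 [r zr]; have mz := lip_measurable lz; have [Lz Lz0 zL] := lip_ge0 lz.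
have M0 : 0 <= M by apply: le_trans (h_M 0%N 0); exact: normr_ge0.
have gi : intg mu (fun x => M * z x).
  apply: (@bounded_support_intg _ _ _ r M); first exact: measurable_funM.
    by move=> x; have /andP[z0 z1] := z01 x; rewrite normrM !ger0_norm// ler_piMr.
  by move=> x /zr ->; rewrite mulr0.
have [||||hi hl] := @rint_dct _ _ _ mu (fun n x => z x * h_ n x)
   (fun x => z x * (pd f (v + w) x - pd f v x - pd f w x)) _ _ _ _ gi _.
- by move=> n; exact: measurable_funM.
- by apply: measurable_funM => //; do 2 ?[apply: measurable_funB]; exact: pd_measurable.
- apply: ae_imp (ae_and (dq_cvg_ae (v + w) lf) (ae_and (dq_cvg_ae v lf) (dq_cvg_ae w lf))) _.
  move=> x [h1 [h2 h3]]; apply: cvgMr; exact: (cvgB (cvgB h1 h2) h3).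
- move=> n x; have /andP[z0 _] := z01 x.
  by rewrite normrM ger0_norm// mulrC ler_wpM2r.
pose r' := r + `|w|.
pose B := fun x : V => \1_[set x : V | (`|x| <= r')%R] x : R.
pose C := Lz * `|w| * (L * `|v|) * rint mu B.
have Bi : intg mu B.
  apply: (@bounded_support_intg _ _ _ r' 1).
  - by apply: measurable_indic; exact: measurable_norm_le.
  - by move=> x; rewrite /B indicE; case: (_ \in _); rewrite ?normr1 ?normr0.
  - by move=> x rx; rewrite /B indicE memNset//= => /(lt_le_trans rx); rewrite ltxx.
have small n : `|rint mu (fun x => z x * h_ n x)| <= C * n.+1%:R^-1.
  have zdi u : intg mu (fun x => z (x + u) * dq f v n x).
    apply: (@bounded_support_intg _ _ _ (r + `|u|) (L * `|v|)).
    - apply: measurable_funM; last exact: dq_measurable.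
      by apply: (measurableT_comp mz); exact: measurable_fun_addv.
    - move=> x; have /andP[z0 z1] := z01 (x + u); rewrite normrM ger0_norm//.
      by apply: le_trans (dq_bound v n x fL); rewrite ler_piMl.
    - move=> x rx; rewrite zr ?mul0r//; have := ler_normB (x + u) u; rewrite addrK; lra.
  have -> : rint mu (fun x => z x * h_ n x) =
     rint mu (fun x => (z (x - n.+1%:R^-1 *: w) - z x) * dq f v n x).
    have zw : intg mu (fun x => z x * dq f v n (x + n.+1%:R^-1 *: w)).
      have := intg_shift (n.+1%:R^-1 *: w) (zdi (- (n.+1%:R^-1 *: w))).
      by rewrite (_ : (fun x => _) = (fun x => z x * dq f v n (x + n.+1%:R^-1 *: w)))//;
        apply/funext => x; rewrite addrK.
    have z1 := zdi 0.
    have e1 x : z x * h_ n x = z x * dq f v n (x + n.+1%:R^-1 *: w) - z (x + 0) * dq f v n x.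
      by rewrite /h_ dqD addr0; ring.
    rewrite (eq_rint _ e1) rintB//.
    rewrite -(rint_shift (- (n.+1%:R^-1 *: w)) zw) -rintB//.
      by apply: eq_rint => x; rewrite subrK addr0; ring.
    by rewrite (_ : (fun x => _) = (fun x => z (x - n.+1%:R^-1 *: w) * dq f v n x))//;
       apply/funext => x; rewrite subrK.
  have -> : C * n.+1%:R^-1 = rint mu (fun x => Lz * `|w| * (L * `|v|) * n.+1%:R^-1 * B x).
    by rewrite rintZ// /C; ring.
  apply: rint_le_norm; last 2 first.
  - exact: intgZ.
  - move=> x; rewrite /B indicE; case: (leP `|x| r') => [xr|rx]; last first.
      rewrite zr; last first.
        have nw : `|n.+1%:R^-1 *: w| <= `|w|.
          by rewrite normrZ ger0_norm// ler_piMl// invf_le1// ler1n.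
        have := ler_normD (x - n.+1%:R^-1 *: w) (n.+1%:R^-1 *: w); rewrite subrK.
        by move: rx; rewrite /r'; lra.
      rewrite zr; last by move: rx; rewrite /r'; have := normr_ge0 w; lra.
      by rewrite subrr mul0r normr0 !mulr_ge0.
    rewrite mem_set// mulr1 normrM [leRHS]mulrAC; apply: ler_pM => //; last exact: dq_bound.
    apply: le_trans (zL _ _) _.
    by rewrite addrAC subrr add0r normrN normrZ ger0_norm// [_^-1 * _]mulrC mulrA.
  - have := intgB (zdi (- (n.+1%:R^-1 *: w))) (zdi 0).
    by rewrite (_ : (fun x => _ - _) = (fun x => (z (x - n.+1%:R^-1 *: w) - z x) * dq f v n x))//;
      apply/funext => x; rewrite addr0 mulrBl.
have h0 : rint mu (fun x => z x * h_ n x) @[n --> \oo] --> (0 : R).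
  apply/norm_cvg0P; apply: (squeeze_cvgr (f := fun=> 0) (h := fun n => C * n.+1%:R^-1)).
  - by apply: nearW => n; rewrite normr_ge0 small.
  - exact: cvg_cst.
  - rewrite -[X in _ --> X](mulr0 C); apply: cvgMr; exact: cvg_harmonic.
exact: cvg_unique hl h0.
Qed.

Definition evec (i : 'I_d) : V := delta_mx 0 i.
Definition gpd f x : V := \row_i pd f (evec i) x.

Lemma dotvDr (u v w : V) : dotv u (v + w) = dotv u v + dotv u w.
Proof. by rewrite /dotv -big_split/=; apply: eq_bigr => i _; rewrite mxE mulrDr. Qed.

Lemma dotvZr (c : R) (u v : V) : dotv u (c *: v) = c * dotv u v.
Proof. by rewrite /dotv mulr_sumr; apply: eq_bigr => i _; rewrite mxE mulrCA. Qed.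

Lemma rd_lin_ae f v : lip f -> {ae mu, forall x, rd f v x (dotv (gpd f x) v)}.
Proof.
move=> lf.
have h (s : seq 'I_d) : {ae mu, forall x, rd f (\sum_(i <- s) v 0 i *: evec i) x
    (\sum_(i <- s) v 0 i * pd f (evec i) x)}.
  elim: s => [|i s ih].
    by apply: aeW => x; rewrite !big_nil; exact: rd0.
  set w := \sum_(i <- s) _ in ih *.
  have hi : {ae mu, forall x, rd f (v 0 i *: evec i) x (v 0 i * pd f (evec i) x)}.
    have [v0|v0|v0] := ltgtP (v 0 i) 0.
    (* [rd_scale] covers positive factors only; additivity for e_i and -e_i, whose sum 0 has
       derivative 0, reverses the sign. *)
    - have hN := ae_and (pdD_ae (evec i) (- evec i) lf) (rd_ae (- evec i) lf).
      apply: ae_imp hN _ => x; rewrite subrr (rd_pd (rd0 f x)) => -[h1 h2].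
      have -> : v 0 i *: evec i = (- v 0 i) *: (- evec i) by rewrite scaleNr scalerN opprK.
      have -> : v 0 i * pd f (evec i) x = (- v 0 i) * pd f (- evec i) x by rewrite mulNr -mulrN; congr (_ * _); lra.
      by apply: rd_scale => //; rewrite oppr_gt0.
    - by apply: ae_imp (rd_ae (evec i) lf) _ => x; exact: rd_scale.
    - by apply: aeW => x; rewrite v0 scale0r mul0r; exact: rd0.
  have h3 := ae_and (pdD_ae (v 0 i *: evec i) w lf) (rd_ae (v 0 i *: evec i + w) lf).
  apply: ae_imp (ae_and h3 (ae_and hi ih)) _ => x [[h1 h2] [h4 h5]].
  by rewrite !big_cons -(rd_pd h4) -(rd_pd h5) -h1.
apply: ae_imp (h (index_enum 'I_d)) _ => x.
have -> : \sum_(i <- index_enum 'I_d) v 0 i *: evec i = v by rewrite -row_sum_delta.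
congr (rd _ _ _ _); apply: eq_bigr => i _; by rewrite mxE mulrC.
Qed.

(** Off one null set the derivative is linear along all integer directions. At every scale a vector
    y is within |y|/m of |y| times one of finitely many rational directions, along which the
    convergence is uniform; the Lipschitz bound covers the remaining distance. *)
Lemma rademacher f : lip f ->
  {ae mu, forall x, has_grad f x (gpd f x) /\ forall v, rd f v x (dotv (gpd f x) v)}.
Proof.
move=> lf; have [L L0 fL] := lip_ge0 lf.
have h := ae_forall_count (fun z : 'rV[int]_d => rd_lin_ae (map_mx intr z) lf).
apply: ae_imp h _ => x hx; set g := gpd f x in hx *.
suff hg : has_grad f x g.
  split => // v e e0.
  have [->|v0] := eqVneq v 0.
    by rewrite /dotv big1; [exact: rd0|move=> i _; rewrite [X in _ * X]mxE mulr0].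
  have v1 : 0 < `|v| by rewrite normr_gt0.
  have [D D0 hD] := hg (e / `|v|) (divr_gt0 e0 v1).
  exists (D / `|v|); first exact: divr_gt0.
  move=> t /andP[t0 tD]; have := hD (t *: v).
  rewrite normrZ gtr0_norm// -ltr_pdivlMr// => /(_ tD).
  by rewrite dotvZr [t * `|v|]mulrC mulrA divfK ?gt_eqF.
move=> e e0.
pose G := \sum_(i < d) `|g 0 i|.
have G0 : 0 <= G by exact: sumr_ge0.
(* Fine enough for the rounding error (L + G)/m to be at most e/2, where G, the sum of the absolute
   entries of g, is its norm dual to the sup norm. *)
pose m := (Num.trunc (2 * (L + G) / e)).+1.
have m0 : 0 < m%:R :> R by rewrite ltr0n.
have mE : (L + G) / m%:R <= e / 2.
  rewrite ler_pdivrMr// mulrC -ler_pdivrMr ?divr_gt0//.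
  apply: le_trans (ltW (truncnS_gt _)); rewrite invf_div.
  by rewrite mulrA [_ * 2]mulrC.
pose q (p : {ffun 'I_d -> 'I_(m.*2).+1}) : 'rV[int]_d := \row_i ((p i)%:Z - m%:Z).
pose Q p : V := map_mx intr (q p).
have hQ p : exists D : R, 0 < D /\ forall t, 0 < t < D ->
    `|f (x + t *: (m%:R^-1 *: Q p)) - f x - t * dotv g (m%:R^-1 *: Q p)| <= e / 2 * t.
  have mi0 : 0 < m%:R^-1 :> R by rewrite invr_gt0.
  have e2 : 0 < e / 2 by rewrite divr_gt0.
  have [D D0 hD] := rd_scale mi0 (hx (q p)) e2.
  by exists D; split => // t /hD; rewrite dotvZr.
have [D hD] := choice hQ.
pose Dm := \big[Num.min/1]_p D p.
have Dm0 : 0 < Dm by apply/bigmin_gtP; split => // p _; have [] := hD p.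
exists Dm => // y yD.
have [->|y0] := eqVneq y 0.
  by rewrite addr0 subrr /dotv big1 ?subrr ?normr0 ?mulr_ge0// ?ltW// => i _; rewrite [X in _ * X]mxE mulr0.
have y1 : 0 < `|y| by rewrite normr_gt0.
have yb (i : 'I_d) : -1 <= y 0 i / `|y| <= 1.
  by rewrite -ler_norml normrM normfV normr_id ler_pdivrMr// mul1r coord_le_norm.
have pb (i : 'I_d) : (Num.trunc (m%:R * (y 0 i / `|y| + 1))%R < (m.*2).+1)%N.
  have /andP[b1 b2] := yb i.
  rewrite ltnS -(ler_nat R); apply: le_trans (_ : m%:R * (y 0 i / `|y| + 1) <= _).
    have /andP[] : (Num.trunc (m%:R * (y 0 i / `|y| + 1)))%:R <= m%:R * (y 0 i / `|y| + 1)
       < (Num.trunc (m%:R * (y 0 i / `|y| + 1))).+1%:R.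
      by apply: truncn_itv; apply: mulr_ge0; [exact: ltW|lra].
    by [].
  by rewrite -muln2 natrM ler_pM2l//; lra.
pose p := [ffun i => Ordinal (pb i)].
set u := m%:R^-1 *: Q p.
have yu : `|y - `|y| *: u| <= `|y| / m%:R.
  apply: norm_rv_le => [|i]; first by rewrite divr_ge0 ?ltW.
  rewrite !mxE ffunE/= intrB/=.
  have /andP[b1 b2] := yb i.
  set s := y 0 i / `|y| in b1 b2 *.
  have -> : y 0 i = `|y| * s by rewrite /s mulrCA divff ?gt_eqF// mulr1.
  have /andP[] : (Num.trunc (m%:R * (s + 1)))%:R <= m%:R * (s + 1)
       < (Num.trunc (m%:R * (s + 1))).+1%:R.
    by apply: truncn_itv; apply: mulr_ge0; [exact: ltW|lra].
  rewrite -natr1; set N := _%:R => n1 n2.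
  rewrite -mulrBr normrM normr_id ler_pM2l//.
  rewrite -[X in `|X|](_ : m%:R^-1 * (m%:R * s - (N - m%:R)) = _); last first.
    by rewrite mulrBr mulrA mulVf ?gt_eqF// mul1r.
  rewrite normrM ger0_norm ?invr_ge0 ?(ltW m0)// -[leRHS]mulr1 ler_pM2l ?invr_gt0//.
  by rewrite ler_norml; apply/andP; split; lra.
have [_ /(_ `|y|)] := hD p; rewrite y1 (lt_le_trans yD) /=; last exact: bigmin_le_cond.
move=> /(_ isT); rewrite -/u => hu.
have hf : `|f (x + y) - f (x + `|y| *: u)| <= L * (`|y| / m%:R).
  apply: le_trans (fL _ _) _; rewrite ler_wpM2l//.
  by rewrite opprD addrACA subrr add0r.
have hg : `|dotv g (y - `|y| *: u)| <= G * (`|y| / m%:R).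
  rewrite /dotv /G mulr_suml; apply: le_trans (ler_norm_sum _ _ _) _.
  apply: ler_sum => i _; rewrite normrM ler_wpM2l//.
  exact: le_trans (coord_le_norm _ _) yu.
have -> : f (x + y) - f x - dotv g y = (f (x + y) - f (x + `|y| *: u)) +
   (f (x + `|y| *: u) - f x - `|y| * dotv g u) - dotv g (y - `|y| *: u).
  rewrite (_ : dotv g (y - _) = dotv g y - `|y| * dotv g u); first by ring.
  by rewrite -scaleNr dotvDr dotvZr mulNr.
have h4 : (L + G) / m%:R * `|y| <= e / 2 * `|y| by rewrite ler_pM2r.
apply: le_trans (ler_normB _ _) _.
have := ler_normD (f (x + y) - f (x + `|y| *: u)) (f (x + `|y| *: u) - f x - `|y| * dotv g u).
move: hg hf hu h4; rewrite mulrDl mulrDl.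
rewrite ![_ * (`|y| / _)]mulrA ![_ * `|y| / _]mulrAC [in e * `|y|](splitr e) mulrDl.
move: (`|_ + _|) (`|_ - _ - _|) (`|dotv _ _|) => a b c.
move: (`|f _ - f _|) => C; lra.
Qed.

End rademacher.

(** * Smooth functions of polynomial growth *)

Section rint_fatou.
Context {R : realType} {dd : measure_display} {T : measurableType dd}.
Variable mu : {measure set T -> \bar R}.

(** Fatou's lemma with converging bounds. It also yields integrability of the limit, and it is how
    the $L^1$ error on the left-hand side of the stability estimate survives each approximation. *)
Lemma rint_fatou (f_ : nat -> T -> R) (f : T -> R) (B_ : nat -> R) (B : R) :
  (forall n, intg mu (f_ n)) -> (forall n x, 0 <= f_ n x) ->
  measurable_fun setT f -> (forall x, 0 <= f x) ->
  {ae mu, forall x, f_ n x @[n --> \oo] --> f x} ->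
  (forall n, rint mu (f_ n) <= B_ n) -> B_ n @[n --> \oo] --> B ->
  intg mu f /\ rint mu f <= B.
Proof.
move=> fi f0 mf pf ff fB BB.
have h : (\int[mu]_x (f x)%:E <= B%:E)%E.
  have -> : (\int[mu]_x (f x)%:E = \int[mu]_x limn_einf (fun n => (f_ n x)%:E))%E.
    apply: ge0_ae_eq_integral => //.
    - exact/measurable_EFinP.
    - rewrite (_ : (fun x => limn_einf _) = (fun x => - limn_esup (fun n => - (f_ n x)%:E))%E); last first.
        apply/funext => x; rewrite -limn_einfN; congr limn_einf.
        by apply/funext => n; rewrite /= opprK.
      apply: (measurableT_comp (f := -%E)) => //; apply: measurable_fun_limn_esup => n.
      by apply/measurable_EFinP; apply: measurableT_comp => //; exact: intg_meas (fi n).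
    - by move=> x _; rewrite lee_fin.
    - move=> x _; rewrite limn_einf_lim; apply: lime_ge; first exact: is_cvg_einfs.
      by apply: nearW => n; apply: le_ereal_inf_tmp => _ [m _ <-]; rewrite lee_fin.
    apply: ae_imp ff _ => x fx _; symmetry.
    apply: (cvg_limn_einf_sup _).1; apply: cvg_EFin => //; exact: nearW.
  apply: le_trans (fatou mu measurableT _ _) _.
  - by move=> n; exact/measurable_EFinP/intg_meas.
  - by move=> n x _; rewrite lee_fin.
  have <- : limn_einf (EFin \o B_) = B%:E.
    by apply: (cvg_limn_einf_sup _).1; apply: cvg_EFin => //; exact: nearW.
  rewrite !limn_einf_lim; apply: lee_lim; [exact: is_cvg_einfs|exact: is_cvg_einfs|].
  apply: nearW => n; apply: le_ereal_inf_tmp => _ [m /= nm <-].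
  apply: (@le_trans _ _ (\int[mu]_x (f_ m x)%:E)%E).
    by apply: ereal_inf_lbound; exists m.
  by rewrite -rintE// lee_fin.
have fin : intg mu f.
  apply/integrableP; split; first exact/measurable_EFinP.
  under eq_integral do rewrite /= ger0_norm//.
  exact: le_lt_trans h (ltry _).
by split => //; rewrite -lee_fin rintE.
Qed.

End rint_fatou.

Section gauge.
Context {R : realType} {d' : nat}.
Local Notation d := d'.+1.
Local Notation V := 'rV[R]_d.
Local Notation mu := (@lam R d').

Lemma expRN_nat (j : nat) : expR (- j%:R) <= (2 ^- j : R).
Proof.
rewrite expRN lef_pV2 ?posrE ?expR_gt0 ?exprn_gt0//.
rewrite -[X in expR X]mulr1 expRM_natl lerXn2r ?nnegrE ?expR_ge0//.
by apply: le_trans (expR_ge1Dx _).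
Qed.

(** Let $J_k$ be the integral over the set N <= 2^k. After the substitution x -> 2x, the bound
    $e^{-2N}\le 2^{-d-1}e^{-N}$ holds where N > d+1, and elsewhere the integrand is at most 1. This
    gives $J_{k+1}\le J_k/2+2^d(d+1)^d l$, whose fixed point is the stated bound. *)
Lemma exp_gauge_intg (N : V -> R) (l : R) : measurable_fun setT N ->
  (forall x, 0 <= N x) -> (forall (s : R) x, 0 < s -> N (s *: x) = s * N x) ->
  lam [set x | N x <= 1] = l%:E ->
  intg mu (fun x => expR (- N x)) /\
  rint mu (fun x => expR (- N x)) <= 2 ^+ d.+1 * d.+1%:R ^+ d * l.
Proof.
move=> mN N0 NZ Nl.
have l0 : 0 <= l by rewrite -lee_fin -Nl; exact: lam_ge0.
have mS r : measurable [set x | N x <= r].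
  rewrite -[X in measurable X]setTI (_ : [set x | _] = N @^-1` `]-oo, r]%classic); last first.
    by apply/seteqP; split => x /=; rewrite in_itv.
  exact: mN.
have Nr r : 0 < r -> lam [set x | N x <= r] = (r ^+ d * l)%:E.
  move=> r0; rewrite EFinM -Nl.
  apply: etrans (esym (leb_outer_scale [set x | N x <= r] r0)) _.
  congr (_ * _)%E; congr leb_outer; apply/seteqP; split => x /=.
    by rewrite NZ// -[X in _ <= X -> _]mulr1 ler_pM2l.
  by rewrite NZ// -[X in _ -> _ <= X]mulr1 ler_pM2l.
pose I r x := \1_[set x | N x <= r] x : R.
have Ii r : 0 < r -> intg mu (I r).
  move=> r0; apply/integrableP; split; first by apply/measurable_EFinP/measurable_indic.
  under eq_integral do rewrite gee0_abs ?lee_fin//.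
  by rewrite integral_indic// setIT; apply: le_lt_trans (ltry (r ^+ d * l)); rewrite -Nr.
have rI r : 0 < r -> rint mu (I r) = r ^+ d * l.
  move=> r0; apply: EFin_inj; rewrite rintE; last exact: Ii.
  by rewrite integral_indic// setIT -Nr.
pose F k x := I (2 ^+ k) x * expR (- N x).
have I01 r x : 0 <= I r x <= 1 by rewrite /I indicE; case: (_ \in _); rewrite ?ler01 ?lexx.
have F0 k x : 0 <= F k x by rewrite mulr_ge0 ?expR_ge0//; have /andP[] := I01 (2 ^+ k) x.
have me : measurable_fun setT (fun x => expR (- N x)).
  by apply: measurableT_comp => //; exact: measurableT_comp.
have FI k x : F k x <= I (2 ^+ k) x.
  rewrite /F -[leRHS]mulr1; have /andP[h _] := I01 (2 ^+ k) x; rewrite ler_wpM2l//.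
  by rewrite -[leRHS]expR0 ler_expR oppr_le0.
have Fi k : intg mu (F k).
  apply: (intg_le _ _ (Ii (2 ^+ k) _)); last by rewrite exprn_gt0.
    by apply: measurable_funM => //; apply: measurable_indic.
  by move=> x; rewrite ger0_norm.
pose B := 2 ^+ d.+1 * d.+1%:R ^+ d * l.
have FB k : rint mu (F k) <= B.
  elim: k => [|k ih].
    apply: (@le_trans _ _ (rint mu (I 1))).
      by apply: rint_le => [||x]; [exact: Fi|exact: Ii|exact: FI].
    rewrite rI// expr1n mul1r /B; apply: ler_peMl => //.
    by rewrite -[leLHS]mulr1; apply: ler_pM; rewrite ?ler01// exprn_ege1// ler1n.
  have h2 : (0 : R) < 2 by [].
  have := rint_scale h2 (Fi k.+1); move=> hs.
  have hle : rint mu (fun x => F k.+1 (2 *: x)) <= 2 ^- d.+1 * rint mu (F k) + d.+1%:R ^+ d * l.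
    rewrite -rI// -rintZ// -rintD//; [|exact: intgZ|exact: Ii].
    apply: rint_le; [exact: intg_scale|by apply: intgD; [exact: intgZ|exact: Ii]|].
    move=> x; rewrite /F NZ//.
    have -> : I (2 ^+ k.+1) (2 *: x) = I (2 ^+ k) x.
      suff h : (2 *: x \in [set x | N x <= 2 ^+ k.+1]) = (x \in [set x | N x <= 2 ^+ k]).
        by rewrite /I !indicE h.
      by apply/idP/idP; rewrite !inE/= NZ// exprS ler_pM2l.
    have /andP[i0 i1] := I01 (2 ^+ k) x; have [Nx|Nx] := leP (N x) d.+1%:R.
      rewrite {3}/I indicE mem_set// -[leLHS]add0r; apply: lerD.
        by rewrite mulr_ge0// mulr_ge0// expR_ge0.
      have e1 : expR (- (2 * N x)) <= 1 by rewrite -[leRHS]expR0 ler_expR oppr_le0 mulr_ge0.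
      by have := ler_pM i0 (expR_ge0 _) i1 e1; rewrite mulr1.
    have /andP[j0 _] := I01 d.+1%:R x.
    rewrite -[leLHS]addr0; apply: lerD => //.
    rewrite mulrCA ler_wpM2l// mulr_natl mulr2n opprD expRD ler_wpM2r ?expR_ge0//.
    by apply: le_trans (expRN_nat _); rewrite ler_expR lerN2 ltW.
  rewrite -hs.
  apply: (@le_trans _ _ (2 ^+ d * (2 ^- d.+1 * rint mu (F k) + d.+1%:R ^+ d * l))).
    by rewrite ler_wpM2l ?exprn_ge0.
  apply: (@le_trans _ _ (2 ^+ d * (2 ^- d.+1 * B + d.+1%:R ^+ d * l))).
    by rewrite ler_wpM2l ?exprn_ge0// lerD2r ler_wpM2l ?invr_ge0 ?exprn_ge0.
  rewrite /B ![2 ^+ d.+1]exprS; set p := 2 ^+ d; set q := _ ^+ d.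
  have p0 : p != 0 by rewrite expf_neq0.
  by rewrite le_eqVlt; apply/orP; left; apply/eqP; field; rewrite p0.
apply: (@rint_fatou _ _ _ mu F _ (fun=> B)) => //.
- apply: (@aeW _ V R mu) => x; apply: cvg_near_cst.
  exists (Num.trunc (N x)).+1 => // k /= kx; rewrite /F /I indicE mem_set ?mul1r//=.
  apply: (@le_trans _ _ k%:R).
    apply: ltW; apply: lt_le_trans (truncnS_gt _) _; by rewrite ler_nat.
  by rewrite -natrX ler_nat; apply: ltnW; exact: ltn_expl.
- exact: cvg_cst.
Qed.

Lemma exp_norm_intg (c : R) : 0 < c -> intg mu (fun x : V => expR (- (c * `|x|))).
Proof.
move=> c0.
have [l hl] : exists l : R, lam [set x : V | `|c *: x| <= 1] = l%:E.
  have := @lam_ball_lty R d' c^-1; have := @lam_ge0 R d' [set x : V | (`|x| <= c^-1)%R].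
  rewrite (_ : [set x : V | (`|x| <= c^-1)%R] = [set x : V | `|c *: x| <= 1]); last first.
    by apply/seteqP; split => x /=; rewrite normrZ gtr0_norm// -ler_pdivlMl// mulr1.
  by case: (lam _) => [l _ _| |//]; [exists l|].
have [] := @exp_gauge_intg (fun x => `|c *: x|) l _ _ _ hl.
- apply: lip_measurable; exists `|c| => x y.
  by apply: le_trans (ler_dist_dist _ _) _; rewrite -scalerBr normrZ.
- by [].
- by move=> s x s0; rewrite scalerA mulrC -scalerA normrZ gtr0_norm.
by move=> + _; rewrite (_ : (fun x => _) = (fun x : V => expR (- (c * `|x|))))//;
  apply/funext => x; rewrite normrZ gtr0_norm.
Qed.

End gauge.

(** * Polynomial growth against exponential decay *)

Section polynomial_growth.
Context {R : realType} {d' : nat}.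
Local Notation d := d'.+1.
Local Notation V := 'rV[R]_d.
Local Notation mu := (@lam R d').
Implicit Types F G : V -> R.

(** A class closed under sums, products and shifts and integrable against every weight below; it
    makes the integrability side conditions of the calculus compositional. *)
Definition pg F := measurable_fun setT F /\
  exists A, exists n : nat, forall x, `|F x| <= A * (1 + `|x|) ^+ n.

Lemma pg_meas F : pg F -> measurable_fun setT F. Proof. by case. Qed.

Lemma one_norm (x : V) : 1 <= 1 + `|x|. Proof. by rewrite lerDl. Qed.

Lemma pgD F G : pg F -> pg G -> pg (fun x => F x + G x).
Proof.
move=> [mF [A [n hF]]] [mG [B [m hG]]]; split; first exact: measurable_funD.
exists (`|A| + `|B|), (n + m)%N => x.
apply: le_trans (ler_normD _ _) _; rewrite mulrDl; apply: lerD.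
  apply: le_trans (hF x) _; apply: (@le_trans _ _ (`|A| * (1 + `|x|) ^+ n)).
    by rewrite ler_wpM2r ?ler_norm// exprn_ge0// addr_ge0.
  by rewrite ler_wpM2l// ler_weXn2l ?one_norm// leq_addr.
apply: le_trans (hG x) _; apply: (@le_trans _ _ (`|B| * (1 + `|x|) ^+ m)).
  by rewrite ler_wpM2r ?ler_norm// exprn_ge0// addr_ge0.
by rewrite ler_wpM2l// ler_weXn2l ?one_norm// leq_addl.
Qed.

Lemma pgM F G : pg F -> pg G -> pg (fun x => F x * G x).
Proof.
move=> [mF [A [n hF]]] [mG [B [m hG]]]; split; first exact: measurable_funM.
exists (A * B), (n + m)%N => x.
by rewrite normrM exprD mulrACA; apply: ler_pM.
Qed.

Lemma pg_cst c : pg (fun=> c).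
Proof. by split; [exact: measurable_cst|exists `|c|, 0%N => x; rewrite expr0 mulr1]. Qed.

Lemma pgZ c F : pg F -> pg (fun x => c * F x).
Proof. by move=> h; apply: pgM => //; exact: pg_cst. Qed.

Lemma pgN F : pg F -> pg (fun x => - F x).
Proof.
move=> h; rewrite (_ : (fun x => _) = (fun x => -1 * F x)); first exact: pgZ.
by apply/funext => x; rewrite mulN1r.
Qed.

Lemma pgB F G : pg F -> pg G -> pg (fun x => F x - G x).
Proof. by move=> h1 h2; apply: pgD => //; exact: pgN. Qed.

Lemma pgX F n : pg F -> pg (fun x => F x ^+ n).
Proof.
move=> h; elim: n => [|n ih].
  by rewrite (_ : (fun x => _) = (fun=> 1)); [exact: pg_cst|apply/funext => x; rewrite expr0].
by rewrite (_ : (fun x => _) = (fun x => F x * F x ^+ n)); [exact: pgM|apply/funext => x; rewrite exprS].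
Qed.

Lemma pg_norm F : pg F -> pg (fun x => `|F x|).
Proof.
move=> [mF [A [n hF]]]; split; first exact: measurableT_comp.
by exists A, n => x; rewrite normr_id.
Qed.

Lemma pg_sum (J : Type) (s : seq J) (F : J -> V -> R) : (forall j, pg (F j)) ->
  pg (fun x => \sum_(j <- s) F j x).
Proof.
move=> h; elim: s => [|j s ih].
  by rewrite (_ : (fun x => _) = (fun=> 0)); [exact: pg_cst|apply/funext => x; rewrite big_nil].
rewrite (_ : (fun x => _) = (fun x => F j x + \sum_(j <- s) F j x)); first exact: pgD.
by apply/funext => x; rewrite big_cons.
Qed.

Lemma pg_lip F : lip F -> pg F.
Proof.
move=> lF; split; first exact: lip_measurable.
have [L L0 FL] := lip_ge0 lF; exists (`|F 0| + L), 1%N => x.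
have := FL x 0; rewrite subr0 => h; have := ler_normD (F x - F 0) (F 0); rewrite subrK.
have := normr_ge0 x; have := mulr_ge0 (normr_ge0 (F 0)) (normr_ge0 x); rewrite expr1; nra.
Qed.

Lemma pg_bounded F (M : R) : measurable_fun setT F -> (forall x, `|F x| <= M) -> pg F.
Proof. by move=> mF h; split => //; exists M, 0%N => x; rewrite expr0 mulr1. Qed.

Lemma pg_pd F v : lip F -> pg (pd F v).
Proof.
move=> lF; have [L L0 FL] := lip_ge0 lF; apply: (@pg_bounded _ (L * `|v|)).
  by apply: pd_measurable; exact: lip_measurable.
by move=> x; exact: pd_bound.
Qed.

Lemma pg_shift F v : pg F -> pg (fun x => F (x + v)).
Proof.
move=> [mF [A [n hF]]]; split.
  by apply: (measurableT_comp mF); exact: measurable_fun_addv.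
exists (A * (1 + `|v|) ^+ n), n => x; apply: le_trans (hF _) _.
have A0 : 0 <= A.
  have := hF 0; rewrite normr0 addr0 expr1n mulr1 => h; exact: le_trans (normr_ge0 _) h.
have n1 y : 0 <= 1 + `|y : V| by rewrite addr_ge0.
rewrite -mulrA -exprMn ler_wpM2l//; apply: lerXn2r; rewrite ?nnegrE ?mulr_ge0//.
have := ler_normD x v; have := mulr_ge0 (normr_ge0 v) (normr_ge0 x); nra.
Qed.

Lemma exp_beats (a : R) : 0 < a -> forall t : R, 0 <= t -> 1 + t <= (1 + a^-1) * expR (a * t).
Proof.
move=> a0 t t0; have := expR_ge1Dx (a * t); move=> h.
apply: (@le_trans _ _ ((1 + a^-1) * (1 + a * t))); last first.
  by rewrite ler_wpM2l// addr_ge0 ?invr_ge0 ?ltW.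
have e : (1 + a^-1) * (1 + a * t) = 1 + t + a * t + a^-1 by field; rewrite gt_eqF.
by rewrite e -addrA lerDl addr_ge0 ?invr_ge0 ?mulr_ge0 ?(ltW a0).
Qed.

Lemma pg_intg F (H : V -> R) (c C : R) : 0 < c -> measurable_fun setT H ->
  (forall x, `|H x| <= C * expR (- (c * `|x|))) -> pg F -> intg mu (fun x => F x * H x).
Proof.
move=> c0 mH hH [mF [A [n hF]]].
(* Since n a <= c/2, the factor $(1+|x|)^n$ costs at most a multiple of $e^{c|x|/2}$, and half of
   the decay is left. *)
pose a := c / (2 * n.+1%:R).
have a0 : 0 < a by rewrite divr_gt0// mulr_gt0.
have c2 : 0 < c / 2 by rewrite divr_gt0.
apply: (intg_le _ _ (intgZ (A * (1 + a^-1) ^+ n * C) (exp_norm_intg c2))).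
  exact: measurable_funM.
move=> x; rewrite normrM -mulrA; apply: le_trans (ler_pM _ _ (hF x) (hH x)) _ => //.
have A0 : 0 <= A.
  have := hF 0; rewrite normr0 addr0 expr1n mulr1 => h; exact: le_trans (normr_ge0 _) h.
have C0 : 0 <= C.
  have := hH 0; rewrite normr0 mulr0 oppr0 expR0 mulr1 => h; exact: le_trans (normr_ge0 _) h.
rewrite -!mulrA ler_wpM2l// mulrCA [leRHS]mulrCA ler_wpM2l//.
apply: (@le_trans _ _ ((1 + a^-1) ^+ n * expR (c / 2 * `|x|) * expR (- (c * `|x|)))).
  rewrite ler_wpM2r ?expR_ge0//.
  apply: (@le_trans _ _ (((1 + a^-1) * expR (a * `|x|)) ^+ n)).
    apply: lerXn2r; rewrite ?nnegrE ?mulr_ge0 ?expR_ge0 ?addr_ge0 ?invr_ge0 ?(ltW a0)//.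
    exact: exp_beats.
  rewrite exprMn ler_wpM2l ?exprn_ge0 ?addr_ge0 ?invr_ge0 ?(ltW a0)//.
  rewrite -expRM_natl ler_expR mulrA ler_wpM2r// /a.
  rewrite (_ : _ * _ = c / 2 * (n%:R / n.+1%:R)); last first.
      have : n.+1%:R != 0 :> R by rewrite pnatr_eq0.
      by move: n.+1%:R => k k0; field.
    by rewrite ler_piMr ?(ltW c2)// ler_pdivrMr ?ltr0n// mul1r ler_nat.
rewrite -mulrA -expRD ler_wpM2l ?exprn_ge0 ?addr_ge0 ?invr_ge0 ?(ltW a0)//.
by rewrite ler_expR; lra.
Qed.

End polynomial_growth.

(** * Differentiable functions with Lipschitz derivatives *)

Section smooth_class.
Context {R : realType} {d' : nat}.
Local Notation d := d'.+1.
Local Notation V := 'rV[R]_d.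
Local Notation mu := (@lam R d').
Implicit Types (f g F G : V -> R) (v w x : V).

Lemma lipD f g : lip f -> lip g -> lip (fun x => f x + g x).
Proof.
move=> [L hL] [M hM]; exists (L + M) => x y; rewrite opprD addrACA mulrDl.
by apply: le_trans (ler_normD _ _) _; exact: lerD.
Qed.

Lemma lipZ (c : R) f : lip f -> lip (fun x => c * f x).
Proof.
move=> /lip_ge0[L L0 hL]; exists (`|c| * L) => x y.
by rewrite -mulrBr normrM -mulrA ler_wpM2l.
Qed.

Lemma lip_cst (c : R) : lip (fun _ : V => c).
Proof. by exists 0 => x y; rewrite subrr normr0 mul0r. Qed.

Lemma lipN f : lip f -> lip (fun x => - f x).
Proof.
move=> h; rewrite (_ : (fun x => _) = (fun x => -1 * f x)); first exact: lipZ.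
by apply/funext => x; rewrite mulN1r.
Qed.

Lemma lipB f g : lip f -> lip g -> lip (fun x => f x - g x).
Proof. by move=> h1 h2; apply: lipD => //; exact: lipN. Qed.

Lemma lip_sum (J : Type) (s : seq J) (F : J -> V -> R) : (forall j, lip (F j)) ->
  lip (fun x => \sum_(j <- s) F j x).
Proof.
move=> h; elim: s => [|j s ih].
  by rewrite (_ : (fun x => _) = (fun=> 0)); [exact: lip_cst|apply/funext => x; rewrite big_nil].
rewrite (_ : (fun x => _) = (fun x => F j x + \sum_(j <- s) F j x)); first exact: lipD.
by apply/funext => x; rewrite big_cons.
Qed.

Lemma lipM f g (A B : R) : lip f -> lip g -> (forall x, `|f x| <= A) -> (forall x, `|g x| <= B) ->
  lip (fun x => f x * g x).
Proof.
move=> /lip_ge0[L L0 hL] /lip_ge0[M M0 hM] hA hB; exists (A * M + B * L) => x y.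
have -> : f x * g x - f y * g y = f x * (g x - g y) + g y * (f x - f y) by ring.
apply: le_trans (ler_normD _ _) _; rewrite mulrDl !normrM -!mulrA.
by apply: lerD; apply: ler_pM.
Qed.

Lemma lip_norm f : lip f -> lip (fun x => `|f x|).
Proof.
move=> [L hL]; exists L => x y; apply: le_trans _ (hL x y).
exact: ler_dist_dist.
Qed.

Lemma dqE f v n x : dq f v n x = n.+1%:R * (f (x + n.+1%:R^-1 *: v) - f x).
Proof. by []. Qed.

Lemma rdD f g v x a b : rd f v x a -> rd g v x b -> rd (fun y => f y + g y) v x (a + b).
Proof.
move=> hf hg e e0; have e2 : 0 < e / 2 by rewrite divr_gt0.
have [D D0 hD] := hf _ e2; have [D' D'0 hD'] := hg _ e2.
exists (Num.min D D'); first by rewrite lt_min D0.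
move=> t /andP[t0]; rewrite lt_min => /andP[tD tD'].
have := hD t; rewrite t0 tD => /(_ isT) h1; have := hD' t; rewrite t0 tD' => /(_ isT) h2.
have -> : f (x + t *: v) + g (x + t *: v) - (f x + g x) - t * (a + b) =
  (f (x + t *: v) - f x - t * a) + (g (x + t *: v) - g x - t * b) by ring.
apply: le_trans (ler_normD _ _) _; lra.
Qed.

Lemma rdZ f v x a (c : R) : rd f v x a -> rd (fun y => c * f y) v x (c * a).
Proof.
move=> hf e e0; have c1 : 0 < `|c| + 1 by rewrite ltr_wpDl.
have [D D0 hD] := hf _ (divr_gt0 e0 c1); exists D => // t ht.
have -> : c * f (x + t *: v) - c * f x - t * (c * a) = c * (f (x + t *: v) - f x - t * a) by ring.
have /andP[t0 _] := ht; rewrite normrM; apply: le_trans (ler_wpM2l _ (hD _ ht)) _ => //.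
rewrite mulrA ler_pM2r// mulrCA ler_piMr ?(ltW e0)// ler_pdivrMr// mul1r lerDl//.
Qed.

Lemma rdM f g v x a b : lip f -> lip g -> rd f v x a -> rd g v x b ->
  rd (fun y => f y * g y) v x (f x * b + g x * a).
Proof.
move=> /lip_ge0[L L0 fL] /lip_ge0[M M0 gM] hf hg e e0.
pose K := `|f x| + `|g x| + 1.
have K0 : 0 < K by rewrite ltr_wpDl// addr_ge0.
have e2 : 0 < e / (2 * K) by rewrite divr_gt0// mulr_gt0.
have [D D0 hD] := hf _ e2; have [D' D'0 hD'] := hg _ e2.
pose Q := L * M * `|v| ^+ 2 + 1.
have Q0 : 0 < Q by rewrite ltr_wpDl// !mulr_ge0// exprn_ge0.
have eQ : 0 < e / (2 * Q) by rewrite divr_gt0// mulr_gt0.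
exists (Num.min (e / (2 * Q)) (Num.min D D')); first by rewrite !lt_min D0 eQ.
move=> t /andP[t0]; rewrite !lt_min => /and3P[tQ tD tD'].
have := hD t; rewrite t0 tD => /(_ isT) h1; have := hD' t; rewrite t0 tD' => /(_ isT) h2.
set y := x + t *: v in h1 h2 *.
have ny : `|y - x| = t * `|v| by rewrite /y addrAC subrr add0r normrZ gtr0_norm.
have h3 : `|(f y - f x) * (g y - g x)| <= e / 2 * t.
  rewrite normrM; apply: (@le_trans _ _ (L * (t * `|v|) * (M * (t * `|v|)))).
    by apply: ler_pM; rewrite // -ny.
  have -> : L * (t * `|v|) * (M * (t * `|v|)) = L * M * `|v| ^+ 2 * t * t by ring.
  rewrite ler_pM2r//; apply: (@le_trans _ _ (Q * t)).
    by rewrite ler_pM2r// lerDl.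
  have := ltW tQ; rewrite -(ler_pM2l Q0) => h; apply: le_trans h _.
  by rewrite le_eqVlt; apply/orP; left; apply/eqP; field; rewrite gt_eqF.
have -> : f y * g y - f x * g x - t * (f x * b + g x * a) =
  f x * (g y - g x - t * b) + g x * (f y - f x - t * a) + (f y - f x) * (g y - g x) by ring.
apply: le_trans (ler_normD _ _) _; have -> : e * t = e / 2 * t + e / 2 * t by rewrite -mulrDl -splitr.
apply: lerD => //.
apply: le_trans (ler_normD _ _) _; rewrite !normrM.
apply: (@le_trans _ _ (`|f x| * (e / (2 * K) * t) + `|g x| * (e / (2 * K) * t))).
  by apply: lerD; apply: ler_wpM2l.
rewrite -mulrDl; apply: (@le_trans _ _ (K * (e / (2 * K) * t))).
  by rewrite ler_wpM2r ?lerDl// mulr_ge0 ?(ltW e2) ?(ltW t0).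
by rewrite le_eqVlt; apply/orP; left; apply/eqP; field; rewrite gt_eqF.
Qed.

Lemma rd_cst (c : R) v x : rd (fun=> c) v x 0.
Proof. by move=> e e0; exists 1 => // t /andP[t0 _]; rewrite subrr mulr0 subrr normr0 mulr_ge0 ?ltW. Qed.

Lemma rd_sum (J : Type) (s : seq J) (F : J -> V -> R) v x (l : J -> R) :
  (forall j, rd (F j) v x (l j)) ->
  rd (fun y => \sum_(j <- s) F j y) v x (\sum_(j <- s) l j).
Proof.
move=> h; elim: s => [|j s ih].
  by rewrite big_nil (_ : (fun y => _) = fun=> 0); [exact: rd_cst|apply/funext => y; rewrite big_nil].
rewrite big_cons (_ : (fun y => _) = fun y => F j y + \sum_(j <- s) F j y); first exact: rdD.
by apply/funext => y; rewrite big_cons.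
Qed.

Definition diffd f := forall x v, rd f v x (pd f v x).

(** All iterated directional derivatives up to order n exist and are Lipschitz. The recursion over
    directions stays within scalar functions, and a convolution with a Lipschitz kernel raises n by
    one. Linearity in the direction is proved in [Sm_pd_dotv], not part of the definition. *)
Fixpoint Sm (n : nat) f : Prop :=
  if n is m.+1 then [/\ lip f, diffd f & forall v, Sm m (pd f v)] else lip f.

Lemma Sm_lip n f : Sm n f -> lip f. Proof. by case: n => [//|n []]. Qed.

Lemma Sm_diff n f : Sm n.+1 f -> diffd f. Proof. by case. Qed.

Lemma Sm_pd n f v : Sm n.+1 f -> Sm n (pd f v). Proof. by move=> [_ _]; exact. Qed.

Lemma Sm_leS n f : Sm n.+1 f -> Sm n f.
Proof.
elim: n f => [|n ih] f; first by case.
by move=> [h1 h2 h3]; split => // v; apply: ih; exact: h3.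
Qed.

Lemma Sm_le m n f : (m <= n)%N -> Sm n f -> Sm m f.
Proof.
move=> /subnK <-; elim: (n - m)%N => [//|k ih]; rewrite addSn => /Sm_leS; exact: ih.
Qed.

Lemma pdD f g v : diffd f -> diffd g ->
  pd (fun x => f x + g x) v = (fun x => pd f v x + pd g v x).
Proof. by move=> h1 h2; apply/funext => x; apply: rd_pd; exact: rdD. Qed.

Lemma pdZ (c : R) f v : diffd f -> pd (fun x => c * f x) v = (fun x => c * pd f v x).
Proof. by move=> h1; apply/funext => x; apply: rd_pd; exact: rdZ. Qed.

Lemma pd_sum (J : Type) (s : seq J) (F : J -> V -> R) v : (forall j, diffd (F j)) ->
  pd (fun x => \sum_(j <- s) F j x) v = (fun x => \sum_(j <- s) pd (F j) v x).
Proof. by move=> h; apply/funext => x; apply: rd_pd; apply: rd_sum => j; exact: h. Qed.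

Lemma Sm_cst n (c : R) : Sm n (fun=> c).
Proof.
elim: n c => [|n ih] c; first exact: lip_cst.
have e v : pd (fun _ : V => c) v = fun=> 0 by apply/funext => x; apply: rd_pd; exact: rd_cst.
split; [exact: lip_cst| |by move=> v; rewrite e].
by move=> x v; rewrite e; exact: rd_cst.
Qed.

Lemma SmD n f g : Sm n f -> Sm n g -> Sm n (fun x => f x + g x).
Proof.
elim: n f g => [|n ih] f g; first exact: lipD.
move=> [lf df hf] [lg dg hg]; split; first exact: lipD.
  by move=> x v; rewrite pdD//; exact: rdD.
by move=> v; rewrite pdD//; apply: ih; [exact: hf|exact: hg].
Qed.

Lemma SmZ n (c : R) f : Sm n f -> Sm n (fun x => c * f x).
Proof.
elim: n f => [|n ih] f; first exact: lipZ.
move=> [lf df hf]; split; first exact: lipZ.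
  by move=> x v; rewrite pdZ//; exact: rdZ.
by move=> v; rewrite pdZ//; apply: ih; exact: hf.
Qed.

(** For outer measure only upper bounds on boxes have been shown. Positivity of the total mass of
    the space is carried as a hypothesis and discharged in [lam_setT_gt0], from the positivity of
    the partition function. *)
Hypothesis lamT : (0 < lam [set: V])%E.

(** If one ball were null, all balls would be, by translation and scaling, and countably many of
    them cover the space. *)
Lemma lam_ball_gt0 (x : V) (r : R) : 0 < r -> (0 < lam [set y : V | (`|y - x| < r)%R])%E.
Proof.
move=> r0; rewrite lt0e lam_ge0 andbT; apply/eqP => h.
have h1 : lam [set y : V | (`|y| < r)%R] = 0%E.
  have := leb_outer_shift x [set y : V | (`|y - x| < r)%R]; rewrite [RHS]h => <-.
  by congr leb_outer; apply/seteqP; split => y /=; rewrite addrK.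
have h2 (n : nat) : lam [set y : V | (`|y| < n.+1%:R * r)%R] = 0%E.
  have n0 : 0 < n.+1%:R :> R by [].
  apply: etrans (esym (leb_outer_scale [set y : V | (`|y| < n.+1%:R * r)%R] n0)) _.
  rewrite -[RHS](mule0 (n.+1%:R ^+ d)%:E) -h1; congr (_ * leb_outer _)%E.
  by apply/seteqP; split => y /=; rewrite normrZ gtr0_norm// ltr_pM2l.
have : (lam [set: V] <= \sum_(0 <= n <oo) lam [set y : V | (`|y| < n.+1%:R * r)%R])%E.
  apply: (@le_trans _ _ (leb_outer (\bigcup_n [set y : V | (`|y| < n.+1%:R * r)%R]))).
    apply: le_leb_outer => y _; exists (Num.trunc (`|y| / r)) => //=.
    by rewrite -ltr_pdivrMr// truncnS_gt.
  exact: leb_outer_sigma_subadditive.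
by rewrite eseries0 ?leNgt ?lamT// => n _ _; exact: h2.
Qed.

Lemma ae_cont_eq f g : continuous f -> continuous g ->
  {ae mu, forall x, f x = g x} -> f = g.
Proof.
move=> cf cg [N [mN N0 hN]]; apply/funext => x; apply/eqP/negPn/negP => fg.
pose e := `|f x - g x| / 2.
have e0 : 0 < e by rewrite divr_gt0// normr_gt0 subr_eq0.
have n1 : nbhs x (fun y => `|f x - f y| < e) := (@cvgrPdist_lt R R^o V (nbhs x) _ f (f x)).1 (cf x) e e0.
have n2 : nbhs x (fun y => `|g x - g y| < e) := (@cvgrPdist_lt R R^o V (nbhs x) _ g (g x)).1 (cg x) e e0.
have [r1 /= r10 h1] := (nbhs_ballP _ _).1 (n1 _).
have [r2 /= r20 h2] := (nbhs_ballP _ _).1 (n2 _).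
have r0 : 0 < Num.min r1 r2 by rewrite lt_min r10.
have := lam_ball_gt0 x r0; rewrite ltNge => /negP; apply.
rewrite -N0; apply: le_leb_outer => y /=; rewrite lt_min => /andP[y1 y2].
apply: hN => /= fgy.
have := h1 y; rewrite -ball_normE/= distrC => /(_ y1) k1.
have := h2 y; rewrite -ball_normE/= distrC => /(_ y2) k2.
have k3 : f x - g x = (f x - f y) - (g x - g y) by rewrite fgy; ring.
have := ler_normB (f x - f y) (g x - g y).
rewrite -k3; move: k1 k2; rewrite /e; lra.
Qed.

(** The two sides agree almost everywhere by [rd_lin_ae], and both are continuous. *)
Lemma Sm_pd_dotv f v x : Sm 1 f -> pd f v x = dotv (gpd f x) v.
Proof.
move=> [lf df hf]; suff : pd f v = (fun x => dotv (gpd f x) v) by move=> ->.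
apply: ae_cont_eq.
- exact/lip_continuous/(hf v).
- apply: lip_continuous; apply: lip_sum => i.
  rewrite (_ : (fun x => _) = (fun x => v 0 i * pd f (evec i) x)); first exact/lipZ/(hf (evec i)).
  by apply/funext => y; rewrite [gpd f y 0 i]mxE mulrC.
- by apply: ae_imp (rd_lin_ae v lf) _ => y hy; exact: rd_pd.
Qed.

Lemma Sm_pd_lin f (J : Type) (s : seq J) (a : J -> R) (v : J -> V) x : Sm 1 f ->
  pd f (\sum_(j <- s) a j *: v j) x = \sum_(j <- s) a j * pd f (v j) x.
Proof.
move=> sf; rewrite Sm_pd_dotv//; elim: s => [|j s ih].
  by rewrite !big_nil /dotv big1// => i _; rewrite [X in _ * X]mxE mulr0.
by rewrite !big_cons dotvDr dotvZr ih -Sm_pd_dotv.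
Qed.

Lemma Sm_pdZ f (a : R) v x : Sm 1 f -> pd f (a *: v) x = a * pd f v x.
Proof. by move=> sf; rewrite !Sm_pd_dotv// dotvZr. Qed.

Lemma Sm_derive f v x (t : R) : Sm 1 f -> is_derive t (1 : R) (fun s : R => f (x + s *: v)) (pd f v (x + t *: v)).
Proof.
move=> sf; have [lf df hf] := sf; set l := pd f v _.
have hl : (fun h : R => h^-1 *: (f (x + (h *: (1 : R) + t) *: v) - f (x + t *: v))) @ 0^' --> l.
  apply/(@cvgrPdist_le R R^o R (0^')) => e e0.
  have [D D0 hD] := df (x + t *: v) v e e0.
  have [D' D'0 hD'] := df (x + t *: v) (- v) e e0.
  exists (Num.min D D') => /=; first by rewrite lt_min D0.
  move=> h /=; rewrite sub0r normrN lt_min => /andP[hD1 hD2] h0.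
  rewrite [h *: (1 : R)]mulr1 scalerDl [h *: v + _]addrC addrA.
  have -> : l - h^-1 *: (f (x + t *: v + h *: v) - f (x + t *: v)) =
    - (h^-1 * (f (x + t *: v + h *: v) - f (x + t *: v) - h * l)).
    by rewrite /GRing.scale/=; field.
  rewrite normrN normrM normfV ler_pdivrMl ?normr_gt0// [leRHS]mulrC.
  have [hp|hn|h00] := ltgtP 0 h; last by rewrite h00 eqxx in h0.
    have := hD h; rewrite hp -{1}(gtr0_norm hp) hD1 => /(_ isT).
    by rewrite (gtr0_norm hp).
  have := hD' (- h); rewrite oppr_gt0 hn -{1}(ltr0_norm hn) hD2 => /(_ isT).
  have -> : pd f (- v) (x + t *: v) = - l by rewrite -[- v]scaleN1r Sm_pdZ// mulN1r.
  by rewrite scalerN scaleNr opprK (ltr0_norm hn) mulrNN.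
apply: DeriveDef; first by apply/cvg_ex; exists l.
exact: cvg_lim hl.
Qed.

Lemma Sm_mvt f x v : Sm 1 f -> exists2 c : R, 0 <= c <= 1 & f (x + v) - f x = pd f v (x + c *: v).
Proof.
move=> sf.
have := @MVT_segment R (fun s => f (x + s *: v)) (fun t => pd f v (x + t *: v)) 0 1 ler01.
case => [t _| |c].
- exact: Sm_derive.
- apply: continuous_subspaceT => t; apply: differentiable_continuous.
  by apply/derivable1_diffP; have [] := Sm_derive v x t sf.
- by rewrite in_itv/= scale1r scale0r addr0 subr0 mulr1 => c01 h; exists c.
Qed.

Lemma pd_shift f v u : pd (fun x => f (x + u)) v = (fun x => pd f v (x + u)).
Proof.
apply/funext => x; rewrite !pdE; congr (fine (limn_esup _)); apply/funext => n.
by rewrite /dq addrAC.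
Qed.

Lemma lip_shift f u : lip f -> lip (fun x => f (x + u)).
Proof.
move=> [L hL]; exists L => x y; apply: le_trans (hL _ _) _.
by rewrite opprD addrACA subrr addr0.
Qed.

Lemma Sm_shift n f u : Sm n f -> Sm n (fun x => f (x + u)).
Proof.
elim: n f => [|n ih] f; first exact: lip_shift.
move=> [lf df hf]; split; first exact: lip_shift.
  move=> x v; rewrite pd_shift => e /(df (x + u) v)[D D0 hD]; exists D => // t /hD.
  by rewrite [x + u + _]addrAC.
by move=> v; rewrite pd_shift; apply: ih; exact: hf.
Qed.

(** Two mean value theorems, first along a and then along b, expand the mixed second difference.
    That difference is symmetric in a and b, so comparing the two expansions gives the symmetry of
    second derivatives in [Sm_pd_comm]. *)
Lemma Sm_mixed f a b x : Sm 2 f -> exists C, forall t : R, 0 < t ->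
  `|f (x + t *: a + t *: b) - f (x + t *: b) - f (x + t *: a) + f x - t ^+ 2 * pd (pd f a) b x|
    <= C * t ^+ 3.
Proof.
move=> sf; have sa : Sm 1 (pd f a) := Sm_pd a sf; have [L L0 hL] := lip_ge0 (Sm_pd b sa : lip _).
exists (L * (`|a| + `|b|)) => t t0.
have s1 := Sm_leS sf.
have sg : Sm 1 (fun y => f (y + t *: b) + -1 * f y) by apply: SmD; [exact: Sm_shift|exact: SmZ].
have [c /andP[c0 c1]] := Sm_mvt x (t *: a) sg.
rewrite Sm_pdZ// pdD; [|exact: Sm_diff (Sm_shift _ s1)|exact: Sm_diff (SmZ _ s1)].
rewrite pd_shift pdZ; last exact: Sm_diff s1.
have [c' /andP[c'0 c'1]] := Sm_mvt (x + c *: (t *: a)) (t *: b) sa.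
rewrite (Sm_pdZ _ _ _ sa).
set P := pd (pd f a) b _ => h1 h2.
have -> : f (x + t *: a + t *: b) - f (x + t *: b) - f (x + t *: a) + f x = t * (t * P).
  by rewrite -h1 -[X in t * X]/(_ - _); move: h2; lra.
have -> : t * (t * P) - t ^+ 2 * pd (pd f a) b x = t ^+ 2 * (P - pd (pd f a) b x) by ring.
rewrite normrM (ger0_norm (exprn_ge0 _ (ltW t0))).
have -> : L * (`|a| + `|b|) * t ^+ 3 = t ^+ 2 * (L * (t * (`|a| + `|b|))) by ring.
rewrite ler_wpM2l ?exprn_ge0 ?(ltW t0)//; apply: le_trans (hL _ _) _.
rewrite ler_wpM2l// [_ - x]addrC 2!addrA addNr add0r; apply: le_trans (ler_normD _ _) _.
rewrite mulrDr !normrZ (gtr0_norm t0) !ger0_norm//; apply: lerD.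
  by rewrite ler_piMl// mulr_ge0// ltW.
by rewrite ler_piMl// mulr_ge0// ltW.
Qed.

Lemma quadratic_coef_unique (D : R -> R) (P Q C C' : R) :
  (forall t, 0 < t -> `|D t - t ^+ 2 * P| <= C * t ^+ 3) ->
  (forall t, 0 < t -> `|D t - t ^+ 2 * Q| <= C' * t ^+ 3) -> P = Q.
Proof.
move=> hC hC'; apply/eqP; rewrite -subr_eq0 -normr_le0; apply/ler_addgt0Pr => e e0; rewrite add0r.
pose K := `|C| + `|C'| + 1.
have K0 : 0 < K by rewrite ltr_wpDl// addr_ge0.
pose t := e / K; have t0 : 0 < t by rewrite divr_gt0.
have h1 := hC t t0; have h2 := hC' t t0.
have t2 : 0 < t ^+ 2 by rewrite exprn_gt0.
have t3 : 0 <= t ^+ 3 by rewrite exprn_ge0// ltW.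
have h3 : t ^+ 2 * `|P - Q| <= K * t ^+ 3.
  rewrite -{1}(gtr0_norm t2) -normrM.
  have -> : t ^+ 2 * (P - Q) = (D t - t ^+ 2 * Q) - (D t - t ^+ 2 * P) by ring.
  apply: le_trans (ler_normB _ _) _; apply: le_trans (lerD h2 h1) _.
  rewrite -mulrDl ler_wpM2r// /K; have := ler_norm C; have := ler_norm C'; lra.
rewrite -(ler_pM2l t2); apply: le_trans h3 _.
rewrite le_eqVlt; apply/orP; left; apply/eqP.
by rewrite /t; field; rewrite gt_eqF.
Qed.

Lemma Sm_pd_comm f a b : Sm 2 f -> pd (pd f a) b = pd (pd f b) a.
Proof.
move=> sf; apply/funext => x.
have [C hC] := Sm_mixed a b x sf; have [C' hC'] := Sm_mixed b a x sf.
apply: (quadratic_coef_unique hC) => t t0.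
rewrite [x + t *: a + _]addrAC [f _ - f (x + t *: b) - _]addrAC; exact: hC'.
Qed.

End smooth_class.

(** * Log-concave weights and mollification *)

Section weight.
Context {R : realType} {d' : nat}.
Local Notation d := d'.+1.
Local Notation V := 'rV[R]_d.
Local Notation mu := (@lam R d').
Implicit Types (f g F G : V -> R) (v w x : V).
Variable phi : V -> R.
Variables N c C : R.
Hypothesis N0 : 0 <= N.
Hypothesis phiL : forall x y, `|phi x - phi y| <= N * `|x - y|.
Hypothesis c0 : 0 < c.
Hypothesis phiC : forall x, c * `|x| - C <= phi x.

Let philip : lip phi. Proof. by exists N. Qed.

Definition rho x : R := expR (- phi x).

Lemma rho_gt0 x : 0 < rho x. Proof. exact: expR_gt0. Qed.
Lemma rho_ge0 x : 0 <= rho x. Proof. exact: expR_ge0. Qed.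

Lemma rho_meas : measurable_fun setT rho.
Proof. by apply: measurableT_comp => //; apply: measurableT_comp => //; exact: lip_measurable. Qed.

Lemma rho_decay x : `|rho x| <= expR C * expR (- (c * `|x|)).
Proof. by rewrite ger0_norm ?rho_ge0// -expRD ler_expR; have := phiC x; lra. Qed.

Lemma rho_shift x h : rho (x + h) <= expR (N * `|h|) * rho x.
Proof.
rewrite -expRD ler_expR; have := phiL x (x + h).
have -> : x - (x + h) = - h by rewrite opprD addrA subrr add0r.
rewrite normrN; have := ler_norm (phi x - phi (x + h)); lra.
Qed.

Lemma pgi F : pg F -> intg mu (fun x => F x * rho x).
Proof. by move=> pF; apply: (pg_intg c0 rho_meas rho_decay pF). Qed.

Fact E_seal : {I : (V -> R) -> R | forall F, I F = rint mu (fun x => F x * rho x)}.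
Proof. by exists (fun F => rint mu (fun x => F x * rho x)). Qed.

(** Integration against $e^{-\phi}$ without normalisation; the mass [E (fun=> 1)] appears explicitly
    in the estimates and is divided out at the very end. *)
Definition E := sval E_seal.

Lemma E_rint F : E F = rint mu (fun x => F x * rho x).
Proof. exact: svalP E_seal _. Qed.

Lemma ED F G : pg F -> pg G -> E (fun x => F x + G x) = E F + E G.
Proof.
move=> pF pG; rewrite !E_rint -rintD; [|exact: pgi|exact: pgi].
by apply: eq_rint => x; rewrite mulrDl.
Qed.

Lemma EZ k F : pg F -> E (fun x => k * F x) = k * E F.
Proof.
move=> pF; rewrite !E_rint -rintZ; last exact: pgi.
by apply: eq_rint => x; rewrite mulrA.
Qed.

Lemma EN F : pg F -> E (fun x => - F x) = - E F.
Proof.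
move=> pF; rewrite !E_rint -rintN; last exact: pgi.
by apply: eq_rint => x; rewrite mulNr.
Qed.

Lemma EB F G : pg F -> pg G -> E (fun x => F x - G x) = E F - E G.
Proof. by move=> pF pG; rewrite (ED pF (pgN pG)) EN. Qed.

Lemma Esum (J : Type) (s : seq J) (F : J -> V -> R) : (forall j, pg (F j)) ->
  E (fun x => \sum_(j <- s) F j x) = \sum_(j <- s) E (F j).
Proof.
move=> pF; rewrite (eq_bigr _ (fun j _ => E_rint (F j))) E_rint -rint_sum; last by move=> j; exact: pgi.
by apply: eq_rint => x; rewrite mulr_suml.
Qed.

Lemma eqE F G : F =1 G -> E F = E G.
Proof. by move=> h; rewrite !E_rint; apply: eq_rint => x; rewrite h. Qed.

Lemma leE F G : pg F -> pg G -> (forall x, F x <= G x) -> E F <= E G.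
Proof.
move=> pF pG h; rewrite !E_rint; apply: rint_le => [||x]; [exact: pgi|exact: pgi|].
by rewrite ler_wpM2r// rho_ge0.
Qed.

Lemma leE_intg F G : pg F -> intg mu (fun x => G x * rho x) -> (forall x, F x <= G x) -> E F <= E G.
Proof.
move=> pF iG h; rewrite !E_rint; apply: rint_le => [||x]; [exact: pgi|exact: iG|].
by rewrite ler_wpM2r// rho_ge0.
Qed.

Lemma Ecst k : E (fun=> k) = k * E (fun=> 1).
Proof. by rewrite -(EZ _ (pg_cst 1)); apply: eqE => x; rewrite mulr1. Qed.

Lemma leE_ae F G : pg F -> pg G -> {ae mu, forall x, F x <= G x} -> E F <= E G.
Proof.
move=> pF pG h; rewrite !E_rint; apply: rint_le_ae; [exact: pgi|exact: pgi|].
by apply: ae_imp h _ => x hx; rewrite ler_wpM2r// rho_ge0.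
Qed.

Lemma E_ge0 F : (forall x, 0 <= F x) -> 0 <= E F.
Proof. by move=> h; rewrite E_rint; apply: rint_ge0 => x; rewrite mulr_ge0// rho_ge0. Qed.

Lemma E_norm F : pg F -> `|E F| <= E (fun x => `|F x|).
Proof.
move=> pF; rewrite !E_rint; apply: rint_le_norm => [||x]; [exact: pgi|by apply: pgi; exact: pg_norm|].
by rewrite normrM (ger0_norm (rho_ge0 x)).
Qed.

Lemma E_CS F G : pg F -> pg G ->
  E (fun x => F x * G x) ^+ 2 <= E (fun x => F x ^+ 2) * E (fun x => G x ^+ 2).
Proof.
move=> pF pG.
pose s x := expR (- (2^-1 * phi x)).
have ss x : s x ^+ 2 = rho x by rewrite expr2 -expRD; congr expR; field.
have ms : measurable_fun setT s by apply: measurableT_comp => //; apply: measurableT_comp => //; apply: measurable_funM => //; exact: lip_measurable.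
have e1 F' x : (F' x * s x) ^+ 2 = F' x ^+ 2 * rho x by rewrite exprMn ss.
have [] := @rint_cauchy_schwarz _ _ _ mu (fun x => F x * s x) (fun x => G x * s x).
- by rewrite (_ : (fun x => _) = (fun x => F x ^+ 2 * rho x)); [exact/pgi/pgX|exact/funext].
- by rewrite (_ : (fun x => _) = (fun x => G x ^+ 2 * rho x)); [exact/pgi/pgX|exact/funext].
- by apply: measurable_funM => //; exact: pg_meas.
- by apply: measurable_funM => //; exact: pg_meas.
move=> _; rewrite !E_rint (eq_rint _ (e1 F)) (eq_rint _ (e1 G)).
rewrite (_ : rint mu (fun x => _ * (G x * _)) = rint mu (fun x => F x * G x * rho x))//.
by apply: eq_rint => x; rewrite mulrACA -expr2 ss.
Qed.

Lemma E_CS1 F : pg F -> E (fun x => `|F x|) ^+ 2 <= E (fun=> 1) * E (fun x => F x ^+ 2).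
Proof.
move=> pF; have := E_CS (pg_cst 1) (pg_norm pF).
by rewrite (@eqE (fun x => 1 * `|F x|) (fun x => `|F x|))// ?(@eqE (fun x => `|F x| ^+ 2) (fun x => F x ^+ 2))// ?(@eqE (fun=> 1 ^+ 2) (fun=> 1))// => x; rewrite ?mul1r ?expr1n ?real_normK ?num_real.
Qed.

Lemma E1_gt0 : (0 < lam [set: V])%E -> 0 < E (fun=> 1).
Proof.
move=> lamT; rewrite lt0r E_ge0// andbT; apply/eqP => h.
have p1 := pgi (pg_cst 1).
rewrite E_rint in h; have [A [mA A0 hA]] := rint_eq0_ae p1 (fun x => mulr_ge0 ler01 (rho_ge0 x)) h.
have AT : A = setT.
  apply/seteqP; split => // x _; apply: hA => /= /eqP; rewrite mul1r gt_eqF//; exact: rho_gt0.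
by move: lamT; rewrite -AT A0 ltxx.
Qed.

Lemma rho_dq_cvg v : diffd phi -> forall x, dq rho v n x @[n --> \oo] --> - (pd phi v x * rho x).
Proof.
move=> dphi x.
have h1 := rd_dq (dphi x v).
pose a n := - (phi (x + n.+1%:R^-1 *: v) - phi x).
have a1 : n.+1%:R * a n @[n --> \oo] --> - pd phi v x.
  rewrite (_ : (fun n => _) = (fun n => - dq phi v n x)); first exact: cvgN.
  by apply/funext => n; rewrite /a mulrN.
pose K := N * `|v|.
have K0 : 0 <= K by rewrite mulr_ge0.
have an n : `|a n| <= K * n.+1%:R^-1.
  rewrite /a normrN; apply: le_trans (phiL _ _) _.
  by rewrite addrAC subrr add0r normrZ ger0_norm// /K [_^-1 * _]mulrC mulrA.
(* A second-order Taylor bound for the exponential with a crude constant, deduced from $1+t\le e^t$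
   alone. *)
have q (t : R) : `|t| <= K -> `|expR t - 1 - t| <= expR K * t ^+ 2.
  move=> tK; have e1 := expR_ge1Dx t; rewrite ger0_norm; last by lra.
  have e2 := expR_ge1Dx (- t).
  have e3 : expR t * expR (- t) = 1 by rewrite -expRD subrr expR0.
  have e4 : expR t * (1 - t) <= 1 by have := ler_wpM2l (expR_ge0 t) e2; rewrite e3.
  have e5 : 1 <= expR K by rewrite -expR0 ler_expR.
  have e6 : expR t <= expR K by rewrite ler_expR; move: tK; rewrite ler_norml => /andP[].
  have [t0|t0] := leP 0 t.
    have : expR t - 1 <= t * expR t by lra.
    move=> h; have : t * (expR t - 1) <= t * (t * expR t) by rewrite ler_wpM2l.
    have : t ^+ 2 * expR t <= t ^+ 2 * expR K by rewrite ler_wpM2l// sqr_ge0.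
    rewrite expr2; lra.
  have : t ^+ 2 * 1 <= t ^+ 2 * expR K by rewrite ler_wpM2l// sqr_ge0.
  have : (1 - t) * (expR t - 1 - t) <= (1 - t) * t ^+ 2.
    have : 0 <= - t * t ^+ 2 by rewrite mulr_ge0 ?sqr_ge0//; lra.
    rewrite expr2; lra.
  rewrite ler_pM2l; last by lra.
  lra.
have e n : dq rho v n x = rho x * (n.+1%:R * a n) + rho x * (n.+1%:R * (expR (a n) - 1 - a n)).
  rewrite /dq /rho (_ : - phi (x + _) = - phi x + a n); last by rewrite /a; ring.
  by rewrite expRD; ring.
rewrite (funext e) [X in _ --> X](_ : _ = rho x * (- pd phi v x) + 0); last by ring.
apply: cvgD; first exact: cvgMr.
rewrite -[X in _ --> X](mulr0 (rho x)); apply: cvgMr.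
apply/norm_cvg0P; apply: (squeeze_cvgr (f := fun=> 0) (h := fun n => expR K * K ^+ 2 * n.+1%:R^-1)).
- apply: nearW => n; rewrite normr_ge0/= normrM ger0_norm//.
  have aK : `|a n| <= K.
    by apply: le_trans (an n) _; rewrite ler_piMr// invf_le1// ler1n.
  apply: le_trans (ler_wpM2l _ (q _ aK)) _ => //.
  have h2 : a n ^+ 2 <= (K * n.+1%:R^-1) ^+ 2.
    by rewrite -[leLHS]real_normK ?num_real// lerXn2r ?nnegrE// mulr_ge0.
  apply: (@le_trans _ _ (n.+1%:R * (expR K * (K * n.+1%:R^-1) ^+ 2))).
    by rewrite ler_wpM2l// ler_wpM2l// expR_ge0.
  rewrite le_eqVlt; apply/orP; left; apply/eqP.
  have : n.+1%:R != 0 :> R by rewrite pnatr_eq0.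
  by move: n.+1%:R => k k0; field.
- exact: cvg_cst.
- rewrite -[X in _ --> X](mulr0 (expR K * K ^+ 2)); apply: cvgMr; exact: cvg_harmonic.
Qed.

(* The integral of a difference quotient of [A * B * rho] vanishes. *)
Lemma ibp (A B : V -> R) v : diffd phi -> lip A -> lip B ->
  E (fun x => A x * pd B v x + B x * pd A v x) = E (fun x => A x * B x * pd phi v x).
Proof.
move=> dphi lA lB.
have pA := pg_lip lA; have pB := pg_lip lB.
have pdA := pg_pd v lA; have pdB := pg_pd v lB; have pdphi := pg_pd v philip.
apply/eqP; rewrite -subr_eq0 -EB; [|by apply: pgD; exact: pgM|by apply: pgM => //; exact: pgM].
have [LA LA0 hA] := lip_ge0 lA; have [LB LB0 hB] := lip_ge0 lB.
pose F x := A x * B x * rho x.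
have pAB : pg (fun x => A x * B x) by exact: pgM.
have Fi : intg mu F by exact: pgi.
pose K := expR (N * `|v|).
have K1 : 1 <= K by rewrite -expR0 ler_expR mulr_ge0.
(* Multiplied by the weight, M dominates all difference quotients of the product: a shift changes A
   by at most LA |v| and the weight by at most the factor K. *)
pose M x := LB * `|v| * (`|A x| + LA * `|v|) * K + LA * `|v| * `|B x| * K + `|A x| * `|B x| * (N * `|v| * K).
have pM : pg M.
  have n1 := pg_norm pA; have n2 := pg_norm pB.
  rewrite /M; apply: pgD; first apply: pgD.
  - by apply: pgM; [apply: pgM; [exact: pg_cst|apply: pgD => //; exact: pg_cst]|exact: pg_cst].
  - by apply: pgM; [apply: pgM => //; exact: pg_cst|exact: pg_cst].
  - by apply: pgM; [exact: pgM|exact: pg_cst].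
have rdq n x : `|dq rho v n x| <= N * `|v| * K * rho x.
  pose h := n.+1%:R^-1 *: v; have hv : `|h| = n.+1%:R^-1 * `|v| by rewrite normrZ ger0_norm.
  have k1 y z : rho y - rho z <= N * `|y - z| * rho y.
    have := expR_ge1Dx (phi y - phi z).
    have -> : expR (phi y - phi z) = rho z / rho y by rewrite /rho -!expRN -expRD; congr expR; lra.
    rewrite ler_pdivlMr ?rho_gt0// => h1.
    have := ler_wpM2r (rho_ge0 y) (phiL y z); have := ler_norm (- (phi y - phi z)).
    rewrite normrN => h2; have := ler_wpM2r (rho_ge0 y) h2; lra.
  have h4 : `|rho (x + h) - rho x| <= N * `|h| * (K * rho x).
    have hN : 0 <= N * `|h| by rewrite mulr_ge0.
    have h5 : rho (x + h) <= K * rho x.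
      apply: le_trans (rho_shift _ _) _; rewrite ler_wpM2r ?rho_ge0// ler_expR ler_wpM2l//.
      by rewrite hv ler_piMl// invf_le1// ler1n.
    have h6 : rho x <= K * rho x by rewrite ler_peMl// rho_ge0.
    rewrite ler_norml; apply/andP; split.
      have := k1 x (x + h); rewrite opprD addrA subrr add0r normrN.
      have := ler_wpM2l hN h6; lra.
    have := k1 (x + h) x; rewrite addrAC subrr add0r.
    have := ler_wpM2l hN h5; lra.
  rewrite /dq normrM ger0_norm//; apply: le_trans (ler_wpM2l _ h4) _ => //.
  rewrite hv le_eqVlt; apply/orP; left; apply/eqP.
  have : n.+1%:R != 0 :> R by rewrite pnatr_eq0.
  by move: n.+1%:R => k k0; field.
have dqF n x : dq F v n x = (A (x + n.+1%:R^-1 *: v) * dq B v n x + B x * dq A v n x) * rho (x + n.+1%:R^-1 *: v)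
    + A x * B x * dq rho v n x.
  by rewrite /dq /F; ring.
have [||||_ +] := @rint_dct _ _ _ mu (fun n => dq F v n)
   (fun x => (A x * pd B v x + B x * pd A v x - A x * B x * pd phi v x) * rho x) (fun x => M x * rho x) _ _ _ (pgi pM) _.
- by move=> n; apply: dq_measurable; exact: intg_meas Fi.
- apply: measurable_funM; last exact: rho_meas.
  by apply: pg_meas; apply: pgB; [apply: pgD; exact: pgM|exact: pgM].
- apply: ae_imp (ae_and (dq_cvg_ae v lA) (dq_cvg_ae v lB)) _ => x [hA' hB'].
  rewrite (funext (dqF ^~ x)).
  have sh f : lip f -> f (x + n.+1%:R^-1 *: v) @[n --> \oo] --> f x.
    move=> lf; have [L L0 fL] := lip_ge0 lf.
    apply/subr_cvg0/norm_cvg0P; apply: (squeeze_cvgr (f := fun=> 0) (h := fun n => L * `|v| * n.+1%:R^-1)).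
    - apply: nearW => n; rewrite normr_ge0/=; apply: le_trans (fL _ _) _.
      by rewrite addrAC subrr add0r normrZ ger0_norm// [_^-1 * _]mulrC mulrA.
    - exact: cvg_cst.
    - rewrite -[X in _ --> X](mulr0 (L * `|v|)); apply: cvgMr; exact: cvg_harmonic.
  have rc : rho (x + n.+1%:R^-1 *: v) @[n --> \oo] --> rho x.
    by apply: (cvg_comp _ _ (cvgN (sh _ philip))); exact: continuous_expR.
  rewrite (_ : (_ - _) * _ = (A x * pd B v x + B x * pd A v x) * rho x + A x * B x * - (pd phi v x * rho x)); last by ring.
  apply: cvgD; last by apply: cvgMr; exact: rho_dq_cvg.
  apply: cvgM => //; apply: cvgD; first by apply: cvgM => //; exact: sh.
  exact: cvgMr.
- move=> n x; rewrite dqF; set h := n.+1%:R^-1 *: v.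
  have hv : `|h| <= `|v| by rewrite normrZ ger0_norm// ler_piMl// invf_le1// ler1n.
  have r1 : rho (x + h) <= K * rho x.
    by apply: le_trans (rho_shift _ _) _; rewrite ler_wpM2r ?rho_ge0// ler_expR ler_wpM2l.
  have a1 : `|A (x + h)| <= `|A x| + LA * `|v|.
    rewrite -[A (x + h)](subrK (A x)) addrC; apply: le_trans (ler_normD _ _) _.
    rewrite lerD2l; apply: le_trans (hA _ _) _.
    by rewrite addrAC subrr add0r ler_wpM2l.
  apply: le_trans (ler_normD _ _) _; rewrite /M [leRHS]mulrDl; apply: lerD.
    rewrite normrM -mulrDl -[leRHS]mulrA; apply: ler_pM => //; last by rewrite ger0_norm ?rho_ge0.
    apply: le_trans (ler_normD _ _) _; rewrite !normrM; apply: lerD.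
      rewrite [leLHS]mulrC; apply: ler_pM => //; rewrite -normrM; exact: (dq_bound v n x hB).
    rewrite [leLHS]mulrC; apply: ler_pM => //; rewrite -normrM; exact: (dq_bound v n x hA).
  by rewrite normrM normrM -!mulrA ler_wpM2l// ler_wpM2l// !mulrA; exact: rdq.
have z n : rint mu (dq F v n) = 0.
  rewrite /dq rintZ; last by apply: intgB => //; exact: intg_shift.
  by rewrite rintB//; [rewrite rint_shift// subrr mulr0|exact: intg_shift].
rewrite (funext z) => h.
by apply/eqP; rewrite E_rint; exact: cvg_unique h (cvg_cst _).
Qed.

End weight.

(** * Convolution with compactly supported even kernels *)

Section conv.
Context {R : realType} {d' : nat}.
Local Notation d := d'.+1.
Local Notation V := 'rV[R]_d.
Local Notation mu := (@lam R d').
Implicit Types (f g F G : V -> R) (v w x : V).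

(** The mass is left free: besides mollifiers of mass 1, the indicator [k2] of a ball serves as a
    kernel for local averages. *)
Record kernel (k : V -> R) (r M : R) : Prop := Kernel {
  k_meas : measurable_fun setT k;
  k_ge0 : forall y, 0 <= k y;
  k_le : forall y, k y <= M;
  k_supp : forall y, r < `|y| -> k y = 0;
  k_even : forall y, k (- y) = k y }.

Fact conv_seal : {K : (V -> R) -> (V -> R) -> V -> R |
  forall k F x, K k F x = rint mu (fun y => F (x + y) * k y)}.
Proof. by exists (fun k F x => rint mu (fun y => F (x + y) * k y)). Qed.

(** Written with F (x + y); for an even kernel this is the usual convolution. *)
Definition conv := sval conv_seal.

Lemma conv_rint k F x : conv k F x = rint mu (fun y => F (x + y) * k y).
Proof. exact: svalP conv_seal _ _ _. Qed.

Section fixed_kernel.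
Variables (k : V -> R) (r M : R).
Hypothesis r0 : 0 <= r.
Hypothesis kk : kernel k r M.

Lemma kernel_decay y : `|k y| <= M * expR r * expR (- (1 * `|y|)).
Proof.
have M0 : 0 <= M by apply: le_trans (k_ge0 kk 0) (k_le kk 0).
rewrite -mulrA -expRD mul1r; have [yr|yr] := leP `|y| r.
  rewrite ger0_norm ?(k_ge0 kk)//; apply: le_trans (k_le kk y) _.
  by rewrite ler_peMr// -[leLHS]expR0 ler_expR subr_ge0.
by rewrite (k_supp kk yr) normr0 mulr_ge0// expR_ge0.
Qed.

Lemma conv_intg F x : pg F -> intg mu (fun y => F (x + y) * k y).
Proof.
move=> pF; apply: (pg_intg ltr01 (k_meas kk) kernel_decay).
rewrite (_ : (fun y => _) = (fun y => F (y + x))); first exact: pg_shift.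
by apply/funext => y; rewrite addrC.
Qed.

Lemma convE F x : pg F -> conv k F x = rint mu (fun z => F z * k (z - x)).
Proof.
move=> pF; rewrite !conv_rint -[LHS](rint_shift (- x)); last exact: conv_intg.
by apply: eq_rint => z; rewrite [z - x]addrC addrA subrr add0r.
Qed.

Lemma convD F G x : pg F -> pg G -> conv k (fun y => F y + G y) x = conv k F x + conv k G x.
Proof.
move=> pF pG; rewrite !conv_rint -rintD; [|exact: conv_intg|exact: conv_intg].
by apply: eq_rint => y; rewrite mulrDl.
Qed.

Lemma convZ c F x : pg F -> conv k (fun y => c * F y) x = c * conv k F x.
Proof.
move=> pF; rewrite !conv_rint -rintZ; last exact: conv_intg.
by apply: eq_rint => y; rewrite mulrA.
Qed.

Lemma convB F G x : pg F -> pg G -> conv k (fun y => F y - G y) x = conv k F x - conv k G x.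
Proof.
move=> pF pG; rewrite !conv_rint -rintB; [|exact: conv_intg|exact: conv_intg].
by apply: eq_rint => y; rewrite mulrBl.
Qed.

Lemma conv_ge0 F x : (forall y, 0 <= F y) -> 0 <= conv k F x.
Proof. by move=> h; rewrite conv_rint; apply: rint_ge0 => y; rewrite mulr_ge0// (k_ge0 kk). Qed.

Lemma conv_le F G x : pg F -> pg G -> (forall y, `|y - x| <= r -> F y <= G y) -> conv k F x <= conv k G x.
Proof.
move=> pF pG h; rewrite !conv_rint; apply: rint_le => [||y]; [exact: conv_intg|exact: conv_intg|].
have [yr|yr] := leP `|y| r; last by rewrite (k_supp kk yr) !mulr0.
by rewrite ler_wpM2r ?(k_ge0 kk)// h// addrAC subrr add0r.
Qed.

Lemma conv_norm F x : pg F -> `|conv k F x| <= conv k (fun y => `|F y|) x.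
Proof.
move=> pF; rewrite !conv_rint; apply: (rint_le_norm (conv_intg x pF) (conv_intg x (pg_norm pF))) => y.
by rewrite normrM (ger0_norm (k_ge0 kk y)).
Qed.

Definition kmass := conv k (fun=> 1) 0.

Lemma conv_cst c x : conv k (fun=> c) x = c * kmass.
Proof.
rewrite /kmass !conv_rint -rintZ; last exact: (conv_intg 0 (pg_cst 1)).
by apply: eq_rint => y; rewrite mul1r.
Qed.

Lemma kmass_ge0 : 0 <= kmass. Proof. by apply: conv_ge0. Qed.

Lemma conv_bound F (A : R) n x : pg F -> (forall y, `|F y| <= A * (1 + `|y|) ^+ n) ->
  `|conv k F x| <= A * (1 + r) ^+ n * kmass * (1 + `|x|) ^+ n.
Proof.
move=> pF h; apply: le_trans (conv_norm _ pF) _.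
have A0 : 0 <= A.
  have := h 0; rewrite normr0 addr0 expr1n mulr1 => h0; exact: le_trans (normr_ge0 _) h0.
rewrite mulrAC -(conv_cst _ x); apply: (conv_le (pg_norm pF) (pg_cst _)) => y yx.
apply: le_trans (h y) _; rewrite -mulrA ler_wpM2l// -exprMn.
apply: lerXn2r; rewrite ?nnegrE ?mulr_ge0 ?addr_ge0//.
have := ler_normD (y - x) x; rewrite subrK; have := mulr_ge0 r0 (normr_ge0 x); nra.
Qed.

(* Cauchy-Schwarz for the weight [k]; the [+ 1] spares the case of zero mass. *)
Lemma conv_sq F x : pg F -> conv k F x ^+ 2 <= (kmass + 1) * conv k (fun y => F y ^+ 2) x.
Proof.
move=> pF; have m0 := kmass_ge0; set a := conv k F x.
have m1 : 0 < kmass + 1 by rewrite ltr_wpDl.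
have pF2 := pgX 2 pF.
set t := a / (kmass + 1).
have : 0 <= conv k (fun y => (F y - t) ^+ 2) x by apply: conv_ge0 => y; exact: sqr_ge0.
have -> : conv k (fun y => (F y - t) ^+ 2) x =
    conv k (fun y => F y ^+ 2 - ((2 * t) * F y - t ^+ 2)) x.
  by congr (conv k _ x); apply/funext => y; ring.
rewrite (convB x pF2); last by apply: pgB; [exact: pgZ|exact: pg_cst].
rewrite (convB x (pgZ _ pF) (pg_cst _)) (convZ _ x pF) conv_cst -/a => h.
set b := conv k _ x in h *.
have e : a = t * (kmass + 1) by rewrite /t divfK// gt_eqF.
have -> : a ^+ 2 = (kmass + 1) * (t ^+ 2 * (kmass + 1)) by rewrite e; ring.
rewrite ler_pM2l//; move: h; rewrite e.
have := sqr_ge0 t; nra.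
Qed.

End fixed_kernel.

Section weighted.
Variable phi : V -> R.
Variables N c C : R.
Hypothesis N0 : 0 <= N.
Hypothesis phiL : forall x y, `|phi x - phi y| <= N * `|x - y|.
Hypothesis c0 : 0 < c.
Hypothesis phiC : forall x, c * `|x| - C <= phi x.
Local Notation rho := (rho phi).
Local Notation E := (E phi).

Let pgi F : pg F -> intg mu (fun x => F x * rho x). Proof. exact: (pgi phiL c0 phiC). Qed.
Let mrho : measurable_fun setT rho. Proof. exact: rho_meas phiL. Qed.

Variables (k : V -> R) (r M : R).
Hypothesis r0 : 0 <= r.
Hypothesis kk : kernel k r M.

Lemma pg_norm1 n : pg (fun x : V => (1 + `|x|) ^+ n).
Proof.
apply: pgX; apply: pgD; first exact: pg_cst.
by apply: pg_lip; exists 1 => x y; rewrite mul1r; exact: ler_dist_dist.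
Qed.

Lemma rho_bounded : exists B, forall x, `|rho x| <= B.
Proof.
exists (expR C) => x; rewrite ger0_norm ?rho_ge0// ler_expR.
have := phiC x; have : 0 <= c * `|x| by rewrite mulr_ge0// ltW.
lra.
Qed.

Lemma rho_dom_pg F (B : R) : measurable_fun setT F -> (forall x, `|F x| <= B * rho x) -> pg F.
Proof.
move=> mF h; have [A hA] := rho_bounded.
apply: (@pg_bounded _ _ _ (`|B| * A)) => // x; apply: le_trans (h x) _.
apply: (@le_trans _ _ (`|B| * rho x)); first by rewrite ler_wpM2r ?rho_ge0// ler_norm.
by rewrite ler_wpM2l//; apply: le_trans (hA x); exact: ler_norm.
Qed.

(** Self-adjointness of convolution, by Fubini and the evenness of the kernel; domination of F by
    the weight pays for the polynomial growth of G. *)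
Lemma conv_fub F G (B : R) : measurable_fun setT F -> (forall x, `|F x| <= B * rho x) -> pg G ->
  intg mu (fun x => F x * conv k G x) /\
  rint mu (fun x => F x * conv k G x) = rint mu (fun x => conv k F x * G x).
Proof.
move=> mF FB pG; have pF := rho_dom_pg mF FB.
have [mG [A [n hA]]] := pG; have mk := k_meas kk.
pose Phi (p : V * V) := F p.1 * (G p.2 * k (p.2 - p.1)).
have mPhi : measurable_fun setT Phi.
  apply: measurable_funM; first by apply: measurableT_comp => //; exact: measurable_fst.
  apply: measurable_funM; first by apply: measurableT_comp => //; exact: measurable_snd.
  apply: (measurableT_comp mk).
  by apply: (measurable_fun_subv (f := snd) (g := fst)); [exact: measurable_snd|exact: measurable_fst].
have cE F' x : pg F' -> rint mu (fun y => F' y * k (y - x)) = conv k F' x.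
  by move=> pF'; rewrite (convE kk).
have ci F' x : pg F' -> intg mu (fun y => F' y * k (y - x)).
  move=> pF'; have := intg_shift (- x) (conv_intg kk x pF').
  rewrite (_ : (fun y => _) = (fun y => F' y * k (y - x)))//; apply/funext => y.
  by rewrite [y - x]addrC addrA subrr add0r.
have kE x y : k (y - x) = k (x - y) by rewrite -(k_even kk) opprB.
have [|x|y|x|i1 i2 e] := @rint_fubini R d' Phi (fun x => B * (A * (1 + r) ^+ n * kmass k) * (1 + `|x|) ^+ n * rho x) mPhi.
- by apply: pgi; apply: pgZ; exact: pg_norm1.
- exact: (intgZ (F x) (ci G x pG)).
- rewrite (_ : (fun x => _) = (fun x => G y * (F x * k (x - y)))); last first.
    by apply/funext => x; rewrite /Phi/= kE; ring.
  by apply: intgZ; exact: ci.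
- rewrite (_ : (fun y => _) = (fun y => `|F x| * (`|G y| * k (y - x)))); last first.
    by apply/funext => y; rewrite /Phi/= !normrM (ger0_norm (k_ge0 kk _)).
  rewrite rintZ; last by apply: ci; exact: pg_norm.
  rewrite cE; last exact: pg_norm.
  have h := conv_bound r0 kk x (pg_norm pG) (fun y => _ : `| `|G y| | <= A * (1 + `|y|) ^+ n).
  have := h (fun y => eq_ind_r (fun t => t <= _) (hA y) (normr_id (G y))) => {}h.
  have cg0 : 0 <= conv k (fun y => `|G y|) x by apply: (conv_ge0 kk).
  apply: le_trans (ler_pM (normr_ge0 _) cg0 (FB x) (le_trans (ler_norm _) h)) _.
  by rewrite le_eqVlt; apply/orP; left; apply/eqP; ring.
have e1 x : rint mu (fun y => Phi (x, y)) = F x * conv k G x.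
  by apply: etrans (rintZ (F x) (ci G x pG)) _; rewrite (cE G x pG).
have e2 y : rint mu (fun x => Phi (x, y)) = conv k F y * G y.
  apply: etrans (_ : rint mu (fun x => G y * (F x * k (x - y))) = _).
    by apply: eq_rint => x; rewrite /Phi/= kE; ring.
  by apply: etrans (rintZ (G y) (ci F y pF)) _; rewrite (cE F y pF) mulrC.
split; first exact: (eq_ind _ (fun g => intg mu g) i1 _ (funext e1)).
by rewrite -(eq_rint _ e1) e; exact: eq_rint.
Qed.

(** On a ball of radius r the weight varies by at most the factor $e^{Nr}$. *)
Lemma conv_rho F (B : R) : measurable_fun setT F -> (forall x, `|F x| <= B * rho x) ->
  forall x, `|conv k F x| <= B * expR (N * r) * kmass k * rho x.
Proof.
move=> mF h x; have pF := rho_dom_pg mF h.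
have B0 : 0 <= B by have := le_trans (normr_ge0 _) (h x); rewrite pmulr_lge0// rho_gt0.
apply: le_trans (conv_norm kk _ pF) _; rewrite mulrAC -(conv_cst kk _ x).
apply: (conv_le kk (pg_norm pF) (pg_cst _)) => y yx; apply: le_trans (h y) _.
rewrite -mulrA ler_wpM2l//; have := rho_shift phiL x (y - x); rewrite addrC subrK => h1.
by apply: le_trans h1 _; rewrite ler_wpM2r ?rho_ge0// ler_expR ler_wpM2l.
Qed.

(** Fubini provides the measurability of the product of the weight with the convolution; the weight
    is then divided out. *)
Lemma conv_meas G : pg G -> measurable_fun setT (conv k G).
Proof.
move=> pG; have [|i _] := @conv_fub rho G 1 mrho _ pG.
  by move=> x; rewrite mul1r ger0_norm ?rho_ge0.
rewrite (_ : conv k G = (fun x => expR (phi x) * (rho x * conv k G x))).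
  apply: measurable_funM; last exact: intg_meas i.
  by apply: measurableT_comp => //; apply: lip_measurable; exists N.
by apply/funext => x; rewrite mulrA /rho -expRD subrr expR0 mul1r.
Qed.

Lemma conv_pg G : pg G -> pg (conv k G).
Proof.
move=> pG; split; first exact: conv_meas.
have [mG [A [n hA]]] := pG; exists (A * (1 + r) ^+ n * kmass k), n => x.
exact: (conv_bound r0 kk x pG hA).
Qed.

Lemma E_conv G : pg G -> (forall x, 0 <= G x) -> E (conv k G) <= expR (N * r) * kmass k * E G.
Proof.
move=> pG G0; have hr x : `|rho x| <= 1 * rho x by rewrite mul1r ger0_norm ?rho_ge0.
have [_ e] := conv_fub mrho hr pG.
rewrite !E_rint (eq_rint _ (fun x => mulrC (conv k G x) (rho x))) e.
rewrite -rintZ; last exact: pgi.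
have hc x := conv_rho mrho hr x.
have mc : measurable_fun setT (conv k rho).
  by apply: conv_meas; exact: rho_dom_pg mrho hr.
have c2 x : `|conv k rho x * G x| <= expR (N * r) * kmass k * (G x * rho x).
  rewrite normrM (ger0_norm (G0 x)); apply: le_trans (ler_wpM2r _ (hc x)) _ => //.
  by rewrite mul1r le_eqVlt; apply/orP; left; apply/eqP; ring.
have i2 : intg mu (fun x => expR (N * r) * kmass k * (G x * rho x)) by apply: intgZ; exact: pgi.
apply: rint_le => //; last by move=> x; apply: le_trans (c2 x); exact: ler_norm.
by apply: (intg_le _ c2 i2); apply: measurable_funM => //; exact: pg_meas.
Qed.

End weighted.

Section mollifier.
Variables (k : V -> R) (s M Lk : R).
Hypothesis s0 : 0 < s.
Hypothesis s1 : s <= 1.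
Hypothesis kk : kernel k s M.
Hypothesis kL : forall x y, `|k x - k y| <= Lk * `|x - y|.
Hypothesis k1 : rint mu k = 1.

Let s0' : 0 <= s. Proof. exact: ltW. Qed.

Lemma kmass1 : kmass k = 1.
Proof. by rewrite -k1 /kmass conv_rint; apply: eq_rint => y; rewrite mul1r. Qed.

Lemma conv_pg' G : pg G -> pg (conv k G).
Proof.
move=> pG; apply: (@conv_pg (fun x => `|x|) 1 1 0 _ _ _ k s M s0' kk G pG) => //.
- by move=> x y; rewrite mul1r; exact: ler_dist_dist.
- by move=> x; rewrite mul1r subr0.
Qed.

Lemma moll_const c x : conv k (fun=> c) x = c.
Proof. by rewrite (conv_cst kk) kmass1 mulr1. Qed.

Lemma moll_near F L x : (forall x y, `|F x - F y| <= L * `|x - y|) -> 0 <= L -> `|conv k F x - F x| <= L * s.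
Proof.
move=> FL L0; have pF : pg F by apply: pg_lip; exists L.
rewrite -[F x in X in `|X|](moll_const (F x) x) -(convB kk x pF (pg_cst _)).
have pB : pg (fun y => F y - F x) by apply: pgB => //; exact: pg_cst.
apply: le_trans (conv_norm kk x pB) _; rewrite -[leRHS](moll_const _ x).
apply: (conv_le kk (pg_norm pB) (pg_cst _)) => y yx.
by apply: le_trans (FL _ _) _; rewrite ler_wpM2l.
Qed.

Lemma conv_shift F x h : conv k F (x + h) = conv k (fun y => F (y + h)) x.
Proof. by rewrite !conv_rint; apply: eq_rint => y; rewrite addrAC. Qed.

Lemma moll_lipL F L : (forall x y, `|F x - F y| <= L * `|x - y|) ->
  forall x y, `|conv k F x - conv k F y| <= L * `|x - y|.
Proof.
move=> FL x y; have lF : lip F by exists L.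
have pF := pg_lip lF.
have pFs := pg_shift (x - y) pF.
have -> : conv k F x = conv k (fun z => F (z + (x - y))) y by rewrite -conv_shift addrC subrK.
rewrite -(convB kk y pFs pF).
have pB := pgB pFs pF.
apply: le_trans (conv_norm kk y pB) _; rewrite -[leRHS](moll_const _ y).
apply: (conv_le kk (pg_norm pB) (pg_cst _)) => z _; apply: le_trans (FL _ _) _.
by rewrite addrAC subrr add0r.
Qed.

Lemma moll_lip F : lip F -> lip (conv k F).
Proof. by move=> [L hL]; exists L; exact: moll_lipL. Qed.

Definition k2 (y : V) : R := \1_[set z : V | (`|z| <= 2)%R] y.

Lemma kernel_k2 : kernel k2 2 1.
Proof.
split.
- by apply: measurable_indic; exact: measurable_norm_le.
- by move=> y; rewrite /k2 indicE.
- by move=> y; rewrite /k2 indicE; case: (_ \in _).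
- by move=> y y2; rewrite /k2 indicE memNset//= => /(lt_le_trans y2); rewrite ltxx.
- by move=> y; rewrite /k2 !indicE; congr (_%:R); congr nat_of_bool; apply/idP/idP; rewrite !inE/= normrN.
Qed.

(** For |x - y| <= 1 and s <= 1 both translates of the kernel live in the ball of radius 2 about x,
    where they differ by at most Lk |x - y|. The increment is thus bounded by a local average of |F|
    rather than by a global norm. *)
Lemma moll_diff F x y : pg F -> `|x - y| <= 1 ->
  `|conv k F x - conv k F y| <= Lk * `|x - y| * conv k2 (fun z => `|F z|) x.
Proof.
move=> pF xy; have h2 : (0 : R) <= 2 by [].
have pn := pg_norm pF.
rewrite (convE kk x pF) (convE kk y pF) (convE kernel_k2 x pn).
have ci F' k' r' M' z : kernel k' r' M' -> pg F' -> intg mu (fun t => F' t * k' (t - z)).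
  move=> kk' pF'; have := intg_shift (- z) (conv_intg kk' z pF').
  rewrite (_ : (fun t => _) = (fun t => F' t * k' (t - z)))//; apply/funext => t.
  by rewrite [t - z]addrC addrA subrr add0r.
have i1 := ci F k s M x kk pF; have i2 := ci F k s M y kk pF.
have i3 := ci _ k2 2 1 x kernel_k2 pn.
rewrite -rintB// -rintZ//; apply: rint_le_norm => [||z]; [exact: intgB|exact: intgZ|].
rewrite -mulrBr normrM [leRHS]mulrCA ler_wpM2l//.
have e : z - x - (z - y) = y - x by rewrite opprB addrC addrA subrK.
have := kL (z - x) (z - y); rewrite e [`|y - x|]distrC => h.
rewrite /k2 indicE; have [z2|z2] := leP `|z - x| 2.
  by rewrite mem_set// mulr1.
have s2 : s < `|z - x| by move: (s1) z2; lra.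
have zy : s < `|z - y|.
  have := ler_normD (z - y) (y - x); rewrite addrA subrK [`|y - x|]distrC; move: (s1) z2 xy; lra.
by rewrite (k_supp kk s2) (k_supp kk zy) subrr normr0 memNset/= ?mulr0// => /(lt_le_trans z2); rewrite ltxx.
Qed.

(** The base case of [moll_Sm]: the derivative of a Lipschitz function is merely bounded and
    measurable, and convolution makes it Lipschitz. *)
Lemma moll_bounded_lip F (B : R) : measurable_fun setT F -> (forall x, `|F x| <= B) -> lip (conv k F).
Proof.
move=> mF FB; have pF := pg_bounded mF FB; have h2 : (0 : R) <= 2 by [].
have B0 : 0 <= B by exact: le_trans (normr_ge0 _) (FB 0).
have Lk0 : 0 <= Lk by have := le_trans (normr_ge0 _) (kL (evec ord0) 0); rewrite pmulr_lge0// subr0 normr_gt0; apply/eqP => /rowP/(_ ord0)/eqP; rewrite !mxE eqxx oner_eq0.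
have bd x : `|conv k F x| <= B.
  apply: le_trans (conv_norm kk x pF) _; rewrite -[leRHS](moll_const _ x).
  by apply: (conv_le kk (pg_norm pF) (pg_cst _)).
exists (Lk * (B * kmass k2) + 2 * B) => x y; rewrite mulrDl.
have m0 : 0 <= kmass k2 := kmass_ge0 kernel_k2.
have [xy|xy] := leP `|x - y| 1.
  apply: le_trans (moll_diff pF xy) _; rewrite -[leLHS]addr0; apply: lerD; last by rewrite !mulr_ge0.
  rewrite mulrAC ler_wpM2r// ler_wpM2l// -(conv_cst kernel_k2 _ x).
  by apply: (conv_le kernel_k2 (pg_norm pF) (pg_cst _)).
rewrite -[leLHS]add0r; apply: lerD; first by rewrite !mulr_ge0.
apply: (@le_trans _ _ (2 * B)); last by rewrite ler_peMr ?mulr_ge0// ltW.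
by apply: le_trans (ler_normB _ _) _; have := bd x; have := bd y; lra.
Qed.

Lemma dq_conv F v n x : pg F -> dq (conv k F) v n x = conv k (dq F v n) x.
Proof.
move=> pF; have pS := pg_shift (n.+1%:R^-1 *: v) pF.
by rewrite /dq conv_shift -(convB kk x pS pF) -(convZ kk)//; exact: pgB.
Qed.

(** Dominated convergence: the quotients of F are bounded by L |v| and converge almost
    everywhere. *)
Lemma moll_rd F v x : lip F -> rd (conv k F) v x (conv k (pd F v) x).
Proof.
move=> lF; apply: dq_rd; first exact: moll_lip.
have pF := pg_lip lF; have [L L0 FL] := lip_ge0 lF.
rewrite conv_rint (_ : (fun n => _) = (fun n => rint mu (fun y => dq F v n (x + y) * k y))); last first.
  by apply/funext => n; rewrite dq_conv// conv_rint.
have mdq n := dq_measurable v n (lip_measurable lF).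
have msh (G : V -> R) : measurable_fun setT G -> measurable_fun setT (fun y => G (x + y)).
  move=> mG; rewrite (_ : (fun y => _) = (fun y => G (y + x))); last by apply/funext => y; rewrite addrC.
  by apply: (measurableT_comp mG); exact: measurable_fun_addv.
have ki : intg mu (fun y => L * `|v| * k y).
  apply: intgZ; have := conv_intg kk 0 (pg_cst 1).
  by rewrite (_ : (fun y => _) = k)//; apply/funext => y; rewrite mul1r.
have [||||_ +] := @rint_dct _ _ _ mu (fun n y => dq F v n (x + y) * k y) (fun y => pd F v (x + y) * k y) _ _ _ _ ki _.
- by move=> n; apply: measurable_funM; [exact: msh|exact: k_meas kk].
- by apply: measurable_funM; [apply: msh; apply: pd_measurable; exact: lip_measurable|exact: k_meas kk].
- apply: ae_imp (ae_shift x (dq_cvg_ae v lF)) _ => y; rewrite addrC => h.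
  by apply: cvgMl.
- move=> n y; rewrite normrM (ger0_norm (k_ge0 kk y)) ler_wpM2r ?(k_ge0 kk)//.
  exact: (dq_bound v n _ FL).
exact.
Qed.

Lemma pd_moll F v : lip F -> pd (conv k F) v = conv k (pd F v).
Proof. by move=> lF; apply/funext => x; apply: rd_pd; exact: moll_rd. Qed.

Lemma moll_Sm n F : Sm n F -> Sm n.+1 (conv k F).
Proof.
elim: n F => [|n ih] F sF.
  have lF : lip F := sF; split; first exact: moll_lip.
    by move=> x v; rewrite pd_moll//; exact: moll_rd.
  move=> v; rewrite pd_moll//; have [L L0 FL] := lip_ge0 lF.
  apply: (@moll_bounded_lip _ (L * `|v|)); first by apply: pd_measurable; exact: lip_measurable.
  by move=> x; exact: pd_bound.
have lF := Sm_lip sF; split; first exact: moll_lip.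
  by move=> x v; rewrite pd_moll//; exact: moll_rd.
by move=> v; rewrite pd_moll//; apply: ih; exact: Sm_pd sF.
Qed.

(** Friedrichs' commutator: on the support of the translated kernel b varies by at most L s. *)
Lemma moll_commutator F b (L : R) x : pg F -> pg b ->
  (forall x y, `|b x - b y| <= L * `|x - y|) -> 0 <= L ->
  `|conv k (fun y => F y * b y) x - b x * conv k F x| <= L * s * conv k (fun y => `|F y|) x.
Proof.
move=> pF pb bL L0; have pFb := pgM pF pb.
rewrite -(convZ kk _ x pF) -(convB kk x pFb (pgZ _ pF)).
rewrite -(convZ kk _ x (pg_norm pF)).
have pD := pgB pFb (pgZ (b x) pF).
apply: le_trans (conv_norm kk x pD) _.
apply: (conv_le kk (pg_norm pD) (pgZ _ (pg_norm pF))) => y yx.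
rewrite -[b x * F y]mulrC -mulrBr normrM mulrC ler_wpM2r//.
by apply: le_trans (bL _ _) _; rewrite ler_wpM2l.
Qed.

(** The derivative falls on the kernel, so that only local averages of F enter and not its Lipschitz
    constant. *)
Lemma moll_pd_bound F v x : lip F ->
  `|pd (conv k F) v x| <= Lk * `|v| * conv k2 (fun z => `|F z|) x.
Proof.
move=> lF; have pF := pg_lip lF.
have W0 : 0 <= conv k2 (fun z => `|F z|) x by apply: (conv_ge0 kernel_k2).
set W := conv k2 _ x in W0 *; rewrite pd_moll//.
have h := moll_rd v x lF; apply/ler_addgt0Pr => e e0; have [D D0 hD] := h e e0.
have v1 : 0 < `|v| + 1 by rewrite ltr_wpDl.
pose t := Num.min (D / 2) (`|v| + 1)^-1.
have t0 : 0 < t by rewrite lt_min divr_gt0//= invr_gt0.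
have tD : t < D by rewrite gt_min; apply/orP; left; lra.
have tv : t * `|v| <= 1.
  apply: (@le_trans _ _ (t * (`|v| + 1))); first by rewrite ler_pM2l// lerDl.
  by rewrite -ler_pdivlMr// mul1r /t ge_min lexx orbT.
have := hD t; rewrite t0 tD => /(_ isT) h1.
have e1 : `|x - (x + t *: v)| = t * `|v| by rewrite opprD addrA subrr add0r normrN normrZ gtr0_norm.
have := moll_diff pF (_ : `|x - (x + t *: v)| <= 1); rewrite e1 distrC => /(_ tv) h2.
rewrite -(ler_pM2l t0) -{1}(gtr0_norm t0) -normrM.
have := ler_normB (conv k F (x + t *: v) - conv k F x) (conv k F (x + t *: v) - conv k F x - t * conv k (pd F v) x).
rewrite opprB addrC subrK => h3; apply: le_trans h3 _.
by move: h1 h2; rewrite -/W; lra.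
Qed.

End mollifier.

Lemma mollifier_exists (s : R) : (0 < lam [set: V])%E -> 0 < s ->
  exists k M Lk, [/\ kernel k s M, (forall x y, `|k x - k y| <= Lk * `|x - y|) & rint mu k = 1].
Proof.
move=> lamT s0; pose k0 (y : V) := Num.max 0 (1 - `|y| / s).
have k0L x y : `|k0 x - k0 y| <= s^-1 * `|x - y|.
  have : `| (1 - `|x| / s) - (1 - `|y| / s)| <= s^-1 * `|x - y|.
    have -> : (1 - `|x| / s) - (1 - `|y| / s) = s^-1 * (`|y| - `|x|) by field; rewrite gt_eqF.
    rewrite normrM normfV (gtr0_norm s0) ler_wpM2l ?invr_ge0 ?(ltW s0)//.
    by rewrite distrC; exact: ler_dist_dist.
  rewrite /k0 ![Num.max 0 _]maxEle; move: (1 - _) (1 - _) => a b.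
  rewrite !ler_norml => /andP[h1 h2]; have := mulr_ge0 (ltW (_ : 0 < s^-1)) (normr_ge0 (x - y)); rewrite invr_gt0 => /(_ s0) h3.
  by case: ifPn => a0; case: ifPn => b0; apply/andP; split; move: a0 b0; rewrite -?ltNge => a0 b0; lra.
have l0 : lip k0 by exists s^-1.
have ker0 : kernel k0 s 1.
  split; first exact: lip_measurable.
  - by move=> y; rewrite le_max lexx.
  - by move=> y; rewrite ge_max ler01 gerBl mulr_ge0// invr_ge0 ltW.
  - by move=> y sy; apply/max_idPl; rewrite subr_le0 ler_pdivlMr// mul1r ltW.
  - by move=> y; rewrite /k0 normrN.
have i0 : intg mu k0.
  have := conv_intg ker0 0 (pg_cst 1).
  by rewrite (_ : (fun y => _) = k0)//; apply/funext => y; rewrite mul1r.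
have I0 : 0 < rint mu k0.
  rewrite lt0r (rint_ge0 _ (k_ge0 ker0)) andbT; apply/eqP => h.
  have [A [mA A0 hA]] := rint_eq0_ae i0 (k_ge0 ker0) h.
  have := lam_ball_gt0 lamT 0 s0; rewrite ltNge => /negP; apply.
  rewrite -A0; apply: le_leb_outer => y /=; rewrite subr0 => ys; apply: hA => /= /eqP.
  rewrite /k0 eq_le ge_max lexx/= => /andP[+ _]; rewrite subr_le0 ler_pdivlMr// mul1r.
  by move=> /(lt_le_trans ys); rewrite ltxx.
set I := rint mu k0 in I0.
have Ii : 0 <= I^-1 by rewrite invr_ge0 ltW.
exists (fun y => I^-1 * k0 y), I^-1, (I^-1 * s^-1); split.
- split.
  + by apply: measurable_funM => //; exact: k_meas ker0.
  + by move=> y; rewrite mulr_ge0// (k_ge0 ker0).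
  + by move=> y; rewrite ler_piMr// (k_le ker0).
  + by move=> y sy; rewrite (k_supp ker0 sy) mulr0.
  + by move=> y; rewrite (k_even ker0).
- by move=> x y; rewrite -mulrBr normrM ger0_norm// -mulrA ler_wpM2l.
- by rewrite rintZ// mulVf// gt_eqF.
Qed.

End conv.

(** * Bochner's formula and solutions of L u = f *)

Section bochner.
Context {R : realType} {d' : nat}.
Local Notation d := d'.+1.
Local Notation V := 'rV[R]_d.
Local Notation mu := (@lam R d').
Implicit Types (f g u F G : V -> R) (x : V).
Hypothesis lamT : (0 < lam [set: V])%E.
Variable phi : V -> R.
Variables N c C : R.
Hypothesis N0 : 0 <= N.
Hypothesis phiL : forall x y, `|phi x - phi y| <= N * `|x - y|.
Hypothesis c0 : 0 < c.
Hypothesis phiC : forall x, c * `|x| - C <= phi x.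
Hypothesis sphi : Sm 2 phi.
Variable v : 'I_d -> V.
Local Notation rho := (rho phi).
Local Notation E := (E phi).

Let ED := (ED phiL c0 phiC).
Let EB := (EB phiL c0 phiC).
Let EN := (EN phiL c0 phiC).
Let EZ := (EZ phiL c0 phiC).
Let Esum := (Esum phiL c0 phiC).
Let ibp := (ibp N0 phiL c0 phiC).
Let dphi : diffd phi := Sm_diff sphi.


(** The frame [v] is arbitrary and not orthonormal. Working in it amounts to an affine change of
    variables, so the estimates can be made in the position adapted to phi while phi and the weight
    stay where they are. *)
Definition L u x : R := \sum_i (pd (pd u (v i)) (v i) x - pd phi (v i) x * pd u (v i) x).

Lemma Sm_pg n f : Sm n f -> pg f.
Proof. by move=> /Sm_lip; exact: pg_lip. Qed.

Lemma pd_bdd f w : lip f -> exists M, forall x, `|pd f w x| <= M.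
Proof. by move=> /lip_ge0[K K0 fK]; exists (K * `|w|) => x; exact: pd_bound. Qed.

Let pphi i : pg (pd phi (v i)). Proof. exact: Sm_pg (Sm_pd (v i) sphi). Qed.

Lemma L_pg u : Sm 2 u -> pg (L u).
Proof.
move=> su; apply: pg_sum => i; have s1 := Sm_pd (v i) su.
by apply: pgB; [exact: pg_pd (Sm_lip s1)|apply: pgM; [exact: pphi|exact: Sm_pg s1]].
Qed.

Lemma L_lip u : Sm 3 u -> lip (L u).
Proof.
move=> su; apply: lip_sum => i.
have s2 : Sm 2 (pd u (v i)) := Sm_pd (v i) su.
have s1 : Sm 1 (pd (pd u (v i)) (v i)) := Sm_pd (v i) s2.
have [A hA] := pd_bdd (v i) (Sm_lip sphi); have [B hB] := pd_bdd (v i) (Sm_lip su).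
apply: lipB; first exact: Sm_lip s1.
by apply: (lipM _ _ hA hB); [exact: Sm_lip (Sm_pd (v i) sphi)|exact: Sm_lip s2].
Qed.

Lemma L_bdd u : Sm 2 u -> exists B, forall x, `|L u x| <= B.
Proof.
move=> su; have h i : exists B, forall x, `|pd (pd u (v i)) (v i) x - pd phi (v i) x * pd u (v i) x| <= B.
  have s1 : Sm 1 (pd u (v i)) := Sm_pd (v i) su.
  have [A hA] := pd_bdd (v i) (Sm_lip sphi); have [B hB] := pd_bdd (v i) (Sm_lip su).
  have [D hD] := pd_bdd (v i) (Sm_lip s1); exists (D + A * B) => x.
  apply: le_trans (ler_normB _ _) _; apply: lerD => //.
  by rewrite normrM; apply: ler_pM.
have [B hB] := choice h; exists (\sum_i B i) => x.
by apply: le_trans (ler_norm_sum _ _ _) _; apply: ler_sum.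
Qed.

Lemma LD u w x (t : R) : Sm 2 u -> Sm 2 w -> L (fun y => u y + t * w y) x = L u x + t * L w x.
Proof.
move=> su sw; rewrite /L mulr_sumr -big_split/=; apply: eq_bigr => i _.
have su1 := Sm_pd (v i) su; have sw1 := Sm_pd (v i) sw.
rewrite pdD; [|exact: Sm_diff su|exact: Sm_diff (SmZ t sw)].
rewrite pdZ; last exact: Sm_diff sw.
rewrite pdD; [|exact: Sm_diff su1|exact: Sm_diff (SmZ t sw1)].
rewrite pdZ; last exact: Sm_diff sw1.
ring.
Qed.

Lemma E_L A u : Sm 2 u -> lip A ->
  E (fun x => A x * L u x) = - \sum_i E (fun x => pd A (v i) x * pd u (v i) x).
Proof.
move=> su lA.
have pA := pg_lip lA.
have pU i : pg (pd u (v i)) := Sm_pg (Sm_pd (v i) su).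
have pUU i : pg (pd (pd u (v i)) (v i)) := pg_pd (v i) (Sm_lip (Sm_pd (v i) su)).
have pdA i : pg (pd A (v i)) := pg_pd (v i) lA.
rewrite (eqE _ (_ : _ =1 (fun x => \sum_i (A x * pd (pd u (v i)) (v i) x - A x * pd u (v i) x * pd phi (v i) x)))); last first.
  by move=> x; rewrite /L mulr_sumr; apply: eq_bigr => i _; ring.
rewrite Esum; last by move=> i; apply: pgB; apply: pgM => //; exact: pgM.
rewrite -sumrN; apply: eq_bigr => i _.
rewrite EB; [|exact: pgM|by apply: pgM => //; exact: pgM].
have := ibp (v i) dphi lA (Sm_lip (Sm_pd (v i) su)).
rewrite ED; [|exact: pgM|exact: pgM].
rewrite (eqE _ (_ : (fun x => pd u (v i) x * pd A (v i) x) =1 (fun x => pd A (v i) x * pd u (v i) x))).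
  by move=> h; lra.
by move=> x; rewrite mulrC.
Qed.

Lemma E_L0 u : Sm 2 u -> E (L u) = 0.
Proof.
move=> su; rewrite (eqE _ (_ : L u =1 (fun x => 1 * L u x))); last by move=> x; rewrite mul1r.
rewrite (E_L su (lip_cst 1)) big1 ?oppr0// => i _.
rewrite (eqE _ (_ : _ =1 (fun=> 0))); first by rewrite (Ecst phiL c0 phiC) mul0r.
by move=> x; rewrite (rd_pd (rd_cst _ _ _)) mul0r.
Qed.

Definition hess2 u x : R := \sum_i \sum_j pd (pd u (v i)) (v j) x ^+ 2.

Lemma hess2_pg u : Sm 2 u -> pg (hess2 u).
Proof.
move=> su; do 2 ![apply: pg_sum => ?]; apply: pgX; apply: pg_pd; exact: Sm_lip (Sm_pd _ su).
Qed.

Lemma bochner u : Sm 3 u ->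
  E (fun x => L u x ^+ 2) = E (hess2 u) +
    E (fun x => \sum_i \sum_j pd u (v i) x * pd u (v j) x * pd (pd phi (v i)) (v j) x).
Proof.
move=> su; have su2 : Sm 2 u := Sm_leS su.
have s2 i : Sm 2 (pd u (v i)) := Sm_pd (v i) su.
have s1 i j : Sm 1 (pd (pd u (v i)) (v j)) := Sm_pd (v j) (s2 i).
have sp i : Sm 1 (pd phi (v i)) := Sm_pd (v i) sphi.
have p1 i : pg (pd u (v i)) := Sm_pg (s2 i).
have p2 i j : pg (pd (pd u (v i)) (v j)) := Sm_pg (s1 i j).
have p3 i j l : pg (pd (pd (pd u (v i)) (v j)) (v l)) := pg_pd (v l) (Sm_lip (s1 i j)).
have pp2 i j : pg (pd (pd phi (v i)) (v j)) := pg_pd (v j) (Sm_lip (sp i)).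
have pdL j x : pd (L u) (v j) x = \sum_i (pd (pd (pd u (v i)) (v i)) (v j) x
    - (pd phi (v i) x * pd (pd u (v i)) (v j) x + pd u (v i) x * pd (pd phi (v i)) (v j) x)).
  apply: rd_pd; apply: rd_sum => i; apply: rdD; first exact: Sm_diff (s1 i i) x (v j).
  rewrite -mulN1r (_ : (fun y => _) = (fun y => -1 * (pd phi (v i) y * pd u (v i) y))); last first.
    by apply/funext => y; rewrite mulN1r.
  apply: rdZ; apply: rdM; [exact: Sm_lip (sp i)|exact: Sm_lip (s2 i)| |].
    exact: Sm_diff (sp i) x (v j).
  exact: Sm_diff (s2 i) x (v j).
rewrite (eqE _ (_ : _ =1 (fun x => L u x * L u x))); last by move=> x; rewrite expr2.
rewrite (E_L su2 (L_lip su)).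
have e j : E (fun x => pd (L u) (v j) x * pd u (v j) x) = \sum_i
   (E (fun x => pd (pd (pd u (v i)) (v i)) (v j) x * pd u (v j) x)
    - E (fun x => pd (pd u (v i)) (v j) x * pd u (v j) x * pd phi (v i) x)
    - E (fun x => pd u (v i) x * pd u (v j) x * pd (pd phi (v i)) (v j) x)).
  rewrite (eqE _ (_ : _ =1 (fun x => \sum_i (pd (pd (pd u (v i)) (v i)) (v j) x * pd u (v j) x
     - pd (pd u (v i)) (v j) x * pd u (v j) x * pd phi (v i) x
     - pd u (v i) x * pd u (v j) x * pd (pd phi (v i)) (v j) x)))); last first.
    by move=> x; rewrite pdL mulr_suml; apply: eq_bigr => i _; ring.
  rewrite Esum; last by move=> i; apply: pgB; [apply: pgB; [exact: pgM|apply: pgM => //; exact: pgM]|apply: pgM => //; exact: pgM].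
  apply: eq_bigr => i _; rewrite EB; last by apply: pgM => //; exact: pgM.
    by rewrite EB//; [exact: pgM|apply: pgM => //; exact: pgM].
  by apply: pgB; [exact: pgM|apply: pgM => //; exact: pgM].
rewrite (eq_bigr _ (fun j _ => e j)) exchange_big/=.
rewrite /hess2 Esum; last by move=> i; apply: pg_sum => j; exact: pgX.
rewrite Esum; last by move=> i; apply: pg_sum => j; apply: pgM => //; exact: pgM.
rewrite -sumrN -big_split/=; apply: eq_bigr => i _.
rewrite Esum; last by move=> j; exact: pgX.
rewrite Esum; last by move=> j; apply: pgM => //; exact: pgM.
rewrite -sumrN -big_split/=; apply: eq_bigr => j _.
have := ibp (v i) dphi (Sm_lip (s1 i j)) (Sm_lip (s2 j)).
rewrite ED; [|exact: pgM|exact: pgM].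
rewrite (Sm_pd_comm lamT (v j) (v i) su2) (Sm_pd_comm lamT (v j) (v i) (s2 i)) => h.
rewrite (eqE _ (_ : (fun x => pd (pd u (v i)) (v j) x ^+ 2) =1
   (fun x => pd (pd u (v i)) (v j) x * pd (pd u (v i)) (v j) x))) => [|x]; last by rewrite expr2.
rewrite (eqE _ (_ : (fun x => pd (pd (pd u (v i)) (v i)) (v j) x * pd u (v j) x) =1
   (fun x => pd u (v j) x * pd (pd (pd u (v i)) (v i)) (v j) x))) => [|x]; last by rewrite mulrC.
lra.
Qed.

(** At each point the Legendre bound is used with w = - grad u. Its integral bounds the Hessian term
    of Bochner's formula from below, and completing the square leaves the distance from f to L u as
    the only error. *)
Lemma dual_bound u f G : Sm 3 u -> Sm 1 f -> intg mu (fun x => G x * rho x) ->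
  (forall x w, 2 * pd f w x - pd (pd phi w) w x <= G x) ->
  E (hess2 u) <= E G - E (fun x => f x ^+ 2) + E (fun x => (f x - L u x) ^+ 2).
Proof.
move=> su sf iG hG; have su2 : Sm 2 u := Sm_leS su.
have s2 i : Sm 2 (pd u (v i)) := Sm_pd (v i) su.
have sp i : Sm 1 (pd phi (v i)) := Sm_pd (v i) sphi.
have p1 i : pg (pd u (v i)) := Sm_pg (s2 i).
have pp2 i j : pg (pd (pd phi (v i)) (v j)) := pg_pd (v j) (Sm_lip (sp i)).
have pf := Sm_pg sf; have pfi i : pg (pd f (v i)) := pg_pd (v i) (Sm_lip sf).
have pLu := L_pg su2.
pose Q x := \sum_i \sum_j pd u (v i) x * pd u (v j) x * pd (pd phi (v i)) (v j) x.
have pQ : pg Q by do 2 ![apply: pg_sum => ?]; apply: pgM => //; exact: pgM.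
pose P x := \sum_i pd f (v i) x * pd u (v i) x.
have pP : pg P by apply: pg_sum => i; exact: pgM.
have key x : - 2 * P x - Q x <= G x.
  (* The direction is the gradient of u at the fixed point x with its sign reversed: its
     coefficients are constants when phi is differentiated. *)
  pose w := \sum_i (- pd u (v i) x) *: v i.
  have e1 : pd f w x = - P x.
    by rewrite (Sm_pd_lin lamT _ _ _ _ sf) /P -sumrN; apply: eq_bigr => i _; rewrite mulNr mulrC.
  have e2 : pd phi w = (fun y => \sum_i (- pd u (v i) x) * pd phi (v i) y).
    by apply/funext => y; rewrite (Sm_pd_lin lamT _ _ _ _ (Sm_leS sphi)).
  have e3 : pd (pd phi w) w x = Q x.
    rewrite e2 pd_sum; last by move=> i; exact: Sm_diff (SmZ _ (sp i)).
    apply: eq_bigr => i _; rewrite pdZ; last exact: Sm_diff (sp i).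
    rewrite (Sm_pd_lin lamT _ _ _ _ (sp i)) mulr_sumr; apply: eq_bigr => j _; ring.
  by have := hG x w; rewrite e1 e3; lra.
have h1 : E (fun x => - 2 * P x - Q x) <= E G.
  by apply: (leE_intg phiL c0 phiC) => //; apply: pgB => //; exact: pgZ.
move: h1; rewrite EB//; last exact: pgZ.
rewrite EZ// => h1.
have h2 : E (fun x => f x * L u x) = - E P.
  by rewrite (E_L su2 (Sm_lip sf)) Esum// => i; exact: pgM.
have h3 := bochner su; rewrite -/Q in h3.
have h4 : E (fun x => (f x - L u x) ^+ 2) =
   E (fun x => f x ^+ 2) - 2 * E (fun x => f x * L u x) + E (fun x => L u x ^+ 2).
  rewrite (eqE _ (_ : _ =1 (fun x => f x ^+ 2 - 2 * (f x * L u x) + L u x ^+ 2))); last by move=> x; ring.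
  rewrite ED; [|apply: pgB; [exact: pgX|by apply: pgZ; exact: pgM]|exact: pgX].
  by rewrite EB ?EZ//; [exact: pgM|exact: pgX|by apply: pgZ; exact: pgM].
rewrite h4 h2 h3; lra.
Qed.

End bochner.

Local Notation weight_rho := rho.
Local Notation Lop := L.

(** * Density of the range of L among mean-zero functions *)

Section density.
Context {R : realType} {d' : nat}.
Local Notation d := d'.+1.
Local Notation V := 'rV[R]_d.
Local Notation mu := (@lam R d').
Implicit Types (f g u F G : V -> R) (x : V).
Hypothesis lamT : (0 < lam [set: V])%E.
Variable phi : V -> R.
Variables N c C : R.
Hypothesis N0 : 0 <= N.
Hypothesis phiL : forall x y, `|phi x - phi y| <= N * `|x - y|.
Hypothesis c0 : 0 < c.
Hypothesis phiC : forall x, c * `|x| - C <= phi x.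
Hypothesis sphi : Sm 2 phi.
Variable v : 'I_d -> V.
Local Notation rho := (rho phi).
Local Notation E := (E phi).
Local Notation L := (L phi v).

Let ED := (ED phiL c0 phiC).
Let EB := (EB phiL c0 phiC).
Let EN := (EN phiL c0 phiC).
Let EZ := (EZ phiL c0 phiC).
Let Esum := (Esum phiL c0 phiC).
Let leE := (leE phiL c0 phiC).
Let pgi := (pgi phiL c0 phiC).
Let dphi : diffd phi := Sm_diff sphi.
Let mrho : measurable_fun setT rho := rho_meas phiL.
Let conv_fub := (conv_fub phiL c0 phiC).
Let conv_rho := (conv_rho N0 phiL c0 phiC).
Let E_conv := (E_conv N0 phiL c0 phiC).
Let rho_dom_pg := (rho_dom_pg c0 phiC).

(** The class of functions such as g times the weight, on which convolution is self-adjoint against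
    functions of polynomial growth. *)
Definition dom F (B : R) := measurable_fun setT F /\ forall x, `|F x| <= B * rho x.

Lemma dom_ge0 F B : dom F B -> 0 <= B.
Proof. by move=> [_ h]; have := le_trans (normr_ge0 _) (h 0); rewrite pmulr_lge0// rho_gt0. Qed.

Lemma dom_pg F B : dom F B -> pg F.
Proof. by move=> [mF h]; exact: rho_dom_pg mF h. Qed.

Lemma dom_intg F G B : dom F B -> pg G -> intg mu (fun x => F x * G x).
Proof.
move=> dF pG; have B0 := dom_ge0 dF; have [mF h] := dF.
apply: (intg_le _ _ (intgZ B (pgi (pg_norm pG)))); first by apply: measurable_funM => //; exact: pg_meas.
move=> x; rewrite normrM mulrC; apply: le_trans (ler_wpM2l _ (h x)) _ => //.
by rewrite le_eqVlt; apply/orP; left; apply/eqP; ring.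
Qed.

Lemma bounded_dom g B : measurable_fun setT g -> (forall x, `|g x| <= B) -> dom (fun x => g x * rho x) B.
Proof.
move=> mg h; split; first exact: measurable_funM.
by move=> x; rewrite normrM (ger0_norm (rho_ge0 _ x)) ler_wpM2r// rho_ge0.
Qed.

Lemma rho_diff x y : rho y - rho x <= N * `|y - x| * rho y.
Proof.
have := expR_ge1Dx (phi y - phi x).
have -> : expR (phi y - phi x) = rho x / rho y by rewrite /rho -!expRN -expRD; congr expR; lra.
rewrite ler_pdivlMr ?rho_gt0// => h1.
have := ler_wpM2r (rho_ge0 phi y) (phiL y x); have := ler_norm (- (phi y - phi x)).
rewrite normrN => h2; have := ler_wpM2r (rho_ge0 phi y) h2; lra.
Qed.

Lemma rho_le x : rho x <= expR C.
Proof.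
rewrite ler_expR; have := phiC x; have : 0 <= c * `|x| by rewrite mulr_ge0// ltW.
lra.
Qed.

Lemma rho_lip : lip rho.
Proof.
exists (N * expR C) => x y; rewrite ler_norml; apply/andP; split.
  have := rho_diff x y; have : N * `|y - x| * rho y <= N * `|y - x| * expR C.
    by rewrite ler_wpM2l ?rho_le// mulr_ge0.
  rewrite distrC; lra.
have := rho_diff y x; have : N * `|x - y| * rho x <= N * `|x - y| * expR C.
  by rewrite ler_wpM2l ?rho_le// mulr_ge0.
lra.
Qed.

Lemma expR_sub1 (t K : R) : `|t| <= K -> `|expR t - 1| <= K * expR K.
Proof.
rewrite ler_norml => /andP[t1 t2]; have K0 : 0 <= K by lra.
have e1 := expR_ge1Dx t; have e2 := expR_ge1Dx (- t).
have e3 : expR t * expR (- t) = 1 by rewrite -expRD subrr expR0.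
have e4 := ler_wpM2l (expR_ge0 t) e2; rewrite e3 in e4.
have e5 : 1 <= expR K by rewrite -[leLHS]expR0 ler_expR.
have e6 : expR t <= expR K by rewrite ler_expR.
have e7 : t * expR t <= K * expR K.
  have [t0|t0] := leP 0 t; first by apply: ler_pM => //; exact: expR_ge0.
  apply: (@le_trans _ _ 0); last by rewrite mulr_ge0 ?expR_ge0.
  by rewrite mulr_le0_ge0 ?expR_ge0// ltW.
have e8 : K * 1 <= K * expR K by rewrite ler_wpM2l.
by rewrite ler_norml; apply/andP; split; lra.
Qed.

(** The size of F and its increments at distance at most 1 are both of the order of the weight, so
    multiplication by $e^{\phi}$ leaves a bounded Lipschitz function. *)
Lemma exp_lip F B B' : dom F B ->
  (forall x y, `|x - y| <= 1 -> `|F x - F y| <= B' * `|x - y| * rho x) ->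
  lip (fun x => expR (phi x) * F x) /\ forall x, `|expR (phi x) * F x| <= B.
Proof.
move=> dF h; have B0 := dom_ge0 dF; have [mF hF] := dF.
have er x : expR (phi x) * rho x = 1 by rewrite -expRD subrr expR0.
have bd x : `|expR (phi x) * F x| <= B.
  rewrite normrM ger0_norm ?expR_ge0//; apply: le_trans (ler_wpM2l (expR_ge0 _) (hF x)) _.
  by rewrite mulrCA er mulr1.
split => //; exists (`|B'| + B * (N * expR N) + 2 * B) => x y.
have k0 : 0 <= N * expR N by rewrite mulr_ge0 ?expR_ge0.
have [xy|xy] := leP `|x - y| 1; last first.
  apply: (@le_trans _ _ (2 * B)); first by apply: le_trans (ler_normB _ _) _; have := bd x; have := bd y; lra.
  rewrite -[leLHS]mulr1; apply: ler_pM => //; [by rewrite mulr_ge0| |exact: ltW].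
  by rewrite lerDr addr_ge0// mulr_ge0.
have -> : expR (phi x) * F x - expR (phi y) * F y =
    expR (phi x) * (F x - F y) + F y * (expR (phi y) * (expR (phi x - phi y) - 1)).
  have ex : expR (phi y) * expR (phi x - phi y) = expR (phi x) by rewrite -expRD addrC subrK.
  by rewrite -ex; ring.
apply: (@le_trans _ _ ((`|B'| + B * (N * expR N)) * `|x - y|)); last by rewrite ler_wpM2r// lerDl mulr_ge0.
apply: le_trans (ler_normD _ _) _; rewrite mulrDl; apply: lerD.
  rewrite normrM ger0_norm ?expR_ge0//.
  apply: (@le_trans _ _ (expR (phi x) * (`|B'| * `|x - y| * rho x))).
    rewrite ler_wpM2l ?expR_ge0//; apply: le_trans (h _ _ xy) _.
    by rewrite ler_wpM2r ?rho_ge0// ler_wpM2r// ler_norm.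
  by rewrite mulrCA er mulr1.
have -> : F y * (expR (phi y) * (expR (phi x - phi y) - 1)) = (expR (phi y) * F y) * (expR (phi x - phi y) - 1).
  by ring.
have t1 : `|phi x - phi y| <= N * `|x - y| by exact: phiL.
have h2 : `|expR (phi x - phi y) - 1| <= N * expR N * `|x - y|.
  apply: le_trans (expR_sub1 t1) _.
  have h3 : expR (N * `|x - y|) <= expR N by rewrite ler_expR ler_piMr.
  have := ler_wpM2l (mulr_ge0 N0 (normr_ge0 (x - y))) h3.
  by move: (expR _) (expR N) => p q; rewrite [N * q * _]mulrAC.
rewrite normrM; apply: le_trans (ler_pM (normr_ge0 _) (normr_ge0 _) (bd y) h2) _.
by move: (expR N) => q; rewrite le_eqVlt; apply/orP; left; apply/eqP; ring.
Qed.

Section test_function.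
Variables (k : V -> R) (s M Lk : R).
Hypothesis s0 : 0 < s.
Hypothesis s1 : s <= 1.
Hypothesis kk : kernel k s M.
Hypothesis kL : forall x y, `|k x - k y| <= Lk * `|x - y|.
Hypothesis k1 : rint mu k = 1.
Local Notation K := (conv k).
Let s0' : 0 <= s. Proof. exact: ltW. Qed.
Let z2 : (0 : R) <= 2. Proof. by []. Qed.
Let km : kmass k = 1 := kmass1 k1.
Let Kpg G : pg G -> pg (K G) := @conv_pg' _ _ k s M s0 kk G.
Let W := conv (@k2 R d').

Lemma conv_dom F B : dom F B -> dom (K F) (B * expR N).
Proof.
move=> dF; have B0 := dom_ge0 dF; have [mF hF] := dF; split; first exact: pg_meas (Kpg (dom_pg dF)).
move=> x; apply: le_trans (conv_rho kk mF hF x) _.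
have e1 : expR (N * s) <= expR N by rewrite ler_expR ler_piMr.
by rewrite km mulr1; apply: ler_wpM2r; [exact: rho_ge0|exact: ler_wpM2l].
Qed.

Lemma W_dom F B : dom F B -> forall x, W (fun y => `|F y|) x <= B * expR (N * 2) * kmass (@k2 R d') * rho x.
Proof.
move=> dF x; have [mF hF] := dF.
have mn : measurable_fun setT (fun y => `|F y|) by exact: measurableT_comp.
have hn y : `| `|F y| | <= B * rho y by rewrite normr_id.
exact: le_trans (ler_norm _) (conv_rho (@kernel_k2 R d') mn hn x).
Qed.

Lemma exp_moll_lip F B : dom F B ->
  lip (fun x => expR (phi x) * K F x) /\ exists B', forall x, `|expR (phi x) * K F x| <= B'.
Proof.
move=> dF; have pF := dom_pg dF.
have [|h1 h2] := @exp_lip (K F) (B * expR N) (Lk * (B * expR (N * 2) * kmass (@k2 R d'))) (conv_dom dF).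
  move=> x y xy; apply: le_trans (moll_diff s1 kk kL pF xy) _.
  have Lk0 : 0 <= Lk.
    have := le_trans (normr_ge0 _) (kL (evec ord0) 0); rewrite pmulr_lge0// subr0 normr_gt0.
    by apply/eqP => /rowP/(_ ord0)/eqP; rewrite !mxE eqxx oner_eq0.
  apply: le_trans (ler_wpM2l (mulr_ge0 Lk0 (normr_ge0 (x - y))) (W_dom dF x)) _.
  by rewrite le_eqVlt; apply/orP; left; apply/eqP; ring.
by split => //; exists (B * expR N).
Qed.

Lemma conv2_fub F G B : dom F B -> pg G ->
  rint mu (fun x => F x * K (K G) x) = rint mu (fun x => K (K F) x * G x).
Proof.
move=> dF pG; have [mF hF] := dF.
have [_ ->] := conv_fub s0' kk mF hF (Kpg pG).
have [mF1 hF1] := conv_dom dF.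
by have [_ ->] := conv_fub s0' kk mF1 hF1 pG.
Qed.

Lemma conv2_commutator F b (Lb : R) x : pg F -> pg b ->
  (forall x y, `|b x - b y| <= Lb * `|x - y|) -> 0 <= Lb ->
  `|K (K (fun y => F y * b y)) x - b x * K (K F) x| <= 2 * Lb * s * K (K (fun y => `|F y|)) x.
Proof.
move=> pF pb bL Lb0.
have pFb := pgM pF pb; have pA := pg_norm pF.
have p1 : pg (fun y => b y * K F y) by apply: pgM => //; exact: Kpg.
have p2 : pg (fun y => K F y * b y) by apply: pgM => //; exact: Kpg.
have -> : K (K (fun y => F y * b y)) x - b x * K (K F) x =
   K (fun y => K (fun z => F z * b z) y - b y * K F y) x +
   (K (fun y => K F y * b y) x - b x * K (K F) x).
  rewrite (convB kk x (Kpg pFb) p1).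
  have -> : K (fun y => b y * K F y) x = K (fun y => K F y * b y) x.
    by congr (conv k _ x); apply/funext => y; rewrite mulrC.
  by ring.
have Ls0 : 0 <= Lb * s by rewrite mulr_ge0.
have c1 : K (fun y => Lb * s * K (fun z => `|F z|) y) x = Lb * s * K (K (fun y => `|F y|)) x.
  exact: (convZ kk _ x (Kpg pA)).
have -> : 2 * Lb * s * K (K (fun y => `|F y|)) x =
  Lb * s * K (K (fun y => `|F y|)) x + Lb * s * K (K (fun y => `|F y|)) x by ring.
apply: le_trans (ler_normD _ _) _; apply: lerD.
  have pD := pgB (Kpg pFb) p1.
  apply: le_trans (conv_norm kk x pD) _; rewrite -c1.
  apply: (conv_le kk (pg_norm pD) (pgZ _ (Kpg pA))) => y _.
  exact: (moll_commutator kk y pF pb bL Lb0).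
apply: le_trans (moll_commutator kk x (Kpg pF) pb bL Lb0) _.
rewrite ler_wpM2l//; apply: (conv_le kk (pg_norm (Kpg pF)) (Kpg pA)) => y _.
exact: (conv_norm kk y pF).
Qed.

Lemma E_moll2 F : pg F -> E (fun x => K (K F) x ^+ 2) <= (2 * expR N) ^+ 2 * E (fun x => F x ^+ 2).
Proof.
have one G : pg G -> E (fun x => K G x ^+ 2) <= 2 * expR N * E (fun x => G x ^+ 2).
  move=> pG; have pG2 := pgX 2 pG; have pK2 := Kpg pG2.
  apply: (@le_trans _ _ (E (fun x => 2 * K (fun y => G y ^+ 2) x))).
    apply: leE => [||x]; [exact: pgX (Kpg pG)|exact: pgZ|].
    by have := conv_sq kk x pG; rewrite km.
  rewrite EZ// -mulrA ler_wpM2l//.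
  apply: le_trans (E_conv s0' kk pG2 (fun x => sqr_ge0 _)) _.
  rewrite km mulr1 ler_wpM2r//; first by apply: E_ge0 => x; exact: sqr_ge0.
  by rewrite ler_expR ler_piMr.
move=> pF; apply: le_trans (one _ (Kpg pF)) _; rewrite expr2 -[leRHS]mulrA.
by rewrite ler_wpM2l ?one// mulr_ge0 ?expR_ge0.
Qed.

Lemma E_W F : pg F -> exists2 B, 0 <= B & forall G, pg G -> E (fun x => W G x ^+ 2) <= B * E (fun x => G x ^+ 2).
Proof.
move=> _; exists ((kmass (@k2 R d') + 1) * (expR (N * 2) * kmass (@k2 R d'))).
  by rewrite mulr_ge0 ?addr_ge0 ?mulr_ge0 ?expR_ge0 ?(kmass_ge0 (@kernel_k2 R d')).
have m0 := kmass_ge0 (@kernel_k2 R d').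
move=> G pG; have pG2 := pgX 2 pG.
have pW G' : pg G' -> pg (W G') by exact: (conv_pg phiL c0 phiC z2 (@kernel_k2 R d')).
apply: (@le_trans _ _ (E (fun x => (kmass (@k2 R d') + 1) * W (fun y => G y ^+ 2) x))).
  apply: leE => [||x]; [exact: pgX (pW _ pG)|apply: pgZ; exact: pW|].
  exact: (conv_sq (@kernel_k2 R d') x pG).
rewrite EZ; last exact: pW.
rewrite -mulrA ler_wpM2l ?addr_ge0//.
exact: (E_conv z2 (@kernel_k2 R d') pG2 (fun x => sqr_ge0 _)).
Qed.

Section one_test.
Variables (g : V -> R) (Bg : R).
Hypothesis lg : lip g.
Hypothesis hg : forall x, `|g x| <= Bg.

(** Convolution is self-adjoint for Lebesgue measure, not for the weight. This is the image of g
    under the weighted adjoint of the double mollification: the integral of g times [K (K F)] equals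
    that of [tw] times F. *)
Definition tw x : R := expR (phi x) * K (K (fun y => g y * rho y)) x.

Let dh : dom (fun y => g y * rho y) Bg. Proof. exact: bounded_dom (lip_measurable lg) hg. Qed.

Lemma tw_rho x : tw x * rho x = K (K (fun y => g y * rho y)) x.
Proof. by rewrite /tw mulrAC -expRD subrr expR0 mul1r. Qed.

(** The inner convolution bounds the derivative of the density by a multiple of the weight; the
    outer one makes that derivative regular enough for [exp_moll_lip] to strip off the weight. *)
Lemma tw_Sm1 : Sm 1 tw.
Proof.
set h := fun y => g y * rho y.
have ph := dom_pg dh; have dh1 := conv_dom dh; have ph1 := dom_pg dh1.
have lh : lip h.
  apply: (lipM lg rho_lip hg) => x; rewrite ger0_norm ?rho_ge0//; exact: rho_le.
have lh1 : lip (K h) := moll_lip kk k1 lh.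
have [lw [Bw hw]] := exp_moll_lip dh1; rewrite -/tw in lw hw.
have sh2 : Sm 1 (K (K h)) := moll_Sm s1 kk kL k1 (lh1 : Sm 0 (K h)).
have dpd w : dom (pd (K h) w) (Lk * `|w| * (Bg * expR (N * 2) * kmass (@k2 R d'))).
  split; first by apply: pd_measurable; exact: lip_measurable.
  move=> x; apply: le_trans (moll_pd_bound s1 kk kL k1 w x lh) _.
  rewrite -[leRHS]mulrA ler_wpM2l//; last exact: W_dom.
  have := le_trans (normr_ge0 _) (kL w 0); rewrite subr0; exact.
pose tp w x := pd phi w x * tw x + expR (phi x) * K (pd (K h) w) x.
have rtw x w : rd tw w x (tp w x).
  apply: dq_rd => //.
  have sh (n : nat) : tw (x + n.+1%:R^-1 *: w) = expR (phi (x + n.+1%:R^-1 *: w)) * K (K h) (x + n.+1%:R^-1 *: w) by [].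
  (* $e^{\phi}$ is the weight of -phi, so [rho_dq_cvg] also differentiates it. *)
  have philN : forall y z, `|- phi y - - phi z| <= N * `|y - z|.
    by move=> y z; rewrite -opprD normrN.
  have dphiN : diffd (fun y => - phi y).
    move=> y a; have := rdZ (-1) (dphi y a).
    rewrite (_ : (fun z => -1 * phi z) = (fun z => - phi z)); last by apply/funext => z; rewrite mulN1r.
    by move=> hr; rewrite (rd_pd hr).
  have e1 : pd (fun y => - phi y) w x = - pd phi w x.
    have := rdZ (-1) (dphi x w).
    rewrite (_ : (fun z => -1 * phi z) = (fun z => - phi z)); last by apply/funext => z; rewrite mulN1r.
    by move=> hr; rewrite (rd_pd hr) mulN1r.
  have q1 := @rho_dq_cvg R d' _ N N0 philN w dphiN x; rewrite e1 mulNr opprK in q1.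
  have ee y : weight_rho (fun z => - phi z) y = expR (phi y) by exact: (congr1 expR (opprK (phi y))).
  have q2 : dq (K (K h)) w n x @[n --> \oo] --> pd (K (K h)) w x := rd_dq (Sm_diff sh2 x w).
  have q3 : K (K h) (x + n.+1%:R^-1 *: w) @[n --> \oo] --> K (K h) x.
    have [L2 L20 hL2] := lip_ge0 (Sm_lip sh2).
    apply/subr_cvg0/norm_cvg0P; apply: (squeeze_cvgr (f := fun=> 0) (h := fun n => L2 * `|w| * n.+1%:R^-1)).
    - apply: nearW => n; rewrite normr_ge0/=; apply: le_trans (hL2 _ _) _.
      by rewrite addrAC subrr add0r normrZ ger0_norm// [_^-1 * _]mulrC mulrA.
    - exact: cvg_cst.
    - rewrite -[X in _ --> X](mulr0 (L2 * `|w|)); apply: cvgMr; exact: cvg_harmonic.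
  have e2 n : dq tw w n x = dq (weight_rho (fun z => - phi z)) w n x * K (K h) (x + n.+1%:R^-1 *: w)
      + expR (phi x) * dq (K (K h)) w n x.
    by rewrite /dq !ee /tw -/h; ring.
  rewrite (funext e2) /tp /tw -/h -(pd_moll kk k1 w lh1) mulrA -(ee x).
  by apply: cvgD; [apply: cvgM|apply: cvgMr].
have pdtw w : pd tw w = tp w by apply/funext => x; exact: rd_pd.
split => //; first by move=> x w; rewrite pdtw.
move=> w; rewrite pdtw; apply: lipD; last by have [] := exp_moll_lip (dpd w).
have [A hA] := pd_bdd w (Sm_lip sphi).
exact: (lipM (Sm_lip (Sm_pd w sphi)) lw hA hw).
Qed.

Definition tS : R := \sum_i E (fun x => pd tw (v i) x ^+ 2).
(** The direction in which the minimiser is varied; the two further convolutions put it in [Sm 3],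
    the class over which [near_minimiser] minimises. *)
Definition tv := K (K tw).

Lemma tv_Sm3 : Sm 3 tv.
Proof. by apply: (moll_Sm s1 kk kL k1); apply: (moll_Sm s1 kk kL k1); exact: tw_Sm1. Qed.

Let swi i : Sm 0 (pd tw (v i)) := Sm_pd (v i) tw_Sm1.

Lemma tv_pd i : pd tv (v i) = K (K (pd tw (v i))).
Proof.
have l := Sm_lip tw_Sm1.
by rewrite /tv (pd_moll kk k1)// ?(pd_moll kk k1)//; exact: (moll_lip kk k1).
Qed.

Lemma tv_pd2 i : pd (pd tv (v i)) (v i) = K (K (pd (pd tw (v i)) (v i))).
Proof.
rewrite tv_pd; have l : lip (pd tw (v i)) := swi i.
by rewrite (pd_moll kk k1)// ?(pd_moll kk k1)//; exact: (moll_lip kk k1).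
Qed.

Lemma E_gK F : pg F -> E (fun x => g x * K (K F) x) = rint mu (fun x => K (K (fun y => g y * rho y)) x * F x).
Proof.
move=> pF; rewrite -(conv2_fub dh pF) E_rint; apply: eq_rint => x; ring.
Qed.

(* Testing with [tv] reproduces the Dirichlet energy of [tw], up to the commutator of the
   mollification with the drift, which is of order [s]. *)
Lemma tS_le (La : R) : 0 < La -> (forall i x y, `|pd phi (v i) x - pd phi (v i) y| <= La * `|x - y|) ->
  2^-1 * tS <= - E (fun x => g x * L tv x) +
    d%:R * (2 * (2 * expR N) ^+ 2 * La ^+ 2) * s ^+ 2 * E (fun x => g x ^+ 2).
Proof.
move=> La0 hLa; set h := fun y => g y * rho y; set kap := (2 * expR N) ^+ 2.
have kap0 : 0 < kap by rewrite exprn_gt0// mulr_gt0// expR_gt0.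
have pgg := pg_lip lg; have ptw := pg_lip (Sm_lip tw_Sm1).
have pwi i : pg (pd tw (v i)) := pg_lip (swi i).
have pwii i : pg (pd (pd tw (v i)) (v i)) := pg_pd (v i) (swi i).
have pphi i : pg (pd phi (v i)) := pg_lip (Sm_lip (Sm_pd (v i) sphi)).
have ph := dom_pg dh; have K2pg F : pg F -> pg (K (K F)) by move=> pF; do 2 apply: Kpg.
pose T i := E (fun x => g x * pd phi (v i) x * K (K (pd tw (v i))) x).
have e1 : E (fun x => g x * L tv x) = \sum_i (E (fun x => g x * K (K (pd (pd tw (v i)) (v i))) x) - T i).
  rewrite (eqE _ (_ : _ =1 (fun x => \sum_i (g x * K (K (pd (pd tw (v i)) (v i))) x
     - g x * pd phi (v i) x * K (K (pd tw (v i))) x)))); last first.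
    by move=> x; rewrite /L mulr_sumr; apply: eq_bigr => i _; rewrite tv_pd2 tv_pd; ring.
  have pA i := pgM pgg (K2pg _ (pwii i)); have pB i := pgM (pgM pgg (pphi i)) (K2pg _ (pwi i)).
  rewrite Esum; last by move=> i; exact: (pgB (pA i) (pB i)).
  by apply: eq_bigr => i _; rewrite (EB (pA i) (pB i)).
have e2 i : E (fun x => g x * K (K (pd (pd tw (v i)) (v i))) x) =
    E (fun x => tw x * pd tw (v i) x * pd phi (v i) x) - E (fun x => pd tw (v i) x ^+ 2).
  rewrite E_gK// (_ : rint mu _ = E (fun x => tw x * pd (pd tw (v i)) (v i) x)); last first.
    by rewrite E_rint; apply: eq_rint => x; rewrite -tw_rho; ring.
  have := ibp N0 phiL c0 phiC (v i) dphi (Sm_lip tw_Sm1) (swi i).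
  rewrite ED; [|exact: pgM|exact: pgM].
  rewrite (eqE _ (_ : (fun x => pd tw (v i) x ^+ 2) =1 (fun x => pd tw (v i) x * pd tw (v i) x))) => [|x]; last by rewrite expr2.
  by move=> <-; rewrite addrK.
have e3 i : `|T i - E (fun x => tw x * pd tw (v i) x * pd phi (v i) x)| <=
    2^-1 * E (fun x => pd tw (v i) x ^+ 2) + 2 * kap * La ^+ 2 * s ^+ 2 * E (fun x => g x ^+ 2).
  have [A hA] := pd_bdd (v i) (Sm_lip sphi).
  have dhp : dom (fun y => h y * pd phi (v i) y) (Bg * A).
    have [mh hh] := dh; split; first by apply: measurable_funM => //; exact: pg_meas.
    move=> x; rewrite normrM mulrAC; apply: ler_pM => //; exact: hh.
  have eT : T i = rint mu (fun x => K (K (fun y => h y * pd phi (v i) y)) x * pd tw (v i) x).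
    rewrite -(conv2_fub dhp (pwi i)) /T E_rint; apply: eq_rint => x; rewrite /h; ring.
  have eU : E (fun x => tw x * pd tw (v i) x * pd phi (v i) x) =
      rint mu (fun x => pd phi (v i) x * K (K h) x * pd tw (v i) x).
    rewrite E_rint; apply: eq_rint => x; rewrite -tw_rho; ring.
  have dKh := conv_dom (conv_dom dh).
  have i1 := dom_intg (conv_dom (conv_dom dhp)) (pwi i).
  have i2 : intg mu (fun x => pd phi (v i) x * K (K h) x * pd tw (v i) x).
    have := dom_intg dKh (pgM (pphi i) (pwi i)).
    by rewrite (_ : (fun x => _) = (fun x => pd phi (v i) x * K (K h) x * pd tw (v i) x))//; apply/funext => x; rewrite /h; ring.
  have dnh : dom (fun y => `|g y| * rho y) Bg.
    by apply: bounded_dom; [exact: measurableT_comp (lip_measurable lg)|move=> x; rewrite normr_id].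
  have nh : (fun y => `|h y|) = (fun y => `|g y| * rho y).
    by apply/funext => y; rewrite /h normrM (ger0_norm (rho_ge0 _ y)).
  have pnw := pg_norm (pwi i).
  have i3 := dom_intg (conv_dom (conv_dom dnh)) pnw.
  rewrite eT eU -rintB//.
  apply: (@le_trans _ _ (2 * La * s * rint mu (fun x => K (K (fun y => `|g y| * rho y)) x * `|pd tw (v i) x|))).
    rewrite -rintZ//; apply: rint_le_norm; [exact: intgB|exact: intgZ|move=> x].
    rewrite -mulrBl normrM mulrA ler_wpM2r//.
    have := conv2_commutator x ph (pphi i) (hLa i) (ltW La0); rewrite -/h nh; exact.
  have -> : rint mu (fun x => K (K (fun y => `|g y| * rho y)) x * `|pd tw (v i) x|) =
      E (fun x => `|g x| * K (K (fun y => `|pd tw (v i) y|)) x).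
    rewrite -(conv2_fub dnh pnw) E_rint; apply: eq_rint => x; ring.
  set X := K (K _); have pX : pg X by exact: K2pg.
  have png := pg_norm pgg.
  rewrite -EZ; last exact: pgM.
  (* Young's inequality with weight 1/(2 kap): by [E_moll2] the double mollification costs at most
     kap, so exactly half of the energy has to be absorbed. *)
  apply: (@le_trans _ _ (E (fun x => (2 * kap)^-1 * X x ^+ 2 + 2 * kap * La ^+ 2 * s ^+ 2 * g x ^+ 2))).
    apply: leE => [||x]; [by apply: pgZ; exact: pgM|by apply: pgD; apply: pgZ; exact: pgX|].
    rewrite -[g x ^+ 2]real_normK ?num_real//; set a := `|g x|; set b := X x.
    rewrite -subr_ge0; have -> : (2 * kap)^-1 * b ^+ 2 + 2 * kap * La ^+ 2 * s ^+ 2 * a ^+ 2 - 2 * La * s * (a * b)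
      = (2 * kap)^-1 * (b - 2 * kap * La * s * a) ^+ 2 by field; rewrite gt_eqF.
    by rewrite mulr_ge0 ?sqr_ge0// invr_ge0 mulr_ge0// ltW.
  rewrite ED; [|by apply: pgZ; exact: pgX|by apply: pgZ; exact: pgX].
  rewrite EZ; last exact: pgX.
  rewrite EZ; last exact: pgX.
  rewrite lerD2r invfM -mulrA ler_wpM2l ?invr_ge0// ler_pdivrMl//.
  have := E_moll2 pnw; rewrite -/kap -/X.
  rewrite (eqE _ (_ : (fun x => `|pd tw (v i) x| ^+ 2) =1 (fun x => pd tw (v i) x ^+ 2)))//.
  by move=> x; rewrite real_normK ?num_real.
have -> : d%:R * (2 * kap * La ^+ 2) * s ^+ 2 * E (fun x => g x ^+ 2) =
   \sum_(i < d) (2 * kap * La ^+ 2 * s ^+ 2 * E (fun x => g x ^+ 2)).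
  by rewrite sumr_const card_ord -mulr_natl; ring.
rewrite e1 -sumrN -big_split/= /tS mulr_sumr; apply: ler_sum => i _.
rewrite e2; have := e3 i; rewrite ler_norml => /andP[h1 h2].
move: h1 h2; set a := E _; set b := E (fun x => tw x * _ * _); set t := T i; set q := _ * E (fun x => g x ^+ 2).
lra.
Qed.

End one_test.

Lemma E_moll1 G : pg G -> E (fun x => K G x ^+ 2) <= 2 * expR N * E (fun x => G x ^+ 2).
Proof.
move=> pG; have pG2 := pgX 2 pG; have pK2 := Kpg pG2.
apply: (@le_trans _ _ (E (fun x => 2 * K (fun y => G y ^+ 2) x))).
  apply: leE => [||x]; [exact: pgX (Kpg pG)|exact: pgZ|].
  by have := conv_sq kk x pG; rewrite km.
rewrite EZ// -mulrA ler_wpM2l//.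
apply: le_trans (E_conv s0' kk pG2 (fun x => sqr_ge0 _)) _.
rewrite km mulr1 ler_wpM2r//; first by apply: E_ge0 => x; exact: sqr_ge0.
by rewrite ler_expR ler_piMr.
Qed.

Lemma sqr_sum_le (c' : 'I_d -> R) : (\sum_i c' i) ^+ 2 <= d%:R * \sum_i c' i ^+ 2.
Proof.
rewrite expr2 mulr_suml; apply: (@le_trans _ _ (\sum_i \sum_j (2^-1 * c' i ^+ 2 + 2^-1 * c' j ^+ 2))).
  apply: ler_sum => i _; rewrite mulr_sumr; apply: ler_sum => j _.
  rewrite -subr_ge0; have -> : 2^-1 * c' i ^+ 2 + 2^-1 * c' j ^+ 2 - c' i * c' j = 2^-1 * (c' i - c' j) ^+ 2 by field.
  by rewrite mulr_ge0 ?sqr_ge0.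
set T := \sum_i c' i ^+ 2.
have e i : \sum_j (2^-1 * c' i ^+ 2 + 2^-1 * c' j ^+ 2) = d%:R * (2^-1 * c' i ^+ 2) + 2^-1 * T.
  by rewrite big_split/= sumr_const card_ord -mulr_sumr mulr_natl.
rewrite (eq_bigr _ (fun i _ => e i)) big_split/= -!mulr_sumr sumr_const card_ord -mulr_natl -/T.
by rewrite le_eqVlt; apply/orP; left; apply/eqP; field.
Qed.

(** One of the two derivatives of [tv] falls on the kernel. The constant therefore depends on the
    scale s, which is harmless because [density] fixes its tolerance e after s. *)
Lemma tv_L2 : exists2 B, 0 <= B & forall g Bg, lip g -> (forall x, `|g x| <= Bg) ->
  E (fun x => L (tv g) x ^+ 2) <= B * tS g.
Proof.
have [BW BW0 hBW] := E_W (pg_cst 0).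
have Lk0 : 0 <= Lk.
  have := le_trans (normr_ge0 _) (kL (evec ord0) 0); rewrite pmulr_lge0// subr0 normr_gt0.
  by apply/eqP => /rowP/(_ ord0)/eqP; rewrite !mxE eqxx oner_eq0.
have [A hA] := choice (fun i => pd_bdd (v i) (Sm_lip sphi)).
pose Q i := 2 * ((Lk * `|v i|) ^+ 2 * (BW * (2 * expR N)) + A i ^+ 2 * (2 * expR N) ^+ 2).
have eN : 0 <= 2 * expR N by rewrite mulr_ge0 ?expR_ge0.
have Q0 i : 0 <= Q i.
  by rewrite mulr_ge0// addr_ge0// mulr_ge0 ?sqr_ge0// mulr_ge0.
exists (d%:R * \sum_i Q i); first by rewrite mulr_ge0// sumr_ge0.
move=> g Bg lg hg.
have sw := tw_Sm1 lg hg; have sv := tv_Sm3 lg hg.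
have swi i : lip (pd (tw g) (v i)) := Sm_pd (v i) sw.
have pwi i := pg_lip (swi i).
have lK i : lip (K (pd (tw g) (v i))) := moll_lip kk k1 (swi i).
have pphi i : pg (pd phi (v i)) := pg_lip (Sm_lip (Sm_pd (v i) sphi)).
pose a i x := pd (pd (tv g) (v i)) (v i) x.
pose b i x := pd phi (v i) x * pd (tv g) (v i) x.
have sv1 i : Sm 2 (pd (tv g) (v i)) := Sm_pd (v i) sv.
have pa i : pg (a i) := pg_pd (v i) (Sm_lip (sv1 i)).
have pb i : pg (b i) := pgM (pphi i) (pg_lip (Sm_lip (sv1 i))).
have hab i : E (fun x => (a i x - b i x) ^+ 2) <= Q i * E (fun x => pd (tw g) (v i) x ^+ 2).
  apply: (@le_trans _ _ (E (fun x => 2 * (a i x ^+ 2 + b i x ^+ 2)))).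
    apply: leE => [||x]; [exact: pgX (pgB (pa i) (pb i))|exact: pgZ (pgD (pgX 2 (pa i)) (pgX 2 (pb i)))|].
    have := sqr_ge0 (a i x + b i x); nra.
  rewrite EZ; last exact: pgD (pgX 2 (pa i)) (pgX 2 (pb i)).
  rewrite ED; [|exact: pgX|exact: pgX].
  rewrite /Q -mulrA ler_wpM2l// mulrDl; apply: lerD.
    have pW G' : pg G' -> pg (W G') by exact: (conv_pg phiL c0 phiC z2 (@kernel_k2 R d')).
    have pn := pg_norm (pg_lip (lK i)).
    apply: (@le_trans _ _ (E (fun x => (Lk * `|v i|) ^+ 2 * W (fun y => `|K (pd (tw g) (v i)) y|) x ^+ 2))).
      apply: leE => [||x]; [exact: pgX|exact: pgZ (pgX 2 (pW _ pn))|].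
      rewrite -exprMn -[a i x ^+ 2]real_normK ?num_real//.
      apply: lerXn2r; rewrite ?nnegrE ?mulr_ge0//; first by apply: (conv_ge0 (@kernel_k2 R d')).
      rewrite /a (tv_pd lg hg); exact: (moll_pd_bound s1 kk kL k1 (v i) x (lK i)).
    rewrite EZ; last exact: pgX (pW _ pn).
    rewrite -[leRHS]mulrA ler_wpM2l ?sqr_ge0//.
    apply: le_trans (hBW _ pn) _; rewrite -mulrA ler_wpM2l//.
    rewrite (eqE _ (_ : _ =1 (fun x => K (pd (tw g) (v i)) x ^+ 2))); last first.
      by move=> x; rewrite real_normK ?num_real.
    exact: E_moll1.
  apply: (@le_trans _ _ (E (fun x => A i ^+ 2 * K (K (pd (tw g) (v i))) x ^+ 2))).
    apply: leE => [||x]; [exact: pgX|by apply: pgZ; apply: pgX; do 2 apply: Kpg|].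
    rewrite /b (tv_pd lg hg) exprMn ler_wpM2r ?sqr_ge0// -[pd _ _ _ ^+ 2]real_normK ?num_real//.
    by apply: lerXn2r; rewrite ?nnegrE//; exact: le_trans (normr_ge0 _) (hA i x).
  rewrite EZ; last by apply: pgX; do 2 apply: Kpg.
  by rewrite -[leRHS]mulrA ler_wpM2l ?sqr_ge0// E_moll2.
apply: (@le_trans _ _ (E (fun x => d%:R * \sum_i (a i x - b i x) ^+ 2))).
  have pab i : pg (fun x => (a i x - b i x) ^+ 2) := pgX 2 (pgB (pa i) (pb i)).
  apply: leE => [||x]; [exact: pgX (L_pg sphi v (Sm_leS sv))|exact: pgZ (pg_sum _ pab)|exact: sqr_sum_le].
have pab i : pg (fun x => (a i x - b i x) ^+ 2) := pgX 2 (pgB (pa i) (pb i)).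
rewrite EZ; last exact: pg_sum.
rewrite Esum// -mulrA ler_wpM2l// /tS mulr_sumr; apply: ler_sum => i _.
apply: le_trans (hab i) _; rewrite ler_wpM2r//; first by apply: E_ge0 => x; exact: sqr_ge0.
by rewrite (bigD1 i)//= lerDl sumr_ge0.
Qed.

End test_function.

Lemma quadratic_disc (a b q : R) : 0 <= a -> 0 <= q -> (forall t, 2 * t * b <= a + t ^+ 2 * q) -> b ^+ 2 <= a * q.
Proof.
move=> a0 q0 h; have [q1|q1] := eqVneq q 0.
  have [->|b0] := eqVneq b 0; first by rewrite expr0n/= mulr_ge0.
  have := h ((a + 1) / (2 * b)); rewrite q1 mulr0 addr0.
  have -> : 2 * ((a + 1) / (2 * b)) * b = a + 1 by field.
  by rewrite gerDl ler10.
have q2 : 0 < q by rewrite lt0r q1.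
have := h (b / q).
have -> : 2 * (b / q) * b = 2 * (b ^+ 2 / q) by field.
have -> : (b / q) ^+ 2 * q = b ^+ 2 / q by field.
by move=> h'; rewrite -ler_pdivrMr//; lra.
Qed.

Lemma le_of_sqr (a b : R) : 0 <= b -> a ^+ 2 <= b ^+ 2 -> a <= b.
Proof. by move=> b0 h; rewrite leNgt; apply/negP => ab; nra. Qed.

(** The infimum need not be attained. A minimiser up to $e^2$, perturbed by t w for all real t,
    gives a quadratic inequality whose discriminant makes the residual orthogonal to L w up to e. *)
Lemma near_minimiser f (e : R) : lip f -> 0 < e -> exists u, [/\ Sm 3 u,
  E (fun x => (f x - L u x) ^+ 2) <= E (fun x => f x ^+ 2) + e ^+ 2 &
  forall w, Sm 3 w -> E (fun x => (f x - L u x) * L w x) ^+ 2 <= e ^+ 2 * E (fun x => L w x ^+ 2)].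
Proof.
move=> lf e0; have pf := pg_lip lf.
have pL w : Sm 3 w -> pg (L w) by move=> sw; exact: (L_pg sphi v (Sm_leS sw)).
pose A := [set E (fun x => (f x - L u x) ^+ 2) | u in [set u | Sm 3 u]].
have L0 : L (fun=> 0) = fun=> 0.
  apply/funext => x; rewrite /L big1// => i _.
  have z w : pd (fun _ : V => (0 : R)) w = fun=> 0 by apply/funext => y; exact: rd_pd (rd_cst _ _ _).
  by rewrite !z mulr0 subr0.
have A0 : A (E (fun x => f x ^+ 2)).
  exists (fun=> 0); first exact: Sm_cst.
  by rewrite L0; apply: eqE => x; rewrite subr0.
have lA : has_lbound A by exists 0 => _ [u _ <-]; apply: E_ge0 => x; exact: sqr_ge0.
have iA : has_inf A by split => //; exists (E (fun x => f x ^+ 2)).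
have e2 : 0 < e ^+ 2 by rewrite exprn_gt0.
have [_ [u su <-] hu] := inf_adherent e2 iA.
exists u; split => //.
  by apply: le_trans (ltW hu) _; rewrite lerD2r; exact: ge_inf.
move=> w sw; have pg0 := pgB pf (pL u su); have pw := pL w sw.
apply: quadratic_disc; [exact: ltW|by apply: E_ge0 => x; exact: sqr_ge0|move=> t].
have : inf A <= E (fun x => (f x - L (fun y => u y + t * w y) x) ^+ 2).
  apply: ge_inf => //; exists (fun y => u y + t * w y) => //.
  by apply: SmD => //; exact: SmZ.
have -> : E (fun x => (f x - L (fun y => u y + t * w y) x) ^+ 2) =
  E (fun x => (f x - L u x) ^+ 2) - 2 * t * E (fun x => (f x - L u x) * L w x) + t ^+ 2 * E (fun x => L w x ^+ 2).
  rewrite -EZ; last exact: pgM.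
  rewrite -EZ; last exact: pgX.
  rewrite -EB; [|exact: pgX|by apply: pgZ; exact: pgM].
  rewrite -ED; [|by apply: pgB; [exact: pgX|apply: pgZ; exact: pgM]|by apply: pgZ; exact: pgX].
  by apply: eqE => x; rewrite (LD _ _ _ _ (Sm_leS (su : Sm 3 u)) (Sm_leS sw)); ring.
move: hu; lra.
Qed.

(** Let g = f - L u be the residual of a near minimiser. Testing with [tv] bounds the Dirichlet
    energy of w = [tw], and the Poincare hypothesis makes w small in $L^1$. As f is bounded and
    close to its double mollification, E (g f) is close to E (w f) and hence small; near
    orthogonality makes E (g L u) small. The difference of the two is E g^2. *)
Lemma density f (Mf CP : R) : lip f -> (forall x, `|f x| <= Mf) -> E f = 0 -> 0 <= CP ->
  (forall w, Sm 1 w -> E w = 0 -> E (fun x => `|w x|) ^+ 2 <= CP * \sum_i E (fun x => pd w (v i) x ^+ 2)) ->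
  forall eta, 0 < eta -> exists2 u, Sm 3 u & E (fun x => (f x - L u x) ^+ 2) <= eta.
Proof.
move=> lf hf Ef CP0 poinc eta eta0.
have [Lf Lf0 fL] := lip_ge0 lf; have pf := pg_lip lf.
have Mf0 : 0 <= Mf := le_trans (normr_ge0 _) (hf 0).
have [La La0 hLa] : exists2 La : R, 0 < La & forall i x y, `|pd phi (v i) x - pd phi (v i) y| <= La * `|x - y|.
  have [l hl] := choice (fun i => (fun h : lip (pd phi (v i)) => h) (Sm_lip (Sm_pd (v i) sphi))).
  exists (1 + \sum_i `|l i|); first by rewrite ltr_wpDr// sumr_ge0.
  move=> i x y; apply: le_trans (hl i x y) _; rewrite ler_wpM2r//.
  apply: le_trans (ler_norm _) _; rewrite (bigD1 i)//= addrCA lerDl addr_ge0// sumr_ge0//.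
pose D := E (fun x => f x ^+ 2) + 1.
have Ef2 : 0 <= E (fun x => f x ^+ 2) by apply: E_ge0 => x; exact: sqr_ge0.
have D1 : 1 <= D by rewrite lerDr.
pose Z := E (fun=> 1); have Z0 : 0 <= Z by exact: E_ge0.
pose D2 := d%:R * (2 * (2 * expR N) ^+ 2 * La ^+ 2).
have D20 : 0 <= D2 by rewrite mulr_ge0// mulr_ge0 ?sqr_ge0// mulr_ge0// sqr_ge0.
pose q := Num.sqrt (4 * CP); have q0 : 0 <= q := sqrtr_ge0 _.
have qq : q ^+ 2 = 4 * CP by rewrite sqr_sqrtr// mulr_ge0.
pose p := Num.sqrt (D2 * D); have p0 : 0 <= p := sqrtr_ge0 _.
have pp : p ^+ 2 = D2 * D by rewrite sqr_sqrtr// mulr_ge0//; lra.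
pose A := 2 * Lf * (Z + D) + Mf * (q * p).
have A0 : 0 <= A by rewrite addr_ge0// ?mulr_ge0//; lra.
pose s := Num.min 1 (eta / (2 * (A + 1))).
have s0 : 0 < s by rewrite lt_min ltr01/= divr_gt0// mulr_gt0//; lra.
have s1 : s <= 1 by rewrite ge_min lexx.
have sA : A * s <= eta / 2.
  have A1 : 0 < A + 1 by lra.
  apply: (@le_trans _ _ ((A + 1) * s)); first by rewrite ler_pM2r//; lra.
  apply: (@le_trans _ _ ((A + 1) * (eta / (2 * (A + 1))))); first by rewrite ler_pM2l// ge_min lexx orbT.
  by rewrite le_eqVlt; apply/orP; left; apply/eqP; field; rewrite gt_eqF.
have [k [M [Lk [kk kL k1]]]] := mollifier_exists lamT s0.
have [B B0 hB] := tv_L2 s0 s1 kk kL k1.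
pose b := Num.sqrt B; have b0 : 0 <= b := sqrtr_ge0 _.
have bb : b ^+ 2 = B by rewrite sqr_sqrtr.
pose Bs := Mf * (q * b) + 2 * D.
have Bs0 : 0 <= Bs by rewrite addr_ge0// ?mulr_ge0//; lra.
(* Chosen after s, because b is a constant of the kernel of scale s. *)
pose e := Num.min 1 (eta / (2 * (Bs + 1))).
have e0 : 0 < e by rewrite lt_min ltr01/= divr_gt0// mulr_gt0//; lra.
have e1 : e <= 1 by rewrite ge_min lexx.
have eB : Bs * e <= eta / 2.
  have B1 : 0 < Bs + 1 by lra.
  apply: (@le_trans _ _ ((Bs + 1) * e)); first by rewrite ler_pM2r//; lra.
  apply: (@le_trans _ _ ((Bs + 1) * (eta / (2 * (Bs + 1))))); first by rewrite ler_pM2l// ge_min lexx orbT.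
  by rewrite le_eqVlt; apply/orP; left; apply/eqP; field; rewrite gt_eqF.
have [u [su hu1 hu2]] := near_minimiser lf e0.
exists u => //; pose g x := f x - L u x.
have lLu := L_lip sphi v su; have pLu := pg_lip lLu.
have lg : lip g by exact: lipB.
have pgg := pg_lip lg.
have [BL hBL] := L_bdd sphi v (Sm_leS su).
have hg x : `|g x| <= Mf + BL by apply: le_trans (ler_normB _ _) _; exact: lerD.
pose X := E (fun x => g x ^+ 2).
have X0 : 0 <= X by apply: E_ge0 => x; exact: sqr_ge0.
have XD : X <= D by apply: le_trans hu1 _; rewrite lerD2l expr_le1// ltW.
have sv := tv_Sm3 s0 s1 kk kL k1 lg hg.
set w := tw k g; have sw : Sm 1 w := tw_Sm1 s0 s1 kk kL k1 lg hg.
set S := tS k g; have S0 : 0 <= S by rewrite sumr_ge0// => i _; apply: E_ge0 => x; exact: sqr_ge0.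
have h1 : 2^-1 * S <= - E (fun x => g x * L (tv k g) x) + D2 * s ^+ 2 * X :=
  tS_le s0 s1 kk kL k1 lg hg La0 hLa.
have h2 : - E (fun x => g x * L (tv k g) x) <= 4^-1 * S + e ^+ 2 * B.
  have eB0 : 0 <= e ^+ 2 * B by rewrite mulr_ge0// sqr_ge0.
  apply: le_of_sqr; first by rewrite addr_ge0// mulr_ge0.
  rewrite sqrrN; apply: le_trans (hu2 _ sv) _.
  apply: (@le_trans _ _ (e ^+ 2 * (B * S))); first by rewrite ler_wpM2l ?sqr_ge0//; exact: hB lg hg.
  have := sqr_ge0 (4^-1 * S - e ^+ 2 * B); nra.
have h3 : S <= 4 * (e ^+ 2 * B) + 4 * (D2 * D * s ^+ 2).
  have : D2 * s ^+ 2 * X <= D2 * s ^+ 2 * D by rewrite ler_wpM2l// mulr_ge0// sqr_ge0.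
  lra.
have pw := pg_lip (Sm_lip sw).
have K1 F : pg F -> pg (conv k F) := @conv_pg' _ _ k s M s0 kk F.
have EgK F : pg F -> E (fun x => g x * conv k (conv k F) x) = E (fun x => w x * F x).
  move=> pF; rewrite (E_gK s0 s1 kk k1 lg hg pF) E_rint; apply: eq_rint => x.
  by rewrite -(tw_rho k g x) -/w; ring.
(* Double mollification fixes constants, so w has the same mean as g, and L u has mean zero. *)
have Ew : E w = 0.
  rewrite (eqE _ (_ : w =1 (fun x => w x * 1))) => [|x]; last by rewrite mulr1.
  rewrite -EgK; last exact: pg_cst.
  rewrite (eqE _ (_ : _ =1 (fun x => f x - L u x))) => [|x]; last first.
    rewrite (_ : conv k (fun=> 1) = fun=> 1) ?(moll_const kk k1) ?mulr1//.
    by apply/funext => y; rewrite (moll_const kk k1).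
  by rewrite EB// Ef (E_L0 N0 phiL c0 phiC sphi v (Sm_leS su)) subrr.
have h4 : E (fun x => `|w x|) <= q * (b * e + p * s).
  have bp0 : 0 <= b * e + p * s by rewrite addr_ge0// mulr_ge0// ltW.
  apply: le_of_sqr; first by rewrite mulr_ge0.
  apply: le_trans (poinc w sw Ew) _; rewrite -/S exprMn qq.
  apply: (@le_trans _ _ (CP * (4 * (e ^+ 2 * B) + 4 * (D2 * D * s ^+ 2)))); first by rewrite ler_wpM2l.
  rewrite -bb -pp [4 * CP]mulrC -[leRHS]mulrA ler_wpM2l//.
  have : 0 <= (b * e) * (p * s) by rewrite mulr_ge0// mulr_ge0// ltW.
  nra.
have h5 : - E (fun x => g x * L u x) <= e * (2 * D).
  have eD : 0 <= e * (2 * D) by rewrite mulr_ge0 ?(ltW e0)//; lra.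
  apply: le_of_sqr => //; rewrite sqrrN; apply: le_trans (hu2 _ su) _.
  rewrite [leRHS]exprMn ler_wpM2l ?sqr_ge0//.
  apply: (@le_trans _ _ (E (fun x => 2 * (f x ^+ 2 + g x ^+ 2)))).
    apply: leE => [||x]; [exact: pgX|by apply: pgZ; apply: pgD; exact: pgX|].
    have -> : L u x = f x - g x by rewrite /g; ring.
    have := sqr_ge0 (f x + g x); nra.
  rewrite EZ; last by apply: pgD; exact: pgX.
  rewrite ED; [|exact: pgX|exact: pgX].
  move: XD D1; rewrite -/X /D; nra.
have h6 : E (fun x => `|g x|) <= Z + D.
  apply: le_of_sqr; first by lra.
  apply: le_trans (E_CS1 phiL c0 phiC pgg) _; rewrite -/Z -/X; nra.
have near2 x : `|f x - conv k (conv k f) x| <= 2 * Lf * s.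
  have := moll_near kk k1 x fL Lf0; have := moll_near kk k1 x (moll_lipL kk k1 fL) Lf0.
  have := ler_normD (conv k (conv k f) x - conv k f x) (conv k f x - f x).
  rewrite addrA subrK [`|f x - _|]distrC; lra.
have pKf : pg (conv k (conv k f)) by exact: (K1 _ (K1 _ pf)).
(* Replacing f by its double mollification costs a multiple of s; the adjoint then moves the
   mollification onto g, which turns it into w. *)
have h7 : E (fun x => g x * f x) <= 2 * Lf * s * (Z + D) + Mf * (q * (b * e + p * s)).
  rewrite (eqE _ (_ : _ =1 (fun x => g x * (f x - conv k (conv k f) x) + g x * conv k (conv k f) x))) => [|x]; last by ring.
  rewrite ED; [|apply: pgM => //; exact: pgB|exact: pgM].
  apply: lerD.
    apply: (@le_trans _ _ (E (fun x => 2 * Lf * s * `|g x|))).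
      apply: leE => [||x]; [apply: pgM => //; exact: pgB|by apply: pgZ; exact: pg_norm|].
      by apply: le_trans (ler_norm _) _; rewrite normrM mulrC ler_wpM2r.
    rewrite EZ; last exact: pg_norm.
    by rewrite ler_wpM2l// mulr_ge0 ?mulr_ge0// ltW.
  rewrite EgK//; apply: (@le_trans _ _ (E (fun x => Mf * `|w x|))).
    apply: leE => [||x]; [exact: pgM|by apply: pgZ; exact: pg_norm|].
    by apply: le_trans (ler_norm _) _; rewrite normrM mulrC ler_wpM2r.
  rewrite EZ; last exact: pg_norm.
  by rewrite ler_wpM2l.
have h8 : X = E (fun x => g x * f x) - E (fun x => g x * L u x).
  rewrite -EB; [|exact: pgM|exact: pgM].
  by apply: eqE => x; rewrite /g; ring.
rewrite -/g -/X; apply: (@le_trans _ _ (A * s + Bs * e)); last by lra.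
rewrite h8; apply: le_trans (lerD h7 h5) _.
by rewrite /A /Bs le_eqVlt; apply/orP; left; apply/eqP; ring.
Qed.

End density.

(** * The L^1 Poincare inequality *)

Section poincare.
Context {R : realType} {d' : nat}.
Local Notation d := d'.+1.
Local Notation V := 'rV[R]_d.
Local Notation mu := (@lam R d').
Implicit Types (f g u F G w : V -> R) (x y h : V).
Hypothesis lamT : (0 < lam [set: V])%E.

Lemma lip_affine F (a : R) y : lip F -> lip (fun x => F (a *: x + y)).
Proof.
move=> /lip_ge0[L L0 hL]; exists (L * `|a|) => x z; apply: le_trans (hL _ _) _.
by rewrite opprD addrACA subrr addr0 -scalerBr normrZ mulrA.
Qed.

Variables (T Ti : 'M[R]_d).
Hypothesis TiT : Ti *m T = 1%:M.
Definition frame (i : 'I_d) : V := row i T.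
(** The sup norm of the coordinates of x in the frame of the rows of T, as Ti is the inverse of
    T. *)
Definition gauge x : R := `|x *m Ti|.

Lemma gaugeD x y : gauge (x + y) <= gauge x + gauge y.
Proof. by rewrite /gauge mulmxDl; exact: ler_normD. Qed.

Lemma gaugeZ (a : R) x : gauge (a *: x) = `|a| * gauge x.
Proof. by rewrite /gauge -scalemxAl normrZ. Qed.

Lemma gaugeN x : gauge (- x) = gauge x.
Proof. by rewrite -scaleN1r gaugeZ normrN1 mul1r. Qed.

Lemma gauge_ge0 x : 0 <= gauge x. Proof. exact: normr_ge0. Qed.

Lemma frame_coord x : x = \sum_i (x *m Ti) 0 i *: frame i.
Proof. by rewrite -mulmx_sum_row -mulmxA TiT mulmx1. Qed.

Lemma gauge_lip : lip gauge.
Proof.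
exists (\sum_i \sum_j `|Ti i j|) => x y; apply: le_trans (ler_dist_dist _ _) _.
rewrite -mulmxBl; apply: norm_rv_le => [|j].
  by rewrite mulr_ge0// sumr_ge0// => i _; rewrite sumr_ge0.
rewrite mxE; apply: le_trans (ler_norm_sum _ _ _) _; rewrite mulr_suml; apply: ler_sum => i _.
rewrite normrM mulrC; apply: ler_pM => //; last exact: coord_le_norm.
by rewrite (bigD1 j)//= lerDl sumr_ge0.
Qed.

Variables (l : R) (xs : V).
Hypothesis hl : lam [set x | gauge x <= 1] = l%:E.
Let n_ x := gauge (x - xs).

Let lip_n : lip n_.
Proof. by have := lip_shift (- xs) gauge_lip. Qed.

Lemma gauge_tri x y : gauge (y - x) <= n_ y + n_ x.
Proof.
rewrite /n_ -(gaugeN (x - xs)); apply: le_trans _ (gaugeD _ _).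
by rewrite opprB addrA subrK.
Qed.

(** The origin of 24: phi grows at rate 1/6 in the gauge, half of the weight keeps 1/12, and half of
    that absorbs the factor 1 + [n_]. The decay left is [n_]/24, and the set where the gauge is at
    most 24 has volume $24^d l$. *)
Definition gauge_const : R := 2 ^+ d.+1 * d.+1%:R ^+ d * 24 ^+ d.

Lemma gauge_exp : intg mu (fun x => expR (- (n_ x / 24))) /\
  rint mu (fun x => expR (- (n_ x / 24))) <= gauge_const * l.
Proof.
have h24 : (0 : R) < 24 by [].
have e24 : lam [set x | gauge x / 24 <= 1] = (24 ^+ d * l)%:E.
  rewrite EFinM -hl; apply: etrans (esym (leb_outer_scale [set x | gauge x / 24 <= 1] h24)) _.
  congr (_ * leb_outer _)%E; apply/seteqP; split => x /=; rewrite gaugeZ ger0_norm// mulrAC divff// mul1r//.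
have [||s x s0|i1 i2] := @exp_gauge_intg R d' (fun x => gauge x / 24) _ _ _ _ e24.
- by apply: measurable_funM => //; exact: lip_measurable gauge_lip.
- by move=> x; rewrite divr_ge0// gauge_ge0.
- by rewrite gaugeZ gtr0_norm// mulrA.
split; first exact: (intg_shift (- xs) i1).
by rewrite (rint_shift (- xs) i1); apply: le_trans i2 _; rewrite /gauge_const le_eqVlt; apply/orP; left; apply/eqP; ring.
Qed.

Lemma gauge_beats x : 1 + n_ x <= 25 * expR (n_ x / 24).
Proof.
have h24 : (0 : R) < 24^-1 by rewrite invr_gt0.
have := exp_beats h24 (gauge_ge0 (x - xs)); rewrite -/(n_ x).
by rewrite invrK [_^-1 * _]mulrC (_ : 1 + 24 = 25)//; ring.
Qed.

Variable phi : V -> R.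
Variables N c C : R.
Hypothesis N0 : 0 <= N.
Hypothesis phiL : forall x y, `|phi x - phi y| <= N * `|x - y|.
Hypothesis c0 : 0 < c.
Hypothesis phiC : forall x, c * `|x| - C <= phi x.
Hypothesis cvx : forall x y (t : R), 0 <= t <= 1 -> phi ((1 - t) *: x + t *: y) <= (1 - t) * phi x + t * phi y.
Variable m : R.
Hypothesis hm : forall x, m <= phi x.
Hypothesis hlow : forall x, m + n_ x / 6 - 2^-1 <= phi x.

Local Notation rho := (rho phi).
Local Notation E := (E phi).
Let ED := (ED phiL c0 phiC).
Let EB := (EB phiL c0 phiC).
Let EN := (EN phiL c0 phiC).
Let EZ := (EZ phiL c0 phiC).
Let Esum := (Esum phiL c0 phiC).
Let leE := (leE phiL c0 phiC).
Let pgi := (pgi phiL c0 phiC).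
Let mrho : measurable_fun setT rho := rho_meas phiL.

Lemma half_moment : intg mu (fun y => (1 + n_ y) * expR (- ((phi y - m) / 2))) /\
  rint mu (fun y => (1 + n_ y) * expR (- ((phi y - m) / 2))) <= 25 * expR 1 * gauge_const * l.
Proof.
have [i1 i2] := gauge_exp.
have b y : `|(1 + n_ y) * expR (- ((phi y - m) / 2))| <= 25 * expR 1 * expR (- (n_ y / 24)).
  have n0 : 0 <= n_ y := gauge_ge0 _.
  have p0 : 0 <= 1 + n_ y by rewrite addr_ge0.
  rewrite ger0_norm ?mulr_ge0 ?expR_ge0//.
  have h1 : expR (- ((phi y - m) / 2)) <= expR (1 - n_ y / 12).
    rewrite ler_expR; have := hlow y; lra.
  apply: le_trans (ler_pM p0 (expR_ge0 _) (gauge_beats y) h1) _.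
  rewrite -!mulrA ler_wpM2l// -!expRD ler_expR; lra.
have i3 := intgZ (25 * expR 1) i1.
have mf : measurable_fun setT (fun y => (1 + n_ y) * expR (- ((phi y - m) / 2))).
  apply: measurable_funM.
    by apply: lip_measurable; apply: lipD => //; exact: lip_cst.
  apply: measurableT_comp => //; apply: measurableT_comp => //; apply: measurable_funM => //.
  by apply: lip_measurable; apply: lipB; [exists N|exact: lip_cst].
have i4 := intg_le mf b i3; split => //.
apply: (@le_trans _ _ (rint mu (fun y => 25 * expR 1 * expR (- (n_ y / 24))))).
  by apply: rint_le => // y; exact: le_trans (ler_norm _) (b y).
rewrite rintZ// -[leRHS]mulrA ler_wpM2l// mulr_ge0// expR_ge0.
Qed.

Let png k : pg (fun x => (1 + n_ x) ^+ k).
Proof. by apply: pgX; apply: pgD; [exact: pg_cst|exact: pg_lip]. Qed.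

Lemma second_moment : E (fun x => (1 + n_ x) ^+ 2) <= 625 * expR 1 * gauge_const * l * expR (- m).
Proof.
have [i1 i2] := gauge_exp.
have i3 := intgZ (625 * expR 1 * expR (- m)) i1.
rewrite E_rint; apply: (@le_trans _ _ (rint mu (fun x => 625 * expR 1 * expR (- m) * expR (- (n_ x / 24))))).
  apply: rint_le => //; first exact: (pgi (png 2)).
  move=> x; have n0 : 0 <= n_ x := gauge_ge0 _.
  have p0 : 0 <= 1 + n_ x by rewrite addr_ge0.
  have h1 : rho x <= expR (1 - m - n_ x / 6) by rewrite ler_expR; have := hlow x; lra.
  have h2 : (1 + n_ x) ^+ 2 <= 625 * expR (n_ x / 12).
    apply: (@le_trans _ _ ((25 * expR (n_ x / 24)) ^+ 2)).
      by rewrite lerXn2r ?nnegrE ?mulr_ge0 ?expR_ge0//; exact: gauge_beats.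
    have -> : n_ x / 12 = n_ x / 24 + n_ x / 24 by field.
    by rewrite expRD le_eqVlt; apply/orP; left; apply/eqP; ring.
  apply: le_trans (ler_pM (sqr_ge0 _) (expR_ge0 _) h2 h1) _.
  have h3 : expR (n_ x / 12) * expR (1 - m - n_ x / 6) <= expR 1 * expR (- m) * expR (- (n_ x / 24)).
    by rewrite -!expRD ler_expR; lra.
  have k5 : (0 : R) <= 625 := ler0n _ _.
  have := ler_wpM2l k5 h3.
  by move: (expR (n_ x / 12)) (expR (1 - m - n_ x / 6)) (expR (- (n_ x / 24))) (expR 1) (expR (- m)) => p1 p2 p3 p4 p5; lra.
rewrite rintZ//; have k5 : (0 : R) <= 625 := ler0n _ _.
have k0 : 0 <= 625 * expR 1 * expR (- m) by exact: mulr_ge0 (mulr_ge0 k5 (expR_ge0 _)) (expR_ge0 _).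
apply: le_trans (ler_wpM2l k0 i2) _.
by move: (expR _) (expR (- m)) => p q; rewrite le_eqVlt; apply/orP; left; apply/eqP; ring.
Qed.

Definition gradsum w x : R := \sum_i `|pd w (frame i) x|.

Lemma gradsum_ge0 w x : 0 <= gradsum w x. Proof. exact: sumr_ge0. Qed.

Lemma gradsum_lip w : Sm 1 w -> lip (gradsum w).
Proof. by move=> sw; apply: lip_sum => i; apply: lip_norm; exact: Sm_lip (Sm_pd (frame i) sw). Qed.

(** Mean value theorem with the gradient frozen at x. The error is quadratic in h, so a segment can
    be treated by subdivision instead of an integral along it. *)
Lemma increment w : Sm 1 w -> exists2 Q, 0 <= Q & forall x h,
  `|w (x + h) - w x| <= gauge h * gradsum w x + Q * gauge h * `|h|.
Proof.
move=> sw; have [Q Q0 hQ] := lip_ge0 (gradsum_lip sw); exists Q => // x h.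
have [a /andP[a0 a1] ->] := Sm_mvt lamT x h sw.
have e : pd w h (x + a *: h) = \sum_i (h *m Ti) 0 i * pd w (frame i) (x + a *: h).
  by rewrite {1}(frame_coord h) (Sm_pd_lin lamT _ _ _ _ sw).
apply: (@le_trans _ _ (gauge h * gradsum w (x + a *: h))).
  rewrite e /gradsum mulr_sumr; apply: le_trans (ler_norm_sum _ _ _) _; apply: ler_sum => i _.
  by rewrite normrM ler_wpM2r//; exact: coord_le_norm.
rewrite [Q * _]mulrC -mulrA -mulrDr ler_wpM2l ?gauge_ge0//.
have := hQ (x + a *: h) x; rewrite addrAC subrr add0r normrZ ger0_norm// => h1.
have := ler_norm (gradsum w (x + a *: h) - gradsum w x).
have : Q * (a * `|h|) <= Q * `|h| by rewrite ler_wpM2l// ler_piMl.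
lra.
Qed.

(** Only the part of the segment from x to the midpoint is used: there the substitution of x by (1 -
    t) x + t y has Jacobian at least $2^{-d}$. The other part is the same expression with x and y
    exchanged. *)
Let half w y := rint mu (fun x => `|w x - w (2^-1 *: x + 2^-1 *: y)| * rho x) * rho y.

(* For fixed [y], the substitution [x -> (1 - t) x + t y] together with log-concavity moves
   the weight to the intermediate point. *)
Lemma slice_bound w y (t : R) : Sm 1 w -> 0 <= t <= 2^-1 ->
  rint mu (fun x => gauge (y - x) * gradsum w ((1 - t) *: x + t *: y) * rho x) * rho y <=
  2 ^+ d.+1 * (expR (- m) * ((1 + n_ y) * expR (- ((phi y - m) / 2))) * E (fun p => (1 + n_ p) * gradsum w p)).
Proof.
move=> sw /andP[t0 t1]; pose u := 1 - t.
have u0 : 0 < u by rewrite /u; lra.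
have u1 : 2^-1 <= u by rewrite /u; lra.
have ly : lip (fun x => gauge (y - x)).
  have := lip_affine (-1) y gauge_lip.
  by rewrite (_ : (fun x => _) = (fun x => gauge (y - x)))//; apply/funext => x; rewrite scaleN1r addrC.
have lD := gradsum_lip sw.
pose K := expR (- m) * expR (- ((phi y - m) / 2)).
have K0 : 0 <= K by rewrite mulr_ge0// expR_ge0.
pose F p := K * u^-1 * (gauge (y - p) * gradsum w p * rho p).
have iF0 : intg mu (fun p => gauge (y - p) * gradsum w p * rho p).
  by apply: pgi; apply: pgM; exact: pg_lip.
have iF : intg mu F := intgZ (K * u^-1) iF0.
have iF1 := intg_shift (t *: y) iF.
have pD : pg (fun x => gradsum w ((1 - t) *: x + t *: y)) by apply: pg_lip; exact: lip_affine.
have i1 : intg mu (fun x => gauge (y - x) * gradsum w ((1 - t) *: x + t *: y) * rho x).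
  by apply: pgi; apply: pgM => //; exact: pg_lip.
have le1 x : rho y * (gauge (y - x) * gradsum w ((1 - t) *: x + t *: y) * rho x) <= F (u *: x + t *: y).
  rewrite /F -/u; set p := u *: x + t *: y.
  have e1 : gauge (y - x) = u^-1 * gauge (y - p).
    have -> : y - p = u *: (y - x).
      by apply/rowP => i; rewrite /p /u !mxE; ring.
    by rewrite gaugeZ gtr0_norm// mulrA mulVf ?mul1r// gt_eqF.
  (* By convexity phi x + phi y - phi p >= t phi x + (1 - t) phi y, which is at least (m + phi y)/2
     because t <= 1/2 and phi >= m: half of the decay in y survives. *)
  have e2 : rho y * rho x <= K * rho p.
    rewrite /K -!expRD ler_expR.
    have ht : 0 <= t <= 1 by apply/andP; split; lra.
    have h1 := cvx x y ht; rewrite -/u -/p in h1.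
    have h2 := ler_wpM2l t0 (hm x).
    have h3 : (1 - t - 2^-1) * m <= (1 - t - 2^-1) * phi y by apply: ler_wpM2l => //; lra.
    move: h1; rewrite /u; lra.
  rewrite e1; apply: (@le_trans _ _ (u^-1 * gauge (y - p) * gradsum w p * (rho y * rho x))).
    by rewrite le_eqVlt; apply/orP; left; apply/eqP; ring.
  apply: (@le_trans _ _ (u^-1 * gauge (y - p) * gradsum w p * (K * rho p))).
    apply: ler_wpM2l => //; rewrite mulr_ge0 ?gradsum_ge0// mulr_ge0 ?gauge_ge0// invr_ge0 ltW//.
  by rewrite le_eqVlt; apply/orP; left; apply/eqP; ring.
rewrite mulrC -rintZ//.
have h1 : rint mu (fun x => rho y * (gauge (y - x) * gradsum w ((1 - t) *: x + t *: y) * rho x)) <=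
    rint mu (fun x => F (u *: x + t *: y)).
  by apply: rint_le => //; [exact: intgZ|exact: (intg_scale u0 iF1)].
apply: le_trans h1 _.
have h2 := rint_scale u0 iF1; rewrite (rint_shift (t *: y) iF) in h2.
have -> : rint mu (fun x => F (u *: x + t *: y)) = u ^- d * rint mu F.
  by rewrite -h2 mulrA mulVf ?mul1r// expf_neq0// gt_eqF.
have h3 : rint mu F <= K * u^-1 * ((1 + n_ y) * E (fun p => (1 + n_ p) * gradsum w p)).
  rewrite /F rintZ// ler_wpM2l//; first by rewrite mulr_ge0// invr_ge0 ltW.
  have pp : pg (fun p => (1 + n_ p) * gradsum w p).
    by apply: pgM; [exact: (png 1)|exact: pg_lip].
  rewrite E_rint -rintZ; last exact: pgi.
  apply: rint_le => //; first by apply: intgZ; exact: pgi.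
  move=> p; rewrite !mulrA ler_wpM2r ?rho_ge0// ler_wpM2r ?gradsum_ge0//.
  apply: le_trans (gauge_tri p y) _.
  have : 0 <= n_ y * n_ p by rewrite mulr_ge0// gauge_ge0.
  lra.
have E0 : 0 <= E (fun p => (1 + n_ p) * gradsum w p).
  by apply: E_ge0 => p; rewrite mulr_ge0 ?gradsum_ge0// addr_ge0// gauge_ge0.
have n0 : 0 <= 1 + n_ y by rewrite addr_ge0// gauge_ge0.
have ud : u ^- d * u^-1 <= 2 ^+ d.+1.
  rewrite -invfM -exprSr -[2 in leRHS]invrK exprVn lef_pV2 ?posrE ?exprn_gt0 ?invr_gt0//.
  by rewrite lerXn2r ?nnegrE ?invr_ge0// ltW.
apply: (@le_trans _ _ (u ^- d * (K * u^-1 * ((1 + n_ y) * E (fun p => (1 + n_ p) * gradsum w p))))).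
  by rewrite ler_wpM2l// invr_ge0 exprn_ge0// ltW.
apply: (@le_trans _ _ ((u ^- d * u^-1) * (K * ((1 + n_ y) * E (fun p => (1 + n_ p) * gradsum w p))))).
  by rewrite le_eqVlt; apply/orP; left; apply/eqP; ring.
apply: le_trans (ler_wpM2r _ ud) _; first by rewrite mulr_ge0// mulr_ge0.
rewrite /K ler_wpM2l ?exprn_ge0//.
by move: (expR _) (expR (- m)) => p q; rewrite le_eqVlt; apply/orP; left; apply/eqP; ring.
Qed.

(** The way from x to the midpoint is cut into n + 1 equal steps. Each first-order term is a
    [slice_bound], the quadratic errors add up to a multiple of 1/(n+1), and n is arbitrary. *)
Lemma half_bound w y : Sm 1 w -> half w y <=
  2 ^+ d * (expR (- m) * ((1 + n_ y) * expR (- ((phi y - m) / 2))) * E (fun p => (1 + n_ p) * gradsum w p)).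
Proof.
move=> sw; have [Q Q0 hQ] := increment sw; have lD := gradsum_lip sw.
set B := expR (- m) * _ * _.
have ly : lip (fun x => gauge (y - x)).
  have := lip_affine (-1) y gauge_lip.
  by rewrite (_ : (fun x => _) = (fun x => gauge (y - x)))//; apply/funext => x; rewrite scaleN1r addrC.
have lyn : lip (fun x => `|y - x|).
  by exists 1 => a b; rewrite mul1r; apply: le_trans (ler_dist_dist _ _) _; rewrite opprD addrACA subrr add0r opprK addrC distrC.
pose q := E (fun x => Q * gauge (y - x) * `|y - x|) * rho y.
have pq : pg (fun x => Q * gauge (y - x) * `|y - x|).
  by apply: pgM; [apply: pgZ; exact: pg_lip|exact: pg_lip].
have key (n : nat) : half w y <= 2 ^+ d * B + q * n.+1%:R^-1.
  pose tk k : R := k%:R / (2 * n.+1%:R).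
  have n0 : 0 < n.+1%:R :> R by [].
  have tk01 k : (k < n.+1)%N -> 0 <= tk k <= 2^-1.
    move=> kn; rewrite divr_ge0//= /tk invfM mulrA mulrAC ler_piMl// ler_pdivrMr// mul1r ler_nat ltnW//.
  pose xk k x : V := (1 - tk k) *: x + tk k *: y.
  pose hh x : V := (2 * n.+1%:R)^-1 *: (y - x).
  have xkS k x : xk k.+1 x = xk k x + hh x.
    rewrite /xk /hh /tk -natr1 [(_ + 1) / _]mulrDl mul1r.
    set a := k%:R / _; set b := (_ * _)^-1.
    by apply/rowP => i; rewrite !mxE; ring.
  have incr k x : `|w (xk k x) - w (xk k.+1 x)| <=
     (2 * n.+1%:R)^-1 * (gauge (y - x) * gradsum w (xk k x)) + (2 * n.+1%:R)^-1 ^+ 2 * (Q * gauge (y - x) * `|y - x|).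
    rewrite distrC xkS; apply: le_trans (hQ _ _) _.
    rewrite /hh gaugeZ normrZ ger0_norm ?invr_ge0 ?mulr_ge0//.
    by rewrite le_eqVlt; apply/orP; left; apply/eqP; ring.
  have x0 x : xk 0%N x = x by rewrite /xk /tk mul0r subr0 scale1r scale0r addr0.
  have xn x : xk n.+1 x = 2^-1 *: x + 2^-1 *: y.
    rewrite /xk /tk (_ : n.+1%:R / (2 * n.+1%:R) = 2^-1).
      by rewrite (_ : 1 - 2^-1 = 2^-1 :> R)//; field.
    by rewrite invfM mulrCA divff ?mulr1// gt_eqF.
  have tel x : `|w x - w (2^-1 *: x + 2^-1 *: y)| <= \sum_(k < n.+1) ((2 * n.+1%:R)^-1 * (gauge (y - x) * gradsum w (xk k x)))
     + (4 * n.+1%:R)^-1 * (Q * gauge (y - x) * `|y - x|).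
    have h1 j : `|w x - w (xk j x)| <= \sum_(k < j) ((2 * n.+1%:R)^-1 * (gauge (y - x) * gradsum w (xk k x))
        + (2 * n.+1%:R)^-1 ^+ 2 * (Q * gauge (y - x) * `|y - x|)).
      elim: j => [|j ih]; first by rewrite big_ord0 x0 subrr normr0.
      rewrite big_ord_recr/=; apply: le_trans _ (lerD ih (incr j x)).
      by apply: le_trans _ (ler_normD _ _); rewrite addrA subrK.
    have := h1 n.+1; rewrite xn big_split/= sumr_const card_ord => h2; apply: le_trans h2 _.
    rewrite lerD2l -[X in X <= _]mulr_natl le_eqVlt; apply/orP; left; apply/eqP.
    by have := lt0r_neq0 n0; move: n.+1%:R => N1 N10; field.
  have pk k : pg (fun x => gauge (y - x) * gradsum w (xk k x)).
    by apply: pgM; [exact: pg_lip|apply: pg_lip; exact: lip_affine].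
  have lw := Sm_lip sw.
  have pw : pg (fun x => `|w x - w (2^-1 *: x + 2^-1 *: y)|).
    by apply: pg_norm; apply: pgB; [exact: pg_lip|apply: pg_lip; exact: lip_affine].
  rewrite /half -E_rint.
  apply: (@le_trans _ _ (E (fun x => \sum_(k < n.+1) ((2 * n.+1%:R)^-1 * (gauge (y - x) * gradsum w (xk k x)))
     + (4 * n.+1%:R)^-1 * (Q * gauge (y - x) * `|y - x|)) * rho y)).
    rewrite ler_wpM2r ?rho_ge0//; apply: leE => //.
    by apply: pgD; [apply: pg_sum => k; exact: pgZ|exact: pgZ].
  rewrite ED; [|by apply: pg_sum => k; exact: pgZ|exact: pgZ].
  rewrite Esum; last by move=> k; exact: pgZ.
  rewrite EZ// mulrDl; apply: lerD; last first.
    rewrite -mulrA -/q mulrC; apply: ler_wpM2l.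
      by rewrite mulr_ge0 ?rho_ge0//; apply: E_ge0 => x; rewrite !mulr_ge0// gauge_ge0.
    by rewrite lef_pV2 ?posrE ?mulr_gt0// ler_peMl// ler1n.
  apply: (@le_trans _ _ (\sum_(k < n.+1) ((2 * n.+1%:R)^-1 * (2 ^+ d.+1 * B)))).
    rewrite mulr_suml; apply: ler_sum => k _; rewrite EZ// -mulrA ler_wpM2l ?invr_ge0 ?mulr_ge0//.
    by rewrite E_rint; apply: slice_bound => //; exact: tk01.
  rewrite sumr_const card_ord -[X in X <= _]mulr_natl exprS le_eqVlt; apply/orP; left; apply/eqP.
  have := lt0r_neq0 n0; move: n.+1%:R => N1 N10; move: (2 ^+ d) => Z; by field.
apply/ler_addgt0Pr => e e0.
have [q0|q0] := leP q 0.
  apply: le_trans (key 0%N) _; rewrite lerD2l invr1 mulr1; lra.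
apply: le_trans (key (Num.trunc (q / e))) _; rewrite lerD2l ler_pdivrMr//.
by rewrite mulrC -ler_pdivrMr//; apply/ltW/truncnS_gt.
Qed.

Lemma E_gradsum_ge0 w : 0 <= E (fun p => (1 + n_ p) * gradsum w p).
Proof.
by apply: E_ge0 => p; rewrite mulr_ge0 ?gradsum_ge0// addr_ge0// gauge_ge0.
Qed.

(** As w has mean zero, |w x| times the mass is at most the weighted integral over y of |w x - w y|.
    Passing through the midpoint and exchanging the variables by Fubini leaves twice the integral of
    [half]; [half_bound] is then summed over y with [half_moment]. *)
Lemma poincare w : Sm 1 w -> E w = 0 ->
  E (fun=> 1) * E (fun x => `|w x|) <=
    2 ^+ d.+1 * (25 * expR 1 * gauge_const) * (l * expR (- m)) * E (fun x => (1 + n_ x) * gradsum w x).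
Proof.
move=> sw Ew; have lw := Sm_lip sw; have pw := pg_lip lw; have [L L0 wL] := lip_ge0 lw.
pose Phi (p : V * V) := `|w p.1 - w (2^-1 *: p.1 + 2^-1 *: p.2)| * rho p.1 * rho p.2.
have mPhi : measurable_fun setT Phi.
  have m1 : measurable_fun setT (fun p : V * V => p.1) := measurable_fst.
  have m2 : measurable_fun setT (fun p : V * V => p.2) := measurable_snd.
  have mw := lip_measurable lw.
  apply: measurable_funM; last exact: measurableT_comp mrho m2.
  apply: measurable_funM; last exact: measurableT_comp mrho m1.
  apply: measurableT_comp => //; apply: measurable_funB; first exact: measurableT_comp mw m1.
  apply: measurableT_comp mw _; apply: measurable_fun_addv.
    by apply: (measurable_fun_scalev (k := fun=> 2^-1)).
  by apply: (measurable_fun_scalev (k := fun=> 2^-1)).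
have wpg y : pg (fun x => `|w x - w (2^-1 *: x + 2^-1 *: y)|).
  by apply: pg_norm; apply: pgB => //; apply: pg_lip; exact: lip_affine.
have wpg2 x : pg (fun y => `|w x - w (2^-1 *: x + 2^-1 *: y)|).
  apply: pg_norm; apply: pgB; first exact: pg_cst.
  rewrite (_ : (fun y => _) = (fun y => w (2^-1 *: y + 2^-1 *: x))); last by apply/funext => y; rewrite addrC.
  by apply: pg_lip; exact: lip_affine.
have wpg3 x : pg (fun y => `|w y - w (2^-1 *: y + 2^-1 *: x)|) := wpg x.
have iy x : intg mu (fun y => Phi (x, y)).
  rewrite (_ : (fun y => _) = (fun y => rho x * (`|w x - w (2^-1 *: x + 2^-1 *: y)| * rho y))); last first.
    by apply/funext => y; rewrite /Phi/=; ring.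
  by apply: intgZ; exact: pgi.
have ix y : intg mu (fun x => Phi (x, y)).
  rewrite (_ : (fun x => _) = (fun x => rho y * (`|w x - w (2^-1 *: x + 2^-1 *: y)| * rho x))); last first.
    by apply/funext => x; rewrite /Phi/=; ring.
  by apply: intgZ; exact: pgi.
pose Z := E (fun=> 1).
have Z0 : 0 <= Z by apply: E_ge0 => x; exact: ler01.
have ln : lip (fun x : V => `|x|) by exists 1 => x y; rewrite mul1r; exact: ler_dist_dist.
pose A x := (L * (`|x| * Z + E (fun y => `|y|))) * rho x.
have Ai : intg mu A.
  apply: pgi; apply: pgZ; apply: pgD; last exact: pg_cst.
  by apply: pgM; [exact: pg_lip|exact: pg_cst].
have hA x : rint mu (fun y => `|Phi (x, y)|) <= A x.
  rewrite (_ : (fun y => _) = (fun y => rho x * (`|w x - w (2^-1 *: x + 2^-1 *: y)| * rho y))); last first.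
    by apply/funext => y; rewrite /Phi/= !normrM normr_id !(ger0_norm (rho_ge0 _ _)); ring.
  rewrite rintZ; last exact: pgi.
  rewrite /A mulrC ler_wpM2r ?rho_ge0// -E_rint.
  apply: (@le_trans _ _ (E (fun y => L * (`|x| * 1 + `|y|)))).
    apply: leE => // [|y]; first by apply: pgZ; apply: pgD; [exact: pg_cst|exact: pg_lip].
    apply: le_trans (wL _ _) _; rewrite ler_wpM2l// mulr1.
    have -> : x - (2^-1 *: x + 2^-1 *: y) = 2^-1 *: (x - y).
      by rewrite scalerBr opprD addrA -{1}[x]scale1r -scalerBl (_ : 1 - 2^-1 = 2^-1 :> R)//; field.
    rewrite normrZ ger0_norm//; have := ler_normB x y; have := normr_ge0 (x - y); lra.
  rewrite EZ; last by apply: pgD; [exact: pg_cst|exact: pg_lip].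
  rewrite ED; [|exact: pg_cst|exact: pg_lip].
  by rewrite EZ//; exact: pg_cst.
have [j1 j2 je] := rint_fubini mPhi Ai iy ix hA.
pose S := rint mu (fun x => rint mu (fun y => Phi (x, y))).
have hS : Z * E (fun x => `|w x|) <= 2 * S.
  have h1 x : Z * (`|w x| * rho x) <= rint mu (fun y => Phi (x, y)) + rint mu (fun y => Phi (y, x)).
    have e1 : Z * w x = E (fun y => w x - w y).
      by rewrite (EB (pg_cst (w x)) pw) Ew subr0 (Ecst phiL c0 phiC (w x)) /Z mulrC.
    have -> : Z * (`|w x| * rho x) = `|Z * w x| * rho x.
      by rewrite normrM (ger0_norm Z0) mulrA.
    have -> : rint mu (fun y => Phi (x, y)) = E (fun y => `|w x - w (2^-1 *: x + 2^-1 *: y)|) * rho x.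
      rewrite E_rint mulrC -rintZ; last exact: pgi.
      by apply: eq_rint => y; rewrite /Phi/=; ring.
    have -> : rint mu (fun y => Phi (y, x)) = E (fun y => `|w y - w (2^-1 *: y + 2^-1 *: x)|) * rho x.
      rewrite E_rint mulrC -rintZ; last exact: pgi.
      by apply: eq_rint => y; rewrite /Phi/=; ring.
    rewrite -mulrDl; apply: ler_wpM2r; first exact: rho_ge0.
    rewrite e1.
    have pwy := pgB (pg_cst (w x)) pw.
    apply: le_trans (E_norm phiL c0 phiC pwy) _; rewrite -(ED (wpg2 x) (wpg3 x)).
    apply: leE => [||y]; [exact: (pg_norm pwy)|exact: (pgD (wpg2 x) (wpg3 x))|].
    have ez : 2^-1 *: y + 2^-1 *: x = 2^-1 *: x + 2^-1 *: y by exact: addrC.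
    rewrite ez; move: (2^-1 *: x + 2^-1 *: y) => z; move: (w x) (w z) (w y) => p q r.
    by have := ler_normD (p - q) (q - r); rewrite addrA subrK [`|q - r|]distrC.
  have -> : 2 * S = S + rint mu (fun x => rint mu (fun y => Phi (y, x))) by rewrite -je /S; ring.
  have iw := pgi (pg_norm pw).
  rewrite E_rint -(rintZ Z iw) -(rintD j1 j2).
  apply: rint_le; [exact: (intgZ Z iw)|exact: (intgD j1 j2)|exact: h1].
have S2 : S <= 2 ^+ d * (expR (- m) * E (fun p => (1 + n_ p) * gradsum w p)) * (25 * expR 1 * gauge_const * l).
  have [k1 k2] := half_moment.
  have E0 := E_gradsum_ge0 w.
  have K0 : 0 <= 2 ^+ d * (expR (- m) * E (fun p => (1 + n_ p) * gradsum w p)).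
    exact: mulr_ge0 (exprn_ge0 _ (ler0n _ 2)) (mulr_ge0 (expR_ge0 _) E0).
  apply: le_trans _ (ler_wpM2l K0 k2); rewrite -(rintZ _ k1) /S je.
  apply: (rint_le j2 (intgZ _ k1)) => y.
  have -> : rint mu (fun x => Phi (x, y)) = half w y.
    rewrite /half mulrC -rintZ; last exact: pgi.
    by apply: eq_rint => x; rewrite /Phi/=; ring.
  apply: le_trans (half_bound y sw) _.
  by move: (expR _) (expR (- m)) => p q; rewrite le_eqVlt; apply/orP; left; apply/eqP; ring.
apply: le_trans hS (le_trans (ler_wpM2l (ler0n _ 2) S2) _).
rewrite [2 ^+ d.+1]exprS; move: (expR (- m)) (expR 1) gauge_const (2 ^+ d) (E _) => p q r s e.
by rewrite le_eqVlt; apply/orP; left; apply/eqP; ring.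
Qed.

End poincare.

(** * A crude John position for the sublevel sets of phi *)

Section normal_position.
Context {R : realType} {d' : nat}.
Local Notation d := d'.+1.
Local Notation V := 'rV[R]_d.
Local Notation mu := (@lam R d').
Implicit Types (x y h : V).
Variable phi : V -> R.
Variables N c C : R.
Hypothesis N0 : 0 <= N.
Hypothesis phiL : forall x y, `|phi x - phi y| <= N * `|x - y|.
Hypothesis c0 : 0 < c.
Hypothesis phiC : forall x, c * `|x| - C <= phi x.
Hypothesis cvx : forall x y (t : R), 0 <= t <= 1 -> phi ((1 - t) *: x + t *: y) <= (1 - t) * phi x + t * phi y.

Definition replace_row (T : 'M[R]_d) (i : 'I_d) (z : V) : 'M[R]_d :=
  \matrix_(j, k) (if j == i then z 0 k else T j k).

(** Cramer's rule, by expansion along the replaced row. *)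
Lemma det_replace_row T i z : T \in unitmx ->
  (z *m invmx T) 0 i * \det T = \det (replace_row T i z).
Proof.
move=> uT; rewrite [RHS](expand_det_row _ i) /invmx uT -scalemxAr mxE mulrAC mulVr -?unitmxE// mul1r.
rewrite mxE; apply: eq_bigr => k _; rewrite [replace_row T i z i k]mxE eqxx mxE.
congr (_ * _); rewrite /cofactor; congr (_ * \det _).
apply/matrixP => a b; rewrite !mxE; case: ifP => // /eqP e.
by have := neq_lift i a; rewrite e eqxx.
Qed.

Lemma det_bound (T : 'M[R]_d) (B : R) : (forall i j, `|T i j| <= B) ->
  `|\det T| <= (\sum_(s : {perm 'I_d}) 1) * B ^+ d.
Proof.
move=> h; rewrite /determinant; apply: le_trans (ler_norm_sum _ _ _) _.
rewrite mulr_suml; apply: ler_sum => s _; rewrite normrM normrX normrN1 expr1n mul1r.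
rewrite normr_prod mul1r; apply: le_trans (ler_prod _ _) _ => [i _|].
  by rewrite normr_ge0/=; exact: h.
by rewrite prodr_const card_ord.
Qed.

(* The axes of the frame nearly maximise the volume they span inside a sublevel set of [phi],
   so that this set has bounded coordinates (a crude John position). *)
Lemma normal_position : exists m xs T, [/\ (forall x, m <= phi x), phi xs <= m + 2^-1,
  T \in unitmx, (forall i, phi (xs + frame T i) <= m + 1) &
  forall x, phi x <= m + 1 -> gauge (invmx T) (x - xs) <= 2].
Proof.
have hb x : - C <= phi x.
  have h0 : 0 <= c * `|x| by rewrite mulr_ge0// ltW.
  have := phiC x; lra.
have iP : has_inf (range phi).
  by split; [exists (phi 0), 0|exists (- C) => _ [x _ <-]].
pose m := inf (range phi).
have hm x : m <= phi x by apply: ge_inf; [case: iP|exists x].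
have h2 : (0 : R) < 2^-1 by rewrite invr_gt0.
have [_ [xs _ <-] hxs] := inf_adherent h2 iP.
rewrite -/m in hxs.
pose S := [set `|\det T| | T in [set T : 'M[R]_d | forall i, phi (xs + row i T) <= m + 1]].
pose B := (m + 1 + C) / c + `|xs|.
have rB z : phi (xs + z) <= m + 1 -> `|z| <= B.
  move=> hz; have := phiC (xs + z) => h1.
  have h3 : `|xs + z| <= (m + 1 + C) / c by rewrite ler_pdivlMr// mulrC; lra.
  have := ler_normB (xs + z) xs; rewrite addrAC subrr add0r /B; lra.
have hS : has_sup S.
  split.
    (* With this q, N q <= 1/2: phi rises by at most 1/2 from xs to the ends of the frame of the
       vectors q e_i, which stays in the sublevel set. *)
    pose q := (2 * (N + 1))^-1.
    exists (`|\det (q%:M : 'M[R]_d)|), q%:M => // i /=.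
    have N1 : 0 < N + 1 by rewrite ltr_wpDl.
    have q0 : 0 < q by rewrite invr_gt0 mulr_gt0.
    have h1 : `|row i (q%:M : 'M[R]_d)| <= q.
      apply: norm_rv_le; first exact: ltW.
      by move=> j; rewrite !mxE; case: (i == j) => /=; [rewrite mulr1n gtr0_norm|rewrite mulr0n normr0 ltW].
    have := phiL (xs + row i (q%:M : 'M[R]_d)) xs; rewrite addrAC subrr add0r => h3.
    have := ler_norm (phi (xs + row i (q%:M : 'M[R]_d)) - phi xs).
    have : N * `|row i (q%:M : 'M[R]_d)| <= 2^-1.
      apply: (@le_trans _ _ ((N + 1) * q)); first by apply: ler_pM => //; rewrite lerDl.
      by rewrite /q invfM mulrCA divff ?mulr1// gt_eqF.
    lra.
  exists ((\sum_(s : {perm 'I_d}) 1) * B ^+ d) => _ [T hT <-]; apply: det_bound => i j.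
  have := coord_le_norm (row i T) j; rewrite mxE => h1; exact: le_trans h1 (rB _ (hT i)).
have hle T : (forall i, phi (xs + row i T) <= m + 1) -> `|\det T| <= sup S.
  by move=> hT; apply: ub_le_sup; [case: hS|exists T].
have sS : 0 < sup S.
  pose q := (2 * (N + 1))^-1.
  have N1 : 0 < N + 1 by rewrite ltr_wpDl.
  have q0 : 0 < q by rewrite invr_gt0 mulr_gt0.
  apply: (@lt_le_trans _ _ `|\det (q%:M : 'M[R]_d)|).
    by rewrite normr_gt0 det_scalar expf_neq0// gt_eqF.
  apply: hle => i.
  have h1 : `|row i (q%:M : 'M[R]_d)| <= q.
    apply: norm_rv_le; first exact: ltW.
    by move=> j; rewrite !mxE; case: (i == j) => /=; [rewrite mulr1n gtr0_norm|rewrite mulr0n normr0 ltW].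
  have := phiL (xs + row i (q%:M : 'M[R]_d)) xs; rewrite addrAC subrr add0r => h3.
  have := ler_norm (phi (xs + row i (q%:M : 'M[R]_d)) - phi xs).
  have : N * `|row i (q%:M : 'M[R]_d)| <= 2^-1.
    apply: (@le_trans _ _ ((N + 1) * q)); first by apply: ler_pM => //; rewrite lerDl.
    by rewrite /q invfM mulrCA divff ?mulr1// gt_eqF.
  lra.
(* A frame whose determinant exceeds half the supremum: replacing one of its rows by another
   admissible vector at most doubles the determinant, and by Cramer's rule the ratio is a coordinate
   of that vector. *)
have s2 : 0 < sup S / 2 by rewrite divr_gt0.
have [_ [T hT <-] hdet] := sup_adherent s2 hS.
have dT : 0 < `|\det T| by apply: lt_trans hdet; lra.
have uT : T \in unitmx by rewrite unitmxE unitfE -normr_gt0.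
exists m, xs, T; split => //; first exact: ltW.
move=> x hx; apply: norm_rv_le => // i.
rewrite -(ler_pM2r dT) -normrM det_replace_row//.
apply: (@le_trans _ _ (sup S)); last by lra.
apply: hle => j; have [->|ji] := eqVneq j i.
  by rewrite (_ : row i _ = x - xs) ?[xs + _]addrC ?subrK//; apply/rowP => k; rewrite !mxE eqxx.
by rewrite (_ : row j _ = row j T); [exact: hT|apply/rowP => k; rewrite !mxE (negbTE ji)].
Qed.

Variables (m : R) (xs : V) (T : 'M[R]_d).
Hypothesis hm : forall x, m <= phi x.
Hypothesis hxs : phi xs <= m + 2^-1.
Hypothesis uT : T \in unitmx.
Hypothesis hT : forall i, phi (xs + frame T i) <= m + 1.
Hypothesis hg : forall x, phi x <= m + 1 -> gauge (invmx T) (x - xs) <= 2.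
Local Notation Ti := (invmx T).
Local Notation ng x := (gauge Ti (x - xs)).

(** On the ray from xs, the point at gauge 3 has phi > m + 1 while phi xs <= m + 1/2. Convexity
    extends this rise of 1/2 over gauge 3 to the slope 1/6. Up to gauge 3 the claimed bound is at
    most m. *)
Lemma gauge_low x : m + ng x / 6 - 2^-1 <= phi x.
Proof.
have [n3|n3] := leP (ng x) 3; first by have := hm x; lra.
pose t := 3 / ng x.
have n0 : 0 < ng x by apply: lt_trans n3.
have t0 : 0 < t by rewrite divr_gt0.
have t1 : t <= 1 by rewrite ler_pdivrMr// mul1r ltW.
have tn : t * ng x = 3 by rewrite /t divfK// gt_eqF.
have hp : m + 1 < phi ((1 - t) *: xs + t *: x).
  rewrite ltNge; apply/negP => /hg.
  have -> : (1 - t) *: xs + t *: x - xs = t *: (x - xs) by apply/rowP => i; rewrite !mxE; ring.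
  by rewrite gaugeZ gtr0_norm// tn; lra.
have ht : 0 <= t <= 1 by rewrite (ltW t0).
have h1 := cvx xs x ht.
have h2 : (1 - t) * phi xs <= (1 - t) * (m + 2^-1) by rewrite ler_wpM2l// subr_ge0.
have h3 : 2^-1 <= t * (phi x - m - 2^-1) by lra.
have h4 : t * (6^-1 * ng x) <= t * (phi x - m - 2^-1) by rewrite mulrCA tn; lra.
move: h4; rewrite ler_pM2l//; lra.
Qed.

Lemma simplex_in (s : seq 'I_d) (a : 'I_d -> R) : (forall i, 0 <= a i) ->
  \sum_(i <- s) a i < 1 -> phi (xs + \sum_(i <- s) a i *: frame T i) <= m + 1.
Proof.
elim: s a => [|i s ih] a a0; first by rewrite !big_nil addr0 => _; move: (hxs); lra.
rewrite !big_cons => h.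
have s0 : 0 <= \sum_(j <- s) a j by exact: sumr_ge0.
have b0 : 0 < 1 - a i by lra.
have := ih (fun j => a j / (1 - a i)) (fun j => divr_ge0 (a0 j) (ltW b0)).
rewrite -mulr_suml ltr_pdivrMr// mul1r => /(_ ltac:(lra)) h1.
have ht : 0 <= a i <= 1 by rewrite a0/=; lra.
have := cvx (xs + \sum_(j <- s) (a j / (1 - a i)) *: frame T j) (xs + frame T i) ht.
have -> : (1 - a i) *: (xs + \sum_(j <- s) (a j / (1 - a i)) *: frame T j) + a i *: (xs + frame T i) =
   xs + (a i *: frame T i + \sum_(j <- s) a j *: frame T j).
  rewrite scalerDr scaler_sumr (eq_bigr (fun j => a j *: frame T j)); last first.
    by move=> j _; rewrite scalerA mulrC divfK// gt_eqF.
  by rewrite scalerDr scalerBl scale1r; apply/rowP => k; rewrite !mxE; ring.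
move=> h2; apply: le_trans h2 _.
have := hT i; have : (1 - a i) * phi (xs + \sum_(j <- s) (a j / (1 - a i)) *: frame T j) <= (1 - a i) * (m + 1).
  by rewrite ler_pM2l.
have : a i * phi (xs + frame T i) <= a i * (m + 1) by rewrite ler_wpM2l.
lra.
Qed.

(** Around [cen] a parallelepiped of half-side [rad] has simplex coordinates between 0 and 2 [rad],
    with sum at most 1/2, so it lies in the simplex spanned by xs and the ends of the frame. *)
Definition rad : R := (4 * d%:R)^-1.
Definition cen : V := xs + \sum_i rad *: frame T i.

Lemma rad_gt0 : 0 < rad. Proof. by rewrite invr_gt0 mulr_gt0. Qed.

Lemma parallelepiped_in (s : 'I_d -> R) : (forall i, `|s i| <= rad) ->
  phi (cen + \sum_i s i *: frame T i) <= m + 1.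
Proof.
move=> hs; rewrite /cen -addrA -big_split/=.
rewrite (eq_bigr (fun i => (rad + s i) *: frame T i)); last by move=> i _; rewrite scalerDl.
apply: simplex_in => [i|]; first by have := hs i; rewrite ler_norml; lra.
apply: (@le_lt_trans _ _ (\sum_(i : 'I_d) (2 * rad))).
  by apply: ler_sum => i _; have := hs i; rewrite ler_norml; lra.
rewrite sumr_const card_ord -[X in X < _]mulr_natl /rad.
have d0 : d%:R != 0 :> R by rewrite pnatr_eq0.
have -> : d%:R * (2 * (4 * d%:R)^-1) = 2^-1 :> R by move: d%:R d0 => k k0; field.
lra.
Qed.

Lemma gauge_ball_finite : exists l, lam [set x | gauge Ti x <= 1] = l%:E.
Proof.
pose B := \sum_i `|frame T i|.
have sub : [set x | gauge Ti x <= 1] `<=` [set x : V | (`|x| <= B)%R].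
  move=> x /= gx; rewrite {1}(frame_coord (mulVmx uT) x); apply: le_trans (ler_norm_sum _ _ _) _.
  apply: ler_sum => i _; rewrite normrZ ler_piMl//.
  exact: le_trans (coord_le_norm _ _) gx.
have := le_lt_trans (le_leb_outer sub) (@lam_ball_lty R d' B).
have := @lam_ge0 R d' [set x | gauge Ti x <= 1]; rewrite /lam.
by case: (leb_outer _) => [l _ _| |//]; [exists l|].
Qed.

Variable l : R.
Hypothesis hl : lam [set x | gauge Ti x <= 1] = l%:E.

(** The parallelepiped around [cen] lies in the set phi <= m + 1, so the mass is at least $e^{-m-1}$
    times its volume. This exchanges the position-dependent quantity $l e^{-m}$ for the mass and
    leaves constants in d alone. *)
Lemma ball_mass : l * expR (- m) <= expR 1 * (4 * d%:R) ^+ d * E phi (fun=> 1).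
Proof.
pose P := [set x | gauge Ti (x - cen) <= rad].
have lP : lam P = (rad ^+ d * l)%:E.
  rewrite EFinM -hl; have r0 := rad_gt0.
  have e1 : leb_outer P = leb_outer [set x | gauge Ti x <= rad].
    have := leb_outer_shift cen P; rewrite -[RHS]/(leb_outer P) => <-.
    by congr leb_outer; apply/seteqP; split => x /=; rewrite /P/= addrK.
  apply: etrans e1 _; apply: etrans (esym (leb_outer_scale [set x | gauge Ti x <= rad] r0)) _.
  congr (_ * leb_outer _)%E; apply/seteqP; split => x /=; rewrite gaugeZ gtr0_norm//.
    by rewrite -[X in _ <= X -> _]mulr1 ler_pM2l.
  by rewrite -[X in _ -> _ <= X]mulr1 ler_pM2l.
have mP : measurable P.
  rewrite -[X in measurable X]setTI (_ : P = (fun x => gauge Ti (x - cen)) @^-1` `]-oo, rad]%classic); last first.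
    by apply/seteqP; split => x /=; rewrite in_itv.
  by apply: (lip_measurable (lip_shift (- cen) (gauge_lip Ti))) => //.
have iP : intg mu (fun x => \1_P x : R).
  apply/integrableP; split; first by apply/measurable_EFinP/measurable_indic.
  under eq_integral do rewrite gee0_abs ?lee_fin//.
  rewrite integral_indic// setIT; apply: le_lt_trans (ltry (rad ^+ d * l)).
  by rewrite -[X in (_ <= X)%E]lP.
have rP : rint mu (fun x => \1_P x : R) = rad ^+ d * l.
  apply: EFin_inj; rewrite (rintE iP) -lP.
  by apply: etrans (integral_indic _ measurableT mP) _; rewrite setIT.
have h1 : expR (- (m + 1)) * (rad ^+ d * l) <= E phi (fun=> 1).
  rewrite -rP E_rint -(rintZ _ iP); apply: rint_le.
  - exact: (intgZ _ iP).
  - exact: (pgi phiL c0 phiC (pg_cst 1)).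
  - move=> x; rewrite mul1r indicE; case: (boolP (x \in P)) => [|_]; last by rewrite mulr0; exact: expR_ge0.
    rewrite inE /P/= => gx; rewrite mulr1 ler_expR lerN2.
    have -> : x = cen + \sum_i ((x - cen) *m Ti) 0 i *: frame T i.
      by rewrite -(frame_coord (mulVmx uT)) addrC subrK.
    by apply: parallelepiped_in => i; exact: le_trans (coord_le_norm _ _) gx.
have e2 : rad ^+ d * (4 * d%:R) ^+ d = 1.
  by rewrite -exprMn /rad mulVf ?expr1n// gt_eqF// mulr_gt0.
have e3 : expR (- m) = expR 1 * expR (- (m + 1)) by rewrite -expRD; congr expR; lra.
have k0 : 0 <= expR (1 : R) * (4 * d%:R) ^+ d by rewrite mulr_ge0 ?expR_ge0// exprn_ge0//.
apply: le_trans _ (ler_wpM2l k0 h1); rewrite e3.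
move: (expR (1 : R)) (expR (- (m + 1))) (rad ^+ d) ((4 * d%:R) ^+ d) e2 => p q r s e2.
have -> : p * s * (q * (r * l)) = l * (p * q) * (r * s) by ring.
by rewrite e2 mulr1.
Qed.

Hypothesis lamT : (0 < lam [set: V])%E.
Hypothesis sphi : Sm 2 phi.

Lemma convex_tangent x h : phi x + pd phi h x <= phi (x + h).
Proof.
have hd := rd_dq (Sm_diff sphi x h).
have le n : dq phi h n x <= phi (x + h) - phi x.
  pose t : R := n.+1%:R^-1.
  have t0 : 0 < t by rewrite invr_gt0.
  have t1 : t <= 1 by rewrite invf_le1// ler1n.
  have ht : 0 <= t <= 1 by rewrite (ltW t0).
  have := cvx x (x + h) ht.
  have -> : (1 - t) *: x + t *: (x + h) = x + t *: h by apply/rowP => i; rewrite !mxE; ring.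
  move=> h1; rewrite /dq -/t -[n.+1%:R]invrK -/t ler_pdivrMl//; lra.
have h1 : pd phi h x <= phi (x + h) - phi x.
  have e := cvg_lim (@Rhausdorff R) hd; rewrite -e.
  by apply: limr_le; [exact: cvgP hd|exact: nearW].
lra.
Qed.

(** The tangent plane of phi at x is evaluated at the point of the parallelepiped around [cen] given
    by the signs of the derivatives of phi. There phi is at most m + 1, hence at most phi x + 1. *)
Lemma drift_bound x : rad * \sum_i `|pd phi (frame T i) x| <= 1 + pd phi (x - cen) x.
Proof.
have s1 : Sm 1 phi := Sm_leS sphi.
pose s i := rad * Num.sg (pd phi (frame T i) x).
have hs i : `|s i| <= rad.
  rewrite /s normrM gtr0_norm ?rad_gt0// ler_piMr ?(ltW rad_gt0)// normr_sg.
  by case: (_ != 0).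
have h1 := parallelepiped_in hs.
pose q := - 1 *: (x - cen) + \sum_i s i *: frame T i.
have := convex_tangent x q.
have -> : x + q = cen + \sum_i s i *: frame T i by rewrite /q scaleN1r opprB addrA addrCA subrr addr0.
have -> : pd phi q x = - pd phi (x - cen) x + rad * \sum_i `|pd phi (frame T i) x|.
  rewrite (Sm_pd_dotv lamT _ _ s1) /q dotvDr dotvZr -(Sm_pd_dotv lamT _ _ s1) mulN1r; congr (_ + _).
  rewrite -(Sm_pd_dotv lamT _ _ s1) (Sm_pd_lin lamT _ _ _ _ s1) mulr_sumr; apply: eq_bigr => i _.
  by rewrite /s -mulrA; congr (_ * _); rewrite mulr_sg_norm || rewrite normrEsg mulrC.
have := hm x; lra.
Qed.

End normal_position.

(** * Smooth potentials *)

Section regular.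
Context {R : realType} {d' : nat}.
Local Notation d := d'.+1.
Local Notation V := 'rV[R]_d.
Local Notation mu := (@lam R d').
Implicit Types (f u F G w : V -> R) (x y h : V).

Lemma cvg_sum_seq (J : Type) (s : seq J) (F : J -> nat -> R) (q : J -> R) :
  (forall j, F j n @[n --> \oo] --> q j) ->
  (\sum_(j <- s) F j n) @[n --> \oo] --> \sum_(j <- s) q j.
Proof.
move=> h; elim: s => [|j s ih].
  rewrite big_nil (_ : (fun n => _) = fun=> 0); first exact: cvg_cst.
  by apply/funext => n; rewrite big_nil.
rewrite big_cons (_ : (fun n => _) = fun n => F j n + \sum_(j <- s) F j n); first exact: cvgD.
by apply/funext => n; rewrite big_cons.
Qed.

Lemma cvg_seq_le (u w : nat -> R) (p q : R) : u n @[n --> \oo] --> p -> w n @[n --> \oo] --> q ->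
  (forall n, u n <= w n) -> p <= q.
Proof.
move=> hu hw h; rewrite -(cvg_lim (@Rhausdorff R) hu) -(cvg_lim (@Rhausdorff R) hw).
by apply: ler_lim; [exact: cvgP hu|exact: cvgP hw|exact: nearW].
Qed.

(** The constants of [poincare] and [second_moment] after [ball_mass] has replaced $l e^{-m}$ by the
    mass. *)
Definition poin_const : R := 2 ^+ d.+1 * (25 * expR (1 : R) * @gauge_const R d') * (expR (1 : R) * (4 * d%:R) ^+ d).
Definition mom_const : R := 625 * expR (1 : R) * @gauge_const R d' * (expR (1 : R) * (4 * d%:R) ^+ d).

Lemma gauge_const_ge0 : 0 <= @gauge_const R d'.
Proof.
rewrite /gauge_const; exact: mulr_ge0 (mulr_ge0 (exprn_ge0 _ (ler0n _ 2)) (exprn_ge0 _ (ler0n _ d.+1))) (exprn_ge0 _ (ler0n _ 24)).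
Qed.

Lemma poin_const_ge0 : 0 <= poin_const.
Proof.
have g0 := gauge_const_ge0; have e0 := expR_ge0 (1 : R).
have k0 : (0 : R) <= (4 * d%:R) ^+ d by rewrite exprn_ge0// mulr_ge0.
have t0 : (0 : R) <= 2 ^+ d.+1 by rewrite exprn_ge0.
exact: mulr_ge0 (mulr_ge0 t0 (mulr_ge0 (mulr_ge0 (ler0n _ 25) e0) g0)) (mulr_ge0 e0 k0).
Qed.

Lemma mom_const_ge0 : 0 <= mom_const.
Proof.
have g0 := gauge_const_ge0; have e0 := expR_ge0 (1 : R).
have k0 : (0 : R) <= (4 * d%:R) ^+ d by rewrite exprn_ge0// mulr_ge0.
exact: mulr_ge0 (mulr_ge0 (mulr_ge0 (ler0n _ 625) e0) g0) (mulr_ge0 e0 k0).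
Qed.

(** In the first factor, 1 stands for the divergence of V and the rest for the drift, by
    [drift_term]; the other factors come from the Cauchy-Schwarz inequality in [weighted_hsum]. *)
Definition reg_const : R := (1 + 4 * d%:R * ((1 + d%:R) * poin_const + 1)) * d%:R * Num.sqrt mom_const.

Hypothesis lamT : (0 < lam [set: V])%E.
Variable phi : V -> R.
Variables N c C : R.
Hypothesis N0 : 0 <= N.
Hypothesis phiL : forall x y, `|phi x - phi y| <= N * `|x - y|.
Hypothesis c0 : 0 < c.
Hypothesis phiC : forall x, c * `|x| - C <= phi x.
Hypothesis cvx : forall x y (t : R), 0 <= t <= 1 -> phi ((1 - t) *: x + t *: y) <= (1 - t) * phi x + t * phi y.
Hypothesis sphi : Sm 2 phi.

Local Notation rho := (rho phi).
Local Notation E := (E phi).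
Let ED := (ED phiL c0 phiC).
Let EB := (EB phiL c0 phiC).
Let EN := (EN phiL c0 phiC).
Let EZ := (EZ phiL c0 phiC).
Let Esum := (Esum phiL c0 phiC).
Let leE := (leE phiL c0 phiC).
Let leE_ae := (leE_ae phiL c0 phiC).
Let E_CS := (E_CS phiL c0 phiC).
Let E_CS1 := (E_CS1 phiL c0 phiC).
Let Ecst := (Ecst phiL c0 phiC).
Let pgi := (pgi phiL c0 phiC).
Let dphi : diffd phi := Sm_diff sphi.
Let Z := E (fun=> 1).
Local Notation rad := (@rad R d').

Lemma E_center w : 0 < Z -> pg w -> E (fun x => w x - Z^-1 * E w) = 0.
Proof.
move=> z0 pw; rewrite (EB pw (pg_cst _)) Ecst -/Z; move: z0; move: Z (E w) => z q z0.
by field; rewrite gt_eqF.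
Qed.

Section position.
Variables (m l : R) (xs : V) (T : 'M[R]_d).
Hypothesis hm : forall x, m <= phi x.
Hypothesis hxs : phi xs <= m + 2^-1.
Hypothesis uT : T \in unitmx.
Hypothesis hT : forall i, phi (xs + frame T i) <= m + 1.
Hypothesis hg : forall x, phi x <= m + 1 -> gauge (invmx T) (x - xs) <= 2.
Hypothesis hl : lam [set x | gauge (invmx T) x <= 1] = l%:E.
Local Notation Ti := (invmx T).
Local Notation n_ x := (gauge Ti (x - xs)).
Local Notation v := (frame T).
Local Notation L := (L phi v).

Let TiT : Ti *m T = 1%:M := mulVmx uT.
Let hlow := gauge_low cvx hm hxs hg.
Let bm : l * expR (- m) <= expR 1 * (4 * d%:R) ^+ d * Z := ball_mass phiL c0 phiC cvx hxs uT hT hl.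

Let Z0 : 0 < Z. Proof. exact: (E1_gt0 phiL c0 phiC lamT). Qed.

Let pn1 : pg (fun x => 1 + n_ x).
Proof. by apply: pgD; [exact: pg_cst|exact: pg_lip (lip_shift (- xs) (gauge_lip Ti))]. Qed.

Lemma poincare_d w : Sm 1 w -> E w = 0 ->
  E (fun x => `|w x|) <= poin_const * E (fun x => (1 + n_ x) * gradsum T w x).
Proof.
move=> sw Ew; rewrite -(ler_pM2l Z0).
have h := poincare lamT TiT hl phiL c0 phiC cvx hm hlow sw Ew; apply: (le_trans h).
have E0 := E_gradsum_ge0 T Ti xs phi w.
rewrite [leRHS]mulrA; apply: ler_wpM2r; first exact: E0.
have k0 : 0 <= 2 ^+ d.+1 * (25 * expR (1 : R) * @gauge_const R d').
  exact: mulr_ge0 (exprn_ge0 _ (ler0n _ 2)) (mulr_ge0 (mulr_ge0 (ler0n _ 25) (expR_ge0 _)) gauge_const_ge0).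
apply: le_trans (ler_wpM2l k0 bm) _; rewrite /poin_const.
move: (2 ^+ d.+1) (expR (1 : R)) ((4 * d%:R) ^+ d) (@gauge_const R d') => p q r s.
by rewrite le_eqVlt; apply/orP; left; apply/eqP; ring.
Qed.

Lemma second_moment_d : E (fun x => (1 + n_ x) ^+ 2) <= mom_const * Z.
Proof.
apply: le_trans (second_moment hl phiL c0 phiC hlow) _.
have k0 : 0 <= 625 * expR (1 : R) * @gauge_const R d'.
  exact: mulr_ge0 (mulr_ge0 (ler0n _ 625) (expR_ge0 _)) gauge_const_ge0.
rewrite -[leLHS]mulrA; apply: le_trans (ler_wpM2l k0 bm) _; rewrite /mom_const.
move: (expR (1 : R)) ((4 * d%:R) ^+ d) (@gauge_const R d') => q r s.
by rewrite le_eqVlt; apply/orP; left; apply/eqP; ring.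
Qed.

Definition hsum u x : R := \sum_i gradsum T (pd u (v i)) x.

Lemma hsum_pg u : Sm 3 u -> pg (hsum u).
Proof. by move=> su; apply: pg_sum => i; apply: pg_lip; apply: gradsum_lip; exact: (Sm_le _ (Sm_pd (v i) su)). Qed.

Lemma hsum_ge0 u x : 0 <= hsum u x.
Proof. by apply: sumr_ge0 => i _; exact: gradsum_ge0. Qed.

Lemma hsum_sqr u x : hsum u x ^+ 2 <= d%:R ^+ 2 * hess2 v u x.
Proof.
apply: le_trans (sqr_sum_le _) _; rewrite expr2 -mulrA ler_wpM2l// /hess2 mulr_sumr.
apply: ler_sum => i _; apply: le_trans (sqr_sum_le _) _; rewrite ler_wpM2l//.
by apply: ler_sum => j _; rewrite real_normK ?num_real.
Qed.

(** Cauchy-Schwarz against the second moment of the gauge, which is a dimensional multiple of the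
    mass. *)
Lemma weighted_hsum u : Sm 3 u ->
  E (fun x => (1 + n_ x) * hsum u x) <= Num.sqrt mom_const * d%:R * Num.sqrt (Z * E (hess2 v u)).
Proof.
move=> su; have ph := hsum_pg su; have pH := hess2_pg v (Sm_leS su).
have H0 : 0 <= E (hess2 v u).
  by apply: E_ge0 => x; do 2 ![apply: sumr_ge0 => ? _]; exact: sqr_ge0.
have M0 := mom_const_ge0; have ZH : 0 <= Z * E (hess2 v u) := mulr_ge0 (ltW Z0) H0.
apply: le_of_sqr; first by rewrite !mulr_ge0// sqrtr_ge0.
apply: le_trans (E_CS pn1 ph) _.
rewrite !exprMn !sqr_sqrtr//.
have h1 : E (fun x => hsum u x ^+ 2) <= d%:R ^+ 2 * E (hess2 v u).
  rewrite -EZ//; apply: leE => [||x]; [exact: pgX|exact: pgZ|exact: hsum_sqr].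
have q0 : 0 <= E (fun x => (1 + n_ x) ^+ 2) by apply: E_ge0 => x; exact: sqr_ge0.
have q1 : 0 <= E (fun x => hsum u x ^+ 2) by apply: E_ge0 => x; exact: sqr_ge0.
apply: le_trans (ler_pM q0 q1 second_moment_d h1) _.
by rewrite le_eqVlt; apply/orP; left; apply/eqP; ring.
Qed.

Lemma frame_coords (i j : 'I_d) : (v i *m Ti) 0 j = (i == j)%:R.
Proof. by rewrite /frame -row_mul mulmxV// !mxE. Qed.

Definition coordf (p : V) (j : 'I_d) x : R := ((x - p) *m Ti) 0 j.

Lemma coordf_lip p j : lip (coordf p j).
Proof.
have [L hL] := gauge_lip Ti; exists (\sum_i `|Ti i j|) => x y.
rewrite /coordf -[_ - _](_ : ((x - y) *m Ti) 0 j = _); last first.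
  by rewrite (_ : x - y = (x - p) - (y - p)) ?mulmxBl ?mxE ?[(- _) _ _]mxE//; apply/rowP => k; rewrite !mxE; ring.
rewrite mxE; apply: le_trans (ler_norm_sum _ _ _) _; rewrite mulr_suml; apply: ler_sum => i _.
by rewrite normrM mulrC ler_wpM2l//; exact: coord_le_norm.
Qed.

Lemma coordf_rd p j i x : rd (coordf p j) (v i) x (i == j)%:R.
Proof.
move=> e e0; exists 1 => // t /andP[t0 _].
have ex : x + t *: v i - p = (x - p) + t *: v i by rewrite addrAC.
have e1 : coordf p j (x + t *: v i) = coordf p j x + t * (i == j)%:R.
  by rewrite /coordf ex mulmxDl -scalemxAl mxE [X in _ + X]mxE frame_coords.
rewrite e1; move: (coordf p j x) (_ * _%:R) => q r.
have -> : q + r - q - r = 0 by ring.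
by rewrite normr0 mulr_ge0// ltW.
Qed.

Lemma gauge_cen : gauge Ti (xs - cen xs T) <= 1.
Proof.
have r0 := @rad_gt0 R d'.
have -> : xs - cen xs T = - (\sum_i rad *: v i) by rewrite /cen opprD addrA subrr add0r.
rewrite gaugeN; apply: norm_rv_le => // j.
rewrite mulmx_suml summxE (bigD1 j)//= big1 ?addr0 => [|i ij]; last first.
  by rewrite -scalemxAl mxE frame_coords (negbTE ij) mulr0.
rewrite -scalemxAl mxE frame_coords eqxx mulr1 gtr0_norm// /rad invf_le1 ?mulr_gt0//.
by rewrite -natrM ler1n.
Qed.

(* The drift [V . grad phi] is controlled by [|V| (x - c) . grad phi], which integrates by parts. *)
Lemma drift_term u (mean : 'I_d -> R) : Sm 3 u -> (forall i, E (fun x => pd u (v i) x - mean i) = 0) ->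
  E (fun x => `|\sum_i (pd u (v i) x - mean i) * pd phi (v i) x|) <=
   4 * d%:R * ((1 + d%:R) * poin_const + 1) * E (fun x => (1 + n_ x) * hsum u x).
Proof.
move=> su Em.
have s2 i : Sm 2 (pd u (v i)) := Sm_pd (v i) su.
pose W i x := pd u (v i) x - mean i.
have sW i : Sm 2 (W i).
  have := SmD (s2 i) (Sm_cst 2 (- mean i)); exact.
have lW i : lip (W i) := Sm_lip (sW i).
have pdW i j x : pd (W i) (v j) x = pd (pd u (v i)) (v j) x.
  apply: rd_pd; have := rdD (Sm_diff (s2 i) x (v j)) (rd_cst (- mean i) (v j) x); by rewrite addr0.
pose B x := \sum_i `|W i x|.
have lB : lip B by apply: lip_sum => i; exact: lip_norm.
have B0 x : 0 <= B x by exact: sumr_ge0.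
have pB := pg_lip lB; have pW i := pg_lip (lW i).
have pphi i : pg (pd phi (v i)) := pg_lip (Sm_lip (Sm_pd (v i) sphi)).
have ph := hsum_pg su.
pose cc := cen xs T.
have pdc x : pd phi (x - cc) x = \sum_j coordf cc j x * pd phi (v j) x.
  by rewrite {1}(frame_coord TiT (x - cc)) (Sm_pd_lin lamT _ _ _ _ (Sm_leS sphi)).
have pcc j : pg (coordf cc j) := pg_lip (coordf_lip cc j).
have pS : pg (fun x => \sum_j coordf cc j x * pd phi (v j) x) by apply: pg_sum => j; exact: pgM.
have pWphi : pg (fun x => \sum_i W i x * pd phi (v i) x) by apply: pg_sum => i; exact: pgM.
have r0 := @rad_gt0 R d'.
have h1 : rad * E (fun x => `|\sum_i W i x * pd phi (v i) x|) <=
    E B + \sum_j E (fun x => B x * coordf cc j x * pd phi (v j) x).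
  rewrite -(EZ _ (pg_norm pWphi : pg (fun x => `|\sum_i W i x * pd phi (v i) x|))).
  rewrite -Esum; last by move=> j; apply: pgM => //; exact: pgM.
  have pS2 : pg (fun x => \sum_j B x * coordf cc j x * pd phi (v j) x).
    by apply: pg_sum => j; apply: pgM => //; exact: pgM.
  rewrite -ED//; apply: leE => [||x]; [by apply: pgZ; exact: pg_norm|exact: pgD|].
  apply: (@le_trans _ _ (B x * (rad * \sum_i `|pd phi (v i) x|))).
    rewrite mulrCA ler_pM2l//; apply: le_trans (ler_norm_sum _ _ _) _.
    rewrite mulr_sumr; apply: ler_sum => i _; rewrite normrM ler_wpM2r//.
    by rewrite /B (bigD1 i)//= lerDl sumr_ge0.
  apply: le_trans (ler_wpM2l (B0 x) (drift_bound cvx hm hxs hT lamT sphi x)) _.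
  rewrite mulrDr mulr1 lerD2l pdc mulr_sumr; apply: ler_sum => j _.
  by rewrite mulrA.
have pgs i : pg (gradsum T (pd u (v i))) := pg_lip (gradsum_lip T (Sm_leS (s2 i))).
have hB : E B <= poin_const * E (fun x => (1 + n_ x) * hsum u x).
  rewrite /B Esum; last by move=> i; exact: pg_norm.
  rewrite (@eqE _ _ phi (fun x => (1 + n_ x) * hsum u x) (fun x => \sum_i (1 + n_ x) * gradsum T (pd u (v i)) x)); last first.
    by move=> x; rewrite /hsum mulr_sumr.
  rewrite Esum; last by move=> i; exact: pgM.
  rewrite mulr_sumr; apply: ler_sum => i _.
  apply: le_trans (poincare_d (Sm_leS (sW i)) (Em i)) _.
  rewrite ler_wpM2l ?poin_const_ge0//; apply: leE => [||x].
  - by apply: pgM => //; exact: pg_lip (gradsum_lip T (Sm_leS (sW i))).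
  - exact: pgM.
  - suff -> : gradsum T (W i) x = gradsum T (pd u (v i)) x by [].
    by apply: eq_bigr => j _; rewrite pdW.
have hj : \sum_j E (fun x => B x * coordf cc j x * pd phi (v j) x) <=
    d%:R * E B + E (fun x => (1 + n_ x) * hsum u x).
  (* Integration by parts moves the derivative of phi onto B times the j-th coordinate, whose own
     derivative along v_j is 1. *)
  have e1 j : E (fun x => B x * coordf cc j x * pd phi (v j) x) =
      E B + E (fun x => coordf cc j x * pd B (v j) x).
    have := ibp N0 phiL c0 phiC (v j) dphi lB (coordf_lip cc j) => <-.
    rewrite ED; [|by apply: pgM => //; exact: (pg_pd (v j) (coordf_lip cc j))|by apply: pgM => //; exact: pg_pd].
    congr (_ + _); apply: eqE => x; rewrite (rd_pd (coordf_rd cc j j x)) eqxx mulr1//.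
  rewrite (eq_bigr _ (fun j _ => e1 j)) big_split/= sumr_const card_ord -[X in X + _ <= _]mulr_natl lerD2l.
  rewrite -Esum; last by move=> j; apply: pgM => //; exact: pg_pd.
  apply: leE_ae; [by apply: pg_sum => j; apply: pgM => //; exact: pg_pd|exact: pgM|].
  apply: ae_imp (ae_forall_count (fun j => dq_cvg_ae (v j) lB)) _ => x hx.
  (* B is a sum of absolute values and only Lipschitz; at almost every point its derivative is
     compared with those of [W i] through the difference quotients. *)
  have pdB j : `|pd B (v j) x| <= \sum_i `|pd (pd u (v i)) (v j) x|.
    have a1 : `|dq B (v j) n x| @[n --> \oo] --> `|pd B (v j) x| by exact: cvg_norm (hx j).
    have a2 i : `|dq (W i) (v j) n x| @[n --> \oo] --> `|pd (pd u (v i)) (v j) x|.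
      rewrite -pdW; apply: cvg_norm; apply: rd_dq; exact: Sm_diff (sW i) x (v j).
    have a3 : (\sum_i `|dq (W i) (v j) n x|) @[n --> \oo] --> \sum_i `|pd (pd u (v i)) (v j) x|.
      exact: cvg_sum_seq a2.
    apply: (cvg_seq_le a1 a3) => n.
    have -> : dq B (v j) n x = \sum_i n.+1%:R * (`|W i (x + n.+1%:R^-1 *: v j)| - `|W i x|).
      by rewrite /dq /B -sumrB mulr_sumr.
    apply: le_trans (ler_norm_sum _ _ _) _; apply: ler_sum => i _.
    by rewrite /dq !normrM ler_wpM2l//; exact: ler_dist_dist.
  have hc j : `|coordf cc j x| <= 1 + n_ x.
    have ec : x - cc = (x - xs) + (xs - cc) by rewrite addrA subrK.
    rewrite /coordf ec; apply: le_trans (coord_le_norm _ _) _.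
    apply: le_trans (gaugeD Ti (x - xs) (xs - cc)) _; rewrite [1 + _]addrC lerD2l; exact: gauge_cen.
  apply: (@le_trans _ _ (\sum_j (1 + n_ x) * \sum_i `|pd (pd u (v i)) (v j) x|)).
    apply: ler_sum => j _; apply: le_trans (ler_norm _) _; rewrite normrM.
    by apply: ler_pM.
  by rewrite -mulr_sumr exchange_big.
have k0 := poin_const_ge0.
set H := E (fun x => (1 + n_ x) * hsum u x) in hB hj *.
set X := E (fun x => `|\sum_i W i x * pd phi (v i) x|) in h1 *.
have h2 : rad * X <= ((1 + d%:R) * poin_const + 1) * H.
  have : (1 + d%:R) * E B <= (1 + d%:R) * (poin_const * H) by rewrite ler_wpM2l// addr_ge0.
  lra.
have h4 : (0 : R) <= 4 * d%:R by rewrite mulr_ge0.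
have := ler_wpM2l h4 h2; rewrite mulrA /rad divff ?mul1r ?mulrA// mulf_neq0//.
Qed.

(** The coefficients beta are determined by f and not by u, so u may vary with the tolerance e while
    the function to be estimated stays fixed. All constants that depend on phi multiply e and vanish
    in the limit; the remaining ones are dimensional. *)
Lemma reg_estimate f G (Mf : R) : Sm 1 f -> (forall x, `|f x| <= Mf) -> E f = 0 ->
  intg mu (fun x => G x * rho x) ->
  (forall x h, 2 * pd f h x - pd (pd phi h) h x <= G x) ->
  E (fun x => `|f x - \sum_i (Z^-1 * E (fun y => f y * coordf xs i y)) * pd phi (v i) x|) <=
    reg_const * Num.sqrt (Z * (E G - E (fun x => f x ^+ 2))).
Proof.
move=> sf fM Ef iG hG.
have pf := pg_lip (Sm_lip sf).
have pphi i : pg (pd phi (v i)) := pg_lip (Sm_lip (Sm_pd (v i) sphi)).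
have pc i : pg (coordf xs i) := pg_lip (coordf_lip xs i).
pose beta i := Z^-1 * E (fun y => f y * coordf xs i y).
pose A := fun x => `|f x - \sum_i beta i * pd phi (v i) x|.
have M0 := mom_const_ge0; have P0 := poin_const_ge0.
have d0 : (0 : R) <= d%:R by [].
have CP0 : 0 <= poin_const ^+ 2 * (mom_const * Z) * d%:R.
  exact: mulr_ge0 (mulr_ge0 (sqr_ge0 _) (mulr_ge0 M0 (ltW Z0))) d0.
have poin2 w : Sm 1 w -> E w = 0 -> E (fun x => `|w x|) ^+ 2 <=
    poin_const ^+ 2 * (mom_const * Z) * d%:R * \sum_i E (fun x => pd w (v i) x ^+ 2).
  move=> sw Ew; have pgw := pg_lip (gradsum_lip T sw).
  have h1 := poincare_d sw Ew.
  have e0 : 0 <= E (fun x => `|w x|) by apply: E_ge0.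
  have g0 := E_gradsum_ge0 T Ti xs phi w.
  apply: (@le_trans _ _ ((poin_const * E (fun x => (1 + n_ x) * gradsum T w x)) ^+ 2)).
    by apply: lerXn2r; rewrite ?nnegrE// mulr_ge0.
  have h2 : E (fun x => gradsum T w x ^+ 2) <= d%:R * \sum_i E (fun x => pd w (v i) x ^+ 2).
    have pi i : pg (fun x => pd w (v i) x ^+ 2) := pgX 2 (pg_lip (Sm_lip (Sm_pd (v i) sw))).
    rewrite -Esum// -EZ; last exact: pg_sum.
    apply: leE => [||x]; [exact: pgX|by apply: pgZ; exact: pg_sum|].
    apply: le_trans (sqr_sum_le _) _; rewrite ler_wpM2l//; apply: ler_sum => i _.
    by rewrite real_normK ?num_real.
  have q0 : 0 <= E (fun x => (1 + n_ x) ^+ 2) by apply: E_ge0 => x; exact: sqr_ge0.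
  have q1 : 0 <= E (fun x => gradsum T w x ^+ 2) by apply: E_ge0 => x; exact: sqr_ge0.
  have h3 := le_trans (E_CS pn1 pgw) (ler_pM q0 q1 second_moment_d h2).
  rewrite exprMn; apply: le_trans (ler_wpM2l (sqr_ge0 _) h3) _.
  by rewrite le_eqVlt; apply/orP; left; apply/eqP; ring.
pose D := E G - E (fun x => f x ^+ 2).
(* Collects the phi-dependent factor of the discrepancy between beta and the means of - grad u; in
   [key] it only multiplies e. *)
pose K := \sum_i (Z^-1 * Num.sqrt (E (fun x => coordf xs i x ^+ 2))) * E (fun x => `|pd phi (v i) x|).
pose Q := reg_const * Num.sqrt Z + Num.sqrt Z + K.
have K0 : 0 <= K.
  apply: sumr_ge0 => i _; apply: mulr_ge0; last by apply: E_ge0.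
  by rewrite mulr_ge0 ?sqrtr_ge0// invr_ge0 ltW.
have C0 : 0 <= reg_const.
  rewrite /reg_const !mulr_ge0 ?sqrtr_ge0// addr_ge0// !mulr_ge0// addr_ge0// mulr_ge0//.
have key e : 0 < e -> 0 <= D + e ^+ 2 /\ E A <= reg_const * Num.sqrt (Z * (D + e ^+ 2)) + (Num.sqrt Z + K) * e.
  move=> e0; have e2 : 0 < e ^+ 2 by rewrite exprn_gt0.
  have [u su hu] := density lamT N0 phiL c0 phiC sphi (v := v) (Sm_lip sf) fM Ef CP0 poin2 e2.
  have hess := dual_bound lamT N0 phiL c0 phiC sphi v su sf iG hG.
  have H0 : 0 <= E (hess2 v u).
    by apply: E_ge0 => x; do 2 ![apply: sumr_ge0 => ? _]; exact: sqr_ge0.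
  have HD : E (hess2 v u) <= D + e ^+ 2 by rewrite /D; lra.
  split; first exact: le_trans HD.
  have s2 i : Sm 2 (pd u (v i)) := Sm_pd (v i) su.
  have pu i : pg (pd u (v i)) := pg_lip (Sm_lip (s2 i)).
  have puu i : pg (pd (pd u (v i)) (v i)) := pg_lip (Sm_lip (Sm_pd (v i) (s2 i))).
  pose mean i := Z^-1 * E (pd u (v i)).
  have Em i : E (fun x => pd u (v i) x - mean i) = 0.
    exact: E_center Z0 (pu i).
  have pLu := L_pg sphi v (Sm_leS su).
  pose g x := f x - L u x.
  have pgg : pg g by exact: pgB.
  (* The splitting behind the estimate: residual, divergence of the centred gradient, its drift, and
     the discrepancy of the coefficients. *)
  have eA x : f x - \sum_i beta i * pd phi (v i) x = g x + \sum_i pd (pd u (v i)) (v i) x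
      - \sum_i (pd u (v i) x - mean i) * pd phi (v i) x - \sum_i (beta i + mean i) * pd phi (v i) x.
    rewrite /g /L -!addrA; congr (_ + _); rewrite -!sumrN -!big_split/=.
    by apply: eq_bigr => i _; ring.
  have pH : pg (fun x => \sum_i pd (pd u (v i)) (v i) x) by exact: pg_sum.
  have pW : pg (fun x => \sum_i (pd u (v i) x - mean i) * pd phi (v i) x).
    by apply: pg_sum => i; apply: pgM => //; apply: pgB => //; exact: pg_cst.
  have pE : pg (fun x => \sum_i (beta i + mean i) * pd phi (v i) x) by apply: pg_sum => i; exact: pgZ.
  have i1 : E A <= E (fun x => `|g x|) + E (hsum u) + E (fun x => `|\sum_i (pd u (v i) x - mean i) * pd phi (v i) x|)
      + \sum_i `|beta i + mean i| * E (fun x => `|pd phi (v i) x|).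
    have pAbs i : pg (fun x => `|beta i + mean i| * `|pd phi (v i) x|) by apply: pgZ; exact: pg_norm.
    have -> : \sum_i `|beta i + mean i| * E (fun x => `|pd phi (v i) x|) =
        E (fun x => \sum_i `|beta i + mean i| * `|pd phi (v i) x|).
      by rewrite Esum//; apply: eq_bigr => i _; rewrite EZ//; exact: pg_norm.
    have ph := hsum_pg su.
    have pg1 := pg_norm pgg; have pW1 := pg_norm pW; have pS : pg (fun x => \sum_i `|beta i + mean i| * `|pd phi (v i) x|) by exact: pg_sum.
    rewrite -ED// -ED; [|exact: pgD|by []].
    rewrite -ED; [|by do ?apply: pgD|by []].
    apply: leE => [||x]; [|by do ?apply: pgD|].
      by apply: pg_norm; apply: pgB => //; apply: pg_sum => i; exact: pgZ.
    rewrite /A eA; apply: le_trans (ler_normB _ _) _; apply: lerD.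
      apply: le_trans (ler_normB _ _) _; rewrite lerD2r; apply: le_trans (ler_normD _ _) _; rewrite lerD2l.
      apply: le_trans (ler_norm_sum _ _ _) _; rewrite /hsum; apply: ler_sum => i _.
      by rewrite /gradsum (bigD1 i)//= lerDl sumr_ge0.
    by apply: le_trans (ler_norm_sum _ _ _) _; apply: ler_sum => i _; rewrite normrM.
  have i2 : E (fun x => `|g x|) <= Num.sqrt Z * e.
    apply: le_of_sqr; first by rewrite mulr_ge0 ?sqrtr_ge0// ltW.
    rewrite exprMn sqr_sqrtr ?(ltW Z0)//; apply: le_trans (E_CS1 pgg) _.
    by rewrite ler_wpM2l// ltW.
  have i3 : E (hsum u) <= E (fun x => (1 + n_ x) * hsum u x).
    have ph := hsum_pg su; apply: leE => [||x]; [exact: ph|exact: pgM|].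
    by rewrite ler_peMl ?hsum_ge0// lerDl gauge_ge0.
  have i4 := drift_term su Em.
  have i5 := weighted_hsum su.
  (* Integrating the i-th coordinate against L u gives minus the integral of the i-th derivative of
     u, so beta + mean is a pairing of that coordinate with the residual. *)
  have i6 i : `|beta i + mean i| <= Z^-1 * Num.sqrt (E (fun x => coordf xs i x ^+ 2)) * e.
    have e1 : E (fun y => coordf xs i y * L u y) = - E (pd u (v i)).
      rewrite (E_L N0 phiL c0 phiC sphi v (Sm_leS su) (coordf_lip xs i)); congr (- _).
      rewrite (bigD1 i)//= [X in _ + X]big1 ?addr0 => [|j ji].
        by apply: eqE => x; rewrite (rd_pd (coordf_rd xs i i x)) eqxx mul1r.
      transitivity (E (fun=> 0)); last by rewrite Ecst mul0r.
      by apply: eqE => x; rewrite (rd_pd (coordf_rd xs i j x)) (negbTE ji) mul0r.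
    have -> : beta i + mean i = Z^-1 * E (fun x => g x * coordf xs i x).
      rewrite /beta /mean -mulrDr; congr (_ * _).
      rewrite -[E (pd u (v i))]opprK -e1 -EB; [|exact: pgM|exact: pgM].
      by apply: eqE => x; rewrite /g; ring.
    rewrite normrM gtr0_norm ?invr_gt0// -mulrA ler_pM2l ?invr_gt0//.
    have q0 : 0 <= E (fun x => coordf xs i x ^+ 2) by apply: E_ge0 => x; exact: sqr_ge0.
    apply: le_of_sqr; first by rewrite mulr_ge0 ?sqrtr_ge0// ltW.
    rewrite real_normK ?num_real// exprMn sqr_sqrtr//; apply: le_trans (E_CS pgg (pc i)) _.
    by rewrite mulrC ler_wpM2l.
  have i7 : \sum_i `|beta i + mean i| * E (fun x => `|pd phi (v i) x|) <= K * e.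
    rewrite /K mulr_suml; apply: ler_sum => i _; rewrite mulrAC ler_wpM2r//.
    by apply: E_ge0.
  have i8 : Num.sqrt (Z * E (hess2 v u)) <= Num.sqrt (Z * (D + e ^+ 2)).
    by rewrite ler_wsqrtr// ler_pM2l.
  set Y := E (fun x => (1 + n_ x) * hsum u x) in i3 i4 i5.
  set c4 := 4 * d%:R * ((1 + d%:R) * poin_const + 1) in i4.
  have c40 : 0 <= c4 by rewrite /c4 !mulr_ge0// addr_ge0// mulr_ge0//.
  have i9 : (1 + c4) * Y <= reg_const * Num.sqrt (Z * (D + e ^+ 2)).
    have s0 : 0 <= Num.sqrt mom_const * d%:R by rewrite mulr_ge0 ?sqrtr_ge0.
    apply: (@le_trans _ _ ((1 + c4) * (Num.sqrt mom_const * d%:R * Num.sqrt (Z * (D + e ^+ 2))))).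
      rewrite ler_wpM2l ?addr_ge0//; apply: le_trans i5 _; by rewrite ler_wpM2l.
    by rewrite /reg_const -/c4 le_eqVlt; apply/orP; left; apply/eqP; ring.
  lra.
(* The Brascamp-Lieb inequality itself: D + e^2 dominates an integral of squares for every positive
   e. *)
have D0 : 0 <= D.
  apply/ler_addgt0Pr => e e0; have se : 0 < Num.sqrt e by rewrite sqrtr_gt0.
  by have [+ _] := key _ se; rewrite sqr_sqrtr// ltW.
apply/ler_addgt0Pr => e e0; rewrite -/D.
have Q0 : 0 <= Q by exact: addr_ge0 (addr_ge0 (mulr_ge0 C0 (sqrtr_ge0 _)) (sqrtr_ge0 _)) K0.
have Q1 : 0 < Q + 1 by lra.
have t0 : 0 < e / (Q + 1) by rewrite divr_gt0.
have [_ h] := key _ t0; set t := e / (Q + 1) in t0 h.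
apply: le_trans h _.
have h1 : Num.sqrt (Z * (D + t ^+ 2)) <= Num.sqrt (Z * D) + Num.sqrt Z * t.
  have ZD : 0 <= Z * D by rewrite mulr_ge0// ltW.
  have s1 : 0 <= Num.sqrt Z * t by rewrite mulr_ge0 ?sqrtr_ge0// ltW.
  apply: le_of_sqr; first by rewrite addr_ge0// sqrtr_ge0.
  rewrite sqr_sqrtr; last by rewrite mulr_ge0 ?(ltW Z0)// addr_ge0// sqr_ge0.
  rewrite sqrrD [(Num.sqrt Z * t) ^+ 2]exprMn (sqr_sqrtr ZD) (sqr_sqrtr (ltW Z0)) mulrDr -addrA lerD2l lerDr.
  by rewrite mulrn_wge0// mulr_ge0 ?sqrtr_ge0.
have h2 : Q * t <= e.
  apply: (@le_trans _ _ ((Q + 1) * t)); first by rewrite ler_pM2r//; lra.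
  by rewrite /t mulrCA divff ?mulr1// gt_eqF.
have := ler_wpM2l C0 h1; move: h2; rewrite /Q; lra.
Qed.

End position.

(** The adapted frame is eliminated: since f - b has mean zero, xs drops out of the frame
    coordinates, and the slope becomes the covariance vector of f and x, which can be followed
    through the later limits. *)
Theorem regular_stability f G (Mf b : R) (a : V) : Sm 1 f -> (forall x, `|f x| <= Mf) ->
  intg mu (fun x => G x * rho x) ->
  (forall x h, 2 * pd f h x - pd (pd phi h) h x <= G x) ->
  b = Z^-1 * E f -> a = \row_k (Z^-1 * E (fun x => (f x - b) * x 0 k)) ->
  E (fun x => `|f x - b - pd phi a x|) <=
    reg_const * Num.sqrt (Z * (E G - (E (fun x => f x ^+ 2) - Z^-1 * E f ^+ 2))).
Proof.
move=> sf fM iG hG eb ea.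
have [m [xs [T [hm hxs uT hT hg]]]] := normal_position N0 phiL c0 phiC.
have [l hl] := gauge_ball_finite uT.
have Z0 : 0 < Z := E1_gt0 phiL c0 phiC lamT.
pose f0 x := f x - b.
have sf0 : Sm 1 f0 by have := SmD sf (Sm_cst 1 (- b)); exact.
have pf := pg_lip (Sm_lip sf); have pf0 := pg_lip (Sm_lip sf0).
have Ef0 : E f0 = 0.
  by rewrite /f0 eb; exact: E_center Z0 pf.
have f0M x : `|f0 x| <= Mf + `|b| by apply: le_trans (ler_normB _ _) _; rewrite lerD2r.
have hG0 x h : 2 * pd f0 h x - pd (pd phi h) h x <= G x.
  have -> : pd f0 h x = pd f h x; last exact: hG.
  by apply: rd_pd; have := rdD (Sm_diff sf x h) (rd_cst (- b) h x); rewrite addr0.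
have := reg_estimate hm hxs uT hT hg hl sf0 f0M Ef0 iG hG0.
have -> : E (fun x => f0 x ^+ 2) = E (fun x => f x ^+ 2) - Z^-1 * E f ^+ 2.
  rewrite (@eqE _ _ phi _ (fun x => f x ^+ 2 - 2 * b * f x + b ^+ 2)); last by move=> x; rewrite /f0; ring.
  rewrite ED; [|by apply: pgB; [exact: pgX|exact: pgZ]|exact: pg_cst].
  rewrite EB; [|exact: pgX|exact: pgZ].
  rewrite EZ// Ecst -/Z eb; field; rewrite gt_eqF//.
suff -> : E (fun x => `|f0 x - \sum_i Z^-1 * E (fun y => f0 y * coordf T xs i y) * pd phi (frame T i) x|) =
  E (fun x => `|f x - b - pd phi a x|) by [].
apply: eqE => x; congr (`|_ - _|).
rewrite {1}(frame_coord (mulVmx uT) a) (Sm_pd_lin lamT _ _ _ _ (Sm_leS sphi)).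
apply: eq_bigr => i _; congr (_ * _).
have lk k : lip (fun y : V => y 0 k).
  by exists 1 => y z; rewrite mul1r; have := coord_le_norm (y - z) k; rewrite !mxE.
have pk k : pg (fun y : V => f0 y * y 0 k) by apply: pgM => //; exact: pg_lip.
rewrite mxE ea (eq_bigr (fun k => Z^-1 * E (fun y => invmx T k i * (f0 y * y 0 k)))); last first.
  by move=> k _; rewrite mxE EZ//; ring.
rewrite -mulr_sumr -Esum; last by move=> k; exact: pgZ.
congr (_ * _).
rewrite (@eqE _ _ phi (fun y => f0 y * coordf T xs i y) (fun y => (\sum_k invmx T k i * (f0 y * y 0 k)) - (xs *m invmx T) 0 i * f0 y)).
  rewrite EB; [|by apply: pg_sum => k; exact: pgZ|exact: pgZ].
  by rewrite EZ// Ef0 mulr0 subr0.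
move=> y; rewrite /coordf mulmxBl mxE [X in _ + X]mxE mulrBr [X in _ - X]mulrC; congr (_ - _).
by rewrite mxE mulr_sumr; apply: eq_bigr => k _; ring.
Qed.

End regular.

(** * Lipschitz potentials *)

Section lipschitz_stage.
Context {R : realType} {d' : nat}.
Local Notation d := d'.+1.
Local Notation V := 'rV[R]_d.
Local Notation mu := (@lam R d').
Implicit Types (f F G w : V -> R) (x y h : V).
Hypothesis lamT : (0 < lam [set: V])%E.

(** Symmetric second difference quotient: linear in phi, nonnegative for convex phi, and commuting
    with convolution, which is what is needed where phi is not twice differentiable. *)
Definition D2 (phi : V -> R) h (n : nat) x : R :=
  n.+1%:R ^+ 2 * (phi (x + n.+1%:R^-1 *: h) + phi (x - n.+1%:R^-1 *: h) - 2 * phi x).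

Definition ratv (p : nat * 'rV[int]_d) : V := p.1.+1%:R^-1 *: map_mx intr p.2.

Lemma ratv_dense h (e : R) : 0 < e -> exists p, `|ratv p - h| <= e.
Proof.
move=> e0; pose n := Num.trunc e^-1.
have n0 : 0 < n.+1%:R :> R by [].
have ne : n.+1%:R^-1 <= e.
  by rewrite -[leRHS]invrK lef_pV2 ?posrE ?invr_gt0//; exact/ltW/truncnS_gt.
exists (n, \row_i Num.floor (n.+1%:R * h 0 i)); apply: norm_rv_le; first exact: ltW.
move=> i; rewrite /ratv !mxE/=.
have /andP[h1 h2] := floor_itv (n.+1%:R * h 0 i).
move: h1 h2; rewrite intrD1; set q := _%:~R => h1 h2.
have -> : n.+1%:R^-1 * q - h 0 i = n.+1%:R^-1 * (q - n.+1%:R * h 0 i).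
  by rewrite mulrBr mulrA mulVf ?mul1r// gt_eqF.
rewrite normrM ger0_norm ?invr_ge0//; apply: le_trans _ ne.
rewrite ler_piMr ?invr_ge0// ler_norml; apply/andP; split; lra.
Qed.

Lemma Sm_D2_cvg f h x : Sm 2 f -> D2 f h n x @[n --> \oo] --> pd (pd f h) h x.
Proof.
move=> sf; have sh : Sm 1 (pd f h) := Sm_pd h sf.
have [L L0 hL] := lip_ge0 (Sm_pd h sh : lip _).
apply/subr_cvg0/norm_cvg0P.
apply: (squeeze_cvgr (f := fun=> 0) (h := fun n => L * `|h| * n.+1%:R^-1)).
- apply: nearW => n; rewrite normr_ge0/=.
  pose t : R := n.+1%:R^-1; have t0 : 0 < t by rewrite invr_gt0.
  have s1 := Sm_leS sf.
  have sg : Sm 1 (fun y => f y + -1 * f (y + - (t *: h))).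
    by apply: SmD => //; apply: SmZ; exact: Sm_shift.
  have [c /andP[c0 c1]] := Sm_mvt lamT x (t *: h) sg.
  rewrite (Sm_pdZ lamT _ _ _ sg) pdD; [|exact: Sm_diff s1|exact: Sm_diff (SmZ _ (Sm_shift _ s1))].
  rewrite pdZ; last exact: Sm_diff (Sm_shift _ s1).
  rewrite pd_shift addrK => e1.
  have [c' /andP[c'0 c'1]] := Sm_mvt lamT (x + c *: (t *: h) + - (t *: h)) (t *: h) sh.
  rewrite subrK (Sm_pdZ lamT _ _ _ sh) => e2.
  set P := pd (pd f h) h _ in e2.
  have -> : D2 f h n x = P.
    rewrite /D2 -/t; move: e1 e2; set a := f (x + t *: h); set b := f (x - t *: h); set q := f x.
    move: (pd f h _) (pd f h _) => u w e1 e2.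
    have -> : a + b - 2 * q = t * (t * P) by rewrite -e2; move: e1; lra.
    have q0 : (n.+1%:R : R) != 0 by rewrite pnatr_eq0.
    by rewrite mulrA [_ * t]mulrC expr2 !mulrA /t mulVf// mul1r divff// mul1r.
  apply: le_trans (hL _ _) _; rewrite -mulrA ler_wpM2l//.
  have -> : x + c *: (t *: h) + - (t *: h) + c' *: (t *: h) - x = (c + c' - 1) *: (t *: h).
    by apply/rowP => i; rewrite !mxE; ring.
  rewrite !normrZ (gtr0_norm t0) -/t [`|h| * t]mulrC ler_piMl ?mulr_ge0 ?(ltW t0)//.
  by rewrite ler_norml; apply/andP; split; lra.
- exact: cvg_cst.
- rewrite -[X in _ --> X](mulr0 (L * `|h|)); apply: cvgMr; exact: cvg_harmonic.
Qed.

Variable phi : V -> R.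
Variables N c C : R.
Hypothesis N0 : 0 <= N.
Hypothesis phiL : forall x y, `|phi x - phi y| <= N * `|x - y|.
Hypothesis c0 : 0 < c.
Hypothesis phiC : forall x, c * `|x| - C <= phi x.
Hypothesis cvx : forall x y (t : R), 0 <= t <= 1 -> phi ((1 - t) *: x + t *: y) <= (1 - t) * phi x + t * phi y.

Section one_mollification.
Variables (k : V -> R) (s M Lk : R).
Hypothesis s0 : 0 < s.
Hypothesis s1 : s <= 1.
Hypothesis kk : kernel k s M.
Hypothesis kL : forall x y, `|k x - k y| <= Lk * `|x - y|.
Hypothesis k1 : rint mu k = 1.
Local Notation K := (conv k).
Let Kpg G : pg G -> pg (K G) := @conv_pg' _ _ k s M s0 kk G.

Lemma moll2_near F (L : R) x : (forall x y, `|F x - F y| <= L * `|x - y|) -> 0 <= L ->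
  `|K (K F) x - F x| <= 2 * L * s.
Proof.
move=> FL L0; have h1 := moll_near kk k1 x FL L0.
have h2 := moll_near kk k1 x (moll_lipL kk k1 FL) L0.
have := ler_normD (K (K F) x - K F x) (K F x - F x); rewrite addrA subrK; lra.
Qed.

Lemma moll_convex F : pg F ->
  (forall x y (t : R), 0 <= t <= 1 -> F ((1 - t) *: x + t *: y) <= (1 - t) * F x + t * F y) ->
  (forall x y (t : R), 0 <= t <= 1 -> K F ((1 - t) *: x + t *: y) <= (1 - t) * K F x + t * K F y).
Proof.
move=> pF cF x y t ht.
have i1 z := conv_intg kk z pF.
rewrite !conv_rint -(rintZ _ (i1 x)) -(rintZ _ (i1 y)) -(rintD (intgZ _ (i1 x)) (intgZ _ (i1 y))).
apply: rint_le; [exact: i1|exact: intgD (intgZ _ (i1 x)) (intgZ _ (i1 y))|move=> z].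
rewrite !mulrA -mulrDl ler_wpM2r ?(k_ge0 kk)//.
have := cF (x + z) (y + z) t ht; congr (F _ <= _).
by apply/rowP => i; rewrite !mxE; ring.
Qed.

Lemma moll_bounds F (a b : R) x : pg F -> (forall y, a <= F y <= b) -> a <= K F x <= b.
Proof.
move=> pF h; rewrite -[a](moll_const kk k1 a x) -[X in _ <= _ <= X](moll_const kk k1 b x).
apply/andP; split; apply: (conv_le kk) => //; try exact: pg_cst.
  by move=> y _; have /andP[] := h y.
by move=> y _; have /andP[] := h y.
Qed.

End one_mollification.

Lemma conv_D2 k s M h n x F : 0 < s -> kernel k s M -> pg F -> conv k (D2 F h n) x = D2 (conv k F) h n x.
Proof.
move=> s0 kk pF.
have p1 := pg_shift (n.+1%:R^-1 *: h) pF; have p2 := pg_shift (- (n.+1%:R^-1 *: h)) pF.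
rewrite /D2 (convZ kk); last by apply: pgB; [exact: pgD|exact: pgZ].
rewrite (convB kk); [|exact: pgD|exact: pgZ].
by rewrite (convD kk)// (convZ kk)// !conv_shift.
Qed.

Lemma convex_D2_ge0 F h n x :
  (forall x y (t : R), 0 <= t <= 1 -> F ((1 - t) *: x + t *: y) <= (1 - t) * F x + t * F y) ->
  0 <= D2 F h n x.
Proof.
move=> cF; rewrite /D2 mulr_ge0 ?sqr_ge0//.
have ht : (0 : R) <= (2^-1 : R) <= (1 : R) by rewrite invr_ge0 invf_le1// ?ler0n ?ltr0n// ler1n.
have := cF (x + n.+1%:R^-1 *: h) (x - n.+1%:R^-1 *: h) 2^-1 ht.
have -> : (1 - 2^-1) *: (x + n.+1%:R^-1 *: h) + 2^-1 *: (x - n.+1%:R^-1 *: h) = x.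
  by move: (n.+1%:R^-1 *: h) => v; apply/rowP => i; rewrite !mxE; field.
lra.
Qed.

Variables (f G : V -> R) (Mf MG : R).
Hypothesis lf : lip f.
Hypothesis fM : forall x, `|f x| <= Mf.
Hypothesis mG : measurable_fun setT G.
Hypothesis GM : forall x, 0 <= G x <= MG.
(** The Legendre bound with the second derivative of phi replaced by second difference quotients for
    large n, along countably many directions; in this form it makes sense for a Lipschitz phi. *)
Hypothesis hG : forall p, {ae mu, forall x, forall e : R, 0 < e ->
  exists n0, forall n, (n0 <= n)%N -> 2 * pd f (ratv p) x - G x - e <= D2 phi (ratv p) n x}.

Let pG : pg G.
Proof. by apply: (pg_bounded mG (M := MG)) => x; have /andP[h1 h2] := GM x; rewrite ger0_norm. Qed.
Let pphi : pg phi. Proof. by apply: pg_lip; exists N. Qed.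
Let lphi : lip phi. Proof. by exists N. Qed.

Section mollified.
Variables (k : V -> R) (s M Lk : R).
Hypothesis s0 : 0 < s.
Hypothesis s1 : s <= 1.
Hypothesis kk : kernel k s M.
Hypothesis kL : forall x y, `|k x - k y| <= Lk * `|x - y|.
Hypothesis k1 : rint mu k = 1.
Local Notation K := (conv k).
Let Kpg F : pg F -> pg (K F) := @conv_pg' _ _ k s M s0 kk F.

Lemma moll2_Sm F : lip F -> Sm 2 (K (K F)).
Proof. by move=> lF; apply: (moll_Sm s1 kk kL k1); apply: (moll_Sm s1 kk kL k1 (lF : Sm 0 F)). Qed.

Lemma conv_cvg (F_ : nat -> V -> R) F (B : R) x : (forall n, measurable_fun setT (F_ n)) ->
  measurable_fun setT F -> (forall n y, `|F_ n y| <= B) -> {ae mu, forall y, F_ n y @[n --> \oo] --> F y} ->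
  K (F_ n) x @[n --> \oo] --> K F x.
Proof.
move=> mF_ mF hB h.
have msh (F' : V -> R) : measurable_fun setT F' -> measurable_fun setT (fun y => F' (x + y)).
  move=> mF'; rewrite (_ : (fun y => _) = (fun y => F' (y + x))); last by apply/funext => y; rewrite addrC.
  by apply: (measurableT_comp mF'); exact: measurable_fun_addv.
have ki : intg mu (fun y => B * k y) := conv_intg kk x (pg_cst B).
rewrite conv_rint (_ : (fun n => _) = (fun n => rint mu (fun y => F_ n (x + y) * k y))); last first.
  by apply/funext => n; rewrite conv_rint.
have [||||_ +] := @rint_dct _ _ _ mu (fun n y => F_ n (x + y) * k y) (fun y => F (x + y) * k y) _ _ _ _ ki _.
- by move=> n; apply: measurable_funM; [exact: msh|exact: k_meas kk].
- by apply: measurable_funM; [exact: msh|exact: k_meas kk].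
- apply: ae_imp (ae_shift x h) _ => y; rewrite addrC => hy; exact: cvgMl.
- by move=> n y; rewrite normrM (ger0_norm (k_ge0 kk y)) ler_wpM2r ?(k_ge0 kk).
exact.
Qed.

(** Since phi is convex, [D2] is nonnegative, so the amount [F n] by which the inequality fails at
    step n is bounded by 2 L |h|. It tends to 0 almost everywhere, hence also after two
    convolutions. Singular second derivatives of phi are nonnegative and only help. *)
Lemma moll_hess_rat p x : 2 * pd (K (K f)) (ratv p) x - pd (pd (K (K phi)) (ratv p)) (ratv p) x <= K (K G) x.
Proof.
set h := ratv p; have [L L0 fL] := lip_ge0 lf.
pose T y := 2 * pd f h y - G y.
have mT : measurable_fun setT T.
  by apply: measurable_funB => //; apply: measurable_funM => //; apply: pd_measurable; exact: lip_measurable.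
have ppd := pg_pd h lf; have p2 : pg (fun y => 2 * pd f h y) := pgZ 2 ppd.
have pT : pg T by exact: pgB.
pose F n y := Num.max 0 (T y - D2 phi h n y).
have pD n : pg (D2 phi h n).
  apply: pgZ; apply: pgB; last exact: pgZ.
  by apply: pgD; exact: pg_shift.
have mF n : measurable_fun setT (F n).
  by apply: measurable_maxr => //; apply: measurable_funB => //; exact: pg_meas.
pose B := 2 * (L * `|h|).
have FB n y : `|F n y| <= B.
  have D0 := convex_D2_ge0 h n y cvx.
  have B0 : 0 <= B by rewrite mulr_ge0// mulr_ge0.
  rewrite ger0_norm ?le_max ?lexx// /F ge_max B0/= /T.
  have /andP[g0 _] := GM y; have := pd_bound h y fL; have := ler_norm (pd f h y); rewrite /B; lra.
have Fc : {ae mu, forall y, F n y @[n --> \oo] --> (0 : R)}.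
  apply: ae_imp (hG p) _ => y hy; apply/cvgrPdist_le => e e0.
  have [n0 hn0] := hy e e0; exists n0 => // n /= nn.
  have := hn0 n nn; rewrite -/h => h1; rewrite sub0r normrN ger0_norm ?le_max ?lexx//.
  by rewrite /F ge_max (ltW e0)/= /T; lra.
have B0 : 0 <= B by rewrite mulr_ge0// mulr_ge0.
have pF n : pg (F n) := pg_bounded (mF n) (FB n).
have KFB n y : `|K (F n) y| <= B.
  apply: le_trans (conv_norm kk y (pF n)) _; rewrite -[leRHS](moll_const kk k1 B y).
  by apply: (conv_le kk (pg_norm (pF n)) (pg_cst B)) => z _; exact: FB.
have z0 : K (fun=> 0) = fun=> 0 :> R by apply/funext => y; rewrite (moll_const kk k1).
have c1 y : K (F n) y @[n --> \oo] --> (0 : R).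
  have := conv_cvg (x := y) mF (measurable_cst _) FB Fc; by rewrite (moll_const kk k1).
have c2 : K (K (F n)) x @[n --> \oo] --> (0 : R).
  have := @conv_cvg (fun n => K (F n)) (fun=> 0) B x (fun n => pg_meas (Kpg (pF n))) (measurable_cst _) KFB (@aeW _ _ _ mu _ c1).
  by rewrite (moll_const kk k1).
have s2 := moll2_Sm lphi.
have c3 := Sm_D2_cvg (h := h) (x := x) s2.
have lKf := moll_lip kk k1 lf.
have eT : K (K T) x = 2 * pd (K (K f)) h x - K (K G) x.
  have -> : K T = fun y => 2 * K (pd f h) y - K G y.
    by apply/funext => y; rewrite (convB kk y p2 pG) (convZ kk _ y ppd).
  rewrite (convB kk x (pgZ 2 (Kpg ppd)) (Kpg pG)) (convZ kk _ x (Kpg ppd)).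
  by rewrite (pd_moll kk k1)// (pd_moll kk k1).
have le n : K (K T) x <= D2 (K (K phi)) h n x + K (K (F n)) x.
  have -> : D2 (K (K phi)) h n x = K (K (D2 phi h n)) x.
    rewrite -(conv_D2 h n x s0 kk (Kpg pphi)); congr (conv k _ x); apply/funext => y.
    by rewrite (conv_D2 h n y s0 kk pphi).
  rewrite -(convD kk x (Kpg (pD n)) (Kpg (pF n))).
  apply: (conv_le kk (Kpg pT) (pgD (Kpg (pD n)) (Kpg (pF n)))) => y _.
  rewrite -(convD kk y (pD n) (pF n)).
  apply: (conv_le kk pT (pgD (pD n) (pF n))) => z _.
  have : T z - D2 phi h n z <= F n z by rewrite /F le_max lexx orbT.
  lra.
have := cvg_seq_le (cvg_cst (K (K T) x)) (cvgD c3 c2) le.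
move=> hh; have := hh _ _; rewrite eT addr0; set u1 := pd _ _ _; set u2 := pd _ _ _; set u3 := K (K G) x.
by move=> h1; rewrite lerBlDr -lerBlDl; exact: h1.
Qed.

(** After mollification both sides are continuous in the direction h, so the dense set of directions
    [ratv] suffices. *)
Lemma moll_hess x h : 2 * pd (K (K f)) h x - pd (pd (K (K phi)) h) h x <= K (K G) x.
Proof.
have sf := moll2_Sm lf; have sphi := moll2_Sm lphi.
have sf1 : Sm 1 (K (K f)) := Sm_leS sf; have sp1 : Sm 1 (K (K phi)) := Sm_leS sphi.
pose g i j := pd (pd (K (K phi)) (evec i)) (evec j) x.
have quad (w : V) : pd (pd (K (K phi)) w) w x = \sum_i \sum_j w 0 i * w 0 j * g i j.
  have ew : w = \sum_i w 0 i *: evec i by rewrite -row_sum_delta.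
  have e1 : pd (K (K phi)) w = (fun y => \sum_i w 0 i * pd (K (K phi)) (evec i) y).
    by apply/funext => y; rewrite {1}ew (Sm_pd_lin lamT _ _ _ _ sp1).
  rewrite e1 pd_sum; last by move=> i; exact: Sm_diff (SmZ _ (Sm_pd (evec i) sphi)).
  apply: eq_bigr => i _; rewrite pdZ; last exact: Sm_diff (Sm_pd (evec i) sphi : Sm 1 _).
  have -> : pd (pd (K (K phi)) (evec i)) w x = \sum_j w 0 j * g i j.
    by rewrite {1}ew (Sm_pd_lin lamT _ _ _ _ (Sm_pd (evec i) sphi : Sm 1 _)).
  rewrite mulr_sumr.
  by apply: eq_bigr => j _; rewrite mulrA.
have [p hp] := choice (fun n : nat => @ratv_dense h n.+1%:R^-1 ltac:(by rewrite invr_gt0)).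
have cc i : ratv (p n) 0 i @[n --> \oo] --> h 0 i.
  apply/subr_cvg0/norm_cvg0P; apply: (squeeze_cvgr (f := fun=> 0) (h := fun n => n.+1%:R^-1)).
  - apply: nearW => n; rewrite normr_ge0/=; have := coord_le_norm (ratv (p n) - h) i.
    by rewrite !mxE => h1; exact: le_trans h1 (hp n).
  - exact: cvg_cst.
  - exact: cvg_harmonic.
have q1 : pd (K (K f)) (ratv (p n)) x @[n --> \oo] --> pd (K (K f)) h x.
  rewrite (Sm_pd_dotv lamT _ _ sf1) (_ : (fun n => _) = (fun n => \sum_i gpd (K (K f)) x 0 i * ratv (p n) 0 i)); last first.
    by apply/funext => n; rewrite (Sm_pd_dotv lamT _ _ sf1).
  by apply: cvg_sum_seq => i; apply: cvgMr.
have q2 : pd (pd (K (K phi)) (ratv (p n))) (ratv (p n)) x @[n --> \oo] --> pd (pd (K (K phi)) h) h x.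
  rewrite quad (_ : (fun n => _) = (fun n => \sum_i \sum_j ratv (p n) 0 i * ratv (p n) 0 j * g i j)); last first.
    by apply/funext => n; rewrite quad.
  by apply: cvg_sum_seq => i; apply: cvg_sum_seq => j; apply: cvgMl; apply: cvgM.
have q3 : 2 * pd (K (K f)) (ratv (p n)) x @[n --> \oo] --> 2 * pd (K (K f)) h x by exact: cvgMr.
have := cvg_seq_le (cvgB q3 q2) (cvg_cst (K (K G) x)) (fun n => moll_hess_rat (p n) x).
exact.
Qed.

End mollified.


Lemma reg_const_ge0 : 0 <= @reg_const R d'.
Proof.
rewrite /reg_const !mulr_ge0 ?sqrtr_ge0// addr_ge0// !mulr_ge0// addr_ge0// mulr_ge0//.
exact: poin_const_ge0.
Qed.

Section limits.
Variables (p_ : nat -> V -> R) (s_ : nat -> R).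
Hypothesis s_0 : s_ n @[n --> \oo] --> (0 : R).
Hypothesis s_01 : forall n, 0 <= s_ n <= 1.
Hypothesis p_L : forall n x y, `|p_ n x - p_ n y| <= N * `|x - y|.
Hypothesis p_near : forall n x, `|p_ n x - phi x| <= 2 * N * s_ n.

Lemma near_coercive n x : c * `|x| - (C + 2 * N) <= p_ n x.
Proof.
have /andP[s0 s1] := s_01 n; have h1 : N * s_ n <= N by rewrite ler_piMr.
have := p_near n x; have := phiC x; rewrite ler_norml => h2 /andP[h3 _]; lra.
Qed.

Lemma near_rho n x : rho (p_ n) x <= expR (2 * N * s_ n) * rho phi x.
Proof.
have := p_near n x; rewrite ler_norml => /andP[h3 _].
by rewrite /rho -expRD ler_expR; lra.
Qed.

Lemma near_rho_cvg x : rho (p_ n) x @[n --> \oo] --> rho phi x.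
Proof.
suff h : - p_ n x @[n --> \oo] --> - phi x by apply: (cvg_comp _ _ h); exact: continuous_expR.
apply: cvgN; apply/subr_cvg0/norm_cvg0P.
apply: (squeeze_cvgr (f := fun=> 0) (h := fun n => 2 * N * s_ n)).
- by apply: nearW => n; rewrite normr_ge0 p_near.
- exact: cvg_cst.
- by rewrite -[X in _ --> X](mulr0 (2 * N)); exact: cvgMr.
Qed.

Lemma near_E_cvg (F_ : nat -> V -> R) F H : (forall n, pg (F_ n)) -> pg F -> pg H ->
  (forall n x, `|F_ n x| <= H x) -> (forall x, F_ n x @[n --> \oo] --> F x) ->
  E (p_ n) (F_ n) @[n --> \oo] --> E phi F.
Proof.
move=> pF_ pF pH FH Fc.
rewrite E_rint (_ : (fun n => _) = (fun n => rint mu (fun x => F_ n x * rho (p_ n) x))); last first.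
  by apply/funext => n; rewrite E_rint.
have gi := intgZ (expR (2 * N)) (pgi phiL c0 phiC pH).
have [||||_ +] := @rint_dct _ _ _ mu (fun n x => F_ n x * rho (p_ n) x) (fun x => F x * rho phi x) _ _ _ _ gi _.
- by move=> n; apply: measurable_funM; [exact: pg_meas|exact: rho_meas (p_L n)].
- by apply: measurable_funM; [exact: pg_meas|exact: rho_meas phiL].
- by apply: (@aeW _ _ _ mu _ _) => x; apply: cvgM; [exact: Fc|exact: near_rho_cvg].
- move=> n x; rewrite normrM (ger0_norm (rho_ge0 _ x)).
  have /andP[s0 s1] := s_01 n; have h1 : 2 * N * s_ n <= 2 * N by rewrite ler_piMr// mulr_ge0.
  have h2 : rho (p_ n) x <= expR (2 * N) * rho phi x.
    by apply: le_trans (near_rho n x) _; rewrite ler_wpM2r ?rho_ge0// ler_expR.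
  rewrite mulrCA; apply: ler_pM (FH n x) h2; [exact: normr_ge0|exact: rho_ge0].
exact.
Qed.

Hypothesis p_S : forall n, Sm 2 (p_ n).
Hypothesis p_cvx : forall n x y (t : R), 0 <= t <= 1 ->
  p_ n ((1 - t) *: x + t *: y) <= (1 - t) * p_ n x + t * p_ n y.

(* By convexity p_n lies above its tangents, so difference quotients of phi at x bound pd p_n x. *)
Lemma near_pd_cvg g v x : has_grad phi x g -> pd (p_ n) v x @[n --> \oo] --> dotv g v.
Proof.
move=> hg; apply/cvgrPdist_le => e e0.
pose e1 := e / (2 * (`|v| + 1)).
have v1 : 0 < `|v| + 1 by rewrite ltr_pwDr.
have e10 : 0 < e1 by rewrite divr_gt0// mulr_gt0.
have [dl dl0 hd] := hg e1 e10.
pose t := dl / (2 * (`|v| + 1)).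
have t0 : 0 < t by rewrite divr_gt0// mulr_gt0.
have tv : t * `|v| < dl.
  rewrite /t mulrAC ltr_pdivrMr ?mulr_gt0// ltr_pM2l//; have := normr_ge0 v; lra.
have ev : e1 * `|v| <= e / 2.
  rewrite /e1 mulrAC ler_pdivrMr ?mulr_gt0//.
  have -> : e / 2 * (2 * (`|v| + 1)) = e * (`|v| + 1) by field.
  by rewrite ler_wpM2l// ?(ltW e0)// lerDl.
have one (w : V) n : `|w| = `|v| -> pd (p_ n) w x <= dotv g w + e / 2 + 4 * N * s_ n / t.
  move=> ew; have ht := convex_tangent (p_cvx n) (p_S n) x (t *: w).
  rewrite (Sm_pdZ lamT _ _ _ (Sm_leS (p_S n))) in ht.
  have := hd (t *: w); rewrite normrZ (gtr0_norm t0) ew => /(_ tv).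
  have -> : dotv g (t *: w) = t * dotv g w.
    by rewrite /dotv mulr_sumr; apply: eq_bigr => i _; rewrite mxE mulrCA.
  have h1 := p_near n x; have h2 := p_near n (x + t *: w).
  move: h1 h2; rewrite !ler_norml => /andP[h1 h1'] /andP[h2 h2'] /andP[h3 h3'].
  have h4 : t * (e1 * `|v|) <= t * (e / 2) by rewrite ler_wpM2l// ltW.
  rewrite -(ler_pM2l t0) !mulrDr [t * (_ / t)]mulrC divfK ?gt_eqF//; lra.
have st0 : 4 * N / t * s_ n @[n --> \oo] --> (0 : R).
  by rewrite -[X in _ --> X](mulr0 (4 * N / t)); exact: cvgMr.
have e20 : 0 < e / 2 by rewrite divr_gt0.
move/cvgrPdist_le: st0 => /(_ _ e20) [n0 _ hn0].
exists n0 => // n /= nn; have := hn0 n nn; rewrite sub0r normrN => /(le_trans (ler_norm _)).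
rewrite mulrAC => hs.
have := one v n erefl; have := one (- v) n (normrN v).
rewrite -scaleN1r (Sm_pdZ lamT _ _ _ (Sm_leS (p_S n))) dotvZr.
move: (4 * N * s_ n / t) hs => q hs h1 h2.
by rewrite ler_norml; apply/andP; split; lra.
Qed.

End limits.

(** The smooth estimate is applied to doubly mollified phi, f and G. Means, variances and slopes
    converge by dominated convergence, and gradients at the points where phi is differentiable;
    Fatou's lemma passes to the limit on the left-hand side. *)
Theorem lip_stability b (a : V) : b = (E phi (fun=> 1))^-1 * E phi f ->
  a = \row_k ((E phi (fun=> 1))^-1 * E phi (fun x => (f x - b) * x 0 k)) ->
  E phi (fun x => `|f x - b - dotv (gpd phi x) a|) <=
  @reg_const R d' * Num.sqrt (E phi (fun=> 1) *
    (E phi G - (E phi (fun x => f x ^+ 2) - (E phi (fun=> 1))^-1 * E phi f ^+ 2))).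
Proof.
move=> eb ea; have [L L0 fL] := lip_ge0 lf.
pose s_ n : R := n.+1%:R^-1.
have s0 n : 0 < s_ n by rewrite invr_gt0.
have s1 n : s_ n <= 1 by rewrite invf_le1// ler1n.
have s01 n : 0 <= s_ n <= 1 by rewrite (ltW (s0 n)) s1.
have sc : s_ n @[n --> \oo] --> (0 : R) by exact: cvg_harmonic.
have [k hk] := choice (fun n => @mollifier_exists R d' (s_ n) lamT (s0 n)).
pose p_ n := conv (k n) (conv (k n) phi).
pose q_ n := conv (k n) (conv (k n) f).
pose g_ n := conv (k n) (conv (k n) G).
have pL n x y : `|p_ n x - p_ n y| <= N * `|x - y|.
  have [M [Lk [kk kL k1]]] := hk n; exact: (moll_lipL kk k1 (moll_lipL kk k1 phiL) x y).
have pn n x : `|p_ n x - phi x| <= 2 * N * s_ n.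
  have [M [Lk [kk kL k1]]] := hk n; have HH := moll2_near kk k1 x phiL N0; exact: HH.
have qn n x : `|q_ n x - f x| <= 2 * L * s_ n.
  have [M [Lk [kk kL k1]]] := hk n; have HH := moll2_near kk k1 x fL L0; exact: HH.
have pC := near_coercive s01 pn.
have pS n : Sm 2 (p_ n) by have [M [Lk [kk kL k1]]] := hk n; exact: moll2_Sm (s1 n) kk kL k1 _ lphi.
have qS n : Sm 1 (q_ n).
  by have [M [Lk [kk kL k1]]] := hk n; exact: Sm_leS (moll2_Sm (s1 n) kk kL k1 lf).
have pcv n x y (t : R) : 0 <= t <= 1 -> p_ n ((1 - t) *: x + t *: y) <= (1 - t) * p_ n x + t * p_ n y.
  have [M [Lk [kk kL k1]]] := hk n => ht.
  have HH := moll_convex kk (conv_pg' (s0 n) kk pphi) (moll_convex kk pphi cvx) x y ht; exact: HH.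
have pf : pg f by exact: pg_lip.
have qb n x : - Mf <= q_ n x <= Mf.
  have [M [Lk [kk kL k1]]] := hk n.
  apply: (moll_bounds kk k1 _ (conv_pg' (s0 n) kk pf)) => y.
  by apply: (moll_bounds kk k1 _ pf) => z; rewrite -ler_norml.
have qM n x : `|q_ n x| <= Mf by rewrite ler_norml qb.
have pgG n : pg (g_ n).
  by have [M [Lk [kk kL k1]]] := hk n; have HH := conv_pg' (s0 n) kk (conv_pg' (s0 n) kk pG); exact: HH.
have pq n : pg (q_ n) by exact: pg_lip (Sm_lip (qS n)).
have qc x : q_ n x @[n --> \oo] --> f x.
  apply/subr_cvg0/norm_cvg0P; apply: (squeeze_cvgr (f := fun=> 0) (h := fun n => 2 * L * s_ n)).
  - by apply: nearW => n; rewrite normr_ge0 qn.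
  - exact: cvg_cst.
  - by rewrite -[X in _ --> X](mulr0 (2 * L)); exact: cvgMr.
have Mf0 : 0 <= Mf := le_trans (normr_ge0 _) (fM 0).
pose Z := E phi (fun=> 1); pose Z_ n := E (p_ n) (fun=> 1).
have Zp : 0 < Z := E1_gt0 phiL c0 phiC lamT.
have Zp_ n : 0 < Z_ n := E1_gt0 (pL n) c0 (pC n) lamT.
have lim := near_E_cvg sc s01 pL pn.
have cZ : Z_ n @[n --> \oo] --> Z.
  by apply: (lim _ _ (fun=> 1)); [by move=> n; exact: pg_cst|exact: pg_cst|exact: pg_cst|
    by move=> n x; rewrite normr1|by move=> x; exact: cvg_cst].
have c1 : E (p_ n) (q_ n) @[n --> \oo] --> E phi f.
  by apply: (lim _ _ (fun=> Mf)) => //; exact: pg_cst.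
have c2 : E (p_ n) (fun x => q_ n x ^+ 2) @[n --> \oo] --> E phi (fun x => f x ^+ 2).
  apply: (lim _ _ (fun=> Mf ^+ 2)).
  - by move=> n; exact: pgX.
  - exact: pgX.
  - exact: pg_cst.
  - by move=> n x; rewrite normrX lerXn2r ?nnegrE.
  - by move=> x; rewrite expr2; under eq_fun do rewrite expr2; apply: cvgM.
have pgx i : pg (fun x : V => x 0 i).
  apply: pg_lip; exists 1 => x y; rewrite mul1r; have := coord_le_norm (x - y) i; by rewrite !mxE.
have c3 i : E (p_ n) (fun x => q_ n x * x 0 i) @[n --> \oo] --> E phi (fun x => f x * x 0 i).
  apply: (lim _ _ (fun x => Mf * `|x 0 i|)).
  - by move=> n; exact: pgM.
  - exact: pgM.
  - exact: pgZ (pg_norm (pgx i)).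
  - by move=> n x; rewrite normrM ler_wpM2r.
  - by move=> x; apply: cvgMl.
have c4 i : E (p_ n) (fun x => x 0 i) @[n --> \oo] --> E phi (fun x => x 0 i).
  apply: (lim _ _ (fun x => `|x 0 i|)) => //.
  - exact: pg_norm.
  - by move=> x; exact: cvg_cst.
have cZi : (Z_ n)^-1 @[n --> \oo] --> Z^-1 by apply: cvgV => //; rewrite gt_eqF.
pose b_ n := (Z_ n)^-1 * E (p_ n) (q_ n).
have cb : b_ n @[n --> \oo] --> b by rewrite eb; exact: cvgM.
pose a_ n : V := \row_i ((Z_ n)^-1 * E (p_ n) (fun x => (q_ n x - b_ n) * x 0 i)).
have split (ps F : V -> R) (N' C' u : R) i : (forall x y, `|ps x - ps y| <= N' * `|x - y|) ->
    (forall x, c * `|x| - C' <= ps x) -> pg F ->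
    E ps (fun x => (F x - u) * x 0 i) = E ps (fun x => F x * x 0 i) - u * E ps (fun x => x 0 i).
  move=> h1 h2 pF; have pp : pg (fun x => F x * x 0 i) by exact: pgM.
  rewrite -(EZ h1 c0 h2 u (pgx i)) -(EB h1 c0 h2 pp (pgZ u (pgx i))).
  by apply: eqE => x; rewrite mulrBl.
have ca i : a_ n 0 i @[n --> \oo] --> a 0 i.
  rewrite ea mxE (split phi f N C b i phiL phiC pf).
  rewrite (_ : (fun n => _) = (fun n => (Z_ n)^-1 * (E (p_ n) (fun x => q_ n x * x 0 i) - b_ n * E (p_ n) (fun x => x 0 i)))); last first.
    by apply/funext => n; rewrite mxE (split _ _ _ _ (b_ n) i (pL n) (pC n) (pq n)).
  apply: cvgM => //; apply: cvgB => //; exact: cvgM.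
pose e_ n := expR (2 * N * s_ n) * (expR (N * s_ n) * expR (N * s_ n)) : R.
have ce : e_ n @[n --> \oo] --> (1 : R).
  have cexp (K : R) : expR (K * s_ n) @[n --> \oo] --> (1 : R).
    have h : K * s_ n @[n --> \oo] --> (0 : R) by rewrite -[X in _ --> X](mulr0 K); exact: cvgMr.
    by rewrite -expR0; apply: (cvg_comp _ _ h); exact: continuous_expR.
  have := cvgM (cexp (2 * N)) (cvgM (cexp N) (cexp N)); rewrite !mulr1; exact.
(* G is only measurable, so instead of the convergence of its mollifications a one-sided bound is
   used, with a factor [e_] that tends to 1. *)
have gE n : E (p_ n) (g_ n) <= e_ n * E phi G.
  have [M [Lk [kk kL k1]]] := hk n; have G0 x : 0 <= G x by have /andP[] := GM x.
  have pKG := conv_pg' (s0 n) kk pG.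
  have KG0 x : 0 <= conv (k n) G x by apply: (conv_ge0 kk).
  have gg0 x : 0 <= g_ n x by apply: (conv_ge0 kk).
  have h1 := E_conv N0 phiL c0 phiC (ltW (s0 n)) kk pG G0.
  have h2 := E_conv N0 phiL c0 phiC (ltW (s0 n)) kk pKG KG0.
  rewrite (kmass1 k1) mulr1 in h1 h2.
  have h3 : E (p_ n) (g_ n) <= expR (2 * N * s_ n) * E phi (g_ n).
    rewrite !E_rint -(rintZ _ (pgi phiL c0 phiC (pgG n))).
    apply: rint_le; [exact: pgi (pL n) c0 (pC n) _ (pgG n)|exact: intgZ (pgi phiL c0 phiC (pgG n))|move=> x].
    by rewrite mulrCA ler_wpM2l// (near_rho pn).
  apply: le_trans h3 _; rewrite /e_ -[leRHS]mulrA ler_wpM2l ?expR_ge0//.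
  apply: le_trans h2 _; rewrite -[leRHS]mulrA; apply: ler_wpM2l h1; exact: expR_ge0.
pose V_ n := E (p_ n) (fun x => q_ n x ^+ 2) - (Z_ n)^-1 * E (p_ n) (q_ n) ^+ 2.
pose B_ n := @reg_const R d' * Num.sqrt (Z_ n * (e_ n * E phi G - V_ n)).
have st n : E (p_ n) (fun x => `|q_ n x - b_ n - pd (p_ n) (a_ n) x|) <= B_ n.
  have [M [Lk [kk kL k1]]] := hk n.
  have hh x h := moll_hess (s0 n) (s1 n) kk kL k1 x h.
  apply: le_trans (regular_stability lamT N0 (pL n) c0 (pC n) (pcv n) (pS n) (qS n) (qM n)
    (pgi (pL n) c0 (pC n) (pgG n)) hh erefl erefl) _.
  rewrite /B_ ler_wpM2l ?reg_const_ge0// ler_wsqrtr// ler_wpM2l ?(ltW (Zp_ n))//.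
  by rewrite lerB.
rewrite E_rint; apply: (proj2 (rint_fatou (mu := mu) (f_ := fun n x => `|q_ n x - b_ n - pd (p_ n) (a_ n) x| * rho (p_ n) x) (B_ := B_) _ _ _ _ _ _ _)).
- move=> n; apply: (pgi (pL n) c0 (pC n)); apply: pg_norm; apply: pgB.
    by apply: pgB => //; exact: pg_cst.
  by apply: pg_pd; exact: Sm_lip (pS n).
- by move=> n x; rewrite mulr_ge0 ?rho_ge0.
- apply: measurable_funM; last exact: rho_meas phiL.
  apply: pg_meas; apply: pg_norm; apply: pgB; first by apply: pgB => //; exact: pg_cst.
  rewrite (_ : (fun x => _) = (fun x => \sum_i a 0 i * pd phi (evec i) x)); last first.
    by apply/funext => x; apply: eq_bigr => i _; rewrite mxE mulrC.
  by apply: pg_sum => i; apply: pgZ; exact: pg_pd.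
- by move=> x; rewrite mulr_ge0 ?rho_ge0.
- apply: ae_imp (rademacher lphi) _ => x [hg _].
  apply: cvgM; last exact: near_rho_cvg sc pn x.
  apply: cvg_norm; apply: cvgB; first exact: cvgB.
  rewrite (_ : (fun n => _) = (fun n => \sum_i pd (p_ n) (evec i) x * a_ n 0 i)); last first.
    by apply/funext => n; rewrite (Sm_pd_dotv lamT _ _ (Sm_leS (pS n))); apply: eq_bigr => i _; rewrite mxE.
  apply: cvg_sum_seq => i; apply: cvgM => //.
  have -> : gpd phi x 0 i = dotv (gpd phi x) (evec i).
    by rewrite /dotv (bigD1 i)//= big1 ?addr0 ?mxE ?eqxx ?mulr1// => j ji; rewrite !mxE eqxx (negbTE ji) mulr0.
  exact: near_pd_cvg sc pn pS pcv _ _ _ hg.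
- by move=> n; rewrite -E_rint; exact: st.
- apply: cvgMr; apply: (@cvg_comp _ _ _ _ Num.sqrt _ _ _ _ (@sqrt_continuous _ _)).
  apply: cvgM => //; apply: cvgB; first by rewrite -[X in _ --> X]mul1r; apply: cvgMl.
  apply: cvgB => //; apply: cvgM => //; rewrite expr2; under eq_fun do rewrite expr2.
  exact: cvgM.
Qed.

End lipschitz_stage.

(** * Extended-valued convex potentials *)

Section extended_convex.
Context {R : realType} {d' : nat}.
Local Notation d := d'.+1.
Local Notation V := 'rV[R]_d.
Local Notation mu := (@lam R d').
Implicit Types (x y h : V).

Lemma coord_le_enorm (x : V) i : `|x 0 i| <= enorm x.
Proof.
rewrite /enorm -sqrtr_sqr ler_sqrt; last by apply: sumr_ge0 => j _; rewrite -expr2 sqr_ge0.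
by rewrite /dotv (bigD1 i)//= -expr2 lerDl; apply: sumr_ge0 => j _; rewrite -expr2 sqr_ge0.
Qed.

Lemma enorm_ge0 (x : V) : 0 <= enorm x. Proof. exact: sqrtr_ge0. Qed.

Lemma hterm_ge0 s (C : set V) : (0 <= hterm s C)%E.
Proof.
rewrite /hterm; case: pselect => // C0; rewrite lee_fin exprn_ge0// fine_ge0//.
have [x Cx] : C !=set0 by apply/set0P/eqP.
apply: le_trans (ereal_sup_ubound _); last by exists x => //; exists x.
by rewrite lee_fin enorm_ge0.
Qed.

(** A set of diameter D <= 1 lies in a box of sides 2 D, whose volume is at most $2^d D^{d-1}$. *)
Lemma hausdorff_null (A : set V) : hausdorff (d - 1) A = 0%E -> leb_outer A = 0%E.
Proof.
rewrite subn1/= => hA; apply/eqP; rewrite eq_le leb_outer_ge0 andbT.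
apply/lee_addgt0Pr => e e0; rewrite add0e.
have d0 : 0 < (2 : R) ^+ d by rewrite exprn_gt0.
have h1 : (hausdorff_pre d' 1 A < (e / 2 ^+ d)%:E)%E.
  apply: (@le_lt_trans _ _ 0%E); last by rewrite lte_fin divr_gt0.
  by rewrite -hA; apply: ereal_sup_ubound; exists (1 : R) => //=; exact: ltr01.
have [_ [C [AC dC] <-] hC] := ereal_inf_lt h1.
pose D k := fine (ediam (C k)).
pose x k : V := xget 0 (C k).
pose B k : V * V := if pselect (C k = set0) then (0, 0) else (x k - const_mx (D k), x k + const_mx (D k)).
have fD k : C k <> set0 -> ediam (C k) = (D k)%:E /\ 0 <= D k <= 1.
  move=> C0; have [z Cz] : C k !=set0 by apply/set0P/eqP.
  have h0 : (0 <= ediam (C k))%E.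
    apply: le_trans (ereal_sup_ubound _); last by exists z => //; exists z.
    by rewrite lee_fin enorm_ge0.
  have e1 : ediam (C k) = (D k)%:E.
    by rewrite /D fineK// ge0_fin_numE//; apply: le_lt_trans (dC k) _; rewrite ltry.
  by split => //; rewrite -!lee_fin -e1 h0 dC.
have AB : A `<=` \bigcup_k box (B k).
  move=> z /AC[k _ Cz]; exists k => //; rewrite /B; case: pselect => [C0|C0]; first by rewrite C0 in Cz.
  have [e1 _] := fD k C0 => i /=; rewrite !mxE -ler_distl.
  have Cx : C k (x k) by apply: xgetPex; exists z.
  have := coord_le_enorm (z - x k) i; rewrite !mxE => /le_trans; apply.
  by rewrite -lee_fin -e1; apply: ereal_sup_ubound; exists z => //; exists (x k).
apply: le_trans (leb_outer_le AB) _.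
have le1 k : ((box_vol (B k))%:E <= (2 ^+ d)%:E * hterm d' (C k))%E.
  rewrite /B /hterm; case: pselect => [C0|C0]; first by rewrite box_vol00 mule0.
  have [e1 /andP[D0 D1]] := fD k C0.
  rewrite -EFinM lee_fin /box_vol -/(D k) (eq_bigr (fun=> 2 * D k)); last first.
    by move=> i _; rewrite !mxE (_ : _ - _ = 2 * D k) ?max_r ?mulr_ge0//; ring.
  by rewrite prodr_const card_ord exprMn ler_wpM2l// exprS ler_piMl// exprn_ge0.
apply: le_trans (lee_nneseries _ (fun k _ => le1 k)) _.
  by move=> k _ _; rewrite lee_fin box_vol_ge0.
rewrite nneseriesZl; last by move=> k _; exact: hterm_ge0.
have -> : e = 2 ^+ d * (e / 2 ^+ d) by rewrite mulrCA divff ?mulr1// gt_eqF.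
by rewrite EFinM lee_wpmul2l ?lee_fin 1?ltW.
Qed.

Lemma lam_shrink (F : nat -> set V) (e : R) : 0 < e -> (lam (F 0%N) < +oo)%E ->
  (forall n, measurable (F n)) -> (forall n m, (n <= m)%N -> F m `<=` F n) ->
  \bigcap_n F n = set0 -> exists n, (lam (F n) < e%:E)%E.
Proof.
move=> e0 F0 mF dF F00.
have := @nonincreasing_cvg_mu _ _ _ mu F F0 mF; rewrite F00 => /(_ measurable0).
rewrite measure0 => h.
have : nbhs (0%E : \bar R) [set y | (y < e%:E)%E].
  by apply: open_nbhs_nbhs; split; [exact: open_ereal_lt_ereal|rewrite /= lte_fin].
have hh : {homo F : n m / (n <= m)%N >-> (m <= n)%O}.
  by move=> n m nm; apply/subsetPset; exact: dF.
move: hh => /h {}h /h[n _ hn]; exists n; exact: (hn n (leqnn n)).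
Qed.

Lemma lam_bigcup0 (F : nat -> set V) : (forall n, lam (F n) = 0%E) -> lam (\bigcup_n F n) = 0%E.
Proof.
move=> F0; apply/eqP; rewrite eq_le lam_ge0 andbT.
by apply: le_trans (leb_outer_sigma_subadditive F) _; rewrite eseries0// => n _ _; exact: F0.
Qed.

Variable phi : V -> \bar R.
Hypothesis nNy : forall x, phi x != -oo%E.
Hypothesis cvx : ext_convex phi.
Hypothesis lsc : lower_semicontinuous phi.

Lemma phi_meas : measurable_fun setT phi.
Proof.
apply: (measurability _ (ErealGenOInfty.measurableE R)) => //.
move=> _ [_ [a ->]] <-; apply: open_measurable_rv; rewrite preimage_itvoy setTI.
by move/lower_semicontinuousP : lsc; exact.
Qed.

Lemma level_meas (a : \bar R) : measurable [set x | (phi x <= a)%E].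
Proof. by rewrite -[X in measurable X]setTI; apply: emeasurable_fun_le => //; exact: phi_meas. Qed.

Lemma dom_meas : measurable [set x | (phi x < +oo)%E].
Proof. by rewrite -[X in measurable X]setTI; apply: emeasurable_fun_lt => //; exact: phi_meas. Qed.

Lemma int_dom_open : open [set x | in_int_dom phi x].
Proof.
rewrite openE => x [r r0 hr]; apply/nbhs_ballP; exists (r / 2); first by rewrite /= divr_gt0.
move=> y; rewrite -ball_normE/= => xy; exists (r / 2); first by rewrite divr_gt0.
move=> z zy; apply: hr; have := ler_normD (z - y) (y - x); rewrite addrA subrK (distrC y x); lra.
Qed.

Lemma int_dom_meas : measurable [set x | in_int_dom phi x].
Proof. by apply: open_measurable_rv; exact: int_dom_open. Qed.

Lemma int_dom_dom x : in_int_dom phi x -> (phi x < +oo)%E.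
Proof. by move=> [r r0 hr]; apply: hr; rewrite subrr normr0. Qed.

Lemma dom_fin x : (phi x < +oo)%E -> phi x = (fine (phi x))%:E.
Proof. by move=> h; rewrite fineK// fin_numE nNy/= -ltey. Qed.

Definition dens x : R := fine (expeR (- phi x)%E).

Lemma dens_ge0 x : 0 <= dens x. Proof. by rewrite fine_ge0// expeR_ge0. Qed.

Lemma densE x : expeR (- phi x)%E = (dens x)%:E.
Proof. by rewrite /dens fineK//; have := nNy x; case: (phi x). Qed.

Lemma dens_dom x : (phi x < +oo)%E -> dens x = expR (- fine (phi x)).
Proof. by move=> h; rewrite /dens (dom_fin h). Qed.

Lemma dens_out x : ~ (phi x < +oo)%E -> dens x = 0.
Proof. by move=> /negP; rewrite -leNgt leye_eq => /eqP h; rewrite /dens h. Qed.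

Lemma dens_meas : measurable_fun setT dens.
Proof.
rewrite (_ : dens = fun x => \1_[set x | (phi x < +oo)%E] x * expR (- fine (phi x))); last first.
  apply/funext => x; rewrite indicE; have [xd|xd] := pselect (phi x < +oo)%E.
    by rewrite mem_set// mul1r dens_dom.
  by rewrite memNset// mul0r dens_out.
apply: measurable_funM; first by apply: measurable_indic; exact: dom_meas.
apply: (measurableT_comp (@measurable_expR R)); apply: measurableT_comp => //.
by apply: measurableT_comp; [exact: fine_measurable|exact: phi_meas].
Qed.

Lemma expeN_meas : measurable_fun setT (fun x => expeR (- phi x)%E).
Proof.
rewrite (_ : (fun x => _) = EFin \o dens); last by apply/funext => x; exact: densE.
by apply: measurableT_comp => //; exact: dens_meas.
Qed.

Lemma boundary_null : hausdorff (d - 1) [set x | ~ {for x, continuous phi}] = 0%E ->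
  lam [set x | (phi x < +oo)%E /\ ~ in_int_dom phi x] = 0%E.
Proof.
move=> /hausdorff_null h; apply/eqP; rewrite eq_le lam_ge0 andbT.
rewrite -h; apply: le_leb_outer => x [xd nx] cx; apply: nx.
have : nbhs (phi x) [set y | (y < +oo)%E].
  by apply: open_nbhs_nbhs; split => //; exact: open_ereal_lt_ereal.
by move=> /cx /nbhs_ballP[r r0 hr]; exists r => // y yx; apply: hr; rewrite -ball_normE/= distrC.
Qed.

(* Nearby points z are midpoints of pairs z - h, z + h inside a sublevel set of almost full measure. *)
Lemma local_bound x : (0 < lam [set: V])%E -> in_int_dom phi x ->
  exists r K : R, 0 < r /\ forall y, `|y - x| < r -> (phi y <= K%:E)%E.
Proof.
move=> lamT [r r0 hr].
pose F (n : nat) : set V := [set y | `|y - x| < r /\ (n%:R%:E < phi y)%E].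
have r20 : 0 < r / 2 by rewrite divr_gt0.
have mball z (s : R) : measurable [set y : V | `|y - z| < s].
  apply: open_measurable_rv; rewrite (_ : [set _ | _] = ball z s); first exact: ball_open_nbhs.1 || exact: ball_open.
  by apply/funext => y; rewrite -ball_normE/= distrC.
have bfin z (s : R) : (lam [set y : V | (`|y - z| < s)%R] < +oo)%E.
  apply: le_lt_trans (lam_ball_lty (`|z| + s)); apply: le_leb_outer => y /= h.
  by have := ler_normD (y - z) z; rewrite subrK; lra.
have b0 := lam_ball_gt0 lamT 0 r20.
pose m := fine (lam [set y : V | (`|y - 0| < r / 2)%R]).
have em : lam [set y : V | (`|y - 0| < r / 2)%R] = m%:E by rewrite /m fineK// ge0_fin_numE// lam_ge0.
have m0 : 0 < m by rewrite -lte_fin -em.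
have m20 : 0 < m / 2 by rewrite divr_gt0.
have [||||n hn] := @lam_shrink F (m / 2) m20.
- by apply: le_lt_trans (bfin x r); apply: le_leb_outer => y [].
- move=> n; apply: measurableI (mball x r) _; rewrite -[X in measurable X]setTI.
  by apply: emeasurable_fun_lt => //; exact: phi_meas.
- by move=> n k nk y [h1 h2]; split => //; apply: le_lt_trans h2; rewrite lee_fin ler_nat.
- apply/seteqP; split => // y Fy; have [h1 _] := Fy 0%N I.
  have e1 := dom_fin (hr y h1).
  have [_] := Fy (Num.bound `|fine (phi y)|) I; rewrite e1/= lte_fin => h.
  have h2 := archi_boundP (normr_ge0 (fine (phi y))); have h3 := ler_norm (fine (phi y)).
  by rewrite ltNge (le_trans h3 (ltW h2)) in h.
exists (r / 2), n%:R; split => // z zx; rewrite leNgt; apply/negP => hz.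
(* If phi z > n, then for each small h one of z + h and z - h lies in [F n]. Hence P and its
   reflection cover a ball of measure m, although each has measure below m/2. *)
pose P : set V := [set h | F n (h + z)].
have lP : lam P = lam (F n) := leb_outer_shift z (F n).
have lP' : lam [set h | P (- h)] = lam (F n) by rewrite -lP; exact: leb_outer_opp.
suff : (m%:E <= lam (F n) + lam (F n))%E.
  apply/negP; rewrite -ltNge.
  have -> : m%:E = ((m / 2)%:E + (m / 2)%:E)%E by rewrite -EFinD -splitr.
  by apply: lteD.
rewrite -[X in (_ <= X + _)%E]lP -[X in (_ <= _ + X)%E]lP' -em.
apply: le_trans (le_leb_outer (y := P `|` [set h | P (- h)]) _) _; last first.
  exact: (outer_measureU2 (@leb_outer R d)).
move=> h /=; rewrite subr0 => hh.
have i1 : `|h + z - x| < r by have := ler_normD h (z - x); rewrite addrA; lra.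
have i2 : `|- h + z - x| < r by have := ler_normD (- h) (z - x); rewrite addrA normrN; lra.
have [H1|H1] := ltP n%:R%:E (phi (h + z)); first by left.
have [H2|H2] := ltP n%:R%:E (phi (- h + z)); first by right.
exfalso; move: hz; apply/negP; rewrite -leNgt.
have ht : 0 < (2^-1 : R) < 1 by rewrite invr_gt0 invf_lt1// ltr0n ltr1n.
have := cvx (h + z) (- h + z) ht.
have -> : 2^-1 *: (h + z) + (1 - 2^-1) *: (- h + z) = z by apply/rowP => i; rewrite !mxE; field.
move: H1 H2; rewrite (dom_fin (hr _ i1)) (dom_fin (hr _ i2)) !lee_fin => H1 H2 /le_trans; apply.
rewrite -!EFinM -EFinD lee_fin; lra.
Qed.


Hypothesis Zpos : (0 < Zphi phi)%E.
Hypothesis Zfin : (Zphi phi < +oo)%E.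

Lemma Zphi_integral : Zphi phi = (\int[mu]_x expeR (- phi x)%E)%E.
Proof. by apply: leb_intE => [|x]; [exact: expeN_meas|exact: expeR_ge0]. Qed.

Lemma lam_setT_gt0 : (0 < lam [set: V])%E.
Proof.
rewrite lt0e lam_ge0 andbT; apply/eqP => h; move: Zpos; rewrite lt0e => /andP[/eqP + _]; apply.
apply/eqP; rewrite eq_le; apply/andP; split; last by rewrite Zphi_integral; apply: integral_ge0 => x _; exact: expeR_ge0.
have /le_trans := @leb_int_le_ae _ _ setT (fun x => expeR (- phi x)%E) (fun=> 0%E) h (fun x nx => False_ind _ (nx I)).
by apply; rewrite leb_intE// integral0.
Qed.

(* Markov's inequality for e^{-phi}. *)
Lemma level_lam (t : R) : (lam [set x | (phi x <= t%:E)%E] <= (expR t * fine (Zphi phi))%:E)%E.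
Proof.
have Zf : Zphi phi \is a fin_num by rewrite ge0_fin_numE// ltW.
have e1 : ((expR (- t))%:E * lam [set x | (phi x <= t%:E)%E])%E = (\int[mu]_(x in [set x | (phi x <= t%:E)%E]) (expR (- t))%:E)%E.
  by rewrite integral_cst//; exact: level_meas.
have le : ((expR (- t))%:E * lam [set x | (phi x <= t%:E)%E] <= Zphi phi)%E.
  rewrite e1 Zphi_integral.
  apply: (@le_trans _ _ (\int[mu]_(x in [set x | (phi x <= t%:E)%E]) expeR (- phi x)%E)%E).
    apply: nn_le_integral => [x _|]; first by rewrite lee_fin expR_ge0.
    move=> x /= h; rewrite (_ : (expR (- t))%:E = expeR (- t%:E))//.
    by rewrite lee_expeR leeN2.
  apply: ge0_subset_integral => //; [exact: level_meas|exact: expeN_meas|by move=> x _; exact: expeR_ge0].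
rewrite EFinM fineK//.
have -> : lam [set x | (phi x <= t%:E)%E] = ((expR t)%:E * ((expR (- t))%:E * lam [set x | (phi x <= t%:E)%E]))%E.
  by rewrite muleA -EFinM -expRD subrr expR0 mul1e.
by rewrite lee_wpmul2l// lee_fin expR_ge0.
Qed.

(** Some bounded piece [A k] of a sublevel set has positive measure. The midpoints between it and
    any y with phi y <= s form a set of fixed measure P on which phi <= (M + s)/2. Compared with
    [level_lam] this bounds phi from below; compared with the small tails of the set phi <= M + 1 it
    bounds that set. Convexity along rays from a point of [A k] then gives linear growth. *)
Lemma coercive : exists c C : R, 0 < c /\ forall x, ((c * `|x| - C)%:E <= phi x)%E.
Proof.
pose A k : set V := [set x | (phi x <= k%:R%:E)%E /\ `|x| <= k%:R].
have mA k : measurable (A k) by apply: measurableI; [exact: level_meas|exact: measurable_norm_le].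
have [k Ak] : exists k, (0 < lam (A k))%E.
  apply: contrapT => /forallNP h.
  have h0 : lam (\bigcup_k A k) = 0%E.
    by apply: lam_bigcup0 => k; apply/eqP; have := h k; rewrite lt0e lam_ge0 andbT => /negP; rewrite negbK.
  move: Zpos; apply/negP; rewrite -leNgt.
  apply: le_trans (leb_int_le_ae (h := fun=> 0%E) (h0 : leb_outer _ = 0%E) _) _; last by rewrite leb_intE// integral0.
  move=> x nx; have [xd|] := ltP (phi x) +oo%E; last by rewrite leye_eq => /eqP ->.
  exfalso; apply: nx; have e1 := dom_fin xd.
  have h2 := archi_boundP (normr_ge0 (fine (phi x))); have h3 := archi_boundP (normr_ge0 x).
  exists (maxn (Num.bound `|fine (phi x)|) (Num.bound `|x|)) => //; split.
    rewrite e1 lee_fin; apply: le_trans (ler_norm _) _; apply: le_trans (ltW h2) _.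
    by rewrite ler_nat leq_maxl.
  by apply: le_trans (ltW h3) _; rewrite ler_nat leq_maxr.
set M : R := k%:R.
have Afin : (lam (A k) < +oo)%E by apply: le_lt_trans (lam_ball_lty M); apply: le_leb_outer => x [].
pose al := fine (lam (A k)).
have eal : lam (A k) = al%:E by rewrite /al fineK// ge0_fin_numE// lam_ge0.
have al0 : 0 < al by rewrite -lte_fin -eal.
pose P : R := (2 ^+ d)^-1 * al.
have d20 : 0 < (2 : R) ^+ d by rewrite exprn_gt0.
have P0 : 0 < P by rewrite mulr_gt0// invr_gt0.
have half y : lam [set z : V | A k (2 *: z - y)] = P%:E.
  have := leb_outer_scale [set w | A k (w + - y)] (ltr0n R 2 : 0 < 2).
  rewrite (leb_outer_shift (- y) (A k)) -/(lam (A k)) eal => h.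
  have : (((2 ^+ d)^-1)%:E * ((2 ^+ d)%:E * lam [set z : V | A k (2 *: z - y)%R]) = P%:E)%E by rewrite [X in (_ * X)%E]h.
  by rewrite muleA -EFinM mulVf ?gt_eqF// mul1e.
have mid y z (s : R) : (phi y <= s%:E)%E -> A k (2 *: z - y) -> (phi z <= ((M + s) / 2)%:E)%E.
  move=> ys [zM _]; have ht : 0 < (2^-1 : R) < 1 by rewrite invr_gt0 invf_lt1// ltr0n ltr1n.
  have := cvx (2 *: z - y) y ht.
  have -> : 2^-1 *: (2 *: z - y) + (1 - 2^-1) *: y = z by apply/rowP => i; rewrite !mxE; field.
  have yd : (phi y < +oo)%E by apply: le_lt_trans ys _; rewrite ltry.
  have zd : (phi (2 *: z - y) < +oo)%E by apply: le_lt_trans zM _; rewrite ltry.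
  move: zM ys; rewrite (dom_fin yd) (dom_fin zd) !lee_fin => h1 h2 /le_trans; apply.
  rewrite -!EFinM -EFinD lee_fin -/M in h1 *; lra.
pose Z := fine (Zphi phi).
have Z0 : 0 < Z by rewrite fine_gt0// Zpos Zfin.
(* Chosen so that [level_lam] at the level (M - K0)/2 gives measure at most P/2. *)
pose K0 := M - 2 * ln (P / (2 * Z)).
have low y : ((- K0)%:E <= phi y)%E.
  rewrite leNgt; apply/negP => hy.
  have h1 : (P%:E <= lam [set z | (phi z <= ((M + - K0) / 2)%:E)%E])%E.
    by rewrite -(half y); apply: le_leb_outer => z /(mid y z _ (ltW hy)).
  have := le_trans h1 (level_lam _); rewrite lee_fin -/Z.
  have -> : (M + - K0) / 2 = ln (P / (2 * Z)) by rewrite /K0; field.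
  rewrite lnK ?posrE ?divr_gt0 ?mulr_gt0//.
  have -> : P / (2 * Z) * Z = P / 2 by field; rewrite gt_eqF.
  lra.
pose F (n : nat) : set V := [set z | (phi z <= (M + 1)%:E)%E /\ n%:R < `|z|].
have [||||n hn] := @lam_shrink F P P0.
- apply: le_lt_trans (le_leb_outer (y := [set z | (phi z <= (M + 1)%:E)%E]) _) _; first by move=> z [].
  by apply: le_lt_trans (level_lam _) _; rewrite ltry.
- move=> n; apply: measurableI; first exact: level_meas.
  rewrite (_ : (fun z : V => _) = ~` [set x : V | (`|x| <= n%:R)%R]); last first.
    by apply/seteqP; split => z /=; [move=> h; apply/negP; rewrite -ltNge|move/negP; rewrite -ltNge].
  by apply: measurableC; exact: measurable_norm_le.
- by move=> n m nm z [h1 h2]; split => //; apply: le_lt_trans h2; rewrite ler_nat.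
- apply/seteqP; split => // z Fz; have [_ h] := Fz (Num.bound `|z|) I.
  by have := archi_boundP (normr_ge0 z); rewrite ltNge (ltW h).
have M0 : 0 <= M by rewrite ler0n.
pose R1 : R := 2 * n%:R + M.
have R1M : M <= R1 by rewrite lerDr mulr_ge0.
have far y : (phi y <= (M + 1)%:E)%E -> `|y| <= R1.
  move=> hy; rewrite leNgt; apply/negP => yR; move: hn; apply/negP; rewrite -leNgt -(half y).
  apply: le_leb_outer => z Az; split.
    apply: le_trans (mid y z _ hy Az) _; rewrite lee_fin; lra.
  have [_ h] := Az; have h2 := lerB_dist y (y - 2 *: z).
  have e2 : `|y - (y - 2 *: z)| = 2 * `|z| by rewrite opprB addrC subrK normrZ ger0_norm.
  by rewrite e2 (distrC y) in h2; move: yR; rewrite /R1 -/M in h *; lra.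
have [a0 [a0M a0k]] : A k !=set0.
  by apply/set0P/eqP => A0; move: Ak; rewrite A0 lam0 ltxx.
rewrite -/M in a0M a0k.
(* As |a0| <= R1, a point at distance r1 from a0 has norm greater than R1 and so lies outside the
   set phi <= M + 1. *)
pose r1 := 2 * R1 + 1; have R10 : 0 <= R1 := le_trans M0 R1M.
have r10 : 0 < r1 by rewrite /r1; lra.
pose K' := M + `|K0| + 1.
have mainb x : ((`|x - a0| / r1 - K')%:E <= phi x)%E.
  have [xr|xr] := leP `|x - a0| r1.
    apply: le_trans (low x); rewrite lee_fin.
    have : `|x - a0| / r1 <= 1 by rewrite ler_pdivrMr// mul1r.
    have := ler_norm K0; rewrite /K'; lra.
  have [xd|] := ltP (phi x) +oo%E; last by rewrite leye_eq => /eqP ->; rewrite leey.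
  have xa0 : 0 < `|x - a0| by exact: lt_trans xr.
  pose t := r1 / `|x - a0|.
  have ht : 0 < t < 1 by rewrite divr_gt0// ltr_pdivrMr// mul1r.
  have := cvx x a0 ht; set z := _ + _ => hz.
  have nz : R1 < `|z|.
    have ez : z = t *: (x - a0) - (- a0) by apply/rowP => i; rewrite !mxE; ring.
    have et : t * `|x - a0| = r1 by rewrite /t divfK ?gt_eqF.
    have := lerB_dist (t *: (x - a0)) (- a0).
    rewrite -ez normrN normrZ (gtr0_norm (proj1 (andP ht))) et /r1; lra.
  have {}nz : ((M + 1)%:E < phi z)%E by rewrite ltNge; apply/negP => /far; rewrite leNgt nz.
  have ad : (phi a0 < +oo)%E by apply: le_lt_trans a0M _; rewrite ltry.
  move: (lt_le_trans nz hz) a0M; rewrite (dom_fin xd) (dom_fin ad) -!EFinM -EFinD lte_fin !lee_fin.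
  move: (fine (phi x)) (fine (phi a0)) => p q h1 h2.
  have /andP[t0 t1] := ht.
  have h3 : (1 - t) * q <= (1 - t) * M by apply: ler_wpM2l => //; lra.
  have h4 : 1 < t * (p - M) by lra.
  have h5 : `|x - a0| / r1 < p - M.
    by rewrite -(ltr_pM2l t0) (_ : t * (`|x - a0| / r1) = 1)// /t; field; rewrite !gt_eqF.
  have := normr_ge0 K0; rewrite /K'; lra.
exists r1^-1, (K' + `|a0| / r1); split => [|x]; first by rewrite invr_gt0.
apply: le_trans (mainb x); rewrite lee_fin.
have : `|x| / r1 <= (`|x - a0| + `|a0|) / r1.
  by rewrite ler_wpM2r ?invr_ge0 ?(ltW r10)//; have := ler_normD (x - a0) a0; rewrite subrK.
rewrite mulrDl [_^-1 * _]mulrC; lra.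
Qed.

End extended_convex.

(** * Lipschitz envelopes and Huber functions *)

Section infimal_convolution.
Context {R : realType} {d' : nat}.
Local Notation d := d'.+1.
Local Notation V := 'rV[R]_d.
Local Notation mu := (@lam R d').
Implicit Types (x y z h w : V).

(** Equality of germs at x. Difference quotients of F and G then coincide for large n, so first and
    second order information passes between phi and its Lipschitz regularisations. *)
Definition agree (F G : V -> R) x := exists2 r : R, 0 < r & forall y, `|y - x| < r -> F y = G y.

Lemma agree_eq F G x : agree F G x -> F x = G x.
Proof. by move=> [r r0 h]; apply: h; rewrite subrr normr0. Qed.

Lemma agreeD F G F' G' x : agree F G x -> agree F' G' x -> agree (fun y => F y + F' y) (fun y => G y + G' y) x.
Proof.
move=> [r r0 h] [s s0 k]; exists (Num.min r s); first by rewrite lt_min r0 s0.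
by move=> y; rewrite lt_min => /andP[/h -> /k ->].
Qed.

Lemma small_step w (r : R) : 0 < r -> exists n0, forall n, (n0 <= n)%N -> `|n.+1%:R^-1 *: w| < r.
Proof.
move=> r0; exists (Num.bound (`|w| / r)) => n nn.
have h := archi_boundP (divr_ge0 (normr_ge0 w) (ltW r0)).
have n1 : 0 < n.+1%:R :> R by [].
rewrite normrZ ger0_norm ?invr_ge0// mulrC ltr_pdivrMr// mulrC -ltr_pdivrMr//.
by apply: lt_le_trans h _; rewrite ler_nat; apply: leq_trans nn _.
Qed.

Lemma agree_D2 F G x w : agree F G x -> exists n0, forall n, (n0 <= n)%N -> D2 F w n x = D2 G w n x.
Proof.
move=> FG; have [r r0 h] := FG; have [n0 hn] := small_step w r0; exists n0 => n nn.
rewrite /D2 (agree_eq FG) !h// addrAC subrr add0r ?normrN; exact: hn.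
Qed.

Lemma agree_dq F G x w : agree F G x -> exists n0, forall n, (n0 <= n)%N -> dq F w n x = dq G w n x.
Proof.
move=> FG; have [r r0 h] := FG; have [n0 hn] := small_step w r0; exists n0 => n nn.
rewrite !dqE (agree_eq FG) h// addrAC subrr add0r; exact: hn.
Qed.

Lemma agree_dq_cvg F G x w (l : R) : agree F G x -> dq G w n x @[n --> \oo] --> l -> dq F w n x @[n --> \oo] --> l.
Proof.
move=> /(agree_dq w)[n0 hn] h; apply: cvg_trans h; apply: near_eq_cvg.
by exists n0 => // n /= nn; rewrite hn.
Qed.

Lemma agree_pd F G x w (l : R) : agree F G x -> rd G w x l -> pd F w x = pd G w x.
Proof. by move=> FG /rd_dq h; rewrite (pd_cvg (agree_dq_cvg FG h)) (pd_cvg h). Qed.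

Lemma agree_has_grad F G x g : agree F G x -> has_grad G x g -> has_grad F x g.
Proof.
move=> FG hg e e0; have [r r0 h] := FG; have [dl dl0 hd] := hg e e0.
exists (Num.min r dl); first by rewrite lt_min r0 dl0.
move=> k; rewrite lt_min => /andP[kr kd]; rewrite (agree_eq FG) h ?hd//.
by rewrite addrAC subrr add0r.
Qed.

Lemma has_grad_dq F x g w : has_grad F x g -> dq F w n x @[n --> \oo] --> dotv g w.
Proof.
move=> hg; apply: rd_dq => e e0.
have w1 : 0 < `|w| + 1 by rewrite ltr_pwDr.
have [dl dl0 hd] := hg (e / (`|w| + 1)) (divr_gt0 e0 w1).
exists (dl / (`|w| + 1)); first exact: divr_gt0.
move=> t /andP[t0 tD]; have nt : `|t *: w| = t * `|w| by rewrite normrZ gtr0_norm.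
have lt1 : `|t *: w| < dl.
  rewrite nt; rewrite ltr_pdivlMr// in tD; apply: le_lt_trans tD.
  by rewrite ler_pM2l// lerDl.
have := hd _ lt1; rewrite dotvZr => /le_trans; apply; rewrite nt.
have -> : e / (`|w| + 1) * (t * `|w|) = e * t * (`|w| / (`|w| + 1)) by ring.
by rewrite ler_piMr ?mulr_ge0 ?(ltW e0) ?(ltW t0)// ler_pdivrMr// mul1r lerDl.
Qed.

Lemma has_grad_inj F x g g' : has_grad F x g -> has_grad F x g' -> g = g'.
Proof.
move=> h h'; apply/rowP => i.
have e1 : dotv g (evec i) = dotv g' (evec i).
  by rewrite -(pd_cvg (has_grad_dq (w := evec i) h)) -(pd_cvg (has_grad_dq (w := evec i) h')).
have dv (u : V) : dotv u (evec i) = u 0 i.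
  by rewrite /dotv (bigD1 i)//= big1 ?addr0 ?mxE ?eqxx ?mulr1// => j ji; rewrite !mxE eqxx (negbTE ji) mulr0.
by rewrite -!dv.
Qed.

Lemma null_ae (N : set V) : measurable N -> lam N = 0%E -> {ae mu, forall x, ~ N x}.
Proof. by move=> mN N0; exists N; split => // x /contrapT. Qed.

(* The Huber function: t^2 for |t| <= r, continued affinely; written as the value at the
   optimal slope of sup_{|p| <= r} (2 p t - p^2). *)
Definition clamp (r t : R) := Num.max (- r) (Num.min r t).
Definition hub (r t : R) := 2 * clamp r t * t - clamp r t ^+ 2.

Lemma clamp_norm r t : 0 <= r -> `|clamp r t| <= r.
Proof. by move=> r0; rewrite ler_norml /clamp le_max lexx/= ge_max ge_min lexx/= andbT; lra. Qed.

Lemma clamp_id r t : `|t| <= r -> clamp r t = t.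
Proof. by rewrite ler_norml => /andP[h1 h2]; rewrite /clamp min_r// max_r. Qed.

Lemma clampP r t : 0 <= r ->
  [\/ t <= - r /\ clamp r t = - r, - r <= t <= r /\ clamp r t = t | r <= t /\ clamp r t = r].
Proof.
move=> r0; have [h1|h1] := leP r t.
  by apply: Or33; split => //; rewrite /clamp min_l// max_r//; lra.
have [h2|h2] := leP t (- r).
  by apply: Or31; split => //; rewrite /clamp min_r ?(ltW h1)// max_l.
by apply: Or32; rewrite clamp_id ?(ltW h1) ?(ltW h2)// ler_norml (ltW h1) (ltW h2).
Qed.

Lemma clamp_lip r s t : 0 <= r -> `|clamp r s - clamp r t| <= `|s - t|.
Proof.
move=> r0; have /andP[h1 h2] : - `|s - t| <= s - t <= `|s - t| by rewrite -ler_norml.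
rewrite ler_norml.
by case: (clampP s r0) => -[h3 ->]; case: (clampP t r0) => -[h4 ->]; apply/andP; split; lra.
Qed.

Lemma hub_ge r p t : `|p| <= r -> 2 * p * t - p ^+ 2 <= hub r t.
Proof.
rewrite /hub /clamp ler_norml => /andP[p1 p2].
have [h1|h1] := leP r t.
  by rewrite max_r; [nra|lra].
have [h2|h2] := leP (- r) t; [have := sqr_ge0 (p - t)|]; nra.
Qed.

Lemma hub_in r t : `|t| <= r -> hub r t = t ^+ 2.
Proof. by move=> h; rewrite /hub clamp_id//; ring. Qed.

Lemma hub_ge0 r t : 0 <= r -> 0 <= hub r t.
Proof. by move=> r0; have := @hub_ge r 0 t; rewrite normr0 => /(_ r0); rewrite !mulr0 mul0r expr0n/= subr0. Qed.

Lemma hub_le r t : hub r t <= t ^+ 2.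
Proof. by rewrite /hub; have := sqr_ge0 (clamp r t - t); lra. Qed.

Lemma hub_lip r s t : 0 <= r -> `|hub r s - hub r t| <= 2 * r * `|s - t|.
Proof.
move=> r0; have main a b : hub r a - hub r b <= 2 * r * `|a - b|.
  have h1 := hub_ge b (clamp_norm a r0).
  have h2 : clamp r a * (a - b) <= r * `|a - b|.
    apply: le_trans (ler_norm _) _; rewrite normrM ler_wpM2r//; exact: clamp_norm.
  rewrite /hub in h1 *; lra.
rewrite ler_norml; apply/andP; split; last exact: main.
by have := main t s; rewrite distrC; lra.
Qed.

Lemma hub_convex r s t (a : R) : 0 <= r -> 0 <= a <= 1 ->
  hub r ((1 - a) * s + a * t) <= (1 - a) * hub r s + a * hub r t.
Proof.
move=> r0 /andP[a0 a1]; set z := (1 - a) * s + a * t.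
have h1 := hub_ge s (clamp_norm z r0); have h2 := hub_ge t (clamp_norm z r0).
have {1}-> : hub r z = (1 - a) * (2 * clamp r z * s - clamp r z ^+ 2) + a * (2 * clamp r z * t - clamp r z ^+ 2).
  by rewrite /hub /z; ring.
by apply: lerD; apply: ler_wpM2l => //; rewrite subr_ge0.
Qed.

(** On the sup-norm ball of radius r it is k times the squared Euclidean norm, yet it is Lipschitz
    on the whole space: uniform convexity where f lives, at a bounded slope. *)
Definition hubs (k r : R) x : R := k * \sum_i hub r (x 0 i).

Section hubs.
Variables (k r : R).
Hypothesis k0 : 0 < k.
Hypothesis r0 : 0 < r.

Lemma hubs_ge0 x : 0 <= hubs k r x.
Proof. by apply: mulr_ge0; [exact: ltW|apply: sumr_ge0 => i _; exact: hub_ge0 (ltW r0)]. Qed.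

Lemma hubs_le x : hubs k r x <= k * \sum_i x 0 i ^+ 2.
Proof. by rewrite ler_pM2l//; apply: ler_sum => i _; exact: hub_le. Qed.

Lemma hubs_lip x y : `|hubs k r x - hubs k r y| <= k * (d%:R * (2 * r)) * `|x - y|.
Proof.
rewrite /hubs -mulrBr normrM (gtr0_norm k0) -mulrA ler_pM2l// -sumrB.
apply: le_trans (ler_norm_sum _ _ _) _.
apply: (@le_trans _ _ (\sum_(i < d) 2 * r * `|x - y|)).
  apply: ler_sum => i _; apply: le_trans (hub_lip _ _ (ltW r0)) _.
  rewrite ler_wpM2l ?mulr_ge0 ?(ltW r0)//; have := coord_le_norm (x - y) i; by rewrite !mxE.
by rewrite sumr_const card_ord -[X in X <= _]mulr_natl mulrA.
Qed.

Lemma hubs_convex x y (t : R) : 0 <= t <= 1 ->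
  hubs k r ((1 - t) *: x + t *: y) <= (1 - t) * hubs k r x + t * hubs k r y.
Proof.
move=> ht; rewrite /hubs mulrCA [t * _]mulrCA -mulrDr ler_pM2l// !mulr_sumr -big_split/=.
by apply: ler_sum => i _; rewrite !mxE; exact: hub_convex (ltW r0) ht.
Qed.

Lemma hubs_D2 x w : `|x| < r ->
  exists n0, forall n, (n0 <= n)%N -> D2 (hubs k r) w n x = 2 * k * \sum_i w 0 i ^+ 2.
Proof.
move=> xr; have [n0 hn] := small_step w (ltac:(by rewrite subr_gt0) : 0 < r - `|x|).
exists n0 => n nn; have := hn n nn; rewrite /D2 /hubs.
pose t : R := n.+1%:R^-1; have tn : n.+1%:R * t = 1 by rewrite mulfV// pnatr_eq0.
rewrite -/t => h.
have c1 i : hub r ((x + t *: w) 0 i) = (x 0 i + t * w 0 i) ^+ 2.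
  rewrite hub_in ?mxE//; apply: le_trans (ler_normD _ _) _.
  by have := coord_le_norm x i; have := coord_le_norm (t *: w) i; rewrite !mxE; lra.
have c2 i : hub r ((x - t *: w) 0 i) = (x 0 i - t * w 0 i) ^+ 2.
  rewrite hub_in ?mxE//; apply: le_trans (ler_normB _ _) _.
  by have := coord_le_norm x i; have := coord_le_norm (t *: w) i; rewrite !mxE; lra.
have c3 i : hub r (x 0 i) = x 0 i ^+ 2.
  by rewrite hub_in//; apply: le_trans (coord_le_norm x i) (ltW xr).
rewrite (eq_bigr _ (fun i _ => c1 i)) (eq_bigr _ (fun i _ => c2 i)) (eq_bigr _ (fun i _ => c3 i)).
have -> : k * (\sum_i (x 0 i + t * w 0 i) ^+ 2) + k * (\sum_i (x 0 i - t * w 0 i) ^+ 2) - 2 * (k * \sum_i x 0 i ^+ 2)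
    = k * \sum_i (2 * t ^+ 2 * w 0 i ^+ 2).
  rewrite [2 * (k * _)]mulrCA -!mulrDr -mulrBr; congr (k * _).
  by rewrite mulr_sumr -big_split/= -sumrB; apply: eq_bigr => i _; ring.
rewrite -mulr_sumr; move: (\sum_i _) => S.
have -> : n.+1%:R ^+ 2 * (k * (2 * t ^+ 2 * S)) = (n.+1%:R * t) ^+ 2 * (2 * k * S) by ring.
by rewrite tn expr1n mul1r.
Qed.

(* Outside its support f contributes nothing; inside, the Huber term has Hessian 2 k. *)
Lemma hubs_dominates (f : V -> R) (L : R) : 0 <= L -> (forall x y, `|f x - f y| <= L * `|x - y|) ->
  (forall x, r - 1 < `|x| -> f x = 0) -> forall x w, exists n0, forall n, (n0 <= n)%N ->
  2 * pd f w x - L ^+ 2 / (2 * k) <= D2 (hubs k r) w n x.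
Proof.
move=> L0 fL fs x w; have [xr|xr] := ltP `|x| r.
  have [n0 hn] := hubs_D2 w xr; exists n0 => n nn; rewrite hn//.
  have h1 : `|w| ^+ 2 <= \sum_i w 0 i ^+ 2.
    have S0 : 0 <= \sum_i w 0 i ^+ 2 by apply: sumr_ge0 => i _; exact: sqr_ge0.
    rewrite -(sqr_sqrtr S0) lerXn2r ?nnegrE ?sqrtr_ge0//; apply: norm_rv_le (sqrtr_ge0 _) _ => i.
    by rewrite -sqrtr_sqr ler_sqrt// (bigD1 i)//= lerDl; apply: sumr_ge0 => j _; exact: sqr_ge0.
  have h2 := pd_bound w x fL; have h3 := ler_norm (pd f w x).
  have h4 : 2 * (L * `|w|) <= L ^+ 2 / (2 * k) + 2 * k * `|w| ^+ 2.
    have : 0 <= 2 * k * (L / (2 * k) - `|w|) ^+ 2 by rewrite mulr_ge0 ?sqr_ge0// mulr_ge0 ?(ltW k0).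
    have -> : 2 * k * (L / (2 * k) - `|w|) ^+ 2 = L ^+ 2 / (2 * k) + 2 * k * `|w| ^+ 2 - 2 * (L * `|w|).
      by field; rewrite gt_eqF.
    lra.
  have h5 : 2 * k * `|w| ^+ 2 <= 2 * k * \sum_i w 0 i ^+ 2 by rewrite ler_wpM2l// mulr_ge0 ?(ltW k0).
  by move: (\sum_i _) h1 h5 => S h1 h5; lra.
exists 0%N => n _.
have -> : pd f w x = 0.
  apply: pd_cvg; apply: (agree_dq_cvg (G := fun=> 0)).
    exists 1 => // y yx; apply: fs; have := ler_normD (x - y) y; rewrite subrK (distrC x); lra.
  by apply: rd_dq; exact: rd_cst.
have := convex_D2_ge0 w n x hubs_convex.
have : 0 <= L ^+ 2 / (2 * k) by rewrite divr_ge0 ?sqr_ge0// mulr_ge0// ltW.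
lra.
Qed.

End hubs.

Variable phi : V -> \bar R.
Variables c C : R.
Hypothesis nNy : forall x, phi x != -oo%E.
Hypothesis cvx : ext_convex phi.
Hypothesis lsc : lower_semicontinuous phi.
Hypothesis c0 : 0 < c.
Hypothesis coer : forall x, ((c * `|x| - C)%:E <= phi x)%E.
Hypothesis prop : exists x, (phi x < +oo)%E.

Local Notation phr := (fun x => fine (phi x)).

(** The Pasch-Hausdorff envelope of phi. The infimum is taken in the reals, over the domain of phi,
    so it relies on phi being bounded below and finite somewhere. *)
Definition ph (m : R) x : R := inf [set fine (phi y) + m * `|x - y| | y in [set y | (phi y < +oo)%E]].

Lemma phr_ge x : (phi x < +oo)%E -> c * `|x| - C <= phr x.
Proof. by move=> h; have := coer x; rewrite (dom_fin nNy h) lee_fin. Qed.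

Lemma phr_geC x : (phi x < +oo)%E -> - C <= phr x.
Proof.
move=> /phr_ge h; have h2 : 0 <= c * `|x| by rewrite mulr_ge0 ?(ltW c0).
move: h; lra.
Qed.

Lemma ph_lb m x y : 0 <= m -> (phi y < +oo)%E -> ph m x <= phr y + m * `|x - y|.
Proof.
move=> m0 yd; apply: ge_inf; last by exists y.
exists (- C) => _ [z zd <-]; have := phr_geC zd; have : 0 <= m * `|x - z| by rewrite mulr_ge0.
lra.
Qed.

Lemma ph_glb m x (A : R) : (forall y, (phi y < +oo)%E -> A <= phr y + m * `|x - y|) -> A <= ph m x.
Proof.
move=> h; apply: lb_le_inf; first by have [z zd] := prop; exists (phr z + m * `|x - z|), z.
by move=> _ [y yd <-]; exact: h.
Qed.

Lemma ph_lip m x y : 0 <= m -> `|ph m x - ph m y| <= m * `|x - y|.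
Proof.
move=> m0; have main a b : ph m a - m * `|a - b| <= ph m b.
  apply: ph_glb => z zd; have h := ph_lb a m0 zd.
  have : m * `|a - z| <= m * (`|a - b| + `|b - z|).
    by rewrite ler_wpM2l//; have := ler_normD (a - b) (b - z); rewrite addrA subrK.
  lra.
by rewrite ler_norml; have := main x y; have := main y x; rewrite (distrC y) => h1 h2; apply/andP; split; lra.
Qed.

Lemma ph_coer m x : c <= m -> c * `|x| - C <= ph m x.
Proof.
move=> cm; apply: ph_glb => y yd; have := phr_ge yd.
have h1 : c * `|x| <= c * (`|y| + `|x - y|).
  by rewrite ler_pM2l//; have := ler_normD (x - y) y; rewrite subrK; lra.
have h2 : c * `|x - y| <= m * `|x - y| by rewrite ler_wpM2r.
lra.
Qed.

Lemma ph_le m x : 0 <= m -> (phi x < +oo)%E -> ph m x <= phr x.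
Proof. by move=> m0 xd; have := ph_lb x m0 xd; rewrite subrr normr0 mulr0 addr0. Qed.

Lemma phr_convex x y (t : R) : 0 < t < 1 -> (phi x < +oo)%E -> (phi y < +oo)%E ->
  (phi (t *: x + (1 - t) *: y)%R < +oo)%E /\ phr (t *: x + (1 - t) *: y) <= t * phr x + (1 - t) * phr y.
Proof.
move=> ht xd yd; have := cvx x y ht; set z := _ + _.
rewrite (dom_fin nNy xd) (dom_fin nNy yd) -!EFinM -EFinD/= => h.
have zd : (phi z < +oo)%E by apply: le_lt_trans h _; rewrite ltry.
by split => //; rewrite (dom_fin nNy zd) lee_fin in h.
Qed.

Lemma ph_convex m x y (t : R) : 0 <= m -> 0 <= t <= 1 ->
  ph m ((1 - t) *: x + t *: y) <= (1 - t) * ph m x + t * ph m y.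
Proof.
move=> m0 /andP[]; rewrite le_eqVlt => /orP[/eqP <- _|t0].
  by rewrite subr0 scale1r scale0r addr0 mul1r mul0r addr0.
rewrite le_eqVlt => /orP[/eqP -> |t1].
  by rewrite subrr scale0r add0r scale1r mul0r add0r mul1r.
set z := _ + _; have s0 : 0 < 1 - t by rewrite subr_gt0.
have both a b : (phi a < +oo)%E -> (phi b < +oo)%E ->
    ph m z <= (1 - t) * (phr a + m * `|x - a|) + t * (phr b + m * `|y - b|).
  move=> ad bd.
  have ht : 0 < 1 - t < 1 by apply/andP; split; lra.
  have [] := phr_convex ht ad bd; rewrite (_ : 1 - (1 - t) = t); last by ring.
  move=> zd h; apply: le_trans (ph_lb z m0 zd) _.
  have : m * `|z - ((1 - t) *: a + t *: b)| <= m * ((1 - t) * `|x - a| + t * `|y - b|).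
    rewrite ler_wpM2l//.
    have -> : z - ((1 - t) *: a + t *: b) = (1 - t) *: (x - a) + t *: (y - b).
      by apply/rowP => i; rewrite !mxE; ring.
    by apply: le_trans (ler_normD _ _) _; rewrite !normrZ (gtr0_norm s0) (gtr0_norm t0).
  lra.
have step1 a : (phi a < +oo)%E -> ph m z <= (1 - t) * (phr a + m * `|x - a|) + t * ph m y.
  move=> ad; rewrite addrC -lerBlDr -ler_pdivrMl//; apply: ph_glb => b bd.
  by rewrite ler_pdivrMl// lerBlDr addrC; exact: both.
rewrite -lerBlDr -ler_pdivrMl//; apply: ph_glb => a ad.
by rewrite ler_pdivrMl// lerBlDr; exact: step1.
Qed.

(** Near x, lower semicontinuity keeps phi above A; at distance r or more the penalty m r outweighs
    the lower bound -C of phi. *)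
Lemma ph_lim x (A : R) : (A%:E < phi x)%E -> exists m0, forall m, m0 <= m -> A <= ph m x.
Proof.
move=> /lsc[W /nbhs_ballP[r r0 hr] hW].
exists (Num.max 0 ((A + C) / r)) => m; rewrite ge_max => /andP[m0 mA].
apply: ph_glb => y yd; have [xy|xy] := ltP `|x - y| r.
  have : (A%:E < phi y)%E by apply: hW; apply: hr; rewrite -ball_normE.
  rewrite (dom_fin nNy yd) lte_fin; have : 0 <= m * `|x - y| by rewrite mulr_ge0.
  by move=> h1 h2 /=; lra.
have h1 : (A + C) <= m * r by rewrite -ler_pdivrMr.
have h2 : m * r <= m * `|x - y| by rewrite ler_wpM2l.
have := phr_geC yd; lra.
Qed.

Definition contact m x := exists2 r : R, 0 < r & forall y, `|y - x| < r -> phi y = (ph m y)%:E.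

Lemma contact_agree m x : contact m x -> agree phr (ph m) x.
Proof. by move=> [r r0 h]; exists r => // y /h ->. Qed.

Lemma contact_open m : open [set x | contact m x].
Proof.
rewrite openE => x [r r0 hr]; apply/nbhs_ballP; exists (r / 2); first by rewrite /= divr_gt0.
move=> y; rewrite -ball_normE/= => xy; exists (r / 2); first by rewrite divr_gt0.
move=> z zy; apply: hr; have := ler_normD (z - y) (y - x); rewrite addrA subrK (distrC y x); lra.
Qed.

Lemma contact_dom m x : contact m x -> in_int_dom phi x.
Proof. by move=> [r r0 h]; exists r => // y /h ->; rewrite ltry. Qed.

(* A convex function bounded by K on a ball of radius r has slopes at most 2 (K + C) / r on half the ball. *)
Lemma contact_ex x : (0 < lam [set: V])%E -> in_int_dom phi x -> exists m0, forall m, m0 <= m -> contact m x.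
Proof.
move=> lamT xd; have [r [K [r0 hK]]] := local_bound nNy cvx lsc lamT xd.
exists (Num.max 0 (4 * (K + C) / r)) => m; rewrite ge_max => /andP[m0 mK].
have r20 : 0 < r / 2 by rewrite divr_gt0.
have r40 : 0 < r / 4 by rewrite divr_gt0.
exists (r / 2) => // z zx.
have zd : (phi z < +oo)%E by apply: le_lt_trans (hK z _) (ltry _); lra.
rewrite (dom_fin nNy zd); congr EFin; apply/eqP; rewrite eq_le ph_le// andbT.
apply: ph_glb => y yd.
have [->|zy] := eqVneq y z; first by rewrite subrr normr0 mulr0 addr0.
have D0 : 0 < `|z - y| by rewrite normr_gt0 subr_eq0 eq_sym.
set D := `|z - y| in D0 *.
pose t := (r / 4) / (D + r / 4).
have Dr : 0 < D + r / 4 by rewrite addr_gt0.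
have ht : 0 < t < 1 by rewrite divr_gt0// ltr_pdivrMr// mul1r ltrDr.
pose w := z + (r / 4 / D) *: (z - y).
have wx : `|w - x| < r.
  have := ler_normD (z - x) ((r / 4 / D) *: (z - y)).
  rewrite normrZ gtr0_norm ?divr_gt0// -/D divfK ?gt_eqF//.
  have -> : z - x + (r / 4 / D) *: (z - y) = w - x by rewrite /w addrAC.
  lra.
have wK := hK w wx; have wd : (phi w < +oo)%E by apply: le_lt_trans wK (ltry _).
have wK' : phr w <= K by rewrite (dom_fin nNy wd) lee_fin in wK.
have [_] := phr_convex ht yd wd.
have -> : t *: y + (1 - t) *: w = z.
  rewrite /w /t; apply/rowP => i; rewrite !mxE; field.
  by rewrite !gt_eqF//; lra.
have /andP[t0 t1] := ht; move=> h.
have yC := phr_geC yd.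
have K0 : 0 <= K + C by have := phr_geC wd; lra.
have h1 : (1 - t) * (phr w - phr y) <= (1 - t) * (K + C) by apply: ler_wpM2l; lra.
have h2 : (1 - t) * (K + C) <= D * (4 * (K + C) / r).
  have -> : (1 - t) * (K + C) = D * ((K + C) / (D + r / 4)) by rewrite /t; field; rewrite gt_eqF//; lra.
  have -> : 4 * (K + C) / r = (K + C) / (r / 4) by field; rewrite gt_eqF.
  rewrite ler_pM2l// ler_wpM2l// lef_pV2 ?posrE//; lra.
have h3 : D * (4 * (K + C) / r) <= m * D by rewrite mulrC ler_wpM2r// ltW.
move: (phr y) (phr w) (phr z) h yC h1 wK' => a b e h yC h1 wK'; lra.
Qed.

(** Where phi is finite the envelopes stay below phi and approach it; where phi is infinite they
    exceed every level, so the weights tend to 0 as the density wants. *)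
Lemma rho_ph_cvg (m_ : nat -> R) x : (forall n, n%:R <= m_ n) -> (forall n, 0 <= m_ n) ->
  rho (ph (m_ n)) x @[n --> \oo] --> dens phi x.
Proof.
move=> mn m_0; apply/cvgrPdist_le => e e0.
have ev (A : R) : (A%:E < phi x)%E -> exists n0, forall n, (n0 <= n)%N -> A <= ph (m_ n) x.
  move=> /ph_lim[m0 hm]; exists (Num.bound `|m0|) => n nn; apply: hm.
  apply: le_trans (ler_norm _) _; apply: le_trans (ltW (archi_boundP (normr_ge0 m0))) _.
  by apply: le_trans (mn n); rewrite ler_nat.
have [xd|xd] := pselect (phi x < +oo)%E.
  rewrite (dens_dom nNy xd); set q := phr x.
  have q1 : 1 < 1 + e / expR (- q) by rewrite ltrDl divr_gt0// expR_gt0.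
  have l0 : 0 < ln (1 + e / expR (- q)) by rewrite ln_gt0.
  have [n0 hn] := ev (q - ln (1 + e / expR (- q))) ltac:(by rewrite (dom_fin nNy xd) lte_fin ltrBlDr ltrDl).
  exists n0 => // n /= nn; have h1 := hn n nn; have h2 := ph_le (m_0 n) xd; rewrite -/q in h2.
  rewrite /rho distrC ger0_norm ?subr_ge0 ?ler_expR ?lerN2// lerBlDr.
  apply: (@le_trans _ _ (expR (- q + ln (1 + e / expR (- q))))); first by rewrite ler_expR; lra.
  rewrite expRD lnK ?posrE ?(lt_trans ltr01)// mulrDr mulr1 mulrCA divff ?mulr1 ?gt_eqF ?expR_gt0//.
  by rewrite addrC.
rewrite (dens_out xd); have xo : phi x = +oo%E by move: xd => /negP; rewrite -leNgt leye_eq => /eqP.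
have [n0 hn] := ev (- ln e) ltac:(by rewrite xo ltry).
exists n0 => // n /= nn; rewrite sub0r normrN ger0_norm ?rho_ge0// /rho -[leRHS](lnK (e0 : e \is Num.pos)).
by rewrite ler_expR; have := hn n nn; lra.
Qed.

End infimal_convolution.

(** * Extended-valued potentials with a bounded, compactly supported f *)

Section compact_stage.
Context {R : realType} {d' : nat}.
Local Notation d := d'.+1.
Local Notation V := 'rV[R]_d.
Local Notation mu := (@lam R d').
Implicit Types (x y h w : V).
Hypothesis lamT : (0 < lam [set: V])%E.
Variable phi : V -> \bar R.
Variables c C : R.
Hypothesis nNy : forall x, phi x != -oo%E.
Hypothesis cvx : ext_convex phi.
Hypothesis lsc : lower_semicontinuous phi.
Hypothesis c0 : 0 < c.
Hypothesis coer : forall x, ((c * `|x| - C)%:E <= phi x)%E.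
Hypothesis prop : exists x, (phi x < +oo)%E.
Hypothesis bnd : lam [set x | (phi x < +oo)%E /\ ~ in_int_dom phi x] = 0%E.
Variables (f G : V -> R) (Mf L k r : R).
Hypothesis L0 : 0 <= L.
Hypothesis fL : forall x y, `|f x - f y| <= L * `|x - y|.
Hypothesis fM : forall x, `|f x| <= Mf.
Hypothesis k0 : 0 < k.
Hypothesis r0 : 0 < r.
Hypothesis fs : forall x, r - 1 < `|x| -> f x = 0.
Local Notation B := (L ^+ 2 / (2 * k)).
Hypothesis mG : measurable_fun setT G.
Hypothesis GM : forall x, 0 <= G x <= B.
Local Notation phr := (fun x => fine (phi x)).
Local Notation Hs := (hubs k r).
Hypothesis hG : forall p, {ae mu, forall x, in_int_dom phi x -> forall e : R, 0 < e ->
  exists n0, forall n, (n0 <= n)%N ->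
    2 * pd f (ratv p) x - G x - e <= D2 phr (ratv p) n x + D2 Hs (ratv p) n x}.

Definition cut_dens x := dens phi x * expR (- Hs x).

Let m_ n : R := c + n%:R.
Let q_ n x := ph phi (m_ n) x + Hs x.
Let N_ n := m_ n + k * (d%:R * (2 * r)).

Let m_0 n : 0 <= m_ n. Proof. by rewrite addr_ge0// ltW. Qed.
Let m_n n : n%:R <= m_ n. Proof. by rewrite lerDr ltW. Qed.
Let m_c n : c <= m_ n. Proof. by rewrite lerDl. Qed.
Let N_0 n : 0 <= N_ n.
Proof. by rewrite addr_ge0// !mulr_ge0// ltW. Qed.

Let qL n x y : `|q_ n x - q_ n y| <= N_ n * `|x - y|.
Proof.
have h1 := ph_lip nNy c0 coer prop x y (m_0 n); have h2 := hubs_lip k0 r0 x y.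
rewrite /q_ opprD addrACA; apply: le_trans (ler_normD _ _) _; rewrite mulrDl; exact: lerD.
Qed.

Let qC n x : c * `|x| - C <= q_ n x.
Proof. by have h1 := ph_coer nNy c0 coer prop x (m_c n); have h2 := hubs_ge0 k0 r0 x; rewrite /q_; lra. Qed.

Let qcvx n x y (t : R) : 0 <= t <= 1 -> q_ n ((1 - t) *: x + t *: y) <= (1 - t) * q_ n x + t * q_ n y.
Proof.
move=> ht; have h1 := ph_convex nNy cvx c0 coer prop x y (m_0 n) ht; have h2 := hubs_convex k0 r0 x y ht.
rewrite /q_; lra.
Qed.

Let q_cvg x : rho (q_ n) x @[n --> \oo] --> cut_dens x.
Proof.
rewrite (_ : (fun n => _) = (fun n => rho (ph phi (m_ n)) x * expR (- Hs x))); last first.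
  by apply/funext => n; rewrite /rho /q_ opprD expRD.
apply: cvgMl; exact: (rho_ph_cvg nNy lsc c0 coer prop m_n m_0).
Qed.

Lemma cut_dens_ge0 x : 0 <= cut_dens x.
Proof. by rewrite mulr_ge0 ?dens_ge0// expR_ge0. Qed.

Let q_dom n x : rho (q_ n) x <= expR C * expR (- (c * `|x|)).
Proof. by have := rho_decay (qC n) x; rewrite ger0_norm ?rho_ge0. Qed.

Let v_dom x : `|cut_dens x| <= expR C * expR (- (c * `|x|)).
Proof.
rewrite ger0_norm ?cut_dens_ge0//.
exact: (cvg_seq_le (@q_cvg x) (cvg_cst _) (fun n => q_dom n x)).
Qed.

Lemma cut_dens_meas : measurable_fun setT cut_dens.
Proof.
apply: measurable_funM; first exact: dens_meas.
apply: (measurableT_comp (@measurable_expR R)); apply: measurableT_comp => //.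
by apply: lip_measurable; exists (k * (d%:R * (2 * r))); exact: hubs_lip.
Qed.

Lemma cut_dens_intg F : pg F -> intg mu (fun x => F x * cut_dens x).
Proof. exact: pg_intg c0 cut_dens_meas v_dom. Qed.

Let dom_intg F : pg F -> intg mu (fun x => F x * (expR C * expR (- (c * `|x|)))).
Proof.
move=> pF; apply: (pg_intg (C := expR C) c0 _ _ pF).
  apply: measurable_funM => //; apply: (measurableT_comp (@measurable_expR R)); apply: measurableT_comp => //.
  by apply: lip_measurable; apply: lipZ; exists 1 => x y; rewrite mul1r; exact: ler_dist_dist.
by move=> x; rewrite ger0_norm// mulr_ge0 ?expR_ge0.
Qed.

Let E_cvg F : pg F -> E (q_ n) F @[n --> \oo] --> rint mu (fun x => F x * cut_dens x).
Proof.
move=> pF; rewrite (_ : (fun n => _) = (fun n => rint mu (fun x => F x * rho (q_ n) x))); last first.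
  by apply/funext => n; rewrite E_rint.
have gi := dom_intg (pg_norm pF).
have [||||_ +] := @rint_dct _ _ _ mu (fun n x => F x * rho (q_ n) x) (fun x => F x * cut_dens x) _ _ _ _ gi _.
- by move=> n; apply: measurable_funM; [exact: pg_meas|exact: rho_meas (qL n)].
- by apply: measurable_funM; [exact: pg_meas|exact: cut_dens_meas].
- by apply: (@aeW _ _ _ mu _ _) => x; apply: cvgMr; exact: q_cvg.
- by move=> n x; rewrite normrM (ger0_norm (rho_ge0 _ x)) ler_wpM2l.
exact.
Qed.

Let off_dom : {ae mu, forall x, in_int_dom phi x \/ cut_dens x = 0}.
Proof.
have mN : measurable [set x | (phi x < +oo)%E /\ ~ in_int_dom phi x].
  by apply: measurableI; [exact: dom_meas|apply: measurableC; exact: int_dom_meas].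
apply: ae_imp (null_ae mN bnd) _ => x nx.
have [xd|xd] := pselect (in_int_dom phi x); first by left.
right; rewrite /cut_dens dens_out ?mul0r// => h; exact: nx.
Qed.

(** Where the envelope coincides with phi near x the given majorant is valid. Elsewhere nothing is
    known about the envelope beyond convexity, and B is the bound that the Huber term secures by
    [hubs_dominates]. *)
Let G_ n x := if pselect (contact phi (m_ n) x) then G x else B.

Let B0 : 0 <= B. Proof. by rewrite divr_ge0 ?sqr_ge0// mulr_ge0// ltW. Qed.

Let G_M n x : 0 <= G_ n x <= B.
Proof. by rewrite /G_; case: pselect => h; [exact: (GM x)|rewrite B0 lexx]. Qed.

Let G_meas n : measurable_fun setT (G_ n).
Proof.
rewrite (_ : G_ n = fun x => (G x - B) * \1_[set x | contact phi (m_ n) x] x + B); last first.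
  apply/funext => x; rewrite /G_ indicE; case: pselect => h.
    by rewrite mem_set// mulr1 subrK.
  by rewrite memNset// mulr0 add0r.
apply: measurable_funD => //; apply: measurable_funM; first exact: measurable_funB.
by apply: measurable_indic; apply: open_measurable_rv; exact: contact_open.
Qed.

Let G_cvg : E (q_ n) (G_ n) @[n --> \oo] --> rint mu (fun x => G x * cut_dens x).
Proof.
rewrite (_ : (fun n => _) = (fun n => rint mu (fun x => G_ n x * rho (q_ n) x))); last first.
  by apply/funext => n; rewrite E_rint.
have gi := dom_intg (pg_cst B).
have [||||_ +] := @rint_dct _ _ _ mu (fun n x => G_ n x * rho (q_ n) x) (fun x => G x * cut_dens x) _ _ _ _ gi _.
- by move=> n; apply: measurable_funM; [exact: G_meas|exact: rho_meas (qL n)].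
- by apply: measurable_funM; [exact: mG|exact: cut_dens_meas].
- apply: ae_imp off_dom _ => x [xd|x0].
    have [m0 hm] := contact_ex nNy cvx lsc c0 coer prop lamT xd.
    have h : G x * rho (q_ n) x @[n --> \oo] --> G x * cut_dens x by apply: cvgMr; exact: q_cvg.
    apply: cvg_trans h; apply: near_eq_cvg; exists (Num.bound `|m0|) => // n /= nn.
    rewrite /G_; case: pselect => // -[]; apply: hm.
    apply: le_trans (ler_norm _) _; apply: le_trans (ltW (archi_boundP (normr_ge0 m0))) _.
    by apply: le_trans (m_n n); rewrite ler_nat.
  rewrite x0 mulr0.
  apply: (squeeze_cvgr (f := fun=> 0) (h := fun n => B * rho (q_ n) x)).
  - apply: nearW => n; have /andP[g0 g1] := G_M n x.
    by rewrite mulr_ge0 ?rho_ge0//= ler_wpM2r ?rho_ge0.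
  - exact: cvg_cst.
  - by rewrite -[X in _ --> X](mulr0 B) -x0; apply: cvgMr; exact: q_cvg.
- move=> n x; have /andP[g0 g1] := G_M n x.
  rewrite normrM (ger0_norm (rho_ge0 _ x)) (ger0_norm g0).
  by apply: ler_pM => //; exact: rho_ge0.
exact.
Qed.

Let hG_ n p : {ae mu, forall x, forall e : R, 0 < e -> exists n0, forall j, (n0 <= j)%N ->
  2 * pd f (ratv p) x - G_ n x - e <= D2 (q_ n) (ratv p) j x}.
Proof.
apply: ae_imp (hG p) _ => x hx e e0; set w := ratv p.
have eD j : D2 (q_ n) w j x = D2 (ph phi (m_ n)) w j x + D2 Hs w j x by rewrite /D2 /q_; ring.
rewrite /G_; case: pselect => h /=.
  have [n1 h1] := hx (contact_dom h) e e0.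
  have [n2 h2] := agree_D2 w (contact_agree h).
  exists (maxn n1 n2) => j; rewrite geq_max => /andP[j1 j2].
  by rewrite eD -(h2 j j2); exact: h1.
have [n1 h1] := hubs_dominates k0 r0 L0 fL fs x w.
exists n1 => j j1; have h2 := h1 j j1; rewrite eD.
have h3 : 0 <= D2 (ph phi (m_ n)) w j x.
  exact: (convex_D2_ge0 w j x (fun y z t ht => ph_convex nNy cvx c0 coer prop y z (m_0 n) ht)).
move: h2 h3; lra.
Qed.

Local Notation I F := (rint mu (fun x => F x * cut_dens x)).
Local Notation psi := (fun x => fine (phi x) + Hs x).
Local Notation Z := (I (fun=> 1)).

(** Almost every point of positive density is interior to the domain and is a contact point for all
    large n; there the gradient of the envelope is that of phi and [G_] equals G. The bad value B
    disappears by dominated convergence. *)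
Theorem bounded_stability b (a : V) : 0 < Z -> b = Z^-1 * I f ->
  a = \row_i (Z^-1 * I (fun x => (f x - b) * x 0 i)) ->
  intg mu (fun x => `|f x - b - dotv (gpd psi x) a| * cut_dens x) /\
  I (fun x => `|f x - b - dotv (gpd psi x) a|) <=
  @reg_const R d' * Num.sqrt (Z * (I G - (I (fun x => f x ^+ 2) - Z^-1 * I f ^+ 2))).
Proof.
move=> Zp eb ea.
have lf : lip f by exists L.
have pf : pg f by exact: pg_lip.
pose Z_ n := E (q_ n) (fun=> 1).
have Zp_ n : 0 < Z_ n := E1_gt0 (qL n) c0 (qC n) lamT.
have cZ : Z_ n @[n --> \oo] --> Z by apply: E_cvg; exact: pg_cst.
have cZi : (Z_ n)^-1 @[n --> \oo] --> Z^-1 by apply: cvgV => //; rewrite gt_eqF.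
have c1 : E (q_ n) f @[n --> \oo] --> I f by exact: E_cvg.
have c2 : E (q_ n) (fun x => f x ^+ 2) @[n --> \oo] --> I (fun x => f x ^+ 2) by apply: E_cvg; exact: pgX.
have pgx i : pg (fun x : V => x 0 i).
  apply: pg_lip; exists 1 => x y; rewrite mul1r; have := coord_le_norm (x - y) i; by rewrite !mxE.
pose b_ n := (Z_ n)^-1 * E (q_ n) f.
have cb : b_ n @[n --> \oo] --> b by rewrite eb; exact: cvgM.
pose a_ n : V := \row_i ((Z_ n)^-1 * E (q_ n) (fun x => (f x - b_ n) * x 0 i)).
have pfx i : pg (fun x => f x * x 0 i) by exact: pgM.
have ca i : a_ n 0 i @[n --> \oo] --> a 0 i.
  rewrite ea mxE.
  have -> : I (fun x => (f x - b) * x 0 i) = I (fun x => f x * x 0 i) - b * I (fun x => x 0 i).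
    rewrite -(rintZ b (cut_dens_intg (pgx i))) -(rintB (cut_dens_intg (pfx i)) (intgZ b (cut_dens_intg (pgx i)))).
    by apply: eq_rint => x; ring.
  rewrite (_ : (fun n => _) = (fun n => (Z_ n)^-1 * (E (q_ n) (fun x => f x * x 0 i) - b_ n * E (q_ n) (fun x => x 0 i)))); last first.
    apply/funext => n; rewrite mxE -(EZ (qL n) c0 (qC n) (b_ n) (pgx i)) -(EB (qL n) c0 (qC n) (pfx i) (pgZ (b_ n) (pgx i))).
    by congr (_ * _); apply: eqE => x; rewrite mulrBl.
  have h1 : E (q_ n) (fun x => f x * x 0 i) @[n --> \oo] --> I (fun x => f x * x 0 i) by exact: E_cvg.
  have h2 : E (q_ n) (fun x => x 0 i) @[n --> \oo] --> I (fun x => x 0 i) by apply: E_cvg.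
  apply: cvgM => //; apply: cvgB => //; exact: cvgM.
pose B_ n := @reg_const R d' * Num.sqrt (Z_ n * (E (q_ n) (G_ n) - (E (q_ n) (fun x => f x ^+ 2) - (Z_ n)^-1 * E (q_ n) f ^+ 2))).
have st n : E (q_ n) (fun x => `|f x - b_ n - dotv (gpd (q_ n) x) (a_ n)|) <= B_ n.
  exact: (lip_stability lamT (N_0 n) (qL n) c0 (qC n) (@qcvx n) lf fM (G_meas n) (G_M n) (hG_ n) erefl erefl).
have cB : B_ n @[n --> \oo] --> @reg_const R d' * Num.sqrt (Z * (I G - (I (fun x => f x ^+ 2) - Z^-1 * I f ^+ 2))).
  apply: cvgMr; apply: (@cvg_comp _ _ _ _ Num.sqrt _ _ _ _ (@sqrt_continuous _ _)).
  apply: cvgM => //; apply: cvgB; first exact: G_cvg.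
  apply: cvgB => //; apply: cvgM => //; rewrite expr2; under eq_fun do rewrite expr2.
  exact: cvgM.
have pgrad (F : V -> R) (u : V) : measurable_fun setT F -> measurable_fun setT (fun x => dotv (gpd F x) u).
  move=> mF; rewrite (_ : (fun x => _) = (fun x => \sum_i u 0 i * pd F (evec i) x)); last first.
    by apply/funext => x; apply: eq_bigr => i _; rewrite mxE mulrC.
  by apply: measurable_sum => i; apply: measurable_funM => //; exact: pd_measurable.
have lHs : lip (Hs : V -> R) by exists (k * (d%:R * (2 * r))); exact: (hubs_lip k0 r0).
have mHs := lip_measurable lHs.
have mpsi : measurable_fun setT psi.
  apply: measurable_funD => //; apply: measurableT_comp; [exact: fine_measurable|exact: phi_meas].
have mf : measurable_fun setT f := lip_measurable lf.
have mq n : measurable_fun setT (q_ n) by apply: lip_measurable; exists (N_ n); exact: qL.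
have mU n : measurable [set x | contact phi (m_ n) x].
  by apply: open_measurable_rv; exact: contact_open.
pose T_ n x := `|f x - b_ n - dotv (gpd (q_ n) x) (a_ n)| * rho (q_ n) x.
have mT n : measurable_fun setT (T_ n).
  apply: measurable_funM; last exact: rho_meas (qL n).
  by apply: measurableT_comp => //; apply: measurable_funB; [exact: measurable_funB|exact: pgrad].
have iT n : intg mu (T_ n).
  apply: (pgi (qL n) c0 (qC n)); apply: pg_norm; apply: pgB; first by apply: pgB => //; exact: pg_cst.
  rewrite (_ : (fun x => _) = (fun x => \sum_i a_ n 0 i * pd (q_ n) (evec i) x)); last first.
    by apply/funext => x; apply: eq_bigr => i _; rewrite mxE mulrC.
  by apply: pg_sum => i; apply: pgZ; apply: pg_pd; exists (N_ n); exact: qL.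
have T0 n x : 0 <= T_ n x by rewrite mulr_ge0 ?rho_ge0.
(* Points off the contact set are dropped from the integrand, which only lowers the left-hand
   side. *)
apply: (@rint_fatou _ _ _ mu (fun n x => T_ n x * \1_[set x | contact phi (m_ n) x] x) _ B_).
- move=> n; apply: intg_le (iT n).
    by apply: measurable_funM => //; exact: measurable_indic.
  by move=> x; rewrite normrM ger0_norm// indicE; case: (_ \in _); rewrite ?normr1 ?mulr1// normr0 mulr0.
- by move=> n x; rewrite mulr_ge0// indicE.
- apply: measurable_funM; last exact: cut_dens_meas.
  by apply: measurableT_comp => //; apply: measurable_funB; [exact: measurable_funB|exact: pgrad].
- by move=> x; rewrite mulr_ge0// cut_dens_ge0.
- have radn n : {ae mu, forall x, has_grad (q_ n) x (gpd (q_ n) x) /\ forall w, rd (q_ n) w x (dotv (gpd (q_ n) x) w)}.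
    by apply: rademacher; exists (N_ n); exact: qL.
  have bound_ev (m0 : R) n : (Num.bound `|m0| <= n)%N -> m0 <= m_ n.
    move=> nn; apply: le_trans (ler_norm _) _; apply: le_trans (ltW (archi_boundP (normr_ge0 m0))) _.
    by apply: le_trans (m_n n); rewrite ler_nat.
  apply: ae_imp (ae_and off_dom (ae_forall_count radn)) _ => x [[xd|x0] rx]; last first.
    rewrite x0 mulr0.
    have out n : ~ contact phi (m_ n) x.
      move=> /contact_dom h; have := int_dom_dom h => h'; move: x0; rewrite /cut_dens (dens_dom nNy h').
      by apply/eqP; rewrite gt_eqF// mulr_gt0 ?expR_gt0.
    rewrite (_ : (fun n => _) = fun=> 0); first exact: cvg_cst.
      apply/funext => n; rewrite indicE (_ : (x \in _) = false) ?mulr0//.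
    by apply: memNset; exact: out.
  have [m0 hm] := contact_ex nNy cvx lsc c0 coer prop lamT xd.
  have cn n : (Num.bound `|m0| <= n)%N -> contact phi (m_ n) x by move=> nn; apply: hm; exact: bound_ev.
  have gq n : (Num.bound `|m0| <= n)%N -> gpd (q_ n) x = gpd psi x.
    move=> nn; apply/rowP => i; rewrite !mxE; symmetry.
    have ag : agree psi (q_ n) x.
      by apply: agreeD; [exact: contact_agree (cn n nn)|exists 1].
    exact: agree_pd ag ((rx n).2 (evec i)).
  have h : `|f x - b_ n - dotv (gpd psi x) (a_ n)| * rho (q_ n) x @[n --> \oo] -->
      `|f x - b - dotv (gpd psi x) a| * cut_dens x.
    apply: cvgM; last exact: q_cvg.
    apply: cvg_norm; apply: cvgB; first by apply: cvgB => //; exact: cvg_cst.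
    by apply: cvg_sum_seq => i; apply: cvgMr.
  apply: cvg_trans h; apply: near_eq_cvg; exists (Num.bound `|m0|) => // n /= nn.
  by rewrite /T_ indicE mem_set ?mulr1 ?gq//; exact: cn.
- move=> n; apply: le_trans (st n); rewrite E_rint; apply: rint_le.
  + apply: intg_le (iT n); first by apply: measurable_funM => //; exact: measurable_indic.
    by move=> x; rewrite normrM ger0_norm// indicE; case: (_ \in _); rewrite ?normr1 ?mulr1// normr0 mulr0.
  + exact: iT.
  + move=> x; rewrite indicE; case: (_ \in _) => /=; rewrite ?mulr1 ?mulr0; [exact: lexx|exact: T0].
- exact: cB.
Qed.

End compact_stage.

(** * Restriction to balls and truncation of f *)

Section truncation.
Context {R : realType} {d' : nat}.
Local Notation d := d'.+1.
Local Notation V := 'rV[R]_d.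
Local Notation mu := (@lam R d').
Implicit Types (x y h w : V).

(** The sphere of the sup norm consists of 2 d faces, each a box with one degenerate side. Face
    number k fixes the coordinate k/2, and the parity of k gives the sign; the remaining boxes are
    degenerate points. *)
Lemma sphere_null (s : R) : 0 < s -> lam [set x : V | `|x| = s] = 0%E.
Proof.
move=> s0; apply/eqP; rewrite eq_le lam_ge0 andbT.
pose B (k : nat) : V * V := if insub k./2 is Some i then
    let e : R := if odd k then s else - s in
    (\row_j (if j == i then e else - s), \row_j (if j == i then e else s)) else (0, 0).
have AB : [set x : V | `|x| = s] `<=` \bigcup_k box (B k).
  move=> x /= xs.
  have [i hi] : exists i, `|x 0 i| = s.
    apply: contrapT => /forallNP h.
    suff : `|x| < s by rewrite xs ltxx.
    apply: norm_rv_lt => // i; rewrite lt_neqAle -{2}xs coord_le_norm andbT; exact/eqP.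
  have xj j : - s <= x 0 j <= s by rewrite -ler_norml -[X in _ <= X]xs coord_le_norm.
  have main (b : bool) : x 0 i = (if b then s else - s) -> exists2 k, True & box (B k) x.
    move=> e; exists (b + i.*2)%N => //; rewrite /B half_bit_double valK => j /=; rewrite !mxE.
    by rewrite oddD odd_double addbF oddb; case: eqP => [->|_]; rewrite ?e ?lexx// xj.
  have [x0|x0] := leP 0 (x 0 i).
    by apply: (main true); rewrite -hi ger0_norm.
  by apply: (main false); rewrite -hi ltr0_norm// opprK.
apply: le_trans (leb_outer_le AB) _; rewrite eseries0// => k _ _.
rewrite /B; case: insubP => [i _ _|_]; last by rewrite box_vol00.
by congr EFin; rewrite /box_vol/= (bigD1 i)//= !mxE eqxx subrr maxxx mul0r.
Qed.

Lemma sphere_ae (s : R) : 0 < s -> {ae mu, forall x, `|x| <> s}.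
Proof.
move=> s0; apply: (@null_ae _ _ [set x : V | `|x| = s]); last exact: sphere_null.
rewrite (_ : [set x : V | _] = [set x : V | `|x| <= s] `&` ~` [set x : V | `|x| < s]); last first.
  apply/seteqP; split => x /=; first by move=> ->; rewrite lexx ltxx.
  by move=> [h1 /negP]; rewrite -leNgt => h2; apply/eqP; rewrite eq_le h1.
apply: measurableI (measurable_norm_le s) _; apply: measurableC; apply: open_measurable_rv.
rewrite (_ : [set x : V | _] = ball 0 s); first exact: ball_open.
by apply/funext => y; rewrite -ball_normE/= sub0r normrN.
Qed.

(** Compactness provides one n for which f is bounded by n + 1 and has Lipschitz constant n + 1 at
    scale 1/(n+1) about every point of the ball. Pairs farther apart are covered by the bound on
    f. *)
Lemma loc_lip_ball (f : V -> R) (s : R) : 0 <= s -> locally_lipschitz f ->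
  exists2 L : R, 0 <= L & forall x y, `|x| <= s -> `|y| <= s -> `|f x - f y| <= L * `|x - y|.
Proof.
move=> s0 fl; pose K := [set x : V | `|x| <= s].
have cK : compact K.
  apply: bounded_closed_compact.
    exists s; split; first exact: num_real.
    by move=> M sM x /= xs; apply: le_trans xs (ltW sM).
  rewrite (_ : K = (fun x : V => `|x|) @^-1` [set t | t <= s]) //; apply: closed_comp; last exact: closed_le.
  by move=> x _; exact: norm_continuous.
pose P (n : nat) x := (forall z, `|z - x| < n.+1%:R^-1 -> `|f z - f x| <= n.+1%:R * `|z - x|) /\ `|f x| <= n.+1%:R.
have [n0 _ hn] : \forall n \near \oo, K `<=` P n.
  have := (compact_near_coveringP K).1 cK; apply => x _.
  have [r r0 [L hL]] := fl x.
  pose m := maxn (Num.bound (2 / r)) (maxn (Num.bound `|L|) (Num.bound (`|f x| + `|L| * r))).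
  exists ([set y | `|y - x| < r / 2], [set n | (m <= n)%N]).
    split; last by exists m.
    apply/nbhs_ballP; exists (r / 2); first by rewrite /= divr_gt0.
    by move=> y; rewrite -ball_normE/= distrC.
  move=> [y n] /= [yx mn].
  have bd (q : R) : 0 <= q -> (Num.bound q <= m)%N -> q <= n.+1%:R.
    move=> q0 qm; apply: le_trans (ltW (archi_boundP q0)) _; rewrite ler_nat.
    by apply: leq_trans qm _; apply: leq_trans mn _.
  have n1 : 2 / r <= n.+1%:R by apply: bd; [rewrite divr_ge0 ?(ltW r0)|exact: leq_maxl].
  have n2 : `|L| <= n.+1%:R by apply: bd => //; rewrite /m maxnA maxnAC; apply: leq_trans (leq_maxr _ _); exact: leqnn || rewrite leq_maxr.
  have n3 : `|f x| + `|L| * r <= n.+1%:R.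
    by apply: bd; [rewrite addr_ge0// mulr_ge0 ?(ltW r0)|rewrite /m maxnA leq_maxr].
  split => [z zy|].
    have ir : n.+1%:R^-1 <= r / 2 by rewrite -[r / 2]invrK lef_pV2 ?posrE ?invr_gt0 ?divr_gt0// invf_div.
    have zy' := lt_le_trans zy ir.
    have zx : `|z - x| < r.
      by rewrite (splitr r) -(subrK y z) -addrA; apply: le_lt_trans (ler_normD _ _) _; exact: ltrD.
    apply: le_trans (hL _ _ zx _) _; first lra.
    by apply: ler_wpM2r => //; apply: le_trans (ler_norm _) n2.
  have yr : `|y - x| < r by lra.
  have h1 := hL y x yr ltac:(by rewrite subrr normr0).
  have h2 : L * `|y - x| <= `|L| * r.
    by apply: le_trans (ler_norm _) _; rewrite normrM normr_id; apply: ler_pM => //; exact: ltW.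
  have := ler_normD (f y - f x) (f x); rewrite subrK; lra.
have {}hn := hn n0 (leqnn n0); set N : R := n0.+1%:R.
have N0 : 0 < N by [].
exists (N + 2 * N * N) => [|x y xs ys]; first by rewrite addr_ge0 ?mulr_ge0 ?(ltW N0).
have [hx bx] := hn x xs; have [hy b_y] := hn y ys; rewrite -/N in hx bx hy b_y.
have [xy|xy] := ltP `|x - y| N^-1.
  by apply: le_trans (hy x xy) _; rewrite ler_wpM2r// lerDl !mulr_ge0 ?(ltW N0).
apply: (@le_trans _ _ (2 * N)).
  by apply: le_trans (ler_normB _ _) _; lra.
have h : 1 <= N * `|x - y| by rewrite -(@divff _ N) ?gt_eqF// ler_pM2l.
rewrite mulrDl; have : 2 * N * 1 <= 2 * N * (N * `|x - y|) by rewrite ler_pM2l// mulr_gt0.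
have : 0 <= N * `|x - y| by rewrite mulr_ge0 ?(ltW N0).
rewrite !mulrA mulr1; lra.
Qed.

(** A 1-Lipschitz retraction onto the sup-norm ball of radius s; composed with it, a locally
    Lipschitz f becomes globally Lipschitz and is unchanged on the ball. *)
Definition clv (s : R) x : V := \row_i clamp s (x 0 i).

Lemma clv_norm s x : 0 <= s -> `|clv s x| <= s.
Proof. by move=> s0; apply: norm_rv_le => // i; rewrite mxE; exact: clamp_norm. Qed.

Lemma clv_id s x : `|x| <= s -> clv s x = x.
Proof. by move=> xs; apply/rowP => i; rewrite mxE clamp_id//; exact: le_trans (coord_le_norm x i) xs. Qed.

Lemma clv_lip s x y : 0 <= s -> `|clv s x - clv s y| <= `|x - y|.
Proof.
move=> s0; apply: norm_rv_le => // i; rewrite !mxE; apply: le_trans (clamp_lip _ _ s0) _.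
by have := coord_le_norm (x - y) i; rewrite !mxE.
Qed.

(* Equal to 1 on the ball of radius s, to 0 off the ball of radius s + 1, affine in |x| in between. *)
Definition cutoff (s : R) x : R := 2^-1 * (1 + clamp 1 (2 * (s - `|x|) + 1)).

Lemma cutoff_in s x : `|x| <= s -> cutoff s x = 1.
Proof.
move=> xs; rewrite /cutoff; have [[h1 e]|[h1 e]|[h1 e]] := @clampP _ 1 (2 * (s - `|x|) + 1) ler01; lra.
Qed.

Lemma cutoff_out s x : s + 1 <= `|x| -> cutoff s x = 0.
Proof.
move=> xs; rewrite /cutoff; have [[h1 e]|[h1 e]|[h1 e]] := @clampP _ 1 (2 * (s - `|x|) + 1) ler01; lra.
Qed.

Lemma cutoff_bound s x : `|cutoff s x| <= 1.
Proof.
rewrite ler_norml /cutoff; have [[h1 e]|[h1 e]|[h1 e]] := @clampP _ 1 (2 * (s - `|x|) + 1) ler01;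
  apply/andP; split; lra.
Qed.

Lemma cutoff_lip s : lip (cutoff s).
Proof.
exists 1 => x y; rewrite /cutoff -mulrBr normrM ger0_norm ?invr_ge0// mul1r.
rewrite opprD addrACA subrr add0r.
have h1 := clamp_lip (2 * (s - `|x|) + 1) (2 * (s - `|y|) + 1) (@ler01 R).
have e : 2 * (s - `|x|) + 1 - (2 * (s - `|y|) + 1) = 2 * (`|y| - `|x|) by ring.
rewrite e normrM ger0_norm// in h1.
have := ler_dist_dist y x; rewrite (distrC y x) => h2.
move: h1 h2; set A := `|clamp _ _ - _|; move: `|_ - _| => B h1 h2; lra.
Qed.

Lemma truncate_lip (f : V -> R) (s : R) : 0 <= s -> locally_lipschitz f ->
  lip (fun x => f (clv s x) * cutoff s x) /\ exists M, forall x, `|f (clv s x) * cutoff s x| <= M.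
Proof.
move=> s0 fl; have [L L0 hL] := loc_lip_ball s0 fl.
have fM x : `|f (clv s x)| <= `|f 0| + L * s.
  have h := hL (clv s x) 0 (clv_norm x s0) ltac:(by rewrite normr0).
  rewrite subr0 in h; have := ler_normD (f (clv s x) - f 0) (f 0); rewrite subrK.
  have : L * `|clv s x| <= L * s by rewrite ler_wpM2l// clv_norm.
  lra.
split.
  apply: (lipM (A := `|f 0| + L * s) (B := 1)) => //; [|exact: cutoff_lip|exact: cutoff_bound].
  exists L => x y; apply: le_trans (hL _ _ (clv_norm x s0) (clv_norm y s0)) _.
  by rewrite ler_wpM2l// clv_lip.
exists (`|f 0| + L * s) => x; rewrite normrM -[leRHS]mulr1; apply: ler_pM => //; exact: cutoff_bound.
Qed.

Lemma truncate_in (f : V -> R) s x : `|x| <= s -> f (clv s x) * cutoff s x = f x.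
Proof. by move=> xs; rewrite clv_id// cutoff_in// mulr1. Qed.

(** Cutting off f alone would create a gradient in the transition shell that the majorant does not
    control. With phi infinite off the ball, the density vanishes on that shell. *)
Definition restrict (phi : V -> \bar R) (s : R) x : \bar R := if `|x| <= s then phi x else +oo%E.

Section restrict.
Variable phi : V -> \bar R.
Variable s : R.
Hypothesis nNy : forall x, phi x != -oo%E.
Hypothesis cvx : ext_convex phi.
Hypothesis lsc : lower_semicontinuous phi.

Lemma restrict_ge x : (phi x <= restrict phi s x)%E.
Proof. by rewrite /restrict; case: ifP => // _; rewrite leey. Qed.

Lemma restrict_nNy x : restrict phi s x != -oo%E.
Proof. by rewrite /restrict; case: ifP. Qed.

Lemma restrict_convex : ext_convex (restrict phi s).
Proof.
move=> x y t ht; have /andP[t0 t1] := ht; have s1 : 0 < 1 - t by rewrite subr_gt0.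
rewrite /restrict; have [xs|xs] := leP `|x| s; have [ys|ys] := leP `|y| s.
- suff -> : `|t *: x + (1 - t) *: y| <= s by exact: cvx.
  apply: le_trans (ler_normD _ _) _; rewrite !normrZ (gtr0_norm t0) (gtr0_norm s1).
  have : t * `|x| <= t * s by rewrite ler_pM2l.
  have : (1 - t) * `|y| <= (1 - t) * s by rewrite ler_pM2l.
  lra.
- rewrite [X in (_ <= _ + X)%E]gt0_muley ?lte_fin// addey ?leey//.
  by have := nNy x; case: (phi x) => // _; rewrite gt0_muley ?lte_fin.
- rewrite [X in (_ <= X + _)%E]gt0_muley ?lte_fin// addye ?leey//.
  by have := nNy y; case: (phi y) => // _; rewrite gt0_muley ?lte_fin.
- by rewrite !gt0_muley ?lte_fin// addye ?leey.
Qed.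

Lemma restrict_lsc : lower_semicontinuous (restrict phi s).
Proof.
move=> x a; rewrite {1}/restrict; have [xs|xs] := leP `|x| s.
  move=> /lsc[W Wx hW]; exists W => // y /hW /lt_le_trans; apply; exact: restrict_ge.
move=> _; exists [set y | s < `|y|].
  apply/nbhs_ballP; exists (`|x| - s); first by rewrite /= subr_gt0.
  move=> y; rewrite -ball_normE/= => xy; have := ler_normD (x - y) y; rewrite subrK; lra.
by move=> y /= ys; rewrite /restrict leNgt ys/= ltry.
Qed.

Lemma restrict_agree x : `|x| < s -> agree (fun y => fine (restrict phi s y)) (fun y => fine (phi y)) x.
Proof.
move=> xs; exists (s - `|x|); first by rewrite subr_gt0.
move=> y yx; rewrite /restrict (_ : `|y| <= s)//.
have := ler_normD (y - x) x; rewrite subrK; lra.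
Qed.

Lemma restrict_int_dom x : in_int_dom (restrict phi s) x -> in_int_dom phi x.
Proof. by move=> [r r0 h]; exists r => // y /h /(le_lt_trans _); apply; exact: restrict_ge. Qed.

Lemma int_dom_restrict x : `|x| < s -> in_int_dom phi x -> in_int_dom (restrict phi s) x.
Proof.
move=> xs [r r0 h]; exists (Num.min r (s - `|x|)); first by rewrite lt_min r0 subr_gt0.
move=> y; rewrite lt_min => /andP[yr ys]; rewrite /restrict (_ : `|y| <= s); first exact: h.
have := ler_normD (y - x) x; rewrite subrK; lra.
Qed.

Lemma restrict_bnd : 0 < s -> lam [set x | (phi x < +oo)%E /\ ~ in_int_dom phi x] = 0%E ->
  lam [set x | (restrict phi s x < +oo)%E /\ ~ in_int_dom (restrict phi s) x] = 0%E.
Proof.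
move=> s0 h0; apply/eqP; rewrite eq_le lam_ge0 andbT.
pose A := [set x | (phi x < +oo)%E /\ ~ in_int_dom phi x].
apply: le_trans (le_leb_outer (y := A `|` [set x : V | `|x| = s]) _) _; last first.
  apply: le_trans (outer_measureU2 (@leb_outer R d) _ _) _.
  by rewrite -[X in (X + _ <= _)%E]/(lam A) h0 add0e -[X in (X <= _)%E]/(lam _) sphere_null.
move=> x [xd nx]; have xd' := le_lt_trans (restrict_ge x) xd.
have xs : `|x| <= s by move: xd; rewrite /restrict; case: ifP => //; rewrite ltxx.
have [e|ne] := eqVneq `|x| s; first by right.
by left; split => // h; apply: nx; apply: int_dom_restrict => //; rewrite lt_neqAle ne.
Qed.

Lemma restrict_dens x : dens (restrict phi s) x = if `|x| <= s then dens phi x else 0.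
Proof. by rewrite /dens /restrict; case: ifP. Qed.

End restrict.

Lemma phr_D2_ge0 (phi : V -> \bar R) x w : (forall x, phi x != -oo%E) -> ext_convex phi -> in_int_dom phi x ->
  exists n0, forall n, (n0 <= n)%N -> 0 <= D2 (fun y => fine (phi y)) w n x.
Proof.
move=> nNy cvx [r r0 h]; have [n0 hn] := small_step w r0; exists n0 => n nn.
have ht : 0 < (2^-1 : R) < 1 by rewrite invr_gt0 invf_lt1// ltr0n ltr1n.
have := hn n nn; rewrite /D2; move: (n.+1%:R^-1 *: w) => v vr.
have d1 : (phi (x + v)%R < +oo)%E by apply: h; rewrite addrAC subrr add0r.
have d2 : (phi (x - v)%R < +oo)%E by apply: h; rewrite addrAC subrr add0r normrN.
have [_] := phr_convex nNy cvx ht d1 d2.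
have -> : 2^-1 *: (x + v) + (1 - 2^-1) *: (x - v) = x by apply/rowP => i; rewrite !mxE; field.
move=> /= h1; apply: mulr_ge0; first exact: sqr_ge0.
move: (fine (phi (x + v))) (fine (phi (x - v))) (fine (phi x)) h1 => a b e h1; clear -h1; lra.
Qed.

End truncation.

(** * Removal of the truncations for locally Lipschitz f *)

Section local_stage.
Context {R : realType} {d' : nat}.
Local Notation d := d'.+1.
Local Notation V := 'rV[R]_d.
Local Notation mu := (@lam R d').
Implicit Types (x y h w : V).
Hypothesis lamT : (0 < lam [set: V])%E.
Variable phi : V -> \bar R.
Variables c C : R.
Hypothesis nNy : forall x, phi x != -oo%E.
Hypothesis cvx : ext_convex phi.
Hypothesis lsc : lower_semicontinuous phi.
Hypothesis c0 : 0 < c.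
Hypothesis coer : forall x, ((c * `|x| - C)%:E <= phi x)%E.
Hypothesis bnd : lam [set x | (phi x < +oo)%E /\ ~ in_int_dom phi x] = 0%E.
Variables (f H : V -> R).
Hypothesis fl : locally_lipschitz f.
Hypothesis mH : measurable_fun setT H.
Hypothesis H0 : forall x, 0 <= H x.
Local Notation phr := (fun x => fine (phi x)).
Local Notation u := (dens phi).
Hypothesis hH : forall p, {ae mu, forall x, in_int_dom phi x -> forall e : R, 0 < e ->
  exists n0, forall n, (n0 <= n)%N -> 2 * dq f (ratv p) n x - H x - e <= D2 phr (ratv p) n x}.
Hypothesis if2 : intg mu (fun x => f x ^+ 2 * u x).
Hypothesis iH : intg mu (fun x => H x * u x).
Local Notation I F := (rint mu (fun x => F x * u x)).
Local Notation Z := (I (fun=> 1)).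
Hypothesis Zp : 0 < Z.

Lemma loc_lip_continuous : continuous f.
Proof.
move=> x; apply/(@cvgrPdist_lt R R^o V (nbhs x)) => e e0.
have [r r0 [L hL]] := fl x.
have L1 : 0 < `|L| + 1 by rewrite ltr_wpDl.
apply/nbhs_ballP; exists (Num.min r (e / (`|L| + 1))); first by rewrite /= lt_min r0 divr_gt0.
move=> y; rewrite -ball_normE/= lt_min => /andP[xr xe].
apply: le_lt_trans (hL _ _ _ _) _; [by rewrite subrr normr0|by rewrite distrC|].
apply: (@le_lt_trans _ _ ((`|L| + 1) * `|x - y|)).
  by rewrite ler_wpM2r// (le_trans (ler_norm L))// lerDl.
by rewrite mulrC -ltr_pdivlMr.
Qed.

Lemma loc_lip_measurable : measurable_fun setT f.
Proof. exact: continuous_measurable_rv loc_lip_continuous. Qed.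

Lemma ph_dom_ex : exists x, (phi x < +oo)%E.
Proof.
apply: contrapT => /forallNP h; move: Zp; rewrite (_ : (fun x : V => _) = fun=> 0) ?rint0 ?ltxx//.
by apply/funext => x; rewrite dens_out ?mulr0.
Qed.

Lemma dens_decay x : `|u x| <= expR C * expR (- (c * `|x|)).
Proof.
rewrite ger0_norm ?dens_ge0//; have [xd|xd] := pselect (phi x < +oo)%E.
  rewrite (dens_dom nNy xd) -expRD ler_expR; have := phr_ge nNy coer xd; lra.
by rewrite dens_out// mulr_ge0 ?expR_ge0.
Qed.

Lemma dens_intg F : pg F -> intg mu (fun x => F x * u x).
Proof. apply: pg_intg c0 _ dens_decay; exact: dens_meas. Qed.

Let pgx i : pg (fun x : V => x 0 i).
Proof. by apply: pg_lip; exists 1 => x y; rewrite mul1r; have := coord_le_norm (x - y) i; rewrite !mxE. Qed.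

Let mf := loc_lip_measurable.
Let mu_ := dens_meas nNy lsc.
Let u0 x : 0 <= u x := dens_ge0 phi x.

Lemma dens_intg_f : intg mu (fun x => f x * u x).
Proof.
apply: (intg_le (g := fun x => 1 * u x + f x ^+ 2 * u x)); last exact: intgD (dens_intg (pg_cst 1)) if2.
  exact: measurable_funM.
move=> x; rewrite normrM (ger0_norm (u0 x)) -mulrDl ler_wpM2r//.
by rewrite -real_normK ?num_real//; have := sqr_ge0 (`|f x| - 1); have := normr_ge0 (f x); nra.
Qed.

Lemma dens_intg_fx i : intg mu (fun x => (f x * x 0 i) * u x).
Proof.
apply: (intg_le (g := fun x => f x ^+ 2 * u x + x 0 i ^+ 2 * u x)); last exact: intgD if2 (dens_intg (pgX 2 (pgx i))).
  by apply: measurable_funM => //; apply: measurable_funM => //; exact: measurable_coord.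
move=> x; rewrite normrM (ger0_norm (u0 x)) -mulrDl ler_wpM2r//.
by rewrite ler_norml; have := sqr_ge0 (f x - x 0 i); have := sqr_ge0 (f x + x 0 i);
  have := sqr_ge0 (f x); have := sqr_ge0 (x 0 i) => *; apply/andP; split; nra.
Qed.

(** This offset puts a fixed point of the domain into every ball, so that all restricted potentials
    are finite somewhere. *)
Let S0 : R := `|xget 0 [set x | (phi x < +oo)%E]| + 1.
Let s_ n : R := n%:R + S0.
(** One more than the radius s + 1 beyond which the truncated f vanishes, as [hubs_dominates] wants.
    With $k=r^{-2}$ the Huber functions tend to 0 at each point, and so do their Lipschitz
    constants, of order k r. *)
Let r_ n := s_ n + 2.
Let k_ n := (r_ n ^+ 2)^-1.
Let p_ n := restrict phi (s_ n).
Let f_ n x := f (clv (s_ n) x) * cutoff (s_ n) x.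
Let v_ n := cut_dens (p_ n) (k_ n) (r_ n).

Let S01 : 1 <= S0. Proof. by rewrite lerDr. Qed.
Let s_n n : n%:R <= s_ n. Proof. by rewrite lerDl (le_trans ler01 S01). Qed.
Let s_0 n : 0 < s_ n. Proof. by apply: lt_le_trans ltr01 _; apply: le_trans S01 _; rewrite lerDr. Qed.
Let r_0 n : 0 < r_ n. Proof. by rewrite addr_gt0. Qed.
Let k_0 n : 0 < k_ n. Proof. by rewrite invr_gt0 exprn_gt0. Qed.

Let r_inv : (r_ n)^-1 @[n --> \oo] --> (0 : R).
Proof.
apply: (squeeze_cvgr (f := fun=> 0) (h := fun n => n.+1%:R^-1)).
- apply: nearW => n; rewrite invr_ge0 (ltW (r_0 n))/= lef_pV2 ?posrE// -natr1 /r_.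
  have := s_n n; lra.
- exact: cvg_cst.
- exact: cvg_harmonic.
Qed.

Let k_cvg : k_ n @[n --> \oo] --> (0 : R).
Proof.
rewrite -(mulr0 (0 : R)) (_ : k_ = fun n => (r_ n)^-1 * (r_ n)^-1); first exact: cvgM.
by apply/funext => n; rewrite /k_ expr2 invfM.
Qed.

Let in_ball x : exists n0, forall n, (n0 <= n)%N -> `|x| < s_ n.
Proof.
exists (Num.bound `|x|) => n nn; apply: lt_le_trans (archi_boundP (normr_ge0 x)) _.
by apply: le_trans (s_n n); rewrite ler_nat.
Qed.

Let v_le n x : 0 <= v_ n x <= u x.
Proof.
rewrite cut_dens_ge0/= /v_ /cut_dens restrict_dens; case: ifP => _; last by rewrite mul0r u0.
rewrite ler_piMr// -expR0 ler_expR oppr_le0; exact: (hubs_ge0 (k_0 n) (r_0 n)).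
Qed.

Let v_out n x : s_ n < `|x| -> v_ n x = 0.
Proof. by move=> xs; rewrite /v_ /cut_dens restrict_dens leNgt xs mul0r. Qed.

Let hubs_cvg x : hubs (k_ n) (r_ n) x @[n --> \oo] --> (0 : R).
Proof.
apply: (squeeze_cvgr (f := fun=> 0) (h := fun n => k_ n * \sum_i x 0 i ^+ 2)).
- by apply: nearW => n; rewrite (hubs_ge0 (k_0 n) (r_0 n))/= (hubs_le (r_ n) (k_0 n)).
- exact: cvg_cst.
- by rewrite -[X in _ --> X](mul0r (\sum_i x 0 i ^+ 2)); exact: cvgMl.
Qed.

Let v_cvg x : v_ n x @[n --> \oo] --> u x.
Proof.
have h1 : u x * expR (- hubs (k_ n) (r_ n) x) @[n --> \oo] --> u x.
  rewrite -[X in _ --> X]mulr1; apply: cvgMr; rewrite -expR0 -[X in _ --> expR X]oppr0.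
  have hN : - hubs (k_ n) (r_ n) x @[n --> \oo] --> - (0 : R) by apply: cvgN; exact: hubs_cvg.
  by apply: (cvg_comp _ _ hN); exact: continuous_expR.
have [n0 hn] := in_ball x.
apply: cvg_trans h1; apply: near_eq_cvg; exists n0 => // n /= nn.
by rewrite /v_ /cut_dens restrict_dens ltW ?hn.
Qed.

Let p_nNy n x : p_ n x != -oo%E. Proof. exact: restrict_nNy. Qed.
Let p_lsc n : lower_semicontinuous (p_ n). Proof. exact: restrict_lsc. Qed.
Let v_meas n : measurable_fun setT (v_ n).
Proof. by apply: cut_dens_meas. Qed.

Let I_cvg (F : V -> R) : measurable_fun setT F -> intg mu (fun x => F x * u x) ->
  rint mu (fun x => F x * v_ n x) @[n --> \oo] --> I F.
Proof.
move=> mF iF.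
have [||||_ +] := @rint_dct _ _ _ mu (fun n x => F x * v_ n x) (fun x => F x * u x) _ _ _ _ (intg_norm iF) _.
- by move=> n; exact: measurable_funM.
- exact: measurable_funM.
- by apply: (@aeW _ _ _ mu _ _) => x; apply: cvgMr; exact: v_cvg.
- move=> n x; have /andP[v0 v1] := v_le n x.
  by rewrite normrM [X in _ <= X]normrM (ger0_norm v0) (ger0_norm (u0 x)) ler_wpM2l.
exact.
Qed.

Let f_v n x : f_ n x * v_ n x = f x * v_ n x.
Proof.
have [xs|xs] := leP `|x| (s_ n); first by rewrite /f_ truncate_in.
by rewrite v_out// !mulr0.
Qed.

Let pprop n : exists x, (p_ n x < +oo)%E.
Proof.
exists (xget 0 [set x | (phi x < +oo)%E]); rewrite /p_ /restrict (_ : _ <= s_ n).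
  by have := ph_dom_ex => -[z zd]; apply: (@xgetPex _ 0 [set x | (phi x < +oo)%E]); exists z.
by rewrite /s_ /S0; have : 0 <= n%:R :> R by []; move: `|_| => q h; lra.
Qed.

Let p_coer n x : ((c * `|x| - C)%:E <= p_ n x)%E.
Proof. exact: le_trans (coer x) (restrict_ge _ _ _). Qed.

Let vi n (F : V -> R) : measurable_fun setT F -> intg mu (fun x => F x * u x) -> intg mu (fun x => F x * v_ n x).
Proof.
move=> mF iF; apply: intg_le (intg_norm iF); first exact: measurable_funM.
move=> x; have /andP[v0 v1] := v_le n x.
by rewrite normrM [X in _ <= X]normrM (ger0_norm v0) (ger0_norm (u0 x)) ler_wpM2l.
Qed.

Let off_dom : {ae mu, forall x, in_int_dom phi x \/ u x = 0}.
Proof.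
have mN : measurable [set x | (phi x < +oo)%E /\ ~ in_int_dom phi x].
  by apply: measurableI; [exact: dom_meas|apply: measurableC; exact: int_dom_meas].
apply: ae_imp (null_ae mN bnd) _ => x nx.
have [xd|xd] := pselect (in_int_dom phi x); first by left.
by right; rewrite dens_out// => h; exact: nx.
Qed.

Let I_n n F := rint mu (fun x => F x * v_ n x).
Let Z_ n := I_n n (fun=> 1).
Let b_ n := (Z_ n)^-1 * I_n n f.
Let a_ n : V := \row_i ((Z_ n)^-1 * I_n n (fun x => (f x - b_ n) * x 0 i)).
Let psi n x := fine (p_ n x) + hubs (k_ n) (r_ n) x.
Let T_ n x := `|f_ n x - b_ n - dotv (gpd (psi n) x) (a_ n)| * v_ n x.
Let V_ n := I_n n (fun x => f x ^+ 2) - (Z_ n)^-1 * I_n n f ^+ 2.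
Let B_ n := @reg_const R d' * Num.sqrt (Z_ n * (I H - V_ n)).

(** The n-th truncation satisfies the hypotheses of [bounded_stability]; under the integrals f may
    stand for its truncation, since [v_] vanishes where they differ. *)
Let step n : 0 < Z_ n -> intg mu (T_ n) /\ rint mu (T_ n) <= B_ n.
Proof.
move=> Zn; have [lf [M fM]] := truncate_lip (ltW (s_0 n)) fl.
have [L L0 hL] := lip_ge0 lf; pose BB := L ^+ 2 / (2 * k_ n).
have BB0 : 0 <= BB by rewrite divr_ge0 ?sqr_ge0// mulr_ge0// ltW.
(* H may be unbounded. Where it exceeds [BB], the Huber term alone secures the bound, so the minimum
   is still a valid majorant. *)
pose G x := Num.min (H x) BB.
have mG : measurable_fun setT G by apply: measurable_minr.
have GM x : 0 <= G x <= BB by rewrite /G le_min H0 BB0/= ge_min lexx orbT.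
have fs x : r_ n - 1 < `|x| -> f_ n x = 0.
  by move=> xr; rewrite /f_ cutoff_out ?mulr0//; move: xr; rewrite /r_; lra.
have hG p : {ae mu, forall x, in_int_dom (p_ n) x -> forall e : R, 0 < e ->
    exists n0, forall j, (n0 <= j)%N -> 2 * pd (f_ n) (ratv p) x - G x - e <=
      D2 (fun y => fine (p_ n y)) (ratv p) j x + D2 (hubs (k_ n) (r_ n)) (ratv p) j x}.
  apply: ae_imp (ae_and (hH p) (ae_and (sphere_ae (s_0 n)) (dq_cvg_ae (ratv p) lf))) _ => x [hx [xs dc]] xd e e0.
  set w := ratv p in hx dc *; have xd' := restrict_int_dom xd.
  have xs' : `|x| < s_ n.
    rewrite lt_neqAle; apply/andP; split; first exact/eqP.
    by have := int_dom_dom xd; rewrite /p_ /restrict; case: ifP => //; rewrite ltxx.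
  have [n1 h1] := agree_D2 w (restrict_agree phi xs').
  have [n2 h2] := phr_D2_ge0 w nNy cvx xd'.
  have [HB|HB] := leP (H x) BB; last first.
    have [n3 h3] := hubs_dominates (k_0 n) (r_0 n) L0 hL fs x w.
    exists (maxn n1 (maxn n2 n3)) => j; rewrite !geq_max => /and3P[j1 j2 j3].
    rewrite (h1 j j1) /G min_r ?(ltW HB)//; have q2 := h2 j j2; have q3 := h3 j j3.
    by move: q2 q3; rewrite -/BB /f_; lra.
  have e20 : 0 < e / 3 by rewrite divr_gt0.
  have [n4 h4] := hx xd' _ e20.
  have af : agree f (f_ n) x.
    exists (s_ n - `|x|); first by rewrite subr_gt0.
    move=> y yx; rewrite /f_ truncate_in//; have := ler_normD (y - x) x; rewrite subrK; lra.
  have [n5 h5] := agree_dq w af.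
  move/cvgrPdist_le: dc => /(_ _ e20) [n6 _ h6].
  exists (maxn n1 (maxn n4 (maxn n5 n6))) => j; rewrite !geq_max => /and4P[j1 j4 j5 j6].
  have D0 : 0 <= D2 (hubs (k_ n) (r_ n)) w j x.
    by apply: convex_D2_ge0; exact: hubs_convex.
  have q4 := h4 j j4; have q6 := h6 j j6.
  rewrite (h1 j j1) /G min_l//; rewrite (h5 j j5) in q4.
  move: q6; rewrite ler_norml /f_ => /andP[_ q6]; move: D0 q4 q6; rewrite /f_.
  move: (D2 _ w j x) (D2 (hubs _ _) w j x) (pd _ w x) (dq _ w j x) => A1 A2 A3 A4.
  lra.
have ef : I_n n (f_ n) = I_n n f by apply: eq_rint => x; exact: f_v.
have ef2 : I_n n (fun x => f_ n x ^+ 2) = I_n n (fun x => f x ^+ 2).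
  by apply: eq_rint => x; rewrite expr2 -mulrA f_v mulrCA f_v mulrCA mulrA -expr2.
have eb : b_ n = (Z_ n)^-1 * I_n n (f_ n) by rewrite ef.
have ea : a_ n = \row_i ((Z_ n)^-1 * I_n n (fun x => (f_ n x - b_ n) * x 0 i)).
  apply/rowP => i; rewrite !mxE; congr (_ * _); apply: eq_rint => x.
  have := f_v n x; move: (f_ n x) (v_ n x) => A1 A2 hA.
  by rewrite !mulrBl -!mulrA [x 0 i * A2]mulrC !mulrA -hA.
have [iT le] := bounded_stability lamT (p_nNy n) (@restrict_convex _ _ phi (s_ n) nNy cvx) (@p_lsc n) c0
  (p_coer n) (pprop n) (restrict_bnd (s_0 n) bnd) L0 hL fM (k_0 n) (r_0 n) fs mG GM hG Zn eb ea.
split; first exact: iT.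
apply: le_trans le _; rewrite /B_ ler_wpM2l ?reg_const_ge0// ler_wsqrtr//.
rewrite -/(I_n n (fun=> 1)) -/(Z_ n) ler_wpM2l ?(ltW Zn)//.
rewrite /V_ -ef -ef2 /I_n lerB//.
apply: rint_le => [||x].
- apply: intg_le (vi n mH iH); first by apply: measurable_funM; [exact: mG|exact: (v_meas n)].
  move=> x; have /andP[v0 _] := v_le n x; have /andP[g0 _] := GM x.
  rewrite ger0_norm; last exact: (mulr_ge0 g0 v0).
  by apply: (ler_wpM2r v0); rewrite /G ge_min lexx.
- exact: iH.
- have /andP[v0 v1] := v_le n x; have /andP[g0 _] := GM x.
  by apply: (ler_pM g0 v0 _ v1); rewrite /G ge_min lexx.
Qed.

Theorem local_stability b (a : V) : b = Z^-1 * I f -> a = \row_i (Z^-1 * I (fun x => (f x - b) * x 0 i)) ->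
  intg mu (fun x => `|f x - b - dotv (gpd phr x) a| * u x) /\
  I (fun x => `|f x - b - dotv (gpd phr x) a|) <=
  @reg_const R d' * Num.sqrt (Z * (I H - (I (fun x => f x ^+ 2) - Z^-1 * I f ^+ 2))).
Proof.
move=> eb ea.
have i1 := dens_intg (pg_cst 1).
have cZ : Z_ n @[n --> \oo] --> Z by exact: I_cvg.
have cZi : (Z_ n)^-1 @[n --> \oo] --> Z^-1 by apply: cvgV => //; rewrite gt_eqF.
have cf : I_n n f @[n --> \oo] --> I f by apply: I_cvg => //; exact: dens_intg_f.
have cb : b_ n @[n --> \oo] --> b by rewrite eb; exact: cvgM.
have mx i : measurable_fun setT (fun x : V => x 0 i) := measurable_coord i.
have mfx i : measurable_fun setT (fun x : V => f x * x 0 i) by exact: measurable_funM.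
have ix i := dens_intg (pgx i).
have ca i : a_ n 0 i @[n --> \oo] --> a 0 i.
  rewrite ea mxE.
  have -> : I (fun x => (f x - b) * x 0 i) = I (fun x => f x * x 0 i) - b * I (fun x => x 0 i).
    rewrite -(rintZ b (ix i)) -(rintB (dens_intg_fx i) (intgZ b (ix i))).
    by apply: eq_rint => x; ring.
  rewrite (_ : (fun n => _) = (fun n => (Z_ n)^-1 * (I_n n (fun x => f x * x 0 i) - b_ n * I_n n (fun x => x 0 i)))); last first.
    apply/funext => n; rewrite mxE; congr (_ * _); rewrite /I_n.
    have j1 := vi n (mfx i) (dens_intg_fx i); have j2 := vi n (mx i) (ix i).
    rewrite -(rintZ (b_ n) j2) -(rintB j1 (intgZ (b_ n) j2)).
    by apply: eq_rint => x; rewrite mulrBl mulrBl !mulrA.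
  have h1 : I_n n (fun x => f x * x 0 i) @[n --> \oo] --> I (fun x => f x * x 0 i).
    by apply: I_cvg => //; exact: dens_intg_fx.
  have h2 : I_n n (fun x => x 0 i) @[n --> \oo] --> I (fun x => x 0 i) by apply: I_cvg.
  apply: cvgM => //; apply: cvgB => //; exact: cvgM.
have cB : B_ n @[n --> \oo] --> @reg_const R d' * Num.sqrt (Z * (I H - (I (fun x => f x ^+ 2) - Z^-1 * I f ^+ 2))).
  apply: cvgMr; apply: (@cvg_comp _ _ _ _ Num.sqrt _ _ _ _ (@sqrt_continuous _ _)).
  apply: cvgM => //; apply: cvgB; first exact: cvg_cst.
  apply: cvgB; first by apply: I_cvg => //; apply: measurable_funX.
  apply: cvgM => //; rewrite expr2; under eq_fun do rewrite expr2.
  exact: cvgM.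
have pgrad (F : V -> R) (z : V) : measurable_fun setT F -> measurable_fun setT (fun x => dotv (gpd F x) z).
  move=> mF; rewrite (_ : (fun x => _) = (fun x => \sum_i z 0 i * pd F (evec i) x)); last first.
    by apply/funext => x; apply: eq_bigr => i _; rewrite mxE mulrC.
  by apply: measurable_sum => i; apply: measurable_funM => //; exact: pd_measurable.
have lhub n : lip (hubs (k_ n) (r_ n) : V -> R).
  by exists (k_ n * (d%:R * (2 * r_ n))); exact: (hubs_lip (k_0 n) (r_0 n)).
have mphr : measurable_fun setT phr.
  by apply: measurableT_comp; [exact: fine_measurable|exact: phi_meas].
(* The masses [Z_] are known to be positive only for large n; for the other indices the integrand is
   set to 0. *)
pose T' n x := if 0 < Z_ n then T_ n x else 0.
have T'E n : T' n = if 0 < Z_ n then T_ n else (fun=> 0) by apply/funext => x; rewrite /T'; case: ifP.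
apply: (@rint_fatou _ _ _ mu T' _ B_).
- by move=> n; rewrite T'E; case: ifP => hn; [exact: (step hn).1|exact: intg0].
- by move=> n x; rewrite /T'; case: ifP => // _; rewrite mulr_ge0//; have /andP[] := v_le n x.
- apply: measurable_funM => //; apply: measurableT_comp => //.
  by apply: measurable_funB; [exact: measurable_funB|exact: pgrad].
- by move=> x; rewrite mulr_ge0.
- have Zev : exists n0, forall n, (n0 <= n)%N -> 0 < Z_ n.
    move/cvgrPdist_lt: cZ => /(_ _ Zp)[n0 _ hn]; exists n0 => n nn.
    have /= := hn n nn; rewrite ltr_norml => /andP[_]; move: (Z_ n) Z => A1 A2; lra.
  have [n0 hn0] := Zev.
  have radn n : {ae mu, forall x, has_grad (ph phi n%:R) x (gpd (ph phi n%:R) x) /\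
      forall w, rd (ph phi n%:R) w x (dotv (gpd (ph phi n%:R) x) w)}.
    by apply: rademacher; exists n%:R => x y; apply: (ph_lip nNy c0 coer ph_dom_ex).
  have hubn (q : nat * 'I_d) : {ae mu, forall x, dq (hubs (k_ q.1) (r_ q.1)) (evec q.2) j x @[j --> \oo] -->
      pd (hubs (k_ q.1) (r_ q.1)) (evec q.2) x} by exact: dq_cvg_ae.
  apply: ae_imp (ae_and off_dom (ae_and (ae_forall_count radn) (ae_forall_count hubn))) _ => x [[xd|x0] [rx hx]]; last first.
    rewrite x0 mulr0 (_ : (fun n => _) = fun=> 0); first exact: cvg_cst.
    apply/funext => n; rewrite /T'; case: ifP => // _; rewrite /T_ (_ : v_ n x = 0) ?mulr0//.
    by have := v_le n x; rewrite x0 => h; apply/eqP; rewrite eq_le andbC.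
  have [m0 hm] := contact_ex nNy cvx lsc c0 coer ph_dom_ex lamT xd.
  have cm : contact phi (Num.bound `|m0|)%:R x.
    apply: hm; apply: le_trans (ler_norm _) _; exact: ltW (archi_boundP (normr_ge0 m0)).
  set m := Num.bound `|m0| in cm.
  have hg : has_grad phr x (gpd (ph phi m%:R) x) := agree_has_grad (contact_agree cm) (rx m).1.
  have dphr i : dq phr (evec i) j x @[j --> \oo] --> pd phr (evec i) x.
    by have h := has_grad_dq (w := evec i) hg; rewrite (pd_cvg h).
  have [n1 hn1] := in_ball x.
  have gpsi i : pd (psi n) (evec i) x @[n --> \oo] --> pd phr (evec i) x.
    (* The derivative of phi is fixed, while that of the Huber function is bounded by its Lipschitz
       constant, which tends to 0. *)
    have h : pd phr (evec i) x + pd (hubs (k_ n) (r_ n)) (evec i) x @[n --> \oo] --> pd phr (evec i) x.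
      rewrite -[X in _ --> X]addr0; apply: cvgD; first exact: cvg_cst.
      apply/norm_cvg0P.
      apply: (squeeze_cvgr (f := fun=> 0) (h := fun n => (r_ n)^-1 * (2 * d%:R * `|evec i : V|))).
      - apply: nearW => n; rewrite normr_ge0/=.
        apply: le_trans (pd_bound (evec i) x (hubs_lip (k_0 n) (r_0 n))) _.
        rewrite le_eqVlt; apply/orP; left; apply/eqP; rewrite /k_.
        by move: (r_0 n) `|evec i : V| => q0 q; field; rewrite gt_eqF.
      - exact: cvg_cst.
      - by rewrite -[X in _ --> X](mul0r (2 * d%:R * `|evec i : V|)); apply: cvgMl; exact: r_inv.
    apply: cvg_trans h; apply: near_eq_cvg; exists n1 => // n /= nn.
    have ag : agree (psi n) (fun y => phr y + hubs (k_ n) (r_ n) y) x.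
      by apply: agreeD; [exact: restrict_agree (hn1 n nn)|exists 1].
    symmetry; apply: pd_cvg; apply: agree_dq_cvg ag _.
    rewrite (_ : (fun j => _) = (fun j => dq phr (evec i) j x + dq (hubs (k_ n) (r_ n)) (evec i) j x)).
      exact: cvgD (dphr i) (hx (n, i)).
    by apply/funext => j; rewrite !dqE; ring.
  have h : T_ n x @[n --> \oo] --> `|f x - b - dotv (gpd phr x) a| * u x.
    apply: cvgM; last exact: v_cvg.
    apply: cvg_norm; apply: cvgB.
      apply: cvgB => //; have hf : (fun=> f x) n @[n --> \oo] --> f x by exact: cvg_cst.
      apply: cvg_trans hf; apply: near_eq_cvg.
      by exists n1 => // n /= nn; rewrite /f_ truncate_in// ltW// hn1.
    by apply: cvg_sum_seq => i; apply: cvgM => //; rewrite mxE; under eq_fun do rewrite mxE; exact: gpsi.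
  apply: cvg_trans h; apply: near_eq_cvg; exists n0 => // n /= nn.
  by rewrite /T' hn0.
- move=> n; rewrite T'E; case: ifP => hn; first exact: (step hn).2.
  by rewrite rint0 /B_ mulr_ge0 ?sqrtr_ge0// reg_const_ge0.
- exact: cB.
Qed.

End local_stage.

(** * From the integrals of the statement to the stability estimate *)

Section conclusion.
Context {R : realType} {d' : nat}.
Local Notation d := d'.+1.
Local Notation V := 'rV[R]_d.
Local Notation mu := (@lam R d').
Implicit Types (x y h w : V).

Lemma limn_esup_le (s : nat -> R) (A : R) : (exists n0, forall n, (n0 <= n)%N -> s n <= A) ->
  (limn_esup (fun n => (s n)%:E) <= A%:E)%E.
Proof.
move=> [n0 hn].
apply: (@le_trans _ _ (ereal_sup [set (s n)%:E | n in [set n | (n0 <= n)%N]])).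
  by apply: ereal_inf_lbound; exists [set n | (n0 <= n)%N] => //; exists n0.
by apply: ge_ereal_sup => _ [n nn <-]; rewrite lee_fin; exact: hn.
Qed.

Lemma limn_esup_ev (s : nat -> R) (A e : R) : (limn_esup (fun n => (s n)%:E) <= A%:E)%E -> 0 < e ->
  exists n0, forall n, (n0 <= n)%N -> s n <= A + e.
Proof.
move=> h e0; have h1 : (limn_esup (fun n => (s n)%:E) < (A + e)%:E)%E.
  by apply: le_lt_trans h _; rewrite lte_fin ltrDl.
have [_ [W [n0 _ hW] <-] hs] := ereal_inf_lt h1.
exists n0 => n nn; rewrite -lee_fin; apply: le_trans (ltW hs).
by apply: ereal_sup_ubound; exists n => //; exact: hW.
Qed.

Lemma ae_null (P : V -> Prop) : {ae mu, forall x, P x} -> exists2 N : set V, leb_outer N = 0%E & forall x, ~ N x -> P x.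
Proof. by move=> [N [_ N0 hN]]; exists N => // x nx; apply: contrapT => h; apply: nx; exact: hN. Qed.

Lemma leb_int_ge0 (g : V -> \bar R) : (0 <= leb_int g)%E.
Proof. by apply: integral_ge0 => t _; exact: leb_outer_ge0. Qed.

Variable phi : V -> \bar R.
Hypothesis nNy : forall x, phi x != -oo%E.
Hypothesis cvx : ext_convex phi.
Hypothesis ess : essentially_continuous phi.
Hypothesis Zpos : (0 < Zphi phi)%E.
Hypothesis Zfin : (Zphi phi < +oo)%E.
Variable f : V -> R.
Hypothesis fl : locally_lipschitz f.
Hypothesis fL2 : in_L2 phi f.
Local Notation phr := (fun x => fine (phi x)).
Local Notation u := (dens phi).
Local Notation I F := (rint mu (fun x => F x * u x)).

Let lsc : lower_semicontinuous phi := ess.1.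
Let lamT := lam_setT_gt0 nNy lsc Zpos.
Let mu_ := dens_meas nNy lsc.
Let mf : measurable_fun setT f := loc_lip_measurable fl.
Let Zf := fine (Zphi phi).
Let Zf0 : 0 < Zf. Proof. by rewrite fine_gt0// Zpos Zfin. Qed.
Let u0 x : 0 <= u x := dens_ge0 phi x.

(** Passes from the layer-cake integrals of the statement to Lebesgue integrals against the real
    density. *)
Let intg_dens (g : V -> R) (q : R) : measurable_fun setT g -> (forall x, 0 <= g x) ->
  (leb_int (fun x => (g x)%:E * expeR (- phi x)) <= q%:E)%E ->
  intg mu (fun x => g x * u x) /\ I g <= q.
Proof.
move=> mg g0; have mgu : measurable_fun setT (fun x => g x * u x) by exact: measurable_funM.
rewrite (_ : (fun x => _) = (fun x => (g x * u x)%:E)); last first.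
  by apply/funext => x; rewrite densE.
rewrite leb_intE => [h||x]; [|by apply: measurableT_comp|by rewrite lee_fin mulr_ge0].
have i1 : intg mu (fun x => g x * u x).
  apply/integrableP; split; first by apply: measurableT_comp.
  apply: le_lt_trans (ltry q); apply: le_trans h.
  by apply: nn_le_integral => x _ //=; rewrite lee_fin ger0_norm// mulr_ge0.
by split => //; rewrite -lee_fin rintE.
Qed.

Let leb_int_dens (g : V -> R) : intg mu (fun x => g x * u x) -> (forall x, 0 <= g x) ->
  leb_int (fun x => (g x)%:E * expeR (- phi x))%E = (I g)%:E.
Proof.
move=> ig g0; rewrite (_ : (fun x => _) = (fun x => (g x * u x)%:E)); last first.
  by apply/funext => x; rewrite densE.
rewrite leb_intE => [||x]; first by rewrite rintE.
- by apply: measurableT_comp => //; exact: intg_meas ig.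
- by rewrite lee_fin mulr_ge0.
Qed.

Let ZE : Zf = I (fun=> 1).
Proof.
have Zr : Zphi phi = Zf%:E by rewrite /Zf fineK// ge0_fin_numE// ltW.
have e1 : leb_int (fun x => (1 : R)%:E * expeR (- phi x))%E = Zf%:E.
  by rewrite -Zr; congr leb_int; apply/funext => x; rewrite mul1e.
have e1' : (leb_int (fun x => (1 : R)%:E * expeR (- phi x)) <= Zf%:E)%E by rewrite [leLHS]e1.
have [i1 _] := @intg_dens (fun=> 1) Zf (measurable_cst _) (fun=> ler01) e1'.
by apply/EFin_inj; rewrite -e1 leb_int_dens.
Qed.

Let rho_intE (g : V -> R) : intg mu (fun x => g x * u x) -> (forall x, 0 <= g x) ->
  rho_int phi (fun x => (g x)%:E) = (Zf^-1 * I g)%:E.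
Proof. by move=> ig g0; rewrite /rho_int leb_int_dens// EFinM. Qed.

Let if2 : intg mu (fun x => f x ^+ 2 * u x).
Proof.
have Zi : 0 < Zf^-1 by rewrite invr_gt0.
have h : (leb_int (fun x => ((f x) ^+ 2)%:E * expeR (- phi x)) < +oo)%E.
  rewrite ltNge leye_eq; apply/negP => /eqP h; move: fL2; rewrite /in_L2 /rho_int h.
  by rewrite gt0_muley ?lte_fin// ltxx.
have mf2 : measurable_fun setT (fun x => f x ^+ 2) by exact: measurable_funX.
pose q := leb_int (fun x => ((f x) ^+ 2)%:E * expeR (- phi x))%E.
have hq : (leb_int (fun x => ((f x) ^+ 2)%:E * expeR (- phi x)) <= (fine q)%:E)%E.
  by rewrite fineK// ge0_fin_numE// leb_int_ge0.
exact: (@intg_dens (fun x => f x ^+ 2) _ mf2 (fun x => sqr_ge0 (f x)) hq).1.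
Qed.

Let ww (k : nat) : V := ratv (odflt (0%N, 0) (unpickle k)).
Let ss w n x : R := Num.max 0 (2 * dq f w n x - D2 phr w n x).
Let hq w x : \bar R := limn_esup (fun n => (ss w n x)%:E).
(** The majorant used for G: the supremum, over the countable set of directions, of the upper limits
    of 2 [dq] f - [D2] phi, truncated below at 0. It is measurable by construction and lies almost
    everywhere on the domain below the integrand with [qinv], of which only the outer layer-cake
    integral is available. *)
Let Hh x : \bar R := esups (fun k => hq (ww k) x) 0%N.

Let mphr : measurable_fun setT phr.
Proof. by apply: measurableT_comp; [exact: fine_measurable|exact: phi_meas]. Qed.

Let mss w n : measurable_fun setT (ss w n).
Proof.
apply: measurable_maxr => //; apply: measurable_funB.
  by apply: measurable_funM => //; exact: dq_measurable.
rewrite /D2; apply: measurable_funM => //.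
have msh v : measurable_fun setT (fun x => phr (x + v)).
  by apply: (measurableT_comp mphr); exact: measurable_fun_addv.
by apply: measurable_funB; [apply: measurable_funD; exact: msh|apply: measurable_funM].
Qed.

Let mHh : measurable_fun setT Hh.
Proof.
apply: measurable_fun_esups => k; apply: measurable_fun_limn_esup => n.
by apply: measurableT_comp => //; exact: mss.
Qed.

Let hq_le k x : (hq (ww k) x <= Hh x)%E.
Proof. by apply: ereal_sup_ubound; exists k. Qed.

Let hq_ge0 w x : (0 <= hq w x)%E.
Proof.
apply: le_ereal_inf_tmp => _ [W [n0 _ hW] <-].
apply: le_trans (ereal_sup_ubound _); last by exists n0; [exact: (hW n0 (leqnn n0))|].
by rewrite lee_fin /ss le_max lexx.
Qed.

Let Hh_ge0 x : (0 <= Hh x)%E. Proof. exact: le_trans (hq_ge0 _ _) (hq_le 0%N x). Qed.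

Let off_dom : {ae mu, forall x, in_int_dom phi x \/ u x = 0}.
Proof.
have mN : measurable [set x | (phi x < +oo)%E /\ ~ in_int_dom phi x].
  by apply: measurableI; [exact: dom_meas|apply: measurableC; exact: int_dom_meas].
apply: ae_imp (null_ae mN (boundary_null ess.2)) _ => x nx.
have [xd|xd] := pselect (in_int_dom phi x); first by left.
by right; rewrite dens_out// => h; exact: nx.
Qed.

Let f_diff : {ae mu, forall x, has_grad f x (grad f x)}.
Proof.
pose g (n : nat) x := f (clv n%:R x) * cutoff n%:R x.
have hg n : {ae mu, forall x, has_grad (g n) x (gpd (g n) x) /\ forall w, rd (g n) w x (dotv (gpd (g n) x) w)}.
  by apply: rademacher; exact: (truncate_lip (ler0n _ _) fl).1.
apply: ae_imp (ae_forall_count hg) _ => x hx.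
have bx := archi_boundP (normr_ge0 x); set n := Num.bound _ in bx.
apply: (@xgetPex _ 0 [set z | has_grad f x z]); exists (gpd (g n) x) => /=.
apply: agree_has_grad (hx n).1; exists (n%:R - `|x|); first by rewrite subr_gt0.
move=> y yx; rewrite /g truncate_in//; have := ler_normD (y - x) x; rewrite subrK; lra.
Qed.

(** In the sum of the expansions at x + h and x - h the first-order terms cancel. *)
Let alex_D2 x A w : alexandrov_hess phi x A -> D2 phr w n x @[n --> \oo] --> dotv (w *m A) w.
Proof.
move=> [_ [_ [p [_ hA]]]]; apply/cvgrPdist_le => e e0.
have W0 : 0 < 2 * (`|w| ^+ 2 + 1) by rewrite mulr_gt0// ltr_pwDr// sqr_ge0.
have [dl dl0 hd] := hA (e / (2 * (`|w| ^+ 2 + 1))) (divr_gt0 e0 W0).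
have [n0 hn] := small_step w dl0; exists n0 => // n /= nn.
have h1 := hd _ (hn n nn); have h2 := hd (- (n.+1%:R^-1 *: w)) ltac:(by rewrite normrN; exact: hn).
rewrite normrN in h2; rewrite /D2; move: h1 h2.
pose t : R := n.+1%:R^-1; pose N : R := n.+1%:R; have Nt : N * t = 1 by rewrite mulfV// pnatr_eq0.
have t0 : 0 < t by rewrite invr_gt0.
rewrite -/t -/N.
have q1 : dotv p (- (t *: w)) = - dotv p (t *: w).
  by rewrite /dotv -sumrN; apply: eq_bigr => i _; rewrite !mxE mulrN.
have q2 : dotv (- (t *: w) *m A) (- (t *: w)) = dotv (t *: w *m A) (t *: w).
  by rewrite mulNmx /dotv; apply: eq_bigr => i _; rewrite !mxE mulrNN.
have q3 : dotv (t *: w *m A) (t *: w) = t ^+ 2 * dotv (w *m A) w.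
  by rewrite -scalemxAl /dotv mulr_sumr; apply: eq_bigr => i _; rewrite !mxE; ring.
rewrite q1 q2 q3 normrZ (gtr0_norm t0) exprMn.
move: (phr (x + t *: w)) (phr (x - t *: w)) (phr x) (dotv p (t *: w)) (dotv (w *m A) w) => /= P1 P2 P3 P4 P5 h1 h2.
have e1 : P5 - N ^+ 2 * (P1 + P2 - 2 * P3) = - (N ^+ 2 * ((P1 - P3 - P4 - 2^-1 * (t ^+ 2 * P5)) + (P2 - P3 + P4 - 2^-1 * (t ^+ 2 * P5)))).
  rewrite [LHS](_ : _ = (N * t) ^+ 2 * P5 - N ^+ 2 * (P1 + P2 - 2 * P3)); last by rewrite Nt expr1n mul1r.
  by field.
rewrite e1 normrN normrM (ger0_norm (sqr_ge0 N)).
rewrite opprK in h2.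
have h3 := le_trans (ler_normD _ _) (lerD h1 h2).
apply: le_trans (ler_wpM2l (sqr_ge0 N) h3) _.
have -> : N ^+ 2 * (e / (2 * (`|w| ^+ 2 + 1)) * (t ^+ 2 * `|w| ^+ 2) + e / (2 * (`|w| ^+ 2 + 1)) * (t ^+ 2 * `|w| ^+ 2))
   = (N * t) ^+ 2 * (e * (2 * `|w| ^+ 2 / (2 * (`|w| ^+ 2 + 1)))) by ring.
rewrite Nt expr1n mul1r ler_piMr ?(ltW e0)// ler_pdivrMr// mul1r ler_pM2l// lerDl//.
Qed.

Let qinv_ge0 (A : 'M[R]_d) (v : V) : (0 <= qinv A v)%E.
Proof.
apply: ereal_sup_ubound; exists 0 => //; congr EFin.
by rewrite mul0mx /dotv !big1 ?mulr0 ?subrr// => i _; rewrite !mxE ?mulr0 ?mul0r.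
Qed.

(** Where an Alexandrov Hessian exists, the quotients converge to the terms of the supremum that
    defines [qinv]. Where it does not, the default Hessian 0 makes [qinv] infinite, unless grad f =
    0; in that case convexity of phi alone gives upper limit at most 0. *)
Let Hh_le : {ae mu, forall x, in_int_dom phi x -> (Hh x <= qinv (hess phi x) (grad f x))%E}.
Proof.
apply: ae_imp f_diff _ => x hg xd; apply: ge_ereal_sup => _ [k _ <-]; set w := ww k.
have dc : dq f w n x @[n --> \oo] --> dotv (grad f x) w := has_grad_dq (w := w) hg.
have [[A hA]|hN] := pselect (exists A, alexandrov_hess phi x A).
  have hA' : alexandrov_hess phi x (hess phi x) by apply: (@xgetPex _ 0 [set A | alexandrov_hess phi x A]); exists A.
  have D2c := alex_D2 (w := w) hA'.
  have c1 : 2 * dq f w n x - D2 phr w n x @[n --> \oo] --> 2 * dotv (grad f x) w - dotv (w *m hess phi x) w.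
    by apply: cvgB => //; exact: cvgMr.
  set A0 := _ - _ in c1.
  apply: (@le_trans _ _ (Num.max 0 A0)%:E); last first.
    by rewrite EFin_max ge_max qinv_ge0/=; apply: ereal_sup_ubound; exists w.
  apply/lee_addgt0Pr => e e0; rewrite -EFinD; apply: limn_esup_le.
  move/cvgrPdist_le: c1 => /(_ _ e0)[n0 _ hn]; exists n0 => n nn.
  have := hn n nn; rewrite ler_norml => /andP[h1 _].
  have m1 : 0 <= Num.max 0 A0 by rewrite le_max lexx.
  have m2 : A0 <= Num.max 0 A0 by rewrite le_max lexx orbT.
  rewrite /ss ge_max; apply/andP; split; lra.
(* From here on no Hessian exists, and [xget] returns its default. *)
have h0 : hess phi x = 0.
  by rewrite /hess xgetPN// => A hA; apply: hN; exists A.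
rewrite h0; have [g0|g0] := eqVneq (grad f x) 0.
  apply: le_trans (qinv_ge0 0 (grad f x)).
  apply/lee_addgt0Pr => e e0; rewrite add0e; apply: limn_esup_le.
  rewrite g0 in dc; have d0 : dotv 0 w = 0 by rewrite /dotv big1// => i _; rewrite mxE mul0r.
  rewrite d0 in dc; have e20 : 0 < e / 2 by rewrite divr_gt0.
  move/cvgrPdist_le: dc => /(_ _ e20)[n1 _ h1].
  have [n2 h2] := phr_D2_ge0 w nNy cvx xd.
  exists (maxn n1 n2) => n; rewrite geq_max => /andP[m1 m2].
  have k1 := h1 n m1; have k2 := h2 n m2; rewrite /ss ge_max (ltW e0)/=.
  move: k1 k2; rewrite sub0r normrN ler_norml => /andP[_ k1] k2; lra.
suff -> : qinv 0 (grad f x) = +oo%E by rewrite leey.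
apply/eqyP => M _; set v := grad f x.
have v0 : 0 < dotv v v.
  have [i vi] : exists i, v 0 i != 0.
    apply: contrapT => /forallNP h; move/eqP: g0; apply; apply/rowP => i; rewrite mxE.
    by apply/eqP; have := h i => /negP; rewrite negbK.
  rewrite /dotv (bigD1 i)//= ltr_wpDr//; first by apply: sumr_ge0 => j _; rewrite -expr2 sqr_ge0.
  by rewrite -expr2 lt0r sqr_ge0 andbT expf_neq0.
apply: ereal_sup_ubound; exists ((M / (2 * dotv v v)) *: v) => //; congr EFin.
have -> : dotv ((M / (2 * dotv v v)) *: v *m 0) ((M / (2 * dotv v v)) *: v) = 0.
  by rewrite mulmx0 /dotv big1// => i _; rewrite mxE mul0r.
by rewrite dotvZr subr0; field; rewrite gt_eqF.
Qed.

Let H x := fine (Hh x).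
Let H0 x : 0 <= H x. Proof. by rewrite fine_ge0. Qed.
Let mH : measurable_fun setT H.
Proof. by apply: measurableT_comp; [exact: fine_measurable|exact: mHh]. Qed.

Let Q := leb_int (fun x => qinv (hess phi x) (grad f x) * expeR (- phi x))%E.

Let HQ : (leb_int (fun x => Hh x * expeR (- phi x)) <= Q)%E.
Proof.
have [N N0 hN] := ae_null (ae_and off_dom Hh_le).
apply: (leb_int_le_ae N0) => x /hN[[xd|x0] hx]; last by rewrite densE// x0 !mule0.
by apply: lee_wpmul2r (hx xd); exact: expeR_ge0.
Qed.

(** The envelopes are differentiable almost everywhere by Rademacher's theorem, and each interior
    point of the domain is a contact point of one of countably many of them. *)
Let grad_phi : {ae mu, forall x, in_int_dom phi x -> ext_grad phi x = gpd phr x}.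
Proof.
have [c [C [c0 coer]]] := coercive nNy cvx lsc Zpos Zfin.
have Zp : 0 < I (fun=> 1) by rewrite -ZE.
have prop := ph_dom_ex Zp.
have radn n : {ae mu, forall x, has_grad (ph phi n%:R) x (gpd (ph phi n%:R) x) /\
    forall w, rd (ph phi n%:R) w x (dotv (gpd (ph phi n%:R) x) w)}.
  by apply: rademacher; exists n%:R => x y; apply: (ph_lip nNy c0 coer prop).
apply: ae_imp (ae_forall_count radn) _ => x rx xd.
have [m0 hm] := contact_ex nNy cvx lsc c0 coer prop lamT xd.
have cm : contact phi (Num.bound `|m0|)%:R x.
  apply: hm; apply: le_trans (ler_norm _) _; exact: ltW (archi_boundP (normr_ge0 m0)).
set m := Num.bound `|m0| in cm.
have hg : has_grad phr x (gpd (ph phi m%:R) x) := agree_has_grad (contact_agree cm) (rx m).1.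
have e1 : gpd phr x = gpd (ph phi m%:R) x.
  apply/rowP => i; rewrite !mxE (pd_cvg (has_grad_dq (w := evec i) hg)).
  by rewrite (rd_pd ((rx m).2 (evec i))).
have hx : ext_has_grad phi x (ext_grad phi x).
  by apply: (@xgetPex _ 0 [set g | ext_has_grad phi x g]); exists (gpd (ph phi m%:R) x).
by rewrite e1; exact: has_grad_inj hx.2 hg.
Qed.

Theorem brascamp_lieb_stability :
  (distL1_OBL phi f <= mul_sqrte (@reg_const R d' + 1) (deltaBL phi f))%E.
Proof.
have [c [C [c0 coer]]] := coercive nNy cvx lsc Zpos Zfin.
have Zp : 0 < I (fun=> 1) by rewrite -ZE.
have reg0 := @reg_const_ge0 R d'.
have iF := dens_intg_f nNy lsc c0 coer fl if2.
pose S1 := I f; pose S2 := I (fun x => f x ^+ 2).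
have Zi0 : 0 <= Zf^-1 by rewrite invr_ge0 ltW.
have mean : rho_mean phi f = Zf^-1 * S1.
  have ip (g : V -> R) : measurable_fun setT g -> (forall x, `|g x| <= `|f x|) -> intg mu (fun x => g x * u x).
    move=> mg hg; apply: (intg_le (g := fun x => `|f x * u x|)); [exact: measurable_funM| |exact: intg_norm].
    by move=> x; rewrite !normrM ler_wpM2r.
  have m1 : measurable_fun setT (fun x => Num.max (f x) 0) by exact: measurable_maxr.
  have m2 : measurable_fun setT (fun x => Num.max (- f x) 0).
    by apply: measurable_maxr => //; exact: measurableT_comp.
  have b1 x : `|Num.max (f x) 0| <= `|f x|.
    by rewrite ger0_norm ?le_max ?lexx ?orbT// ge_max normr_ge0 ler_norm.
  have b2 x : `|Num.max (- f x) 0| <= `|f x|.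
    by rewrite ger0_norm ?le_max ?lexx ?orbT// ge_max normr_ge0 -normrN ler_norm.
  rewrite /rho_mean (rho_intE (ip _ m1 b1)); last by move=> x; rewrite le_max lexx orbT.
  rewrite (rho_intE (ip _ m2 b2)); last by move=> x; rewrite le_max lexx orbT.
  rewrite /= -mulrBr -(rintB (ip _ m1 b1) (ip _ m2 b2)); congr (_ * _); apply: eq_rint => x.
  by rewrite -mulrBl -pos_neg_partE.
have i1 := dens_intg nNy lsc c0 coer (pg_cst 1).
have var : rho_var phi f = (Zf^-1 * S2 - (Zf^-1 * S1) ^+ 2)%:E.
  rewrite /rho_var mean; set b := Zf^-1 * S1.
  have ib : intg mu (fun x => f x ^+ 2 * u x - 2 * b * (f x * u x) + b ^+ 2 * (1 * u x)).
    by apply: intgD; [apply: intgB => //; exact: intgZ|exact: intgZ].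
  have ev : (fun x => (f x - b) ^+ 2 * u x) = (fun x => f x ^+ 2 * u x - 2 * b * (f x * u x) + b ^+ 2 * (1 * u x)).
    by apply/funext => x; ring.
  rewrite rho_intE; [|by rewrite ev|by move=> x; exact: sqr_ge0].
  rewrite ev rintD; [|by apply: intgB => //; exact: intgZ|exact: intgZ].
  rewrite rintB; [|by []|exact: intgZ].
  have ZE' : Zf = rint mu (fun x => 1 * u x) := ZE.
  rewrite (rintZ (2 * b) iF) (rintZ (b ^+ 2) (i1 : intg mu (fun x => 1 * u x))) -ZE' -/S1 -/S2; congr EFin; rewrite /b; field; rewrite gt_eqF//.
(* The variance is finite, so an infinite first term makes the deficit infinite and the bound
   trivial. *)
have [Qy|Qy] := eqVneq Q +oo%E.
  suff -> : deltaBL phi f = +oo%E by rewrite /= leey.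
  by rewrite /deltaBL /rho_int -/Q Qy var gt0_muley ?lte_fin ?invr_gt0// addye.
have Qf : Q \is a fin_num by rewrite ge0_fin_numE ?leb_int_ge0// ltey.
pose q := fine Q; have eQ : Q = q%:E by rewrite fineK.
have dl : deltaBL phi f = (Zf^-1 * q - (Zf^-1 * S2 - (Zf^-1 * S1) ^+ 2))%:E.
  by rewrite /deltaBL /rho_int -/Q eQ var -EFinM -EFinB.
have HuQ : (\int[mu]_x (Hh x * (u x)%:E) <= q%:E)%E.
  rewrite -eQ; apply: le_trans HQ; rewrite leb_intE.
  - by apply: nn_le_integral => x _; [rewrite mule_ge0// lee_fin|rewrite densE].
  - apply: emeasurable_funM => //; exact: expeN_meas.
  - by move=> x; rewrite mule_ge0// expeR_ge0.
(* [fine] sends +oo to 0, so H represents [Hh] only where [Hh] is finite. On the interior of the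
   domain the density is positive, and the finite integral gives finiteness almost everywhere. *)
have fin : {ae mu, forall x, in_int_dom phi x -> Hh x = (H x)%:E}.
  have ii : mu.-integrable setT (fun x => Hh x * (u x)%:E)%E.
    apply/integrableP; split.
      by apply: emeasurable_funM => //; apply: measurableT_comp.
    apply: le_lt_trans (ltry q); apply: le_trans HuQ.
    by apply: nn_le_integral => x _; rewrite ?abse_ge0// gee0_abs// mule_ge0// lee_fin.
  apply: ae_imp (integrable_ae measurableT ii) _ => x hx xd.
  have := hx Logic.I; have xd' := int_dom_dom xd.
  have ux : 0 < u x by rewrite (dens_dom nNy xd') expR_gt0.
  rewrite /H; have := Hh_ge0 x; case: (Hh x) => //.
  by rewrite mulyr gtr0_sg// mul1e.
have [iH HHq] : intg mu (fun x => H x * u x) /\ I H <= q.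
  apply: intg_dens => //; rewrite -eQ; apply: le_trans HQ; apply: leb_int_le => x.
  rewrite lee_wpmul2r ?expeR_ge0// /H.
  by have := Hh_ge0 x; case: (Hh x).
have hH p : {ae mu, forall x, in_int_dom phi x -> forall e : R, 0 < e ->
    exists n0, forall n, (n0 <= n)%N -> 2 * dq f (ratv p) n x - H x - e <= D2 phr (ratv p) n x}.
  apply: ae_imp fin _ => x hx xd e e0.
  have ep : ratv p = ww (pickle p) by rewrite /ww pickleK.
  have := hq_le (pickle p) x; rewrite (hx xd) -ep => /limn_esup_ev /(_ e0)[n0 hn].
  exists n0 => n nn; have := hn n nn; rewrite /ss ge_max => /andP[_]; lra.
have bnd := boundary_null ess.2.
have [iT le] := local_stability lamT nNy cvx lsc c0 coer bnd fl mH H0 hH if2 iH Zp erefl erefl.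
set b := _^-1 * _ in iT le; set a := \row_i _ in iT le.
rewrite dl /=.
(* The mean b of f and the covariance vector a give an explicit competitor in the infimum. *)
apply: (@le_trans _ _ (rho_int phi (fun x => (`|f x - (dotv a (ext_grad phi x) + b)|)%:E))).
  by apply: ereal_inf_lbound; exists (a, b).
apply: (@le_trans _ _ (Zf^-1 * I (fun x => `|f x - b - dotv (gpd phr x) a|))%:E).
  rewrite EFinM /rho_int lee_wpmul2l ?lee_fin//.
  rewrite -(leb_int_dens iT (fun x => normr_ge0 _)).
  have [N N0 hN] := ae_null (ae_and off_dom grad_phi).
  apply: (leb_int_le_ae N0) => x /hN[[xd|x0] hx]; last by rewrite densE// x0 !mule0.
  rewrite (hx xd) lee_wpmul2r ?expeR_ge0// lee_fin.
  by rewrite opprD addrCA addrC (_ : dotv a (gpd phr x) = dotv (gpd phr x) a) 1?addrC ?addrA// /dotv; apply: eq_bigr => i _; rewrite mulrC.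
rewrite lee_fin; set dd := _ - _; rewrite -ZE -/S1 -/S2 in le.
(* The mass under the root becomes a factor that cancels the normalisation, which turns the
   unnormalised estimate into the one for the probability measure. *)
have h1 : Zf * (I H - (S2 - Zf^-1 * S1 ^+ 2)) <= Zf ^+ 2 * dd.
  have -> : Zf ^+ 2 * dd = Zf * (q - (S2 - Zf^-1 * S1 ^+ 2)) by rewrite /dd; field; rewrite gt_eqF.
  by rewrite ler_pM2l// lerB.
have h2 : Num.sqrt (Zf * (I H - (S2 - Zf^-1 * S1 ^+ 2))) <= Zf * Num.sqrt dd.
  apply: le_trans (ler_wsqrtr h1) _.
  by rewrite sqrtrM ?sqr_ge0// sqrtr_sqr gtr0_norm.
rewrite ler_pdivrMl//; apply: le_trans le _.
apply: le_trans (ler_wpM2l reg0 h2) _.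
have : 0 <= Zf * Num.sqrt dd by rewrite mulr_ge0 ?sqrtr_ge0// ltW.
by move: (Num.sqrt dd) => q0 h3; rewrite mulrCA mulrDl mul1r mulrDr [Zf * (_ * _)]mulrCA lerDl.
Qed.

End conclusion.

Theorem theorem3p2 (R : realType) (d : nat) (hd : (0 < d)%N) :
  exists2 C : R, 0 < C &
    forall phi : 'rV[R]_d -> \bar R,
      (forall x, phi x != -oo%E) ->
      ext_convex phi ->
      essentially_continuous phi ->
      (0 < Zphi phi)%E -> (Zphi phi < +oo)%E ->
      forall f : 'rV[R]_d -> R,
        locally_lipschitz f -> in_L2 phi f ->
        (distL1_OBL phi f <= mul_sqrte C (deltaBL phi f))%E.
Proof.
(* Only nonnegativity of [reg_const] is at hand; the summand 1 makes the constant positive. *)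
case: d hd => [//|d'] _; exists (@reg_const R d' + 1); first by rewrite ltr_wpDl// reg_const_ge0.
by move=> phi nNy cvx ess Z0 Zfin f fl f2; exact: brascamp_lieb_stability.
Qed.
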